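(* Let $e\ge0$ and $U\in\mathcal C$. Under the change of cost unit $(e,U)\mapsto(\lambda e,\lambda U)$ with $\lambda>0$, the cost geometry transforms by homothety: $$\tilde g_{e,U}\mapsto\lambda\,\tilde g_{e,U},\qquad d_e\mapsto\sqrt\lambda\,d_e,\qquad K\mapsto K/\lambda,$$ the last for the Gauss curvature $K$ on (two-dimensional) location-scale leaves. Consequently the following are invariant under this change of unit: the sign of $K$ (in particular hyperbolicity, $K<0$); the finiteness or infiniteness of $d_e$-distances (in particular whether $\partial_\infty$ lies at infinite distance), and well-posedness; the traces of the geodesics and the ratios of distances; and the eikonal proportionality (the property that $U=cJ$ for some $c>0$, equivalently that $-H$ has constant slope for $\tilde g_{0,U}$). At $e=0$ and on the family $U=cJ$, $c>0$, where $K$ is constant on each location-scale leaf, the ranking of the leaves by curvature and its extremum at the Gaussian leaf are also invariant, with $K(\text{Gauss})/K(\varphi_0)=J_0$. The following depend on the unit: every absolute distance, the slope $\kappa=1/\sqrt{2c}$, and the value $K=-1/(2cJ_0)$ (equal to $-1/(4J_0)$ for $c=2$, and to $-\tfrac14$ for the Gaussian $J_0=1$).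
   Context: $\mathcal P_2(\mathbb R^n)$: Borel probability measures with finite second moment, with the quadratic Wasserstein distance $\mathcal W_2$ and transport metric $g_{\mathcal W_2}$. $H(p)=-\int p\ln p$ (equal to $-\infty$ for measures without density), $J(p)=\int|\nabla p|^2/p\in[0,\infty]$ Fisher information, $\partial_\infty=\{H=-\infty\}$. $\mathcal C$ is the set of functions $U:\mathcal P_2(\mathbb R^n)\to[0,\infty]$ that are sequentially lower semicontinuous for narrow convergence and satisfy $U\ge\varepsilon J$ pointwise for some $\varepsilon>0$. The cost geometry is $\tilde g_{e,U}=2(e+U)g_{\mathcal W_2}$, with length $\ell_e(\gamma)=\int_0^T\sqrt{2(e+U(\gamma_t))}\,|\dot\gamma|(t)\,dt$ for $AC^2$ curves ($|\dot\gamma|$ the metric speed) and $d_e=\inf\ell_e$ over $AC^2$ curves joining two given points. Geodesics are minimizers of $\ell_e$. Well-posedness means existence and stability of minimizers (with no finite-cost approach to $\partial_\infty$). Location-scale leaf ($n=1$): for a standardized base density $\varphi_0$ on $\mathbb R$ (mean $0$, variance $1$, absolutely continuous, positive, $J_0:=\int(\varphi_0')^2/\varphi_0<\infty$), $\mathcal L_{\varphi_0}=\{\sigma^{-1}\varphi_0((\cdot-\mu)/\sigma):\mu\in\mathbb R,\sigma>0\}$; it is $\mathcal W_2$-isometric to the half-plane $\{\sigma>0\}$ with $d\mu^2+d\sigma^2$, so $\tilde g_{e,U}$ restricts to $f\,(d\mu^2+d\sigma^2)$ with $f=2(e+U)$, and $K$ is its Gauss curvature (where $f$ is smooth enough for it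 to be defined). On the leaf $J=J_0/\sigma^2$. The Gaussian leaf is $\varphi_0=\mathcal N(0,1)$, $J_0=1$. The slope $\kappa$ is the metric slope of $-H$ for $\tilde g_{0,U}$, equal to $\sqrt J/\sqrt{2U}$ for $U=cJ$. *)

(* Defs.v *)
From HB Require Import structures.
From mathcomp Require Import all_boot all_order all_algebra.
From mathcomp Require Import all_classical all_reals all_analysis.
From mathcomp Require Import measurable_realfun.
Set Implicit Arguments.
Unset Strict Implicit.
Unset Printing Implicit Defensive.
Import Order.TTheory GRing.Theory Num.Theory.
Import numFieldTopology.Exports numFieldNormedType.Exports.
Local Open Scope classical_set_scope.
Local Open Scope ring_scope.

(* The product of the Borel sigma-algebras of the coordinates; it is the Borel
   sigma-algebra of R^n, see [rV_borel]. *)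
Section measurable_rV.
Context {R : realType}.
Variable n : nat.

Let coors : 'I_n -> 'rV[R]_n -> R := fun i x => x ord0 i.

Let rV_set0 : g_sigma_preimage coors set0.
Proof. exact: sigma_algebra0. Qed.

Let rV_setC A : g_sigma_preimage coors A -> g_sigma_preimage coors (~` A).
Proof. exact: sigma_algebraC. Qed.

Let rV_bigcup (F : (set 'rV[R]_n)^nat) :
  (forall i, g_sigma_preimage coors (F i)) ->
  g_sigma_preimage coors (\bigcup_i (F i)).
Proof. exact: sigma_algebra_bigcup. Qed.

HB.instance Definition _ := @isMeasurable.Build default_measure_display
  'rV[R]_n (g_sigma_preimage coors) rV_set0 rV_setC rV_bigcup.

End measurable_rV.

Section lebesgue.
Context {R : realType}.

Lemma measurable_coord n (i : 'I_n) :
  measurable_fun setT (fun x : 'rV[R]_n => x ord0 i).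
Proof.
move=> _ Y mY; rewrite setTI; apply: sub_sigma_algebra => /=.
rewrite -bigcup_seq/=; exists i => /=; first by rewrite mem_index_enum.
by exists Y => //; rewrite setTI.
Qed.

Lemma measurable_fun_rVP d (T : measurableType d) n (f : T -> 'rV[R]_n) :
  (forall i, measurable_fun setT (fun x => f x ord0 i)) ->
  measurable_fun setT f.
Proof.
move=> mf.
suff H : measurable `<=` image_set_system setT f measurable.
  by move=> _ Y /H; rewrite /image_set_system/= setTI.
apply: smallest_sub => /=.
  exact/sigma_algebra_image/sigma_algebra_measurable.
apply: (big_ind (fun S => S `<=` _)).
- exact: sub0set.
- by move=> S1 S2 h1 h2; rewrite subUset.
- move=> i _ B [Y mY <-]; rewrite /image_set_system/= !setTI.
  by have := mf i measurableT _ mY; rewrite setTI.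
Qed.

Lemma rV_borel n : @measurable _ 'rV[R]_n = <<s @open 'rV[R]_n >>.
Proof.
rewrite eqEsubset; split.
  apply: smallest_sub; first exact: smallest_sigma_algebra.
  apply: (big_ind (fun S => S `<=` _)).
  - exact: sub0set.
  - by move=> S1 S2 h1 h2; rewrite subUset.
  - move=> i _ B [Y mY <-]; rewrite setTI.
    pose f := fun x : g_sigma_algebraType (@open 'rV[R]_n) =>
      (x : 'rV[R]_n) ord0 i.
    suff mf : measurable_fun setT f.
      by have := mf measurableT _ mY; rewrite setTI.
    apply: (measurability _ (RGenOpens.measurableE R)).
    move=> _ [_ [a [b ->]] <-]; rewrite setTI; apply: sub_sigma_algebra.
    apply: open_comp => [x _|]; last exact: interval_open.
    exact: coord_continuous.
apply: smallest_sub; first exact: sigma_algebra_measurable.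
move=> O oO.
pose c (q : 'rV[rat]_n) : 'rV[R]_n := map_mx ratr q.
pose D := [set q : 'rV[rat]_n * rat | ball (c q.1) (ratr q.2) `<=` O].
have -> : O = \bigcup_(q in D) ball (c q.1) (ratr q.2).
  rewrite eqEsubset; split; last by move=> x [q Dq]; exact: Dq.
  move=> x Ox.
  have /nbhs_ballP[r /= r0 xrO] : nbhs x O by exact: open_nbhs_nbhs.
  have [k [k0 k2]] : exists k : rat, 0 < ratr k :> R /\ ratr k *+ 2 <= r :> R.
    have [k] := rat_in_itvoo (divr_gt0 r0 (ltr0n R 2)).
    rewrite in_itv/= => /andP[k0 k2]; exists k; split => //.
    by rewrite -mulr_natr -ler_pdivlMr// ltW.
  have /boolp.choice[f fP] : forall i : 'I_n, exists q : rat,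
      `|x ord0 i - ratr q| < ratr k.
    move=> i; have /rat_in_itvoo[q] : x ord0 i - ratr k < x ord0 i + ratr k.
      by rewrite ltrBlDr -addrA ltrDl addr_gt0.
    by rewrite in_itv/= => q1; exists q; rewrite distrC ltr_distl.
  have bx : ball (c (\row_i f i)) (ratr k) x.
    split => // i j; rewrite !mxE (ord1 i) /ball/= distrC; exact: fP.
  exists (\row_i f i, k) => //= y xy; apply: xrO.
  by apply: (le_ball k2); rewrite mulr2n; apply: (ball_triangle (ball_sym bx)).
rewrite bigcup_mkcond; apply: countable_bigcupT_measurable.
  exact: countableP.
move=> q; case: ifP => // _.
have [r0|r0] := leP (ratr q.2 : R) 0; first by rewrite le0_ball0.
have -> : ball (c q.1) (ratr q.2 : R) =
    \bigcap_(i in [set: 'I_n])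
      [set x | ball (c q.1 ord0 i) (ratr q.2) (x ord0 i)].
  rewrite eqEsubset; split => x.
    by move=> [_ qx] i _; exact: qx.
  by move=> qx; split => // i j; rewrite (ord1 i); exact: qx.
apply: fin_bigcap_measurable => // i _.
rewrite -[X in measurable X]setTI; apply: measurable_coord => //.
exact: measurable_ball.
Qed.

Definition consrV n (z : R * 'rV[R]_n) : 'rV[R]_n.+1 :=
  \row_i (if unlift ord0 i is Some j then z.2 ord0 j else z.1).

Definition unconsrV n (x : 'rV[R]_n.+1) : R * 'rV[R]_n :=
  (x ord0 ord0, \row_j x ord0 (lift ord0 j)).

Lemma consrVK n : cancel (@consrV n) (@unconsrV n).
Proof.
move=> [x v]; rewrite /unconsrV !mxE unlift_none/=; congr pair.
by apply/rowP => j; rewrite !mxE liftK.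
Qed.

Lemma measurable_consrV n : measurable_fun setT (@consrV n).
Proof.
apply: measurable_fun_rVP => i; under eq_fun do rewrite mxE.
case: unliftP => [j|] _ //=; last exact: measurable_fst.
exact: (measurableT_comp (measurable_coord j) measurable_snd).
Qed.

Lemma measurable_unconsrV n : measurable_fun setT (@unconsrV n).
Proof.
apply/measurable_fun_prod => /=; first exact: measurable_coord.
apply: measurable_fun_rVP => i; under eq_fun do rewrite mxE.
exact: measurable_coord.
Qed.

Lemma sigma_finite_product d1 d2 (T1 : measurableType d1)
    (T2 : measurableType d2) (m1 : {sigma_finite_measure set T1 -> \bar R})
    (m2 : {sigma_finite_measure set T2 -> \bar R}) :
  sigma_finite setT (m1 \x m2)%E.
Proof.
have /sigma_finiteP[F [TF ndF Foo]] := sigma_finiteT m1.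
have /sigma_finiteP[G [TG ndG Goo]] := sigma_finiteT m2.
exists (fun k => F k `*` G k).
  rewrite -setXTT TF TG predeqE => -[x y]; split.
    move=> [/= [k _ Fkx] [l _ Gly]]; exists (maxn k l) => //; split.
    - by move: x Fkx; exact/subsetPset/ndF/leq_maxl.
    - by move: y Gly; exact/subsetPset/ndG/leq_maxr.
  by move=> [k _ []/= ? ?]; split; exists k.
move=> k; have [? ?] := Foo k; have [? ?] := Goo k.
split; first exact: measurableX.
by rewrite product_measure1E// lte_mul_pinfty// ge0_fin_numE.
Qed.

Section cons_measure.
Variables (n : nat) (m : {sigma_finite_measure set 'rV[R]_n -> \bar R}).
Local Open Scope ereal_scope.

Definition cons_measure : set 'rV[R]_n.+1 -> \bar R :=
  pushforward (lebesgue_measure \x m) (@consrV n).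

Let pm := measure_function_pushforward__canonical__measure_function_Measure
  (lebesgue_measure \x m) (@measurable_consrV n).

HB.instance Definition _ := isMeasure.Build _ _ _ cons_measure
  (measure0 pm) (measure_ge0 pm) (@measure_semi_sigma_additive _ _ _ pm).

Let cons_measure_sigma_finite : sigma_finite setT cons_measure.
Proof.
have [F TF Foo] := sigma_finite_product lebesgue_measure m.
exists (fun k => @unconsrV n @^-1` F k).
  by rewrite -preimage_bigcup -TF preimage_setT.
move=> k; have [mF Fk] := Foo k; split.
  by rewrite -[X in measurable X]setTI; exact: measurable_unconsrV.
rewrite /cons_measure /pushforward -comp_preimage.
by rewrite (_ : _ \o _ = id) //; apply/funext => z; rewrite /= consrVK.
Qed.

HB.instance Definition _ := Measure_isSigmaFinite.Build _ _ _ cons_measure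
  cons_measure_sigma_finite.

End cons_measure.

Fixpoint lebesgue_rV n : {sigma_finite_measure set 'rV[R]_n -> \bar R} :=
  match n with
  | 0 => dirac (0 : 'rV[R]_0)
  | k.+1 => cons_measure (lebesgue_rV k)
  end.

End lebesgue.

Section euclidean.
Context {R : realType} {n : nat}.
Implicit Types v w x : 'rV[R]_n.

Definition dot v w : R := \sum_i v ord0 i * w ord0 i.
Definition sqnorm v : R := dot v v.

Definition partial (i : 'I_n) (h : 'rV[R]_n -> R) : 'rV[R]_n -> R :=
  fun x => 'D_(delta_mx ord0 i) h x.

Definition gradient (h : 'rV[R]_n -> R) : 'rV[R]_n -> 'rV[R]_n :=
  fun x => \row_i partial i h x.

(* C^1 test functions define the same weak gradients as smooth ones. *)
Definition test_function (psi : 'rV[R]_n -> R) :=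
  [/\ forall i x, derivable psi x (delta_mx ord0 i),
      forall i, continuous (partial i psi)
    & exists2 K, compact K & forall x, ~ K x -> psi x = 0].

Definition C2_near (h : 'rV[R]_n -> R) x :=
  \forall y \near x, forall i j,
    [/\ derivable h y (delta_mx ord0 i),
        derivable (partial i h) y (delta_mx ord0 j),
        {for y, continuous (partial i h)}
      & {for y, continuous (partial j (partial i h))}].

End euclidean.

Local Open Scope ereal_scope.

(* A MathComp measure is a function on all sets, so distinct elements of [P2]
   may agree on the Borel sets. This is harmless: every functional in [classC]
   takes equal values on them, being lower semicontinuous along constant
   sequences. *)
Record P2 (R : realType) (n : nat) := MkP2 {
  law :> probability 'rV[R]_n R ;
  second_moment : \int[law]_x (sqnorm x)%:E < +oo }.

HB.instance Definition _ R n := gen_eqMixin (P2 R n).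
HB.instance Definition _ R n := gen_choiceMixin (P2 R n).

Lemma dirac0_second_moment (R : realType) n :
  \int[dirac (0%R : 'rV[R]_n)]_x (sqnorm x)%:E < +oo.
Proof.
rewrite integral_dirac//; last first.
  apply/measurable_EFinP; apply: measurable_sum => i.
  by apply: measurable_funM; exact: measurable_coord.
by rewrite diracT mul1e ltry.
Qed.

HB.instance Definition _ R n :=
  isPointed.Build (P2 R n) (MkP2 (@dirac0_second_moment R n)).

Section transport.
Context {R : realType} {n : nat}.
Implicit Types (p q : P2 R n) (U F : P2 R n -> \bar R) (e T : R).
Implicit Types (gamma : R -> P2 R n) (rho : 'rV[R]_n -> R).

Definition coupling p q (pi : probability ('rV[R]_n * 'rV[R]_n)%type R) :=
  forall A, measurable A ->
    pi (A `*` setT) = p A /\ pi (setT `*` A) = q A.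

Definition W2 p q : \bar R :=
  sqrte (ereal_inf [set c | exists2 pi, coupling p q pi &
    c = \int[pi]_z (sqnorm (z.1 - z.2))%:E]).

Definition narrow_cvg (p_ : nat -> P2 R n) p :=
  forall f : 'rV[R]_n -> R, continuous f ->
    (exists M : R, forall x, (`|f x| <= M)%R) ->
    (\int[p_ k]_x (f x)%:E) @[k --> \oo] --> \int[p]_x (f x)%:E.

Definition is_density p rho :=
  [/\ measurable_fun setT rho, forall x, (0 <= rho x)%R
    & forall A, measurable A -> p A = \int[lebesgue_rV n]_(x in A) (rho x)%:E].

(* The supremum is over the densities of [p], which all give the same value;
   it is -oo when there is none. *)
Definition entropy p : \bar R :=
  ereal_sup [set - \int[lebesgue_rV n]_x (rho x * ln (rho x))%:E |
    rho in is_density p].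

Definition weak_gradient rho (G : 'rV[R]_n -> 'rV[R]_n) :=
  forall i, (lebesgue_rV n).-integrable setT (fun x => (G x ord0 i)%:E) /\
    forall psi, test_function psi ->
      \int[lebesgue_rV n]_x (rho x * partial i psi x)%:E =
      - \int[lebesgue_rV n]_x (G x ord0 i * psi x)%:E.

(* The infimum is over the densities of [p] and their weak gradients, which
   all give the same value; it is +oo when there is none. The integrand is 0
   where the density vanishes, since so does its weak gradient, almost
   everywhere. Requiring the gradient to be integrable loses nothing: by
   Cauchy-Schwarz it is so as soon as the integral is finite. *)
Definition fisher p : \bar R :=
  ereal_inf [set c | exists rho G, [/\ is_density p rho, weak_gradient rho G
    & c = \int[lebesgue_rV n]_x (sqnorm (G x) / rho x)%:E]].

Definition classC U :=
  [/\ forall p, 0 <= U p,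
      forall (p_ : nat -> P2 R n) p, narrow_cvg p_ p ->
        U p <= limn_einf (U \o p_)
    & exists2 eps : R, (0 < eps)%R & forall p, eps%:E * fisher p <= U p].

Definition change_unit (lambda : R) U : P2 R n -> \bar R :=
  fun p => lambda%:E * U p.

(* The tangent space at [p]: closure in L^2(p) of gradients. *)
Definition tangent p (v : 'rV[R]_n -> 'rV[R]_n) :=
  [/\ measurable_fun setT v, \int[p]_x (sqnorm (v x))%:E < +oo
    & forall eps : R, (0 < eps)%R -> exists2 psi, test_function psi &
      \int[p]_x (sqnorm (v x - gradient psi x))%:E < eps%:E].

Definition transport_metric p (v w : 'rV[R]_n -> 'rV[R]_n) : \bar R :=
  \int[p]_x (dot (v x) (w x))%:E.

Definition cost_metric e U p v w : \bar R :=
  2%:E * (e%:E + U p) * transport_metric p v w.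

Definition AC2 T gamma :=
  exists m : R -> R,
    [/\ measurable_fun setT m, forall t, (0 <= m t)%R,
        \int[lebesgue_measure]_(t in `[0%R, T]) ((m t) ^+ 2)%:E < +oo
      & forall s t, (0 <= s)%R -> (s <= t)%R -> (t <= T)%R ->
        W2 (gamma s) (gamma t) <=
        \int[lebesgue_measure]_(r in `[s, t]) (m r)%:E].

Definition metric_speed gamma (t : R) : \bar R :=
  lim ((W2 (gamma s) (gamma t) / `|s - t|%:E) @[s --> t^']).

Definition cost_speed e U gamma (t : R) : \bar R :=
  sqrte (2%:E * (e%:E + U (gamma t))) * metric_speed gamma t.

Definition cost_length e U T gamma : \bar R :=
  \int[lebesgue_measure]_(t in `[0%R, T]) cost_speed e U gamma t.

Definition cost_dist e U p q : \bar R :=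
  ereal_inf [set c | exists T gamma, [/\ (0 < T)%R, AC2 T gamma,
    gamma 0%R = p, gamma T = q & c = cost_length e U T gamma]].

Definition geodesic e U T gamma :=
  [/\ (0 < T)%R, AC2 T gamma,
      cost_length e U T gamma = cost_dist e U (gamma 0%R) (gamma T)
    & cost_length e U T gamma < +oo].

Definition geodesic_traces e U p q : set (set (P2 R n)) :=
  [set A | exists T gamma, [/\ geodesic e U T gamma,
    gamma 0%R = p, gamma T = q & A = gamma @` `[0%R, T]]].

Definition constant_W2_speed gamma :=
  exists c : R, {ae lebesgue_measure, forall t : R,
    (0 < t < 1)%R -> metric_speed gamma t = c%:E}.

Definition minimizers_exist e U :=
  forall p q, cost_dist e U p q < +oo ->
    exists T gamma, [/\ geodesic e U T gamma, gamma 0%R = p & gamma T = q].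

(* Minimizers whose endpoints converge for the cost distance subconverge to a
   minimizer. As the length does not see the parametrization, it is normalized
   to constant Wasserstein speed on [0, 1]. *)
Definition minimizers_stable e U :=
  forall (p_ q_ : nat -> P2 R n) (gamma_ : nat -> R -> P2 R n) p q,
    cost_dist e U p q < +oo ->
    cost_dist e U (p_ k) p @[k --> \oo] --> 0 ->
    cost_dist e U (q_ k) q @[k --> \oo] --> 0 ->
    (forall k, [/\ geodesic e U 1 (gamma_ k), constant_W2_speed (gamma_ k),
      gamma_ k 0%R = p_ k & gamma_ k 1%R = q_ k]) ->
    exists (phi : nat -> nat) gamma,
      [/\ {homo phi : i j / (i < j)%N}, geodesic e U 1 gamma,
          gamma 0%R = p, gamma 1%R = q
        & forall t, (0 <= t <= 1)%R ->
          narrow_cvg (fun k => gamma_ (phi k) t) (gamma t)].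

Definition no_finite_cost_approach e U :=
  forall T gamma, (0 < T)%R ->
    (forall S, (0 < S)%R -> (S < T)%R -> AC2 S gamma) ->
    entropy (gamma 0%R) != -oo ->
    entropy (gamma t) @[t --> T^'-] --> -oo ->
    \int[lebesgue_measure]_(t in `[0%R, T[) cost_speed e U gamma t = +oo.

Definition well_posed e U :=
  [/\ minimizers_exist e U, minimizers_stable e U
    & no_finite_cost_approach e U].

Definition boundary_at_infinity e U :=
  forall p q, entropy p != -oo -> entropy q = -oo -> cost_dist e U p q = +oo.

Definition fisher_multiple (c : R) : P2 R n -> \bar R :=
  fun p => c%:E * fisher p.

Definition eikonal U := exists2 c : R, (0 < c)%R & U = fisher_multiple c.

(* Descending slope; 0 at isolated points. *)
Definition metric_slope (d : P2 R n -> P2 R n -> \bar R) F p : \bar R :=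
  maxe 0 (ereal_inf [set ereal_sup [set maxe 0 (F p - F q) / d p q |
    q in [set q | 0 < d p q < r%:E]] | r in [set r : R | (0 < r)%R]]).

(* The length, for the metric 2 (e + U) g_W2 frozen at [p], of the displacement
   from [p] to [q]. *)
Definition tensor_length e U p q : \bar R :=
  sqrte (2%:E * (e%:E + U p)) * W2 p q.

(* The slope of -H is taken with respect to the metric tensor at [p], not to
   [cost_dist 0 U]: the latter does not see a modification of [U] at a single
   point, hence could not characterize proportionality to [fisher]. *)
Definition entropy_slope U p : \bar R :=
  metric_slope (tensor_length 0 U) (fun q => - entropy q) p.

Definition constant_entropy_slope U :=
  exists2 k : R, (0 < k)%R &
    forall p, fisher p < +oo -> entropy_slope U p = k%:E.

End transport.

Section surface.
Context {R : realType}.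
Local Open Scope ring_scope.
Implicit Types (g : 'rV[R]_2 -> 'M[R]_2) (z : 'rV[R]_2) (i j k l : 'I_2).

Definition christoffel g k i j z : R :=
  2^-1 * \sum_l invmx (g z) k l *
    (partial i (fun y => g y j l) z + partial j (fun y => g y i l) z
     - partial l (fun y => g y i j) z).

(* The component along [l] of R(d_i, d_j) d_k. *)
Definition riemann g l k i j z : R :=
  partial i (christoffel g l j k) z - partial j (christoffel g l i k) z
  + \sum_m (christoffel g l i m z * christoffel g m j k z
            - christoffel g l j m z * christoffel g m i k z).

Definition gauss_curvature g z : R :=
  (\sum_l g z ord0 l * riemann g l ord_max ord0 ord_max z) / \det (g z).

End surface.

Section leaf.
Context {R : realType}.
Implicit Types (phi : R -> R) (U : P2 R 1 -> \bar R) (e mu sigma : R).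
Implicit Types z : 'rV[R]_2.

(* Being the indefinite integral of a locally integrable function is, by
   Lebesgue, absolute continuity on every compact interval. *)
Definition locally_absolutely_continuous phi :=
  exists2 g : R -> R, locally_integrable setT g &
    forall a b, (a <= b)%R ->
      (phi b - phi a)%:E = \int[lebesgue_measure]_(x in `[a, b]) (g x)%:E.

Definition base_fisher phi : \bar R :=
  \int[lebesgue_measure]_x ((derive1 phi x) ^+ 2 / phi x)%:E.

Definition base_density phi :=
  [/\ locally_absolutely_continuous phi /\ forall x, (0 < phi x)%R,
      \int[lebesgue_measure]_x (phi x)%:E = 1,
      \int[lebesgue_measure]_x (x * phi x)%:E = 0,
      \int[lebesgue_measure]_x (x ^+ 2 * phi x)%:E = 1
    & base_fisher phi < +oo].

Definition J0 phi : R := fine (base_fisher phi).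

Definition gaussian : R -> R := normal_pdf 0 1.

Definition leaf_density phi mu sigma : 'rV[R]_1 -> R :=
  fun x => (sigma^-1 * phi ((x ord0 ord0 - mu) / sigma))%R.

(* The law with density [leaf_density phi mu sigma], for [0 < sigma]. *)
Definition leaf_law phi mu sigma : P2 R 1 :=
  get [set p | is_density p (leaf_density phi mu sigma)].

(* A point of the leaf has coordinates mu = z_0 and sigma = z_1. *)
Definition leaf_point phi z : P2 R 1 :=
  leaf_law phi (z ord0 ord0) (z ord0 ord_max).

Definition leaf_factor e U phi z : R :=
  fine (2%:E * (e%:E + U (leaf_point phi z))).

(* The restriction to the leaf of 2 (e + U) g_W2, where g_W2 restricts to
   d mu ^ 2 + d sigma ^ 2. *)
Definition leaf_metric e U phi z : 'M[R]_2 := (leaf_factor e U phi z)%:M.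

Definition leaf_curvature e U phi z : R :=
  gauss_curvature (leaf_metric e U phi) z.

Definition curvature_defined e U phi z :=
  [/\ (0 < z ord0 ord_max)%R,
      \forall y \near z, U (leaf_point phi y) \is a fin_num
    & C2_near (leaf_factor e U phi) z].

End leaf.

(* Main.v *)
(* A change of unit multiplies the metric by lambda, hence lengths, distances
   and slopes by powers of lambda. The substance is that eikonal proportionality is
   equivalent to constant slope: the slope of the entropy for W2 is sqrt J. That it is
   at most sqrt J is the HWI inequality H(q) <= H(p) + sqrt J W2(p, q); that it is
   at least sqrt J follows by pushing p by x + t xi(x), xi close to the opposite
   of the score in L^2(p). For a tensor 2 U g_W2 the slope is then
   sqrt J / sqrt (2 U), so a constant slope forces U to be a multiple of J. On a
   leaf, J = J_0 / sigma^2, the metric is a multiple of the hyperbolic one, and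
   Cramer-Rao gives J_0 >= 1 with equality for the Gaussian. *)
Require Import Defs.
From HB Require Import structures.
From mathcomp Require Import all_boot all_order all_algebra.
From mathcomp Require Import all_classical all_reals all_analysis.
From mathcomp Require Import measurable_realfun ring lra.
Set Implicit Arguments.
Unset Strict Implicit.
Unset Printing Implicit Defensive.
Import Order.TTheory GRing.Theory Num.Theory.
Import numFieldTopology.Exports numFieldNormedType.Exports.
Local Open Scope classical_set_scope.
Local Open Scope ring_scope.

Import HBNNSimple.

(** The upper bound sqrt J is obtained without optimal maps or displacement convexity. A long
    product of Gaussian averages along the axes, of total variance S in each direction, plays the
    heat flow. Along it the entropy grows by about S J / 2, a discrete de Bruijn bound, while
    duality in each step gives a log-Harnack inequality that moves the base point from x to y at the
    price |x - y|^2 / (2 S). Integrating the latter against a coupling, Gibbs' inequality for q and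
    the choice S = W2 / sqrt J conclude. The averages act on positive functions with Lipschitz
    logarithm, for which every error is dominated by an exponential; hence p is first convolved with
    a kernel proportional to exp(- M |x|_1), and M tends to infinity at the end. The resulting slope
    depends on p alone, which in turn shows that the Fisher information does not depend on the
    chosen density and gradient, and yields its value on the leaves. The push of the lower bound is
    a composition of shears, one per axis, so that one-dimensional changes of variables suffice. *)

(** * Measures with a density *)

Section weighted_measure.
Context d (T : measurableType d) (R : realType) (mu : {measure set T -> \bar R}).
Variable f : T -> R.
Hypotheses (mf : measurable_fun setT f) (f0 : forall x, 0 <= f x).
Local Open Scope ereal_scope.

(** The two proofs are arguments so that the measure structure can be attached to the term
    itself. *)
Definition weighted of measurable_fun setT f & (forall x, 0 <= f x)%R :=
  fun A : set T => \int[mu]_(x in A) (f x)%:E.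

Let emf : measurable_fun setT (EFin \o f).
Proof. exact/measurable_EFinP. Qed.

Let ef0 x : 0 <= (f x)%:E.
Proof. by rewrite lee_fin. Qed.

Let w := weighted mf f0.

Let w0 : w set0 = 0.
Proof. exact: integral_set0. Qed.

Let w_ge0 A : 0 <= w A.
Proof. by apply: integral_ge0 => x _. Qed.

Let w_sigma_additive : semi_sigma_additive w.
Proof.
move=> F mF tF mUF; rewrite /w/weighted ge0_integral_bigcup//; last first.
  exact: measurable_funTS.
by apply: is_cvg_ereal_nneg_natsum_cond => n _ _; exact: integral_ge0.
Qed.

HB.instance Definition _ := isMeasure.Build _ _ _
  (weighted mf f0) w0 w_ge0 w_sigma_additive.

(** Both sides are limits along simple functions increasing to [h], by monotone convergence; on a
    simple function they are the same finite sum over level sets. *)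
Lemma integral_weighted (h : T -> \bar R) : measurable_fun setT h ->
  (forall x, 0 <= h x) ->
  \int[weighted mf f0]_x h x = \int[mu]_x (h x * (f x)%:E).
Proof.
move=> mh h0.
pose g := nnsfun_approx measurableT mh.
have gh x : limn (fun n => (g n x)%:E) = h x.
  by apply/cvg_lim => //; exact: cvg_nnsfun_approx.
have ndg x : {homo (fun n => (g n x)%:E) : n m / (n <= m)%N >-> n <= m}.
  by move=> a b ab; rewrite lee_fin; move: (nd_nnsfun_approx measurableT mh ab) => /lefP.
have mg n : measurable_fun setT (fun x => (g n x)%:E).
  by apply/measurable_EFinP; exact: measurable_funPT.
have -> : \int[weighted mf f0]_x h x =
    limn (fun n => \int[weighted mf f0]_x (g n x)%:E).
  rewrite -monotone_convergence//; last by move=> n x _; rewrite lee_fin.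
  by apply: eq_integral => x _; rewrite gh.
have -> : \int[mu]_x (h x * (f x)%:E) = limn (fun n => \int[mu]_x ((g n x)%:E * (f x)%:E)).
  rewrite -monotone_convergence//.
  - apply: eq_integral => x _; rewrite -(gh x) -limeMr//.
    exact: ereal_nondecreasing_is_cvgn.
  - by move=> n; exact: emeasurable_funM.
  - by move=> n x _; rewrite mule_ge0// lee_fin.
  - by move=> x _ a b ab; rewrite lee_wpmul2r// ndg.
congr (limn _); apply/funext => n.
rewrite integralT_nnsfun sintegralE.
under [RHS]eq_integral => x _.
  rewrite fimfunE -fsumEFin// ge0_mule_fsuml; last first.
    by move=> r; rewrite EFinM nnfun_muleindic_ge0.
  over.
rewrite ge0_integral_fsum//=; last 2 first.
- move=> r; apply: emeasurable_funM => //; apply/measurable_EFinP.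
  by apply: measurable_funM => //; apply: measurable_indic; exact: measurable_sfunP.
- by move=> r x _; rewrite mule_ge0// EFinM nnfun_muleindic_ge0.
apply: eq_fsbigr => r; rewrite inE/= => -[t _ <-].
under [RHS]eq_integral do rewrite EFinM -muleA.
rewrite ge0_integralZl_EFin//; last 2 first.
- by move=> x _; rewrite mule_ge0// lee_fin.
- apply: emeasurable_funM => //; apply/measurable_EFinP.
  by apply: measurable_indic; exact: measurable_sfunP.
congr (_ * _); rewrite /weighted integral_mkcond.
by apply: eq_integral => x _; rewrite epatch_indic muleC.
Qed.

End weighted_measure.

(** * Change of variables on the line for expanding maps *)

Section change_of_variable.
Context {R : realType}.
Local Notation mu := (@lebesgue_measure R).

Lemma is_derive1E (T j : R -> R) (x : R) : is_derive x 1 T (j x) -> derive1 T x = j x.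
Proof. by move=> dT; rewrite derive1E derive_val. Qed.

Lemma is_derive_continuous (T j : R -> R) :
  (forall x : R, is_derive x 1 T (j x)) -> continuous T.
Proof.
by move=> dT x; apply/differentiable_continuous/derivable1_diffP; case: (dT x).
Qed.

Lemma integral_is_derive (T j : R -> R) (a b : R) : a <= b ->
  (forall x : R, is_derive x 1 T (j x)) -> continuous j ->
  (\int[mu]_(x in `[a, b]) (j x)%:E = (T b - T a)%:E)%E.
Proof.
rewrite le_eqVlt => /orP[/eqP ->|ab] dT cj.
  by rewrite set_itv1 integral_set1 subrr.
have cT := is_derive_continuous dT.
rewrite (continuous_FTC2 (F := T) ab) ?EFinB//.
- exact: continuous_subspaceT.
- split => [x _||]; first by case: (dT x).
  + exact/cvg_at_right_filter/cT.
  + exact/cvg_at_left_filter/cT.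
- by move=> x _; exact: is_derive1E.
Qed.

Variables (T j : R -> R) (c : R).
Hypotheses (c0 : 0 < c) (cj : forall x, c <= j x) (dT : forall x : R, is_derive x 1 T (j x))
  (ctj : continuous j).

Let j0 x : 0 <= j x. Proof. exact/(le_trans _ (cj x))/ltW. Qed.

Lemma expanding_le x y : x <= y -> c * (y - x) <= T y - T x.
Proof.
move=> xy; rewrite -lee_fin -(integral_is_derive xy dT ctj).
have -> : ((c * (y - x))%:E = \int[mu]_(z in `[x, y]) c%:E)%E.
  rewrite integral_cst//= lebesgue_measure_itv/= lte_fin EFinM.
  move: xy; rewrite le_eqVlt => /orP[/eqP ->|->//].
  by rewrite ltxx subrr.
apply: ge0_le_integral => //=.
- by move=> z _; rewrite lee_fin ltW.
- apply/measurable_EFinP/measurable_funTS; exact: continuous_measurable_fun.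
- by move=> z _; rewrite lee_fin.
Qed.

Lemma expanding_leE x y : (T x <= T y) = (x <= y).
Proof.
have [xy|yx] := leP x y.
  by rewrite -subr_ge0 (le_trans _ (expanding_le xy))// mulr_ge0 ?subr_ge0// ltW.
apply/negbTE; rewrite -ltNge -subr_gt0 (lt_le_trans _ (expanding_le (ltW yx)))//.
by rewrite mulr_gt0// subr_gt0.
Qed.

Lemma expanding_ltE x y : (T x < T y) = (x < y).
Proof. by rewrite !ltNge expanding_leE. Qed.

Lemma expanding_surj y : exists x, T x = y.
Proof.
(* Since [T] expands by at least [c], the ends of [- k, k] are carried beyond [y] on either side. *)
pose k := `|y - T 0| / c.
have k0 : 0 <= k by rewrite divr_ge0// ltW.
have kc : c * k = `|y - T 0| by rewrite mulrC divfK// gt_eqF.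
have Nk0 : - k <= 0 by rewrite oppr_le0.
have H1 := expanding_le k0; have H2 := expanding_le Nk0.
rewrite subr0 kc in H1; rewrite sub0r opprK kc in H2.
suff : Num.min (T (- k)) (T k) <= y <= Num.max (T (- k)) (T k).
  move=> /(IVT (le_trans Nk0 k0)
    (continuous_subspaceT (is_derive_continuous dT)))[x _ xy].
  by exists x.
have H3 := ler_norm (y - T 0); have H4 := ler_norm (- (y - T 0)).
rewrite normrN in H4.
rewrite ge_min le_max; apply/andP; split; apply/orP; [left|right]; lra.
Qed.

(** The measure of density [j], pushed forward by [T], gives ]T x, T y] the mass T y - T x by the
    fundamental theorem of calculus; uniqueness of Lebesgue measure identifies it. *)
Lemma ge0_change_of_variable (F : R -> \bar R) :
  measurable_fun setT F -> (forall x, 0 <= F x)%E ->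
  (\int[mu]_x (F (T x) * (j x)%:E) = \int[mu]_x F x)%E.
Proof.
move=> mF F0.
have mj : measurable_fun setT j by exact: continuous_measurable_fun.
have mT : @measurable_fun _ _ (measurableTypeR R) (measurableTypeR R) setT T.
  by apply: continuous_measurable_fun; exact: is_derive_continuous dT.
rewrite -(integral_weighted mu mj j0); last 2 first.
- exact: measurableT_comp.
- by move=> x; exact: F0.
rewrite -[in LHS](preimage_setT T) -(ge0_integral_pushforward mT)//.
pose nu : {measure set (measurableTypeR R) -> \bar R} :=
  measure_function_pushforward__canonical__measure_function_Measure
    (weighted mu mj j0) mT.
suff -> : (\int[mu]_x F x = \int[nu]_x F x)%E by [].
apply: (eq_measure_integral nu) => A mA _.
apply: (@lebesgue_measure_unique _ nu) => // _ [[a b] _ <-]/=.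
rewrite lebesgue_measure_itv/= lte_fin /nu/= /pushforward /weighted.
have [x <-] := expanding_surj a; have [y <-] := expanding_surj b.
have -> : T @^-1` `]T x, T y]%classic = `]x, y]%classic.
  by apply/seteqP; split => z/=; rewrite !in_itv/= expanding_leE expanding_ltE.
rewrite expanding_ltE; have [xy|yx] := ltP x y.
  rewrite -EFinB -(integral_is_derive (ltW xy) dT ctj).
  by rewrite integral_itv_obnd_cbnd//; apply/measurable_EFinP/measurable_funTS.
by rewrite set_itv_ge ?integral_set0// bnd_simp -leNgt.
Qed.

End change_of_variable.

(** * Lebesgue measure on R^n along lines parallel to the axes *)

Section lebesgue_lines.
Context {R : realType}.
Local Notation mu := (@lebesgue_measure R).
Local Notation E i := (delta_mx ord0 i).

Lemma measurable_rVD d (T : measurableType d) n (f g : T -> 'rV[R]_n) :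
  measurable_fun setT f -> measurable_fun setT g ->
  measurable_fun setT (fun x => f x + g x).
Proof.
move=> mf mg; apply: measurable_fun_rVP => i.
under eq_fun do rewrite mxE; apply: measurable_funD.
- exact: (measurableT_comp (measurable_coord i) mf).
- exact: (measurableT_comp (measurable_coord i) mg).
Qed.

Lemma measurable_rVZ d (T : measurableType d) n (a : T -> R) (f : T -> 'rV[R]_n) :
  measurable_fun setT a -> measurable_fun setT f ->
  measurable_fun setT (fun x => a x *: f x).
Proof.
move=> ma mf; apply: measurable_fun_rVP => i.
under eq_fun do rewrite mxE; apply: measurable_funM => //.
exact: (measurableT_comp (measurable_coord i) mf).
Qed.

Lemma measurable_line n (v : 'rV[R]_n) :
  measurable_fun setT (fun z : 'rV[R]_n * R => z.1 + z.2 *: v).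
Proof.
apply: measurable_rVD; first exact: measurable_fst.
by apply: measurable_rVZ => //; exact: measurable_snd.
Qed.

Lemma measurable_shift_rV n (v : 'rV[R]_n) : 
  measurable_fun setT (fun x : 'rV[R]_n => x + v).
Proof. exact: measurable_rVD. Qed.

Lemma measurable_on_line n (x v : 'rV[R]_n) :
  measurable_fun setT (fun s : R => x + s *: v).
Proof. by apply: measurable_rVD => //; exact: measurable_rVZ. Qed.

Local Open Scope ereal_scope.

Lemma integral_lebesgue_cons n (f : 'rV[R]_n.+1 -> \bar R) :
  measurable_fun setT f -> (forall x, 0 <= f x) ->
  \int[lebesgue_rV n.+1]_x f x =
  \int[mu]_s \int[lebesgue_rV n]_v f (consrV (s, v)).
Proof.
move=> mf f0.
have mc : @measurable_fun _ _ (measurableTypeR R * 'rV[R]_n)%type _ setT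
    (@consrV R n) by exact: measurable_consrV.
transitivity (\int[(mu \x lebesgue_rV n)%E]_z f (consrV z)).
  exact: (ge0_integral_pushforward mc (mu \x lebesgue_rV n)%E measurableT mf
    (fun x _ => f0 x)).
by rewrite fubini_tonelli1//; exact: measurableT_comp.
Qed.

Lemma integral_lebesgue_consr n (f : 'rV[R]_n.+1 -> \bar R) :
  measurable_fun setT f -> (forall x, 0 <= f x) ->
  \int[lebesgue_rV n.+1]_x f x =
  \int[lebesgue_rV n]_v \int[mu]_s f (consrV (s, v)).
Proof.
move=> mf f0; rewrite integral_lebesgue_cons//.
rewrite (@fubini_tonelli _ _ _ _ _ mu (lebesgue_rV n) (f \o @consrV R n))//.
  by apply: measurableT_comp => //; exact: measurable_consrV.
by move=> x; exact: f0.
Qed.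

Lemma consrV0D n (s t : R) (v : 'rV[R]_n) :
  consrV (s + t, v)%R = (consrV (s, v) + t *: E ord0)%R.
Proof.
apply/rowP => j; rewrite !mxE eqxx/=; case: unliftP => [k ->|->].
  by rewrite eq_sym (negbTE (neq_lift _ _)) mulr0 addr0.
by rewrite eqxx mulr1.
Qed.

Lemma consrVlD n (s t : R) (v : 'rV[R]_n) i :
  consrV (s, v + t *: E i)%R = (consrV (s, v) + t *: E (lift ord0 i))%R.
Proof.
apply/rowP => j; rewrite !mxE eqxx/=; case: unliftP => [k ->|->].
  by rewrite !mxE eqxx (inj_eq lift_inj).
by rewrite (negbTE (neq_lift _ _)) mulr0 addr0.
Qed.

(** Fubini, by induction on the dimension: either the direction is the first coordinate, which is
    then integrated innermost, or it survives in the remaining ones. This is the device by which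
    one-dimensional facts pass to R^n. *)
Lemma le_integral_lines n (i : 'I_n) (f h : 'rV[R]_n -> \bar R) :
  measurable_fun setT f -> (forall x, 0 <= f x) ->
  measurable_fun setT h -> (forall x, 0 <= h x) ->
  (forall x, \int[mu]_s f (x + s *: E i)%R <= \int[mu]_s h (x + s *: E i)%R) ->
  \int[lebesgue_rV n]_x f x <= \int[lebesgue_rV n]_x h x.
Proof.
elim: n i f h => [[]//|n IH] i f h mf f0 mh h0 fh.
have mc (g : _ -> \bar R) : measurable_fun setT g ->
    measurable_fun setT (g \o @consrV R n).
  by move=> mg; apply: measurableT_comp => //; exact: measurable_consrV.
case: (unliftP ord0 i) => [j ij|i0]; last first.
  rewrite !integral_lebesgue_consr//; apply: ge0_le_integral => //.
  - by move=> v _; exact: integral_ge0.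
  - exact: (@measurable_fun_fubini_tonelli_G _ _ _ _ _ mu (f \o @consrV R n) (mc _ mf) (fun=> f0 _)).
  - exact: (@measurable_fun_fubini_tonelli_G _ _ _ _ _ mu (h \o @consrV R n) (mc _ mh) (fun=> h0 _)).
  move=> v _; have := fh (consrV (0, v)%R); rewrite i0.
  by under eq_integral do rewrite -consrV0D add0r;
    under [leRHS]eq_integral do rewrite -consrV0D add0r.
rewrite !integral_lebesgue_cons//; apply: ge0_le_integral => //.
- by move=> v _; exact: integral_ge0.
- exact: (@measurable_fun_fubini_tonelli_F _ _ _ _ _ (lebesgue_rV n) (f \o @consrV R n) (mc _ mf) (fun=> f0 _)).
- exact: (@measurable_fun_fubini_tonelli_F _ _ _ _ _ (lebesgue_rV n) (h \o @consrV R n) (mc _ mh) (fun=> h0 _)).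
move=> s _.
have ms (g : 'rV[R]_n.+1 -> \bar R) : measurable_fun setT g ->
    measurable_fun setT (fun v : 'rV[R]_n => g (consrV (s, v))).
  move=> mg; apply: (measurableT_comp mg).
  by apply: (measurableT_comp (@measurable_consrV R n)); exact: measurable_pair1.
apply: (IH j) => //; [exact: ms|exact: ms|] => v.
have := fh (consrV (s, v)%R); rewrite ij.
by under eq_integral do rewrite -consrVlD;
  under [leRHS]eq_integral do rewrite -consrVlD.
Qed.

Lemma eq_integral_lines n (i : 'I_n) (f h : 'rV[R]_n -> \bar R) :
  measurable_fun setT f -> (forall x, 0 <= f x) ->
  measurable_fun setT h -> (forall x, 0 <= h x) ->
  (forall x, \int[mu]_s f (x + s *: E i)%R = \int[mu]_s h (x + s *: E i)%R) ->
  \int[lebesgue_rV n]_x f x = \int[lebesgue_rV n]_x h x.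
Proof.
move=> mf f0 mh h0 fh; apply/eqP; rewrite eq_le.
by apply/andP; split; apply: (le_integral_lines (i := i)) => // x; rewrite fh.
Qed.

Lemma ge0_integral_shift1 (t : R) (f : R -> \bar R) :
  measurable_fun setT f -> (forall x, 0 <= f x) ->
  \int[mu]_s f (s + t)%R = \int[mu]_s f s.
Proof.
move=> mf f0.
have d (x : R) : is_derive x (1%R : R) (fun y => y + t)%R (cst 1%R x).
  by apply: is_derive_eq; rewrite addr0.
rewrite -(ge0_change_of_variable ltr01 _ d _ mf f0)//.
- by apply: eq_integral => x _; rewrite mule1.
- by move=> x; exact: cvg_cst.
Qed.

Lemma ge0_integral_scale1 (c : R) (f : R -> \bar R) : (0 < c)%R ->
  measurable_fun setT f -> (forall x, 0 <= f x) ->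
  \int[mu]_s (f (c * s)%R * c%:E) = \int[mu]_s f s.
Proof.
move=> c0 mf f0.
have d (x : R) : is_derive x (1%R : R) (fun y => c * y)%R (cst c x).
  by apply: is_derive_eq; rewrite /GRing.scale/= mulr1.
rewrite -(ge0_change_of_variable c0 _ d _ mf f0)//.
by move=> x; exact: cvg_cst.
Qed.

Lemma ge0_integral_shift n (v : 'rV[R]_n) (f : 'rV[R]_n -> \bar R) :
  measurable_fun setT f -> (forall x, 0 <= f x) ->
  \int[lebesgue_rV n]_x f (x + v)%R = \int[lebesgue_rV n]_x f x.
Proof.
move=> mf f0.
have H i t (g : 'rV[R]_n -> \bar R) :
    measurable_fun setT g -> (forall x, 0 <= g x) ->
    \int[lebesgue_rV n]_x g (x + t *: E i)%R = \int[lebesgue_rV n]_x g x.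
  move=> mg g0; apply: (eq_integral_lines (i := i)) => //.
    by apply: measurableT_comp => //; exact: measurable_shift_rV.
  move=> x; rewrite -[RHS](ge0_integral_shift1 t)//; last first.
    by apply: measurableT_comp => //; exact: measurable_on_line.
  by apply: eq_integral => s _; rewrite scalerDl addrA.
rewrite [v]row_sum_delta; elim: (index_enum _) f mf f0 => [|i r IH] f mf f0.
  by apply: eq_integral => x _; rewrite big_nil addr0.
rewrite -[RHS](H i (v ord0 i))//.
rewrite -[RHS](IH (fun x => f (x + v ord0 i *: E i)%R))//; last first.
  by apply: measurableT_comp => //; exact: measurable_shift_rV.
by apply: eq_integral => x _; rewrite big_cons -addrA [(_ *: _ + _)%R]addrC.
Qed.

End lebesgue_lines.

(** * Integrals under measure-preserving maps *)

Section invariant.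
Context d (T : measurableType d) (R : realType) (mu : {measure set T -> \bar R}).
Variable tau : T -> T.
Hypotheses (mtau : measurable_fun setT tau)
  (htau : forall f : T -> \bar R, measurable_fun setT f -> (forall x, 0 <= f x)%E ->
    (\int[mu]_x f (tau x) = \int[mu]_x f x)%E).

Lemma integral_invariant (f : T -> \bar R) : measurable_fun setT f ->
  (\int[mu]_x f (tau x) = \int[mu]_x f x)%E.
Proof.
move=> mf; rewrite integralE [RHS]integralE; congr (_ - _)%E.
- rewrite -(htau (measurable_funepos mf) (funepos_ge0 _)).
  by apply: eq_integral => x _; rewrite !unlock.
- rewrite -(htau (measurable_funeneg mf) (funeneg_ge0 _)).
  by apply: eq_integral => x _; rewrite !unlock.
Qed.

Lemma integrable_invariant (f : T -> \bar R) :
  mu.-integrable setT f -> mu.-integrable setT (f \o tau).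
Proof.
move=> /integrableP[mf foo]; apply/integrableP; split.
  exact: measurableT_comp.
have /= -> // : (\int[mu]_x (abse \o f) (tau x) = \int[mu]_x (abse \o f) x)%E.
by apply: htau => [|x]; [exact: measurableT_comp|exact: abse_ge0].
Qed.

End invariant.

(** * Integration by parts against the identity on the line *)

Section real_line.
Context {R : realType}.
Local Notation mu := (@lebesgue_measure R).

Lemma measurable_shift1 (t : R) : @measurable_fun _ _ (measurableTypeR R)
  (measurableTypeR R) setT (fun x => x + t).
Proof. exact: measurable_funD. Qed.

Lemma integral_shift1 (t : R) (f : R -> \bar R) : measurable_fun setT f ->
  (\int[mu]_x f (x + t)%R = \int[mu]_x f x)%E.
Proof.
move=> mf; apply: (integral_invariant (mu := mu) (tau := fun x => x + t) _ mf).
by move=> g mg g0; exact: ge0_integral_shift1.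
Qed.

Lemma integrable_shift1 (t : R) (f : R -> \bar R) : mu.-integrable setT f ->
  mu.-integrable setT (fun x => f (x + t)%R).
Proof.
apply: (integrable_invariant (mu := mu) (measurable_shift1 t)) => g mg g0.
exact: ge0_integral_shift1.
Qed.

Lemma ge0_integral_opp (f : R -> \bar R) : measurable_fun setT f ->
  (forall x, 0 <= f x)%E -> (\int[mu]_x f (- x)%R = \int[mu]_x f x)%E.
Proof.
move=> mf f0.
have mN : @measurable_fun _ _ (measurableTypeR R) (measurableTypeR R) setT -%R.
  exact: (@measurable_funN _ _ _ setT id).
rewrite -(ge0_integral_pushforward mN mu measurableT mf (fun x _ => f0 x)).
apply: (eq_measure_integral (@lebesgue_measure R)) => A mA _; exact: lebesgue_measureN.
Qed.

Lemma integrable_EFinM_indic (f : R -> R) (A : set R) : measurable A ->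
  mu.-integrable setT (EFin \o f) ->
  mu.-integrable setT (fun x => (f x * \1_A x)%:E).
Proof.
move=> mA fi; apply: (le_integrable _ _ _ fi) => //.
  apply/measurable_EFinP/measurable_funM => //.
  by case/integrableP : fi => /measurable_EFinP.
move=> x _; rewrite lee_fin normrM ler_piMr// indicE ger0_norm//.
by case: (_ \in _).
Qed.

(* Integrate [x (phi (x + 1) - phi x)], the second factor being the integral
   of [g (x + s)] over [s] in [0, 1], in both orders. *)
Lemma integral_id_derivative (phi g : R -> R) :
  (forall a b : R, (a <= b)%R ->
    (phi b - phi a)%:E = \int[mu]_(x in `[a, b]) (g x)%:E)%E ->
  mu.-integrable setT (EFin \o phi) ->
  mu.-integrable setT (fun x => (x * phi x)%:E) ->
  mu.-integrable setT (EFin \o g) ->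
  mu.-integrable setT (fun x => (x * g x)%:E) ->
  (\int[mu]_x (x * g x)%:E = - \int[mu]_x (phi x)%:E)%E.
Proof.
move=> phig phii xphii gi xgi.
have mg : measurable_fun setT g by case/integrableP : gi => /measurable_EFinP.
pose I : set R := `[0, 1]%classic.
have mI : measurable I by exact: measurable_itv.
have I1 : (\int[mu]_s (\1_I s)%:E = 1 :> \bar R)%E.
  by rewrite integral_indic//= setIT /I lebesgue_measure_itv/= lte01 oppr0 adde0.
have inner x : (\int[mu]_s (g (x + s) * \1_I s)%:E = (phi (x + 1) - phi x)%:E)%E.
  rewrite phig ?lerDl// [RHS]integral_mkcond.
  rewrite -[RHS](integral_shift1 x); last first.
    apply/(measurable_restrictT _ _).1 => //.
    by apply: measurable_funTS; exact/measurable_EFinP.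
  apply: eq_integral => s _; rewrite epatch_indic/= addrC EFinM.
  congr (_ * (_ %:R)%:E)%E; rewrite /I; congr nat_of_bool.
  apply/idP/idP; rewrite !inE/= !in_itv/= addrC => /andP[? ?]; apply/andP; split; lra.
have mphi : measurable_fun setT phi by case/integrableP : phii => /measurable_EFinP.
have mh (h : R -> R) : measurable_fun setT h ->
    measurable_fun setT (fun x : R => (x * h x)%:E).
  by move=> m; apply/measurable_EFinP/measurable_funM.
(* The exchange of integrals is used twice: with [w = 1] it shows that [g] has integral 0, with
   [w = id] it gives the formula itself. *)
have swap (w : R -> R) (C : R) : measurable_fun setT w ->
    (forall s, (\int[mu]_x (`|w x * g (x + s)| * \1_I s)%:E <= (C * \1_I s)%:E)%E) ->
  (\int[mu]_x (w x * (phi (x + 1) - phi x))%:E =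
    \int[mu]_s \int[mu]_x (w x * g (x + s) * \1_I s)%:E)%E.
  move=> mw wC.
  pose F (z : R * R) : \bar R := (w z.1 * g (z.1 + z.2) * \1_I z.2)%:E.
  have mF : measurable_fun setT F.
    apply/measurable_EFinP/measurable_funM; last first.
      by apply: (measurableT_comp _ measurable_snd) => //; exact: measurable_indic.
    apply: measurable_funM; first exact: (measurableT_comp mw measurable_fst).
    by apply: (measurableT_comp mg); exact: measurable_funD.
  have iF : (mu \x mu)%E.-integrable setT F.
    apply/integrable21ltyP => //.
    apply: (@le_lt_trans _ _ (\int[mu]_s (C%:E * (\1_I s)%:E))%E).
      apply: ge0_le_integral => //.
      - by move=> s _; exact: integral_ge0.
      - apply: (measurable_fun_fubini_tonelli_G (m1 := mu) (abse \o F)) => [|x].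
          exact: measurableT_comp.
        exact: abse_ge0.
      - apply: emeasurable_funM => //; exact/measurable_EFinP/measurable_indic.
      move=> s _; rewrite -EFinM; apply: le_trans (wC s).
      rewrite le_eqVlt; apply/orP; left; apply/eqP/eq_integral => x _.
      by rewrite /F/= normrM [`|\1_I s|]ger0_norm.
    rewrite integralZl//; first by rewrite I1 mule1 ltry.
    exact: integrable_indic_itv.
  rewrite -[RHS](Fubini iF); apply: eq_integral => x _.
  rewrite /F/= EFinM -inner -integralZl//.
    by apply: eq_integral => s _; rewrite -EFinM mulrA.
  apply: integrable_EFinM_indic => //.
  by under [X in integrable _ _ X]funext do rewrite /= addrC;
    exact: (integrable_shift1 x gi).
have eI s : (s \in I) = (0 <= s <= 1) 
  by apply/idP/idP; rewrite inE /I /= in_itv.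
have gs s : mu.-integrable setT (fun x => (g (x + s))%:E) by exact: integrable_shift1 gi.
pose G := fine (\int[mu]_x (g x)%:E)%E.
have GE : (G%:E = \int[mu]_x (g x)%:E)%E by rewrite fineK// integrable_fin_num.
have mshift (h : R -> R) s : measurable_fun setT h ->
    measurable_fun setT (fun x : R => h (x + s)).
  by move=> m; exact: (measurableT_comp m (measurable_shift1 s)).
have absg : mu.-integrable setT (fun x => `|g x|%:E) by exact: integrable_norm gi.
have absxg : mu.-integrable setT (fun x => `|x * g x|%:E) by exact: integrable_norm xgi.
pose A := fine (\int[mu]_x `|g x|%:E)%E.
have AE : (A%:E = \int[mu]_x `|g x|%:E)%E by rewrite fineK// integrable_fin_num.
pose B := fine (\int[mu]_x `|x * g x|%:E)%E.
have BE : (B%:E = \int[mu]_x `|x * g x|%:E)%E by rewrite fineK// integrable_fin_num.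
have g0 : (\int[mu]_x (g x)%:E = 0)%E.
  have C1 s : (\int[mu]_x (`|cst 1 x * g (x + s)| * \1_I s)%:E <= (A * \1_I s)%:E)%E.
    under eq_integral do rewrite mul1r.
    rewrite indicE; case: (s \in I); last first.
      by rewrite mulr0; under eq_integral do rewrite mulr0; rewrite integral0.
    rewrite mulr1; under eq_integral do rewrite mulr1.
    by rewrite (integral_shift1 s (f := fun x => `|g x|%:E)) -?AE//;
      case/integrableP : absg.
  have := swap (cst 1) A (measurable_cst _) C1.
  under eq_integral do rewrite mul1r EFinB.
  rewrite integralB//; last exact: (integrable_shift1 1 phii).
  rewrite (integral_shift1 1 (f := EFin \o phi)); last exact/measurable_EFinP.
  rewrite subee; last exact: integrable_fin_num.
  under eq_integral => s _.
    under eq_integral do rewrite mul1r EFinM.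
    rewrite integralZr//.
    rewrite (integral_shift1 s (f := EFin \o g)); last exact/measurable_EFinP.
    rewrite -GE; over.
  rewrite integralZl//; last exact: integrable_indic_itv.
  by rewrite I1 mule1 GE => <-.
have := swap id (B + A) (@measurable_id _ _ _).
have -> : (\int[mu]_x (x * (phi (x + 1) - phi x))%:E = - \int[mu]_x (phi x)%:E)%E.
  transitivity (\int[mu]_x (((x + 1) * phi (x + 1))%:E - (x * phi x)%:E -
      (phi (x + 1))%:E))%E.
    apply: eq_integral => x _; rewrite -!EFinB; congr EFin; lra.
  have i1 := integrable_shift1 1 xphii; have i2 := integrable_shift1 1 phii.
  rewrite integralB//; last exact: integrableB.
  rewrite integralB//.
  rewrite (integral_shift1 1 (f := fun x => (x * phi x)%:E)); last exact: mh.
  rewrite (integral_shift1 1 (f := EFin \o phi)); last exact/measurable_EFinP.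
  by rewrite subee ?sub0e//; exact: integrable_fin_num.
move=> ->; last first.
  move=> s; rewrite indicE; case: (boolP (s \in I)); last first.
    by rewrite mulr0; under eq_integral do rewrite mulr0; rewrite integral0.
  rewrite eI => /andP[s0 s1]; rewrite mulr1; under eq_integral do rewrite mulr1.
  rewrite EFinD AE BE -ge0_integralD//; last 2 first.
  - by case/integrableP : absxg.
  - by case/integrableP : absg.
  rewrite -(integral_shift1 s (f := fun x => (`|x * g x|%:E + `|g x|%:E)%E)); last first.
    by apply: emeasurable_funD; [case/integrableP : absxg|case/integrableP : absg].
  apply: ge0_le_integral => //.
  - by apply/measurable_EFinP/measurableT_comp => //; apply: measurable_funM => //; exact: mshift.
  - apply/measurable_EFinP/measurable_funD; apply: measurableT_comp => //.
      by apply: measurable_funM; [exact: measurable_shift1|exact: mshift].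
    exact: mshift.
  move=> x _; rewrite -EFinD lee_fin.
  have -> : x * g (x + s) = (x + s) * g (x + s) - s * g (x + s) by lra.
  rewrite (le_trans (ler_normB _ _))// lerD2l normrM ger0_norm// ler_piMl//.
under [RHS]eq_integral => s _.
  under eq_integral => x _.
    (* Recentring at x + s leaves the term - s g(x + s), whose integral vanishes by [g0]; the rest
       no longer depends on s. *)
    have -> : x * g (x + s) * \1_I s = ((x + s) * g (x + s) - s * g (x + s)) * \1_I s by lra.
    rewrite EFinM EFinB.
    over.
  have i3 := integrable_shift1 s xgi.
  have i4 : mu.-integrable setT (fun x => (s * g (x + s))%:E).
    by under [X in integrable _ _ X]funext do rewrite EFinM; exact: integrableZl.
  rewrite integralZr//; last exact: integrableB.
  rewrite integralB//.
  rewrite (integral_shift1 s (f := fun x => (x * g x)%:E)); last exact: mh.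
  under [X in (_ - X)%E]eq_integral do rewrite EFinM.
  rewrite integralZl//.
  rewrite (integral_shift1 s (f := EFin \o g)); last exact/measurable_EFinP.
  rewrite g0 mule0 sube0.
  over.
rewrite -(fineK (integrable_fin_num _ xgi))// integralZl//.
  by rewrite I1 mule1.
exact: integrable_indic_itv.
Qed.

End real_line.

(** * The standard Gaussian: translations, exponential moments, variance *)

Section gaussian.
Context {R : realType}.
Local Notation mu := (@lebesgue_measure R).
Local Notation gamma := (@normal_prob R 0 1).
Local Notation g := (@normal_pdf R 0 1).

Lemma std_normal_pdfE x : g x = normal_peak 1 * expR (- (x ^+ 2) / 2).
Proof.
by rewrite normal_pdfE ?oner_eq0//= /normal_fun subr0 expr1n.
Qed.

Lemma std_normal_pdfB (a x : R) : g (x - a) = g x * expR (a * x - a ^+ 2 / 2).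
Proof.
rewrite !std_normal_pdfE -mulrA -expRD; congr (_ * expR _); by field.
Qed.

Lemma std_normal_pdfN (x : R) : g (- x) = g x.
Proof. by rewrite !std_normal_pdfE sqrrN. Qed.

Lemma measurable_std_normal_pdf : measurable_fun setT g.
Proof. exact: measurable_normal_pdf. Qed.
Let mg := measurable_std_normal_pdf.

Lemma integral_std_normal (h : R -> \bar R) : measurable_fun setT h ->
  (forall x, 0 <= h x)%E -> (\int[gamma]_x h x = \int[mu]_x (h x * (g x)%:E))%E.
Proof.
move=> mh h0; rewrite -(integral_weighted mu mg (normal_pdf_ge0 0 1) mh h0).
by apply: eq_measure_integral.
Qed.

(** With [h = 1] this gives the exponential moments; in [harnack_step] it turns a displacement of
    the base point into a weight on the Gaussian. *)
Lemma std_normal_cameron_martin (a : R) (h : R -> \bar R) :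
  measurable_fun setT h -> (forall x, 0 <= h x)%E ->
  (\int[gamma]_x h (x + a)%R =
   \int[gamma]_x (h x * (expR (a * x - a ^+ 2 / 2))%:E))%E.
Proof.
move=> mh h0.
have me : measurable_fun setT (fun x : R => expR (a * x - a ^+ 2 / 2)).
  apply: measurableT_comp => //; exact: measurable_funB.
rewrite integral_std_normal//; last first.
  exact: (measurableT_comp mh (measurable_shift1 a)).
rewrite integral_std_normal//; last 2 first.
- by apply: emeasurable_funM => //; exact/measurable_EFinP.
- by move=> x; rewrite mule_ge0// lee_fin expR_ge0.
rewrite -(ge0_integral_shift1 (- a)); last 2 first.
- apply: emeasurable_funM; first exact: (measurableT_comp mh (measurable_shift1 a)).
  exact/measurable_EFinP.
- by move=> x; rewrite mule_ge0// lee_fin normal_pdf_ge0.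
apply: eq_integral => x _; rewrite subrK std_normal_pdfB -muleA; congr (_ * _)%E.
by rewrite -EFinM mulrC.
Qed.

Lemma std_normal_exp (a : R) :
  (\int[gamma]_x (expR (a * x))%:E = (expR (a ^+ 2 / 2))%:E)%E.
Proof.
have := std_normal_cameron_martin a (measurable_cst (1%E : \bar R)) (fun=> lee01).
rewrite integral_cst//= probability_setT mule1 => H.
have me : measurable_fun setT (fun x : R => (expR (a * x - a ^+ 2 / 2))%:E).
  apply/measurable_EFinP; apply: measurableT_comp => //; exact: measurable_funB.
transitivity (\int[gamma]_x ((expR (a ^+ 2 / 2))%:E * (expR (a * x - a ^+ 2 / 2))%:E))%E.
  by apply: eq_integral => x _; rewrite -EFinM -expRD addrC subrK.
rewrite ge0_integralZl_EFin ?expR_ge0// -[RHS]mule1 [in RHS]H.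
by congr (_ * _)%E; apply: eq_integral => x _; rewrite mul1e.
Qed.

Lemma std_normal_opp (h : R -> \bar R) :
  measurable_fun setT h -> (forall x, 0 <= h x)%E ->
  (\int[gamma]_x h (- x)%R = \int[gamma]_x h x)%E.
Proof.
move=> mh h0; have mN : @measurable_fun _ _ (measurableTypeR R) (measurableTypeR R) setT -%R.
  exact: (@measurable_funN _ _ _ setT id).
rewrite !integral_std_normal//; last exact: (measurableT_comp mh mN).
rewrite -[RHS]ge0_integral_opp; last 2 first.
- by apply: emeasurable_funM => //; exact/measurable_EFinP.
- by move=> x; rewrite mule_ge0// lee_fin normal_pdf_ge0.
by apply: eq_integral => x _; rewrite std_normal_pdfN.
Qed.

Lemma measurable_exp_norm (c : R) : measurable_fun setT (fun x : R => expR (c * `|x|)).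
Proof.
by apply: measurableT_comp => //; exact: measurable_funM.
Qed.

Lemma std_normal_exp_norm (c : R) :
  gamma.-integrable setT (fun x => (expR (c * `|x|))%:E).
Proof.
apply/integrableP; split; first by apply/measurable_EFinP; exact: measurable_exp_norm.
have me a : measurable_fun setT (fun x : R => (expR (a * x))%:E).
  by apply/measurable_EFinP; apply: measurableT_comp => //; exact: measurable_funM.
have me0 a x : [set: R] x -> (0 <= (expR (a * x))%:E)%E by rewrite lee_fin expR_ge0.
apply: (@le_lt_trans _ _ (\int[gamma]_x ((expR (c * x))%:E + (expR (- c * x))%:E))%E).
  apply: ge0_le_integral => //.
  - by apply: measurableT_comp => //; apply/measurable_EFinP; exact: measurable_exp_norm.
  - exact: (emeasurable_funD (me c) (me (- c))).
  - move=> x _; rewrite -EFinD lee_fin ger0_norm ?expR_ge0//.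
    have [x0|x0] := leP 0 x; first by rewrite ger0_norm// lerDl expR_ge0.
    by rewrite ltr0_norm// mulrN -mulNr lerDr expR_ge0.
rewrite (ge0_integralD gamma measurableT (me0 c) (me c) (me0 (- c)) (me (- c))).
by rewrite !std_normal_exp -EFinD ltry.
Qed.

Lemma std_normal_exp_dominated (c C : R) (h : R -> R) : measurable_fun setT h ->
  (forall x, `|h x| <= C * expR (c * `|x|)) ->
  gamma.-integrable setT (EFin \o h).
Proof.
move=> mh hC.
apply: (le_integrable _ _ _ (integrableZl measurableT C (std_normal_exp_norm c))) => //.
  exact/measurable_EFinP.
by move=> x _; rewrite -EFinM/= lee_fin (le_trans (hC x))// ler_norm.
Qed.

Lemma norm_le_exp (x : R) : `|x| <= expR `|x|.
Proof. by rewrite (le_trans _ (expR_ge1Dx _))// lerDr. Qed.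

Lemma std_normal_mean : (\int[gamma]_x x%:E = 0)%E.
Proof.
have i : gamma.-integrable setT (EFin \o id).
  by apply: (@std_normal_exp_dominated 1 1) => // x; rewrite !mul1r norm_le_exp.
have : (\int[gamma]_x (- x)%:E = \int[gamma]_x x%:E)%E.
  have mN : @measurable_fun _ _ (measurableTypeR R) (measurableTypeR R) setT -%R.
    exact: (@measurable_funN _ _ _ setT id).
  have mE : measurable_fun setT (@EFin R) by exact/measurable_EFinP.
  apply: (integral_invariant (mu := gamma) (tau := -%R) _ mE).
  by move=> f mf f0; exact: std_normal_opp.
under eq_integral do rewrite EFinN.
rewrite integralN; last exact: integrable_add_def.
rewrite -(fineK (integrable_fin_num _ i))// -EFinN => -[] H.
congr EFin; move: H; lra.
Qed.

Lemma expr2_le_exp (x : R) : x ^+ 2 <= 4 * expR `|x|.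
Proof.
have := norm_le_exp (x / 2); rewrite normrM (@ger0_norm _ 2^-1)// => H.
have -> : expR `|x| = expR (`|x| / 2) * expR (`|x| / 2) by rewrite -expRD -splitr.
rewrite -[x ^+ 2]real_normK ?num_real//.
have : (`|x| / 2) * (`|x| / 2) <= expR (`|x| / 2) * expR (`|x| / 2).
  by apply: ler_pM; rewrite ?divr_ge0.
by rewrite expr2; lra.
Qed.

Lemma integrable_std_normal_pdf (h : R -> R) :
  gamma.-integrable setT (EFin \o h) ->
  mu.-integrable setT (fun x => (h x * g x)%:E).
Proof.
move=> /integrableP[/measurable_EFinP mh hoo]; apply/integrableP; split.
  exact/measurable_EFinP/measurable_funM.
apply: le_lt_trans hoo; rewrite integral_std_normal//; last first.
  by apply: measurableT_comp => //; exact/measurable_EFinP.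
rewrite le_eqVlt; apply/orP; left; apply/eqP/eq_integral => x _.
by rewrite EFinM abseM [`|(g x)%:E|%E]gee0_abs// lee_fin normal_pdf_ge0.
Qed.

Lemma is_derive_std_normal_pdf (x : R) : is_derive x (1 : R) g (- x * g x).
Proof.
have -> : g = fun x => normal_peak 1 * expR (- (x ^+ 2) / 2).
  by apply/funext => y; rewrite std_normal_pdfE.
by apply: is_derive_eq; rewrite /GRing.scale/=; field.
Qed.

(** The density has derivative - x times itself, so [integral_id_derivative] turns the variance into
    the total mass. *)
Lemma std_normal_variance : (\int[gamma]_x (x ^+ 2)%:E = 1)%E.
Proof.
have i0 : gamma.-integrable setT (EFin \o cst 1).
  by apply: (@std_normal_exp_dominated 0 1) => // x; rewrite mul0r expR0 mulr1 normr1.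
have i1 : gamma.-integrable setT (EFin \o id).
  by apply: (@std_normal_exp_dominated 1 1) => // x; rewrite !mul1r norm_le_exp.
have i2 : gamma.-integrable setT (EFin \o (fun x => x ^+ 2)).
  apply: (@std_normal_exp_dominated 1 4) => [|x]; first exact: measurable_funX.
  by rewrite mul1r ger0_norm ?sqr_ge0// expr2_le_exp.
have {}i0 := integrable_std_normal_pdf i0.
have {}i1 := integrable_std_normal_pdf i1.
have {}i2 := integrable_std_normal_pdf i2.
have cg : continuous (fun x : R => - x * g x).
  move=> x; apply: continuousM; first exact: continuousN.
  exact: (is_derive_continuous is_derive_std_normal_pdf).
have : (\int[mu]_x (x * (- x * g x))%:E = - \int[mu]_x (g x)%:E)%E.
  apply: integral_id_derivative => //.
  - move=> a b ab; apply/esym/integral_is_derive => //.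
    exact: is_derive_std_normal_pdf.
  - exact: integrable_normal_pdf.
  - apply: eq_integrable (integrableN i1) => // x _ /=.
    by rewrite mulNr.
  - apply: eq_integrable (integrableN i2) => // x _ /=.
    by rewrite mulNr mulrN expr2 mulrA.
rewrite integral_normal_pdf integral_std_normal//; last 2 first.
- exact/measurable_EFinP/measurable_funX.
- by move=> x; rewrite lee_fin sqr_ge0.
under eq_integral do rewrite mulNr mulrN mulrA -expr2 EFinN.
rewrite integralN; last exact: integrable_add_def.
by move=> /(congr1 (fun x => - x)%E); rewrite !oppeK.
Qed.

(* From [expR u <= 1 + u expR u]. *)
Lemma std_normal_variance_perturbed (M eps : R) : 0 <= M -> 0 < eps ->
  exists2 d : R, 0 < d & forall s, 0 < s -> s < d ->
    (\int[gamma]_x (x ^+ 2 * expR (M * s * `|x|))%:E <= (1 + eps)%:E)%E.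
Proof.
move=> M0 e0.
pose h (x : R) := x ^+ 2 * (`|x| * expR (M * `|x|)).
have mh : measurable_fun setT h.
  apply: measurable_funM; first exact: measurable_funX.
  by apply: measurable_funM; [exact: normr_measurable|exact: measurable_exp_norm].
have h0 x : 0 <= h x by rewrite /h mulr_ge0 ?sqr_ge0// mulr_ge0 ?expR_ge0.
have hi : gamma.-integrable setT (EFin \o h).
  apply: (@std_normal_exp_dominated (2 + M) 4) => // x.
  rewrite ger0_norm//.
  have -> : expR ((2 + M) * `|x|) = expR `|x| * expR `|x| * expR (M * `|x|).
    by rewrite -!expRD; congr expR; ring.
  rewrite /h !mulrA ler_wpM2r ?expR_ge0//.
  by rewrite ler_pM ?sqr_ge0 ?expr2_le_exp ?norm_le_exp.
pose C := fine (\int[gamma]_x (h x)%:E)%E.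
have CE : (\int[gamma]_x (h x)%:E = C%:E)%E by rewrite fineK// integrable_fin_num.
have C0 : 0 <= C by rewrite -lee_fin -CE integral_ge0// => x _; rewrite lee_fin.
(* The bound s < 1 replaces the exponential of M s |x| by that of M |x|, so that the remainder
   integrates to at most s M C; the second bound makes this at most [eps], and the 1 added to M C
   keeps the quotient meaningful when M C = 0. *)
exists (Num.min 1 (eps / (M * C + 1))) => [|s s0].
  by rewrite lt_min ltr01 divr_gt0// ltr_wpDl// mulr_ge0.
rewrite lt_min => /andP[s1 se].
have q0 x : [set: R] x -> (0 <= (x ^+ 2)%:E)%E by rewrite lee_fin sqr_ge0.
have mq : measurable_fun setT (fun x : R => (x ^+ 2)%:E).
  by apply/measurable_EFinP; exact: measurable_funX.
have sM0 : 0 <= s * M by rewrite mulr_ge0// ltW.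
have hh0 x : [set: R] x -> (0 <= (s * M)%:E * (h x)%:E)%E by rewrite mule_ge0 ?lee_fin.
have mhh : measurable_fun setT (fun x : R => (s * M)%:E * (h x)%:E)%E.
  by apply: emeasurable_funM => //; exact/measurable_EFinP.
apply: (@le_trans _ _ (\int[gamma]_x ((x ^+ 2)%:E + (s * M)%:E * (h x)%:E))%E).
  apply: ge0_le_integral => //.
  - by move=> x _; rewrite lee_fin mulr_ge0 ?sqr_ge0 ?expR_ge0.
  - apply/measurable_EFinP/measurable_funM; first exact: measurable_funX.
    exact: measurable_exp_norm.
  - exact: (emeasurable_funD mq mhh).
  move=> x _; rewrite -EFinM -EFinD lee_fin /h.
  have -> : x ^+ 2 + s * M * (x ^+ 2 * (`|x| * expR (M * `|x|))) =
    x ^+ 2 * (1 + s * M * `|x| * expR (M * `|x|)) by ring.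
  rewrite ler_wpM2l ?sqr_ge0//.
  have u0 : 0 <= M * s * `|x| by rewrite !mulr_ge0// ltW.
  set u := M * s * `|x| in u0 *.
  have uM : expR u <= expR (M * `|x|).
    by rewrite ler_expR /u -!mulrA ler_wpM2l// ler_piMl// ltW.
  have -> : s * M * `|x| = u by rewrite /u [s * M]mulrC.
  rewrite (le_trans (_ : _ <= 1 + u * expR u))//; last by rewrite lerD2l ler_wpM2l.
  have H := expR_ge1Dx (- u).
  have : expR u * (1 - u) <= 1.
    by rewrite (le_trans (ler_wpM2l (expR_ge0 u) H))// -expRD subrr expR0.
  by rewrite mulrBr mulr1 lerBlDr [u * _]mulrC.
rewrite (ge0_integralD gamma measurableT q0 mq hh0 mhh) std_normal_variance.
rewrite ge0_integralZl_EFin//; last 2 first.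
- by move=> x _; rewrite lee_fin.
- exact/measurable_EFinP.
rewrite CE -EFinM -EFinD lee_fin lerD2l.
have MC : 0 < M * C + 1 by rewrite ltr_wpDl// mulr_ge0.
move: se; rewrite ltr_pdivlMr//; nra.
Qed.

End gaussian.

Lemma measurable_fun_inv d (T : measurableType d) (R : realType) (f : T -> R) :
  measurable_fun setT f -> measurable_fun setT (fun x => (f x)^-1).
Proof.
(* with Rocq's convention [0^-1 = 0] and [ln 0 = 0] *)
have E (x : R) : x^-1 = x * expR (- ln (x ^+ 2)).
  have [->|x0] := eqVneq x 0; first by rewrite invr0 mul0r.
  by rewrite expRN lnK ?posrE ?exprn_even_gt0// expr2 invfM mulrA divff// mul1r.
move=> mf; under eq_fun do rewrite E.
apply: measurable_funM => //; apply: measurableT_comp => //.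
apply: measurable_funN; apply: measurableT_comp; first exact: measurable_ln.
exact: measurable_funX.
Qed.

(** * Elementary inequalities for x ln x *)

Section entropy_kernel.
Context {R : realType}.
Implicit Types t u a b c : R.

Lemma ge0_of_derive_ge1 (G dG : R -> R) t :
  (forall x : R, 0 < x -> is_derive x (1 : R) G (dG x)) ->
  (forall x : R, 1 < x -> 0 <= dG x) -> G 1 = 0 -> 1 <= t -> 0 <= G t.
Proof.
move=> dd d0 G1 t1; rewrite -G1.
have pos (x : R) : x \in `]1, +oo[ -> 0 < x.
  by rewrite in_itv/= andbT; exact: lt_trans.
apply: (@ger0_derive1_ndecry _ G 1) => //.
- by move=> x x1; case: (dd x (pos x x1)).
- move=> x x1; rewrite derive1E (@derive_val _ _ _ _ _ _ _ (dd x (pos x x1))).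
  by apply: d0; move: x1; rewrite in_itv/= andbT.
- apply: derivable_within_continuous => x; rewrite in_itv/= andbT => x1.
  by case: (dd x (lt_le_trans ltr01 x1)).
Qed.

Lemma ln_le_subr1 t : 0 < t -> ln t <= t - 1.
Proof.
move=> t0; have := @le_ln1Dx R (t - 1); rewrite addrCA subrr addr0; apply.
by rewrite ltrBDr addNr.
Qed.

Lemma xlnx_le_sqr t : 1 <= t -> t * ln t - t + 1 <= (t - 1) ^+ 2 / 2.
Proof.
move=> t1; rewrite -subr_ge0.
pose G (x : R) := (x - 1) ^+ 2 / 2 - (x * ln x - x + 1).
pose dG (x : R) := x - 1 - ln x.
have dd (x : R) : 0 < x -> is_derive x (1 : R) G (dG x).
  move=> x0; have H := is_derive1_ln x0.
  rewrite /G /dG; apply: is_derive_eq; rewrite /GRing.scale/=; field.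
  by rewrite gt_eqF.
have d0 (x : R) : 1 < x -> 0 <= dG x.
  by move=> x1; rewrite subr_ge0 ln_le_subr1// (lt_trans ltr01).
have G1 : G 1 = 0 by rewrite /G ln1; lra.
exact: (ge0_of_derive_ge1 dd d0 G1 t1).
Qed.

Lemma ln_ge_sqr t : 1 <= t -> t - 1 - (t - 1) ^+ 2 / 2 <= ln t.
Proof.
move=> t1; rewrite -subr_ge0.
pose G (x : R) := ln x - (x - 1 - (x - 1) ^+ 2 / 2).
pose dG (x : R) := (x - 1) ^+ 2 / x.
have dd (x : R) : 0 < x -> is_derive x (1 : R) G (dG x).
  move=> x0; have H := is_derive1_ln x0.
  rewrite /G /dG; apply: is_derive_eq; rewrite /GRing.scale/=; field.
  by rewrite gt_eqF.
have d0 (x : R) : 1 < x -> 0 <= dG x.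
  by move=> x1; rewrite divr_ge0 ?sqr_ge0// ltW// (lt_trans ltr01).
have G1 : G 1 = 0 by rewrite /G ln1; lra.
exact: (ge0_of_derive_ge1 dd d0 G1 t1).
Qed.

(** The left side is c times t ln t - t + 1 at t = a / c, which vanishes to second order at t = 1.
    For t >= 1 it is at most (t - 1)^2 / 2; for t < 1 the quadratic bound has [a] as denominator
    instead of [c], which the hypothesis on the ratio repairs at the price of [expR u]. *)
Lemma entropy_kernel_le a c u : 0 < a -> 0 < c -> 0 <= u ->
  c <= expR u * a ->
  a * ln a - a * ln c - a + c <= 2^-1 * expR u * ((a - c) ^+ 2 / c).
Proof.
move=> a0 c0 u0 ca; have eu : 1 <= expR u by rewrite -[leLHS]expR0 ler_expR.
have eu0 := expR_gt0 u.
have [ac|ac] := leP c a.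
  have t1 : 1 <= a / c by rewrite ler_pdivlMr// mul1r.
  have := xlnx_le_sqr t1; rewrite lnM ?posrE ?invr_gt0// lnV ?posrE//.
  move=> /(ler_wpM2l (ltW c0)).
  have -> : c * (a / c * (ln a - ln c) - a / c + 1) = a * ln a - a * ln c - a + c.
    by field; rewrite gt_eqF.
  have -> : c * ((a / c - 1) ^+ 2 / 2) = 2^-1 * ((a - c) ^+ 2 / c).
    by field; rewrite gt_eqF.
  move=> /le_trans; apply; rewrite -mulrA ler_wpM2l// ler_peMl//.
  by rewrite divr_ge0 ?sqr_ge0// ltW.
have t1 : 1 <= c / a by rewrite ler_pdivlMr// mul1r ltW.
have := ln_ge_sqr t1; rewrite lnM ?posrE ?invr_gt0// lnV ?posrE//.
move=> /(ler_wpM2l (ltW a0)).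
have -> : a * (c / a - 1 - (c / a - 1) ^+ 2 / 2) = c - a - 2^-1 * ((a - c) ^+ 2 / a).
  by field; rewrite gt_eqF.
rewrite mulrBr => H.
have : 2^-1 * ((a - c) ^+ 2 / a) <= 2^-1 * expR u * ((a - c) ^+ 2 / c).
  rewrite -mulrA ler_wpM2l// mulrCA ler_wpM2l ?sqr_ge0//.
  by rewrite ler_pdivlMr// mulrC ler_pdivrMr.
lra.
Qed.

(** Gibbs' inequality in pointwise form, from ln t <= t - 1 at t = c / a. *)
Lemma entropy_kernel_ge0 a c : 0 <= a -> 0 < c -> 0 <= a * ln a - a * ln c - a + c.
Proof.
rewrite le_eqVlt => /orP[/eqP <-|a0] c0; first by rewrite !mul0r; lra.
have := ln_le_subr1 (divr_gt0 c0 a0); rewrite lnM ?posrE ?invr_gt0// lnV ?posrE//.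
move=> /(ler_wpM2l (ltW a0)).
have -> : a * (c / a - 1) = c - a by field; rewrite gt_eqF.
lra.
Qed.

End entropy_kernel.

(** * Convexity inequalities for integrals *)

Section integral_complements.
Context d (T : measurableType d) (R : realType) (mu : {measure set T -> \bar R}).
Local Open Scope ereal_scope.

Lemma le_integral_integrable_ge0 (f g : T -> \bar R) :
  mu.-integrable setT f -> measurable_fun setT g -> (forall x, 0 <= g x) ->
  (forall x, f x <= g x) -> \int[mu]_x f x <= \int[mu]_x g x.
Proof.
move=> fi mg g0 fg; have [goo|] := ltP (\int[mu]_x g x) +oo; last first.
  by rewrite leye_eq => /eqP ->; exact: leey.
apply: le_integral => //; apply/integrableP; split => //.
by rewrite (eq_integral g)// => x _; rewrite gee0_abs.
Qed.

End integral_complements.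

Section jensen.
Context d (T : measurableType d) (R : realType) (P : probability T R).

(** Jensen for the convex function D^2 / A, which lies above each 2 l D - l^2 A; the proof
    integrates this bound with l the ratio of the two integrals. *)
Lemma sqr_integral_div_le (D A : T -> R) :
  P.-integrable setT (EFin \o D) -> P.-integrable setT (EFin \o A) ->
  (forall x, 0 < A x) ->
  (((fine (\int[P]_x (D x)%:E)) ^+ 2 / fine (\int[P]_x (A x)%:E))%:E <=
   \int[P]_x ((D x) ^+ 2 / A x)%:E)%E.
Proof.
move=> Di Ai A0.
have [mD mA] : measurable_fun setT D /\ measurable_fun setT A.
  by split; [case/integrableP : Di|case/integrableP : Ai] => /measurable_EFinP.
set d1 := fine _; set a := fine _.
have dE : (\int[P]_x (D x)%:E = d1%:E)%E by rewrite fineK// integrable_fin_num.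
have aE : (\int[P]_x (A x)%:E = a%:E)%E by rewrite fineK// integrable_fin_num.
pose l := d1 / a.
have i1 : P.-integrable setT (fun x => ((2 * l) * D x)%:E).
  by under [X in integrable _ _ X]funext do rewrite EFinM; exact: integrableZl.
have i2 : P.-integrable setT (fun x => (l ^+ 2 * A x)%:E).
  by under [X in integrable _ _ X]funext do rewrite EFinM; exact: integrableZl.
have : (\int[P]_x (((2 * l) * D x)%:E - (l ^+ 2 * A x)%:E) <=
    \int[P]_x ((D x) ^+ 2 / A x)%:E)%E.
  apply: le_integral_integrable_ge0.
  - exact: integrableB.
  - apply/measurable_EFinP/measurable_funM; first exact: measurable_funX.
    exact: measurable_fun_inv.
  - by move=> x; rewrite lee_fin divr_ge0 ?sqr_ge0// ltW.
  - move=> x; rewrite -EFinB lee_fin -subr_ge0.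
    have -> : (D x) ^+ 2 / A x - (2 * l * D x - l ^+ 2 * A x) = (D x - l * A x) ^+ 2 / A x.
      by field; rewrite gt_eqF.
    by rewrite divr_ge0 ?sqr_ge0// ltW.
rewrite integralB//.
under eq_integral do rewrite EFinM.
under [X in (_ - X)%E]eq_integral do rewrite EFinM.
rewrite !integralZl// dE aE -!EFinM -EFinB; apply: le_trans.
rewrite lee_fin /l.
have [->|a0] := eqVneq a 0; first by rewrite invr0 !mulr0 !mul0r subrr.
rewrite le_eqVlt; apply/orP; left; apply/eqP; by field.
Qed.

End jensen.

(** * Gaussian averages along one coordinate *)

Section averages.
Context {R : realType} {n : nat}.
Local Notation mu := (@lebesgue_measure R).
Local Notation gamma := (@normal_prob R 0 1).
Local Notation V := 'rV[R]_n.
Local Notation L := (@lebesgue_rV R n).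
Local Notation E i := (delta_mx ord0 i : V).
Implicit Types (s M b : R) (i : 'I_n) (x : V) (f : V -> R) (h : V -> \bar R).

(** One step of the discrete heat flow: convolution with a centred Gaussian of variance s^2 carried
    by the i-th axis. *)
Definition eavg s i h x : \bar R := \int[gamma]_z h (x + (s * z) *: E i)%R.

Definition avg s i f x : R := fine (eavg s i (EFin \o f) x).

Lemma measurable_gauss_line s i :
  measurable_fun setT (fun z : V * R => z.1 + (s * z.2) *: E i).
Proof.
apply: measurable_rVD; first exact: measurable_fst.
by apply: measurable_rVZ => //; apply: measurable_funM => //; exact: measurable_snd.
Qed.

Lemma measurable_on_gauss_line s i x :
  measurable_fun setT (fun z : R => x + (s * z) *: E i).
Proof. by apply: measurable_rVD => //; apply: measurable_rVZ. Qed.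

Lemma measurable_eavg s i h : measurable_fun setT h -> (forall x, 0 <= h x)%E ->
  measurable_fun setT (eavg s i h).
Proof.
move=> mh h0.
apply: (@measurable_fun_fubini_tonelli_F _ _ _ _ _ gamma
  (fun z : V * R => h (z.1 + (s * z.2) *: E i))) => //.
by apply: measurableT_comp => //; exact: measurable_gauss_line.
Qed.

Lemma eavg_ge0 s i h x : (forall x, 0 <= h x)%E -> (0 <= eavg s i h x)%E.
Proof. by move=> h0; exact: integral_ge0. Qed.

Lemma le_eavg s i (h1 h2 : V -> \bar R) x :
  measurable_fun setT h1 -> (forall x, 0 <= h1 x)%E -> measurable_fun setT h2 ->
  (forall x, h1 x <= h2 x)%E -> (eavg s i h1 x <= eavg s i h2 x)%E.
Proof.
move=> m1 h10 m2 h12; apply: ge0_le_integral => //.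
- exact: (measurableT_comp m1 (measurable_on_gauss_line s i x)).
- exact: (measurableT_comp m2 (measurable_on_gauss_line s i x)).
Qed.

(** Each average is self-adjoint, by translation invariance of Lebesgue measure and symmetry of the
    Gaussian. *)
Lemma integral_eavg_mul s i (h k : V -> \bar R) :
  measurable_fun setT h -> (forall x, 0 <= h x)%E ->
  measurable_fun setT k -> (forall x, 0 <= k x)%E ->
  (\int[L]_x (eavg s i h x * k x) = \int[L]_x (h x * eavg s i k x))%E.
Proof.
move=> mh h0 mk k0.
have ml := measurable_gauss_line s i.
transitivity (\int[L]_x \int[gamma]_z (h (x + (s * z) *: E i)%R * k x))%E.
  apply: eq_integral => x _; rewrite -ge0_integralZr//.
  exact: (measurableT_comp mh (measurable_on_gauss_line s i x)).
rewrite (@fubini_tonelli _ _ _ _ _ L gamma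
  (fun z : V * R => h (z.1 + (s * z.2) *: E i)%R * k z.1)%E); last 2 first.
- apply: emeasurable_funM; first exact: measurableT_comp.
  exact: (measurableT_comp mk measurable_fst).
- by move=> z; rewrite mule_ge0.
transitivity (\int[gamma]_z \int[L]_x (h x * k (x + (s * - z) *: E i)%R))%E.
  apply: eq_integral => z _.
  rewrite -[LHS](ge0_integral_shift ((s * - z) *: E i)); last 2 first.
  - apply: emeasurable_funM => //.
    exact: (measurableT_comp mh (measurable_shift_rV ((s * z) *: E i))).
  - by move=> x; rewrite mule_ge0.
  apply: eq_integral => x _.
  by rewrite -addrA -scalerDl -mulrDr addNr mulr0 scale0r addr0.
have mhk : measurable_fun setT
    (fun z : V * R => h z.1 * k (z.1 + (s * z.2) *: E i)%R)%E.
  apply: emeasurable_funM; first exact: (measurableT_comp mh measurable_fst).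
  exact: measurableT_comp.
pose W (z : R) := (\int[L]_x (h x * k (x + (s * z) *: E i)%R))%E.
have mW : measurable_fun setT W.
  apply: (@measurable_fun_fubini_tonelli_G _ _ _ _ _ L _ mhk).
  by move=> z; rewrite mule_ge0.
have W0 z : (0 <= W z)%E by apply: integral_ge0 => x _; rewrite mule_ge0.
transitivity (\int[gamma]_z W z)%E; first exact: (std_normal_opp mW W0).
rewrite -(@fubini_tonelli _ _ _ _ _ L gamma
  (fun z : V * R => h z.1 * k (z.1 + (s * z.2) *: E i)%R)%E)//; last first.
  by move=> z; rewrite mule_ge0.
apply: eq_integral => x _ /=; rewrite ge0_integralZl//.
exact: (measurableT_comp mk (measurable_on_gauss_line s i x)).
Qed.

Lemma eavg_cst s i (c : \bar R) x : eavg s i (cst c) x = c.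
Proof. by rewrite /eavg integral_cst//= probability_setT mule1. Qed.

Lemma integral_eavg s i h : measurable_fun setT h -> (forall x, 0 <= h x)%E ->
  (\int[L]_x eavg s i h x = \int[L]_x h x)%E.
Proof.
move=> mh h0; have := @integral_eavg_mul s i h (cst 1%E) mh h0 (measurable_cst _) (fun=> lee01).
under eq_integral do rewrite mule1.
by move=> ->; apply: eq_integral => x _; rewrite eavg_cst mule1.
Qed.

(* [f] is positive and [ln f] is Lipschitz along each coordinate. *)
Definition loglip M f := [/\ 0 <= M, measurable_fun setT f, forall x, 0 < f x
  & forall i x (t : R), f (x + t *: E i) <= expR (M * `|t|) * f x].

Section loglip_avg.
Variables (M : R) (f : V -> R) (s : R) (i : 'I_n).
Hypothesis (lf : loglip M f).
Let mf : measurable_fun setT f. Proof. by case: lf. Qed.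
Let M0 : 0 <= M. Proof. by case: lf. Qed.
Let f0 x : 0 < f x. Proof. by case: lf => _ _ /(_ x). Qed.
Let fM j x (t : R) : f (x + t *: E j) <= expR (M * `|t|) * f x.
Proof. by case: lf => _ _ _ /(_ j x t). Qed.

Lemma loglip_ge j x (t : R) : f x <= expR (M * `|t|) * f (x + t *: E j).
Proof.
have := fM j (x + t *: E j) (- t); rewrite normrN.
by rewrite -addrA -scalerDl subrr scale0r addr0.
Qed.

Lemma loglip_le_gauss x z :
  f (x + (s * z) *: E i) <= f x * expR (M * `|s| * `|z|).
Proof. by rewrite [leRHS]mulrC -mulrA -normrM. Qed.

Lemma integrable_loglip_gauss x :
  gamma.-integrable setT (fun z => (f (x + (s * z) *: E i))%:E).
Proof.
apply: (@std_normal_exp_dominated _ (M * `|s|) (f x)).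
  exact: (measurableT_comp mf (measurable_on_gauss_line s i x)).
by move=> z; rewrite gtr0_norm// loglip_le_gauss.
Qed.

Lemma EFin_avg x : (avg s i f x)%:E = eavg s i (EFin \o f) x.
Proof. by rewrite fineK// integrable_fin_num//; exact: integrable_loglip_gauss. Qed.

(** Pointwise f(x + s z) is at least f(x) / exp(c |z|), and Jensen bounds the mean of exp(- c |z|)
    below by 1 / K. *)
Lemma avg_gt0 x : 0 < avg s i f x.
Proof.
pose c := M * `|s|; have c0 : 0 <= c by rewrite mulr_ge0.
pose K := fine (\int[gamma]_z (expR (c * `|z|))%:E)%E.
have KE : (K%:E = \int[gamma]_z (expR (c * `|z|))%:E)%E.
  by rewrite fineK// integrable_fin_num//; exact: std_normal_exp_norm.
have K0 : 0 < K.
  rewrite -lte_fin; apply: (@lt_le_trans _ _ 1%E) => //.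
  rewrite KE -(eavg_cst s i 1%E x); apply: ge0_le_integral => //.
    by apply/measurable_EFinP; exact: measurable_exp_norm.
  by move=> z _; rewrite lee_fin -expR0 ler_expR mulr_ge0.
have H := sqr_integral_div_le (P := gamma) (D := cst 1) (A := fun z => expR (c * `|z|))
  (finite_measure_integrable_cst _ 1 measurableT) (std_normal_exp_norm c) (fun z => expR_gt0 _).
rewrite -lte_fin EFin_avg; apply: (@lt_le_trans _ _ ((f x)%:E * (1 / K)%:E)%E).
  by rewrite -EFinM lte_fin mulr_gt0// divr_gt0.
apply: (@le_trans _ _ ((f x)%:E * \int[gamma]_z ((cst 1 z) ^+ 2 / expR (c * `|z|))%:E)%E).
  apply: lee_wpmul2l; first by rewrite lee_fin ltW.
  apply: le_trans H.
  have G1 : (\int[gamma]_z (cst (1 : R) z)%:E = 1)%E := eavg_cst s i 1%E x.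
  by rewrite G1/= expr1n lexx.
have mi : measurable_fun setT (fun z : R => (cst 1 z ^+ 2 / expR (c * `|z|))%:E).
  apply/measurable_EFinP; apply: measurable_funM; first exact: measurable_funX.
  by apply: measurable_fun_inv; exact: measurable_exp_norm.
have mi0 z : [set: R] z -> (0 <= (cst 1 z ^+ 2 / expR (c * `|z|))%:E)%E.
  by move=> _; rewrite lee_fin divr_ge0 ?expR_ge0 ?sqr_ge0.
rewrite -ge0_integralZl_EFin//; last by rewrite ltW.
rewrite /eavg; apply: ge0_le_integral => //.
- by move=> z _; rewrite mule_ge0// ?mi0// lee_fin ltW.
- exact: emeasurable_funM.
- apply/measurable_EFinP.
  exact: (measurableT_comp mf (measurable_on_gauss_line s i x)).
move=> z _; rewrite -EFinM lee_fin/= expr1n mul1r ler_pdivrMr ?expR_gt0//.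
by rewrite [leRHS]mulrC /c -mulrA -normrM; exact: loglip_ge.
Qed.

Lemma loglip_avg : loglip M (avg s i f).
Proof.
split=> //.
- apply: measurableT_comp => //; apply: measurable_eavg.
    exact/measurable_EFinP.
  by move=> x; rewrite lee_fin ltW.
- exact: avg_gt0.
move=> j x t; rewrite -lee_fin EFinM !EFin_avg /eavg -ge0_integralZl_EFin ?expR_ge0//.
- have ms y : measurable_fun setT (fun z : R => (f (y + (s * z) *: E i))%:E).
    apply/measurable_EFinP.
    exact: (measurableT_comp mf (measurable_on_gauss_line s i y)).
  apply: ge0_le_integral => //=.
  + by move=> z _; rewrite lee_fin ltW.
  + exact: (ms (x + t *: E j)).
  + by apply: emeasurable_funM => //; exact: ms.
  + by move=> z _; rewrite -EFinM lee_fin addrAC.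
- by move=> z _; rewrite lee_fin ltW.
- apply/measurable_EFinP.
  exact: (measurableT_comp mf (measurable_on_gauss_line s i x)).
Qed.

Lemma avg_le b x : (forall x, f x <= b) -> avg s i f x <= b.
Proof.
move=> fb; rewrite -lee_fin EFin_avg -[leRHS](eavg_cst s i _ x).
apply: le_eavg => //; first exact/measurable_EFinP.
by move=> y; rewrite lee_fin ltW.
Qed.

Lemma integral_avg : (\int[L]_x (avg s i f x)%:E = \int[L]_x (f x)%:E)%E.
Proof.
under eq_integral do rewrite EFin_avg.
apply: integral_eavg; first exact/measurable_EFinP.
by move=> x; rewrite lee_fin ltW.
Qed.

(* Jensen's inequality for the relative entropy along the Gaussian, with
   reference value [f x]. *)
Lemma entropy_avg_le b x : (forall x, ln (f x) <= b) ->
  ((avg s i f x * (b - ln (avg s i f x)))%:E <=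
   eavg s i (fun y => (f y * (b - ln (f y)))%:E) x +
   \int[gamma]_z (2^-1 * expR (M * `|s| * `|z|) *
     ((f (x + (s * z) *: E i) - f x) ^+ 2 / f x))%:E)%E.
Proof.
move=> fb; set a := avg s i f x.
have a0 : 0 < a := avg_gt0 x.
have i1 := integrable_loglip_gauss x.
have mF : measurable_fun setT (fun z : R => f (x + (s * z) *: E i)).
  exact: (measurableT_comp mf (measurable_on_gauss_line s i x)).
(* [G] is the tangent at [f x] of the concave function y (b - ln y), evaluated at f(x + s z). By
   linearity its mean is the tangent at the mean [a], which lies above the function; at each sample
   the tangent exceeds the function by exactly the entropy kernel. *)
pose G z := f (x + (s * z) *: E i) * (b - ln (f x) - 1) + f x.
have Gi : gamma.-integrable setT (EFin \o G).
  rewrite (_ : EFin \o G = fun z => ((b - ln (f x) - 1)%:E * (f (x + (s * z) *: E i))%:E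
     + (f x)%:E)%E); last by apply/funext => z; rewrite /G/= EFinD EFinM muleC.
  apply: integrableD => //; first exact: integrableZl.
  exact: finite_measure_integrable_cst.
have GE : (\int[gamma]_z (G z)%:E = (a * (b - ln (f x) - 1) + f x)%:E)%E.
  transitivity (\int[gamma]_z ((b - ln (f x) - 1)%:E * (f (x + (s * z) *: E i))%:E
     + (f x)%:E))%E; first by apply: eq_integral => z _; rewrite /G EFinD EFinM muleC.
  rewrite integralD//; last 2 first.
  - exact: integrableZl.
  - exact: finite_measure_integrable_cst.
  rewrite integralZl// integral_cst//= probability_setT mule1.
  by rewrite [RHS]EFinD [in RHS]EFinM /a EFin_avg [in RHS]muleC.
apply: (@le_trans _ _ (\int[gamma]_z (G z)%:E)%E).
  rewrite GE lee_fin.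
  have := ln_le_subr1 (divr_gt0 (f0 x) a0); rewrite lnM ?posrE ?invr_gt0// lnV ?posrE//.
  move=> /(ler_wpM2l (ltW a0)).
  have -> : a * (f x / a - 1) = f x - a by field; rewrite gt_eqF.
  by rewrite mulrBr; lra.
have m1 : measurable_fun setT (fun z : R =>
    (f (x + (s * z) *: E i) * (b - ln (f (x + (s * z) *: E i))))%:E).
  apply/measurable_EFinP; apply: measurable_funM => //; apply: measurable_funB => //.
  exact: measurableT_comp.
have m2 : measurable_fun setT (fun z : R => (2^-1 * expR (M * `|s| * `|z|) *
     ((f (x + (s * z) *: E i) - f x) ^+ 2 / f x))%:E).
  apply/measurable_EFinP; apply: measurable_funM.
    by apply: measurable_funM => //; exact: measurable_exp_norm.
  by apply: measurable_funM => //; apply: measurable_funX; exact: measurable_funB.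
have p1 z : (0 <= (f (x + (s * z) *: E i) * (b - ln (f (x + (s * z) *: E i))))%:E)%E.
  by rewrite lee_fin; apply: mulr_ge0; [exact: ltW|rewrite subr_ge0].
have p2 z : (0 <= (2^-1 * expR (M * `|s| * `|z|) *
     ((f (x + (s * z) *: E i) - f x) ^+ 2 / f x))%:E)%E.
  rewrite lee_fin; apply: mulr_ge0; first by rewrite mulr_ge0 ?expR_ge0.
  by rewrite divr_ge0 ?sqr_ge0// ltW.
rewrite /eavg -(ge0_integralD gamma measurableT (fun z _ => p1 z) m1 (fun z _ => p2 z) m2).
apply: le_integral_integrable_ge0 => //.
- exact: emeasurable_funD.
- by move=> z; rewrite adde_ge0.
move=> z; rewrite -EFinD lee_fin /G.
have u0 : 0 <= M * `|s| * `|z| by rewrite !mulr_ge0.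
have := entropy_kernel_le (f0 (x + (s * z) *: E i)) (f0 x) u0.
have := loglip_ge i x (s * z); rewrite normrM mulrA => H /(_ H).
by set F := f (x + _); rewrite !mulrBr; lra.
Qed.

End loglip_avg.

End averages.

(** * The discrete heat flow: entropy growth and log-Harnack inequality *)

Section harnack.
Context {R : realType} {n : nat}.
Local Notation mu := (@lebesgue_measure R).
Local Notation gamma := (@normal_prob R 0 1).
Local Notation V := 'rV[R]_n.
Local Notation L := (@lebesgue_rV R n).
Local Notation E i := (delta_mx ord0 i : V).
Implicit Types (s M b : R) (i : 'I_n) (x : V) (f F : V -> R) (h : V -> \bar R)
  (J : 'I_n -> R) (w : seq 'I_n).

(** A finite-difference form of the Fisher information: to leading order in t, [J i] bounds its part
    in the i-th direction. In this form the bound needs only Jensen to be carried through the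
    averages. *)
Definition chi2_bound M J f := forall i (t : R),
  (\int[L]_x ((f (x + t *: E i) - f x) ^+ 2 / f x)%:E <=
   (t ^+ 2 * expR (M * `|t|) * J i)%:E)%E.

Lemma measurable_chi2 f (v : V) : measurable_fun setT f ->
  measurable_fun setT (fun x => ((f (x + v) - f x) ^+ 2 / f x)%:E).
Proof.
move=> mf; apply/measurable_EFinP; apply: measurable_funM.
  apply: measurable_funX; apply: measurable_funB => //.
  exact: (measurableT_comp mf (measurable_shift_rV v)).
exact: measurable_fun_inv.
Qed.

Lemma chi2_ge0 M f (v x : V) : loglip M f ->
  (0 <= ((f (x + v) - f x) ^+ 2 / f x)%:E)%E.
Proof. by case=> _ _ f0 _; rewrite lee_fin divr_ge0 ?sqr_ge0// ltW. Qed.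

Lemma chi2_avg M J f s i : loglip M f -> chi2_bound M J f ->
  chi2_bound M J (avg s i f).
Proof.
move=> lf cf j t; have [M0 mf f0 fM] := lf.
apply: le_trans (cf j t).
have m2 := measurable_chi2 (t *: E j) mf.
rewrite -(integral_eavg s i m2); last by move=> x; exact: (chi2_ge0 _ _ lf).
have la := loglip_avg s i lf.
apply: ge0_le_integral => //.
- by move=> x _; exact: (chi2_ge0 _ _ la).
- by apply: measurable_chi2; case: la.
- by apply: measurable_eavg => // x; exact: (chi2_ge0 _ _ lf).
move=> x _.
have i1 := integrable_loglip_gauss s i lf x.
have i2 := integrable_loglip_gauss s i lf (x + t *: E j).
have := @sqr_integral_div_le _ _ _ gamma
  (fun z => f (x + t *: E j + (s * z) *: E i) - f (x + (s * z) *: E i))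
  (fun z => f (x + (s * z) *: E i)) (integrableB measurableT i2 i1) i1
  (fun z => f0 _).
rewrite /eavg; under [in X in (_ <= X)%E -> _]eq_integral do rewrite addrAC.
move=> H; apply: le_trans H; rewrite le_eqVlt; apply/orP; left; apply/eqP.
congr ((_ ^+ 2 / _)%:E); under eq_integral do rewrite EFinB.
rewrite integralB// -[X in (X - _)%E]/(eavg s i (EFin \o f) _).
by rewrite -[X in (_ - X)%E]/(eavg s i (EFin \o f) _) -!(EFin_avg s i lf).
Qed.

(** A discrete de Bruijn inequality. Integrate [entropy_avg_le]: averaging preserves the integral of
    f (b - ln f), and [chi2_bound] at displacement s z supplies (s z)^2 J i. One exponential of M s
    |z| comes from the entropy kernel and one from [chi2_bound], whence the 2 M. *)
Lemma entropy_step M J f s i b : 0 < s -> loglip M f -> chi2_bound M J f ->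
  (forall x, ln (f x) <= b) ->
  (\int[L]_x (avg s i f x * (b - ln (avg s i f x)))%:E <=
   \int[L]_x (f x * (b - ln (f x)))%:E +
   (2^-1 * s ^+ 2 * J i)%:E *
     \int[gamma]_z (z ^+ 2 * expR (2 * M * s * `|z|))%:E)%E.
Proof.
move=> s0 lf cf fb; have [M0 mf f0 fM] := lf.
have la := loglip_avg s i lf; have [_ ma a0 _] := la.
have Ji : 0 <= J i.
  have : (0%:E <= (1 ^+ 2 * expR (M * `|1|) * J i)%:E)%E.
    by apply: le_trans (cf i 1); apply: integral_ge0 => x _; exact: (chi2_ge0 _ _ lf).
  by rewrite lee_fin expr1n mul1r pmulr_rge0// expR_gt0.
pose D (z : V * R) := (2^-1 * expR (M * s * `|z.2|) *
  ((f (z.1 + (s * z.2) *: E i) - f z.1) ^+ 2 / f z.1))%:E.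
have mD : measurable_fun setT D.
  have m1 : measurable_fun setT (fun z : V * R => f z.1).
    exact: (measurableT_comp mf measurable_fst).
  apply/measurable_EFinP; apply: measurable_funM.
    apply: measurable_funM => //.
    exact: (measurableT_comp (measurable_exp_norm (M * s)) measurable_snd).
  apply: measurable_funM; last exact: measurable_fun_inv.
  apply: measurable_funX; apply: measurable_funB => //.
  exact: (measurableT_comp mf (measurable_gauss_line s i)).
have D0 z : (0 <= D z)%E.
  rewrite lee_fin; apply: mulr_ge0; first by rewrite mulr_ge0 ?expR_ge0.
  by rewrite divr_ge0 ?sqr_ge0// ltW.
have mfb : measurable_fun setT (fun x => (f x * (b - ln (f x)))%:E).
  apply/measurable_EFinP; apply: measurable_funM => //; apply: measurable_funB => //.
  exact: measurableT_comp.
have fb0 x : (0 <= (f x * (b - ln (f x)))%:E)%E.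
  by rewrite lee_fin mulr_ge0 ?subr_ge0// ltW.
have lb x : ln (avg s i f x) <= b.
  rewrite -(expRK b) ler_ln ?posrE ?expR_gt0//; apply: (avg_le _ _ lf) => y.
  by rewrite -[f y]lnK ?posrE// ler_expR.
apply: (@le_trans _ _ (\int[L]_x (eavg s i (fun y => (f y * (b - ln (f y)))%:E) x +
    \int[gamma]_z D (x, z)))%E).
  apply: ge0_le_integral => //.
  - by move=> x _; rewrite lee_fin mulr_ge0 ?subr_ge0// ltW.
  - apply/measurable_EFinP; apply: measurable_funM => //; apply: measurable_funB => //.
    exact: measurableT_comp.
  - apply: emeasurable_funD; first exact: measurable_eavg.
    exact: (@measurable_fun_fubini_tonelli_F _ _ _ _ _ gamma D).
  - move=> x _; have := entropy_avg_le s i lf x fb.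
    by rewrite (gtr0_norm s0).
rewrite ge0_integralD//; last 4 first.
- by move=> x _; exact: eavg_ge0.
- exact: measurable_eavg.
- by move=> x _; exact: integral_ge0.
- exact: (@measurable_fun_fubini_tonelli_F _ _ _ _ _ gamma D).
rewrite integral_eavg// leeD2l// (@fubini_tonelli _ _ _ _ _ L gamma D)//.
have mz : measurable_fun setT (fun z : R => (z ^+ 2 * expR (2 * M * s * `|z|))%:E).
  apply/measurable_EFinP; apply: measurable_funM; first exact: measurable_funX.
  exact: measurable_exp_norm.
rewrite -ge0_integralZl_EFin//; last 2 first.
- by move=> z _; rewrite lee_fin mulr_ge0 ?sqr_ge0// expR_ge0.
- by rewrite mulr_ge0// mulr_ge0// sqr_ge0.
apply: ge0_le_integral => //.
- by move=> z _; exact: integral_ge0.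
- exact: (@measurable_fun_fubini_tonelli_G _ _ _ _ _ L D).
- exact: emeasurable_funM.
move=> z _; rewrite /D/=; under eq_integral do rewrite EFinM.
rewrite ge0_integralZl_EFin//; last 2 first.
- by move=> x _; exact: (chi2_ge0 _ _ lf).
- exact: measurable_chi2.
apply: (@le_trans _ _ ((2^-1 * expR (M * s * `|z|))%:E *
    ((s * z) ^+ 2 * expR (M * `|s * z|) * J i)%:E)%E).
  by apply: lee_wpmul2l; [rewrite lee_fin mulr_ge0 ?expR_ge0|exact: cf].
rewrite -!EFinM lee_fin normrM (gtr0_norm s0).
have -> : expR (2 * M * s * `|z|) = expR (M * s * `|z|) * expR (M * s * `|z|).
  by rewrite -expRD; congr expR; ring.
rewrite mulrA (_ : M * (s * `|z|) = M * s * `|z|) ?mulrA//.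
by rewrite le_eqVlt; apply/orP; left; apply/eqP; ring.
Qed.

(** Log-Harnack inequality for one step. Translation by a = s al puts the weight [w] on the
    Gaussian, so that F w / c has mean 1; then ln t <= t - 1 at t = F w / c, integrated, gives the
    claim. The cost al^2 / 2 is the relative entropy of a Gaussian with respect to its translate by
    al. *)
Lemma harnack_step M F s i b (a : R) x : 0 < s -> loglip M F ->
  (forall x, ln (F x) <= b) ->
  ((b - ln (avg s i F (x + a *: E i)))%:E <=
   eavg s i (fun y => (b - ln (F y))%:E) x + (a ^+ 2 / (2 * s ^+ 2))%:E)%E.
Proof.
move=> s0 lF Fb; have [M0 mF F0 FM] := lF.
set c := avg s i F _; have c0 : 0 < c by exact: (avg_gt0 s i lF).
pose al := a / s.
have sal : s * al = a by rewrite /al mulrC divfK// gt_eqF.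
have mFx : measurable_fun setT (fun z : R => F (x + (s * z) *: E i)).
  exact: (measurableT_comp mF (measurable_on_gauss_line s i x)).
pose w (z : R) := expR (al * z - al ^+ 2 / 2).
have mw : measurable_fun setT w.
  by apply: measurableT_comp => //; exact: measurable_funB.
have mFw : measurable_fun setT (fun z : R => (c^-1 * (F (x + (s * z) *: E i) * w z))%:E).
  by apply/measurable_EFinP; apply: measurable_funM => //; exact: measurable_funM.
have cE : (\int[gamma]_z (c^-1 * (F (x + (s * z) *: E i) * w z))%:E = 1)%E.
  under eq_integral do rewrite EFinM.
  rewrite ge0_integralZl_EFin//; last 3 first.
  - by move=> z _; rewrite lee_fin mulr_ge0 ?expR_ge0// ltW.
  - by apply/measurable_EFinP; exact: measurable_funM.
  - by rewrite invr_ge0 ltW.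
  have -> : (\int[gamma]_z (F (x + (s * z) *: E i) * w z)%:E = c%:E)%E.
    rewrite /c (EFin_avg s i lF) /eavg.
    transitivity (\int[gamma]_z (F (x + (s * (z + al)) *: E i))%:E)%E; last first.
      by apply: eq_integral => z _ /=; rewrite mulrDr sal scalerDl [_ + a *: _]addrC addrA.
    have m' : measurable_fun setT (fun z : R => (F (x + (s * z) *: E i))%:E).
      exact/measurable_EFinP.
    have p' z : (0 <= (F (x + (s * z) *: E i))%:E)%E by rewrite lee_fin ltW.
    by rewrite (std_normal_cameron_martin al m' p').
  by rewrite -EFinM mulVf// gt_eqF.
pose f1 (z : R) := ((b - ln c + 1)%:E + (al%:E * z%:E))%E.
have iz : gamma.-integrable setT (EFin \o id).
  by apply: (@std_normal_exp_dominated _ 1 1) => // z; rewrite !mul1r norm_le_exp.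
have i1 : gamma.-integrable setT f1.
  apply: integrableD => //; first exact: finite_measure_integrable_cst.
  exact: (integrableZl measurableT al iz).
have f1E : (\int[gamma]_z f1 z = (b - ln c + 1)%:E)%E.
  rewrite /f1 integralD//; last 2 first.
  - exact: finite_measure_integrable_cst.
  - exact: (integrableZl measurableT al iz).
  rewrite (integralZl measurableT iz) std_normal_mean mule0 adde0.
  by rewrite integral_cst//= probability_setT mule1.
pose k z := ((b - ln (F (x + (s * z) *: E i)))%:E)%E.
have mk : measurable_fun setT k.
  by apply/measurable_EFinP; apply: measurable_funB => //; exact: measurableT_comp.
have k0 z : (0 <= k z)%E by rewrite lee_fin subr_ge0.
have al0 : (0 <= (al ^+ 2 / 2)%:E)%E by rewrite lee_fin divr_ge0 ?sqr_ge0.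
have mka : measurable_fun setT (fun z => k z + (al ^+ 2 / 2)%:E)%E.
  exact: emeasurable_funD.
have ka0 z : (0 <= k z + (al ^+ 2 / 2)%:E)%E by rewrite adde_ge0.
have w0 z : (0 <= (c^-1 * (F (x + (s * z) *: E i) * w z))%:E)%E.
  by rewrite lee_fin; apply: mulr_ge0; [rewrite invr_ge0 ltW|rewrite mulr_ge0 ?expR_ge0 ?ltW].
have : (\int[gamma]_z f1 z <= \int[gamma]_z (k z + (al ^+ 2 / 2)%:E +
    (c^-1 * (F (x + (s * z) *: E i) * w z))%:E))%E.
  apply: le_integral_integrable_ge0 => //.
  - exact: emeasurable_funD.
  - by move=> z; rewrite adde_ge0.
  move=> z; rewrite /f1 /k -EFinM -!EFinD lee_fin.
  set y := F _; have y0 : 0 < y by exact: F0.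
  have t0 : 0 < c^-1 * (y * w z) by rewrite mulr_gt0 ?invr_gt0// mulr_gt0// expR_gt0.
  have := ln_le_subr1 t0; rewrite lnM ?posrE ?invr_gt0//; last by rewrite mulr_gt0// expR_gt0.
  rewrite lnM ?posrE ?expR_gt0// lnV ?posrE// /w expRK; lra.
rewrite f1E (ge0_integralD gamma measurableT (fun z _ => ka0 z) mka (fun z _ => w0 z) mFw).
rewrite cE (ge0_integralD gamma measurableT (fun z _ => k0 z) mk (fun z _ => al0) (measurable_cst _)).
rewrite integral_cst//= probability_setT mule1 [X in (X%:E <= _)%E -> _]addrC EFinD.
rewrite [X in (_ <= X)%E -> _]addeC leeD2lE//.
by rewrite /al expr_div_n -mulrA -invfM [s ^+ 2 * 2]mulrC.
Qed.

(** The word [w] lists the coordinates to be averaged: [fwd] applies its first letter first, [bwd]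
    and [ebwd] apply it last. As each average is self-adjoint, [fwd] and [ebwd] are adjoint to each
    other. *)
Definition fwd s w f := foldl (fun f i => avg s i f) f w.
Definition bwd s w f := foldr (fun i f => avg s i f) f w.
Definition ebwd s w h := foldr (eavg s) h w.

Lemma loglip_bwd M s w f : loglip M f -> loglip M (bwd s w f).
Proof. by move=> lf; elim: w => //= i w; exact: loglip_avg. Qed.

Lemma loglip_fwd M s w f : loglip M f -> loglip M (fwd s w f).
Proof. by elim: w f => //= i w IH f lf; apply: IH; exact: loglip_avg. Qed.

Lemma ebwd_ge0 s w h : (forall x, 0 <= h x)%E -> forall x, (0 <= ebwd s w h x)%E.
Proof. by move=> h0; elim: w => //= i w IH x; exact: eavg_ge0. Qed.

Lemma measurable_ebwd s w h : measurable_fun setT h -> (forall x, 0 <= h x)%E ->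
  measurable_fun setT (ebwd s w h).
Proof.
move=> mh h0; elim: w => //= i w IH; apply: measurable_eavg => //.
exact: ebwd_ge0.
Qed.

Lemma loglip_shift M f (v : V) : loglip M f -> loglip M (fun x => f (x + v)).
Proof.
case=> M0 mf f0 fM; split=> //.
- exact: (measurableT_comp mf (measurable_shift_rV v)).
- by move=> i x t; rewrite addrAC.
Qed.

Lemma ln_avg_le M f s i b : loglip M f -> (forall x, ln (f x) <= b) ->
  forall x, ln (avg s i f x) <= b.
Proof.
move=> lf fb x; have [M0 mf f0 fM] := lf.
rewrite -(expRK b) ler_ln ?posrE ?expR_gt0//; last exact: (avg_gt0 s i lf).
by apply: (avg_le _ _ lf) => y; rewrite -[f y]lnK ?posrE// ler_expR.
Qed.

Lemma ln_bwd_le M f s w b : loglip M f -> (forall x, ln (f x) <= b) ->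
  forall x, ln (bwd s w f x) <= b.
Proof.
move=> lf fb; elim: w => //= i w IH.
exact: (ln_avg_le s i (loglip_bwd s w lf) IH).
Qed.

Lemma ln_fwd_le M f s w b : loglip M f -> (forall x, ln (f x) <= b) ->
  forall x, ln (fwd s w f x) <= b.
Proof.
elim: w f => //= i w IH f lf fb.
exact: (IH _ (loglip_avg s i lf) (ln_avg_le s i lf fb)).
Qed.

(** The displacement is spent letter by letter and the quadratic costs add up: the part left to the
    later letters only translates the function being averaged, and translation commutes with
    averaging. *)
Lemma harnack_bwd M F s b w (a : 'I_n -> R) x : 0 < s -> loglip M F ->
  (forall x, ln (F x) <= b) ->
  ((b - ln (bwd s w F (x + \sum_(i <- w) a i *: E i)))%:E <=
   ebwd s w (fun y => (b - ln (F y))%:E) x +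
     (\sum_(i <- w) a i ^+ 2 / (2 * s ^+ 2))%:E)%E.
Proof.
move=> s0 lF Fb; have [M0 mF F0 FM] := lF.
have mh : measurable_fun setT (fun y => (b - ln (F y))%:E).
  by apply/measurable_EFinP; apply: measurable_funB => //; exact: measurableT_comp.
have h0 y : (0 <= (b - ln (F y))%:E)%E by rewrite lee_fin subr_ge0.
elim: w x => [|i w IH] x; first by rewrite !big_nil addr0 adde0.
rewrite !big_cons/=; set v := \sum_(j <- w) a j *: E j.
set cw := \sum_(j <- w) (_ / _) in IH *.
have lG := loglip_shift v (loglip_bwd s w lF).
have Gb y : ln (bwd s w F (y + v)) <= b by exact: (ln_bwd_le s w lF Fb).
have -> : avg s i (bwd s w F) (x + (a i *: E i + v)) =
    avg s i (fun y => bwd s w F (y + v)) (x + a i *: E i).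
  congr fine; apply: eq_integral => z _ /=; congr (bwd s w F _)%:E.
    by rewrite [in LHS]addrA [LHS]addrAC.
have H := harnack_step i (a i) x s0 lG Gb.
apply: (le_trans H).
rewrite [(_ + cw)%:E]EFinD [((_ / _)%:E + _)%E]addeC addeA leeD2r//.
have mb := measurable_ebwd s w mh h0; have b0 := ebwd_ge0 s w h0.
have cw0 : (0 <= cw%:E)%E.
  by rewrite lee_fin sumr_ge0// => j _; rewrite divr_ge0 ?sqr_ge0// mulr_ge0 ?sqr_ge0.
have -> : (eavg s i (ebwd s w (fun y => (b - ln (F y))%:E)) x + cw%:E =
    eavg s i (fun y => ebwd s w (fun y => (b - ln (F y))%:E) y + cw%:E) x)%E.
  rewrite [RHS]/eavg (ge0_integralD gamma measurableT (fun z _ => b0 _) _ (fun z _ => cw0))//.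
  - by congr (_ + _)%E; rewrite integral_cst//= probability_setT mule1.
  - exact: (measurableT_comp mb (measurable_on_gauss_line s i x)).
apply: le_eavg.
- apply/measurable_EFinP; apply: measurable_funB => //; apply: measurableT_comp => //.
  by case: lG.
- by move=> y; rewrite lee_fin subr_ge0.
- exact: emeasurable_funD.
- exact: IH.
Qed.

Lemma integral_fwd_mul M f s w h : loglip M f ->
  measurable_fun setT h -> (forall x, 0 <= h x)%E ->
  (\int[L]_x ((fwd s w f x)%:E * h x) = \int[L]_x ((f x)%:E * ebwd s w h x))%E.
Proof.
move=> lf mh h0; elim: w f lf => //= i w IH f lf.
rewrite IH; last exact: loglip_avg.
have [M0 mf f0 _] := lf.
under eq_integral do rewrite (EFin_avg s i lf).
apply: integral_eavg_mul => //.
- exact/measurable_EFinP.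
- by move=> x; rewrite lee_fin ltW.
- exact: measurable_ebwd.
- exact: ebwd_ge0.
Qed.

Lemma entropy_fwd M J f s w b : 0 < s -> loglip M f -> chi2_bound M J f ->
  (forall i, 0 <= J i) -> (forall x, ln (f x) <= b) ->
  (\int[L]_x (fwd s w f x * (b - ln (fwd s w f x)))%:E <=
   \int[L]_x (f x * (b - ln (f x)))%:E +
   (2^-1 * s ^+ 2 * \sum_(i <- w) J i)%:E *
     \int[gamma]_z (z ^+ 2 * expR (2 * M * s * `|z|))%:E)%E.
Proof.
move=> s0 lf cf J0 fb; set kp := (\int[gamma]_z _)%E.
have kp0 : (0 <= kp)%E.
  by apply: integral_ge0 => z _; rewrite lee_fin mulr_ge0 ?sqr_ge0 ?expR_ge0.
elim: w f lf cf fb => [|i w IH] f lf cf fb /=.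
  by rewrite big_nil mulr0 mul0e adde0.
have := IH _ (loglip_avg s i lf) (chi2_avg s i lf cf) (ln_avg_le s i lf fb).
move=> /le_trans; apply.
have h0 : 0 <= 2^-1 * s ^+ 2 by rewrite mulr_ge0 ?sqr_ge0.
rewrite big_cons mulrDr EFinD ge0_muleDl ?lee_fin; last 2 first.
- exact: mulr_ge0.
- by rewrite mulr_ge0// sumr_ge0.
by rewrite addeA leeD2r//; exact: entropy_step.
Qed.

Lemma integral_bwd M f s w : loglip M f ->
  (\int[L]_x (bwd s w f x)%:E = \int[L]_x (f x)%:E)%E.
Proof.
move=> lf; elim: w => //= i w IH.
by rewrite (integral_avg s i (loglip_bwd s w lf)).
Qed.

Lemma integral_fwd M f s w : loglip M f ->
  (\int[L]_x (fwd s w f x)%:E = \int[L]_x (f x)%:E)%E.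
Proof.
elim: w f => //= i w IH f lf; rewrite (IH _ (loglip_avg s i lf)).
exact: (integral_avg s i lf).
Qed.

Lemma big_flatten_nseq (U : nmodType) (N : nat) w (G : 'I_n -> U) :
  \sum_(i <- flatten (nseq N w)) G i = (\sum_(i <- w) G i) *+ N.
Proof.
by elim: N => [|N IH]; rewrite ?big_nil ?mulr0n//= big_cat/= IH mulrS.
Qed.

(** [G] is obtained by running the word forward, to [F], and then backward. [harnack_bwd] bounds b -
    ln G by backward averages of b - ln F; adjointness moves these averages onto [f], where they
    rebuild [F]. The integral of f h is thus that of F (b - ln F), which [entropy_fwd] controls. *)
Lemma smooth_harnack M J f b (S eps : R) : loglip M f -> chi2_bound M J f ->
  (forall i, 0 <= J i) -> (forall x, ln (f x) <= b) -> 0 < S -> 0 < eps ->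
  exists (G : V -> R) h,
    [/\ measurable_fun setT G, forall x, 0 < G x, forall x, ln (G x) <= b
      & (\int[L]_x (G x)%:E = \int[L]_x (f x)%:E)%E] /\
    [/\ measurable_fun setT h, forall x, (0 <= h x)%E,
      forall x v, ((b - ln (G (x + v)))%:E <= h x + (sqnorm v / (2 * S))%:E)%E
    & (\int[L]_x ((f x)%:E * h x) <= \int[L]_x (f x * (b - ln (f x)))%:E +
       (S / 2 * (\sum_i J i) * (1 + eps))%:E)%E].
Proof.
move=> lf cf J0 fb S0 e0; have [M0 mf f0 _] := lf.
have [d d0 kd] := std_normal_variance_perturbed (mulr_ge0 (ler0n R 2) M0) e0.
(* Enough rounds for the step s, with s^2 = S / N, to fall below the threshold [d] under which the
   perturbed variance is at most 1 + eps. *)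
have [N N0 Nd] : exists2 N : nat, (0 < N)%N & S / d ^+ 2 < N%:R.
  exists (Num.truncn (S / d ^+ 2)).+1 => //.
  exact: truncnS_gt.
have NR : 0 < N%:R :> R by rewrite ltr0n.
pose s := Num.sqrt (S / N%:R).
have s2 : s ^+ 2 = S / N%:R by rewrite sqr_sqrtr// divr_ge0// ltW.
have s0 : 0 < s by rewrite sqrtr_gt0 divr_gt0.
have sd : s < d.
  rewrite -(ltr_pXn2r (_ : 0 < 2)%N) ?nnegrE ?ltW// s2.
  by move: Nd; rewrite ltr_pdivrMr ?exprn_gt0// ltr_pdivrMr// mulrC.
pose w := flatten (nseq N (index_enum 'I_n)).
pose F := fwd s w f.
have lF : loglip M F by exact: loglip_fwd.
have [_ mF F0 _] := lF.
have Fb : forall x, ln (F x) <= b by exact: (ln_fwd_le s w lf fb).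
pose k y := (b - ln (F y))%:E.
have mk : measurable_fun setT k.
  by apply/measurable_EFinP; apply: measurable_funB => //; exact: measurableT_comp.
have k0 y : (0 <= k y)%E by rewrite lee_fin subr_ge0.
have [_ mG G0 _] := loglip_bwd s w lF.
exists (bwd s w F), (ebwd s w k); split; split => //.
- exact: (ln_bwd_le s w lF Fb).
- by rewrite (integral_bwd s w lF); exact: (integral_fwd s w lf).
- exact: measurable_ebwd.
- exact: ebwd_ge0.
(* Each of the N rounds spends v / N; with s^2 = S / N the costs N (v_i / N)^2 / (2 s^2) sum to
   |v|^2 / (2 S), whatever N is. *)
- move=> x v; have := harnack_bwd w (fun i => v ord0 i / N%:R) x s0 lF Fb.
  have -> : \sum_(i <- w) (v ord0 i / N%:R) *: E i = v.
    rewrite big_flatten_nseq -scaler_nat scaler_sumr [RHS]row_sum_delta.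
    apply: eq_bigr => i _; rewrite scalerA mulrC divfK// gt_eqF//.
  have -> // : \sum_(i <- w) (v ord0 i / N%:R) ^+ 2 / (2 * s ^+ 2) = sqnorm v / (2 * S).
  rewrite big_flatten_nseq s2 /sqnorm /dot -sumrMnl mulr_suml.
  apply: eq_bigr => i _; rewrite -mulr_natl; field.
  by rewrite !gt_eqF.
- rewrite -(integral_fwd_mul s w lf mk k0).
  apply: le_trans (_ : _ <= \int[L]_x (F x * (b - ln (F x)))%:E)%E _.
    by rewrite le_eqVlt; apply/orP; left; apply/eqP/eq_integral => x _; rewrite EFinM.
  apply: (le_trans (entropy_fwd w s0 lf cf J0 fb)); rewrite leeD2l//.
  rewrite big_flatten_nseq s2 [leRHS]EFinM.
  have -> : 2^-1 * (S / N%:R) * ((\sum_(i <- index_enum 'I_n) J i) *+ N) =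
      S / 2 * \sum_i J i.
    by rewrite -mulr_natl; field; rewrite gt_eqF.
  apply: lee_wpmul2l; last exact: kd.
  by rewrite lee_fin mulr_ge0 ?sumr_ge0// divr_ge0// ltW.
Qed.

End harnack.

(** * C^1 plateau functions of one variable *)

Section bumps.
Context {R : realType}.
Implicit Types a b u : R.

Lemma is_derive_of_remainder (f : R -> R) (u d C : R) :
  (forall h, `|f (u + h) - f u - d * h| <= C * h ^+ 2) -> is_derive u (1 : R) f d.
Proof.
move=> fC.
have C0 : 0 <= C by have := le_trans (normr_ge0 _) (fC 1); rewrite expr1n mulr1.
suff H : h^-1 *: ((f \o shift u) (h *: (1 : R)) - f u) @[h --> 0^'] --> d.
  split; first by apply/cvg_ex; exists d.
  exact: (cvg_lim _ H).
apply/cvgrPdist_le => /= e e0; near=> h.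
have h0 : h != 0 by near: h; exact: nbhs_dnbhs_neq.
rewrite /GRing.scale/= mulr1 [h + u]addrC distrC.
have -> : h^-1 * (f (u + h) - f u) - d = h^-1 * (f (u + h) - f u - d * h).
  by field.
rewrite normrM normfV ler_pdivrMl ?normr_gt0//.
rewrite (le_trans (fC h))// -[h ^+ 2]real_normK ?num_real// expr2 mulrCA.
rewrite ler_wpM2l//.
have : `|h| <= e / (C + 1).
  near: h; apply: dnbhs0_le; rewrite divr_gt0// ltr_wpDl//.
rewrite ler_pdivlMr ?ltr_wpDl// mulrDr mulr1 mulrC; apply: le_trans.
by rewrite lerDl.
Unshelve. all: by end_near. Qed.

(** Squaring the positive part makes it C^1, the regularity that [test_function] asks for. *)
Definition pos2 u := Num.max 0 u ^+ 2.

Lemma continuous_max0 : continuous (fun u : R => Num.max 0 u).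
Proof. by move=> u; apply: continuous_max; [exact: cvg_cst|exact: cvg_id]. Qed.

Lemma is_derive_pos2 u : is_derive u (1 : R) pos2 (2 * Num.max 0 u).
Proof.
apply: (@is_derive_of_remainder _ _ _ 1) => h; rewrite mul1r /pos2.
have [u0|u0] := leP 0 u; have [v0|v0] := leP 0 (u + h);
  rewrite ler_norml; apply/andP; split; nra.
Qed.

Definition bump a b u := pos2 (u - a) * pos2 (b - u).

Lemma bump_ge0 a b u : 0 <= bump a b u.
Proof. by rewrite mulr_ge0 ?sqr_ge0. Qed.

Lemma bump_in a b u : a < u -> u < b -> 0 < bump a b u.
Proof.
move=> au ub; rewrite /bump /pos2 mulr_gt0// exprn_gt0// lt_max ?subr_gt0.
  by rewrite au orbT.
by rewrite ub orbT.
Qed.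

Lemma bump_out a b u : ~~ (a < u < b) -> bump a b u = 0.
Proof.
rewrite negb_and -!leNgt /bump /pos2 => /orP[ua|bu].
  by rewrite max_l ?subr_le0// expr0n mul0r.
by rewrite mulrC max_l ?subr_le0// expr0n mul0r.
Qed.

Definition dbump a b u :=
  2 * Num.max 0 (u - a) * pos2 (b - u) - pos2 (u - a) * (2 * Num.max 0 (b - u)).

Lemma is_derive_bump a b u : is_derive u (1 : R) (bump a b) (dbump a b u).
Proof.
have d1 : is_derive u (1 : R) (fun u => pos2 (u - a)) (2 * Num.max 0 (u - a)).
  have H := is_derive_pos2 (u - a).
  have H2 : is_derive u (1 : R) (fun u => u - a) 1 by apply: is_derive_eq; rewrite subr0.
  have := @is_derive1_comp _ pos2 (fun u => u - a) u _ _ H H2.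
  by rewrite mulr1.
have d2 : is_derive u (1 : R) (fun u => pos2 (b - u)) (- (2 * Num.max 0 (b - u))).
  have H := is_derive_pos2 (b - u).
  have H2 : is_derive u (1 : R) (fun u => b - u) (-1) 
    by apply: is_derive_eq; rewrite /=; lra.
  have := @is_derive1_comp _ pos2 (fun u => b - u) u _ _ H H2.
  by rewrite mulrN1.
rewrite /bump /dbump; apply: is_derive_eq; rewrite /GRing.scale/=; ring.
Qed.

Lemma continuous_pos2 : continuous pos2.
Proof. exact: is_derive_continuous is_derive_pos2. Qed.

Lemma continuous_dbump a b : continuous (dbump a b).
Proof.
have c1 : continuous (fun u : R => u - a).
  by move=> u; apply: continuousB; [exact: cvg_id|exact: cvg_cst].
have c2 : continuous (fun u : R => b - u).
  by move=> u; apply: continuousB; [exact: cvg_cst|exact: cvg_id].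
have m1 u : {for u, continuous (fun u : R => Num.max 0 (u - a))}.
  exact: (continuous_comp (c1 u) (@continuous_max0 _)).
have m2 u : {for u, continuous (fun u : R => Num.max 0 (b - u))}.
  exact: (continuous_comp (c2 u) (@continuous_max0 _)).
have p1 u : {for u, continuous (fun u : R => pos2 (u - a))}.
  exact: (continuous_comp (c1 u) (@continuous_pos2 _)).
have p2 u : {for u, continuous (fun u : R => pos2 (b - u))}.
  exact: (continuous_comp (c2 u) (@continuous_pos2 _)).
have cc u : {for u, continuous (fun u : R => 2 : R)} by exact: cvg_cst.
move=> u; apply: (@continuousB _ _ _ (fun u => 2 * Num.max 0 (u - a) * pos2 (b - u))
    (fun u => pos2 (u - a) * (2 * Num.max 0 (b - u)))).
- by apply: continuousM => //; apply: continuousM.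
- by apply: continuousM => //; apply: continuousM.
Qed.

(* C^1 functions increasing to the indicator of ]a, b[ as k grows. *)
Definition plateau (k : nat) a b u := 1 - (1 + k%:R * bump a b u)^-1.

Lemma plateau_den_ge1 k a b u : 1 <= 1 + k%:R * bump a b u.
Proof. by rewrite lerDl mulr_ge0// bump_ge0. Qed.

Lemma plateau_ge0 k a b u : 0 <= plateau k a b u.
Proof. by rewrite subr_ge0 invf_le1 ?plateau_den_ge1// (lt_le_trans ltr01)// plateau_den_ge1. Qed.

Lemma plateau_le1 k a b u : plateau k a b u <= 1.
Proof. by rewrite lerBlDr lerDl invr_ge0 (le_trans ler01)// plateau_den_ge1. Qed.

Lemma plateau_out k a b u : ~~ (a < u < b) -> plateau k a b u = 0.
Proof. by move=> /bump_out; rewrite /plateau => ->; rewrite mulr0 addr0 invr1 subrr. Qed.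

Definition dplateau k a b u := k%:R * dbump a b u / (1 + k%:R * bump a b u) ^+ 2.

Lemma is_derive_plateau k a b u :
  is_derive u (1 : R) (plateau k a b) (dplateau k a b u).
Proof.
have H := is_derive_bump a b u.
have n0 : 1 + k%:R * bump a b u != 0.
  by rewrite gt_eqF// (lt_le_trans ltr01)// plateau_den_ge1.
have d1 : is_derive u (1 : R) (fun u => 1 + k%:R * bump a b u) (k%:R * dbump a b u).
  by apply: is_derive_eq; rewrite /GRing.scale/=; ring.
have d2 := @is_deriveV _ (fun u => 1 + k%:R * bump a b u) u _ _ n0 d1.
rewrite /plateau; apply: is_derive_eq; rewrite /dplateau /GRing.scale/=.
by field.
Qed.

Lemma continuous_dplateau k a b : continuous (dplateau k a b).
Proof.
have cb : continuous (bump a b) := is_derive_continuous (is_derive_bump a b).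
have cd := @continuous_dbump a b.
have c1 u : {for u, continuous (fun u => 1 + k%:R * bump a b u)}.
  apply: (@continuousD _ _ _ (fun=> 1 : R) (fun u => k%:R * bump a b u)); first exact: cvg_cst.
  by apply: continuousM; [exact: cvg_cst|exact: cb].
move=> u; apply: (@continuousM _ _ (fun u => k%:R * dbump a b u)
    (fun u => ((1 + k%:R * bump a b u) ^+ 2)^-1)).
  by apply: continuousM; [exact: cvg_cst|exact: cd].
apply: continuousV.
  by rewrite expf_neq0// gt_eqF// (lt_le_trans ltr01)// plateau_den_ge1.
exact: (continuousM (c1 u) (c1 u)).
Qed.

Lemma cvg_plateau a b u :
  plateau k a b u @[k --> \oo] --> ((a < u < b)%R%:R : R).
Proof.
have [/andP[au ub]|uo] := boolP (a < u < b); last first.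
  by under eq_fun do rewrite plateau_out//; exact: cvg_cst.
have b0 := bump_in au ub.
apply/cvgrPdist_le => /= e e0; near=> k.
rewrite /plateau opprB addrC subrK ger0_norm; last first.
  by rewrite invr_ge0 (le_trans ler01)// plateau_den_ge1.
rewrite -[leRHS]invrK lef_pV2 ?posrE ?invr_gt0//; last first.
  by rewrite (lt_le_trans ltr01)// plateau_den_ge1.
have : e^-1 / bump a b u <= k%:R by near: k; exact: nbhs_infty_ger.
by rewrite ler_pdivrMr//; lra.
Unshelve. all: by end_near. Qed.

(* [C1c g g']: [g] is C^1 with derivative [g'], and has compact support. *)
Record C1c (g g' : R -> R) : Prop := MkC1c {
  C1c_derive : forall x : R, is_derive x (1 : R) g (g' x);
  C1c_continuous : continuous g';
  C1c_support : exists A, forall x, A < `|x| -> g x = 0 }.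

Lemma C1c_plateau k a b : C1c (plateau k a b) (dplateau k a b).
Proof.
split; [exact: is_derive_plateau|exact: continuous_dplateau|].
exists (`|a| + `|b|) => x H; apply: plateau_out; apply/negP => /andP[ax xb].
move: H; apply/negP; rewrite -leNgt ler_norml.
have := ler_norm b; have := ler_norm (- a); rewrite normrN.
have := normr_ge0 a; have := normr_ge0 b.
move=> ? ? ? ?; apply/andP; split; lra.
Qed.

End bumps.

(** * Tensor products as test functions on R^n *)

Section tensors.
Context {R : realType} {n : nat}.
Local Notation V := 'rV[R]_n.
Local Notation E i := (delta_mx ord0 i : V).
Local Notation L := (@lebesgue_rV R n).

Lemma is_derive_line (f : V -> R) (x v : V) (d : R) :
  is_derive (0 : R) (1 : R) (fun t : R => f (x + t *: v)) d -> is_derive x v f d.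
Proof.
move=> [df dv].
have E0 : (fun h : R => h^-1 *: ((f \o shift x) (h *: v) - f x)) =
    (fun h : R => h^-1 *: (((fun t : R => f (x + t *: v)) \o shift (0 : R)) (h *: (1 : R)) -
      f (x + (0 : R) *: v))).
  apply/funext => h /=; have -> : h *: (1 : R) = h by exact: mulr1.
  by rewrite scale0r !addr0 [h *: v + x]addrC.
by split; [rewrite /derivable E0|rewrite -dv /derive E0].
Qed.

Lemma is_derive_on_line (f : V -> R) (x v : V) (t d : R) :
  is_derive (x + t *: v) v f d -> is_derive t (1 : R) (fun t : R => f (x + t *: v)) d.
Proof.
move=> [df dv].
have E0 : (fun h : R => h^-1 *: ((f \o shift (x + t *: v)) (h *: v) - f (x + t *: v))) =
    (fun h : R => h^-1 *: (((fun t : R => f (x + t *: v)) \o shift t) (h *: (1 : R)) -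
      f (x + t *: v))).
  apply/funext => h /=; have -> : h *: (1 : R) = h by exact: mulr1.
  by rewrite [h *: v + _]addrC -addrA -scalerDl [t + h]addrC.
by split; [rewrite /derivable -E0|rewrite -dv /derive -E0].
Qed.

Definition tensor (g : 'I_n -> R -> R) (x : V) : R := \prod_i g i (x ord0 i).

Definition dtensor (i : 'I_n) (g g' : 'I_n -> R -> R) : V -> R :=
  tensor (fun j => if j == i then g' j else g j).

Lemma continuous_tensor g : (forall i, continuous (g i)) -> continuous (tensor g).
Proof.
move=> cg; apply: continuous_big => [x|i _ x].
  by apply: continuousM; [exact: cvg_fst|exact: cvg_snd].
apply: (@continuous_comp _ _ _ (fun x : V => x ord0 i) (g i)).
  exact: coord_continuous.
exact: cg.
Qed.

Lemma measurable_tensor g : (forall i, measurable_fun setT (g i)) ->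
  measurable_fun setT (tensor g).
Proof.
move=> mg; apply: measurable_prod => i _.
exact: (measurableT_comp (mg i) (measurable_coord i)).
Qed.

Lemma is_derive_tensor (g g' : 'I_n -> R -> R) i (x : V) :
  (forall u : R, is_derive u (1 : R) (g i) (g' i u)) ->
  is_derive x (E i) (tensor g) (dtensor i g g' x).
Proof.
move=> dg; apply: is_derive_line.
pose C := \prod_(j | j != i) g j (x ord0 j).
have -> : (fun t : R => tensor g (x + t *: E i)) = (fun t => g i (x ord0 i + t) * C).
  apply/funext => t; rewrite /tensor (bigD1 i)//= !mxE !eqxx mulr1; congr (_ * _).
  by apply: eq_bigr => j ji; rewrite !mxE eqxx/= (negbTE ji) mulr0 addr0.
have -> : dtensor i g g' x = g' i (x ord0 i) * C.
  rewrite /dtensor /tensor (bigD1 i)//= eqxx; congr (_ * _).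
  by apply: eq_bigr => j ji; rewrite (negbTE ji).
have H : is_derive (x ord0 i + 0) (1 : R) (g i) (g' i (x ord0 i)).
  by rewrite addr0.
have H2 : is_derive (0 : R) (1 : R) (fun t => x ord0 i + t) 1.
  apply: (@is_derive_of_remainder _ _ _ _ 0) => h.
  by rewrite mul0r normr_le0; apply/eqP; ring.
have H3 := @is_derive1_comp _ (g i) (fun t => x ord0 i + t) 0 _ _ H H2.
by apply: is_derive_eq; rewrite /GRing.scale/= mulr0 add0r mulr1 mulrC.
Qed.

Lemma partial_tensor (g g' : 'I_n -> R -> R) i : (forall i, C1c (g i) (g' i)) ->
  partial i (tensor g) = dtensor i g g'.
Proof.
move=> cg; apply/funext => x; apply: derive_val; apply: is_derive_tensor.
by case: (cg i).
Qed.

Lemma test_function_tensor (g g' : 'I_n -> R -> R) : (forall i, C1c (g i) (g' i)) ->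
  test_function (tensor g).
Proof.
move=> cg; split.
- move=> i x; have [dg _ _] := cg i; by case: (is_derive_tensor x dg).
- move=> i; rewrite (partial_tensor i cg); apply: continuous_tensor => j.
  have [dg c' _] := cg j; case: ifP => _; [exact: c'|exact: is_derive_continuous dg].
have /boolp.choice[A hA] : forall i, exists A : R, forall x : R, A < `|x| -> g i x = 0.
  by move=> i; have [_ _ [A hA]] := cg i; exists A.
exists [set v : V | forall i, `[- A i, A i]%classic (v ord0 i)].
  apply: (@rV_compact R n (fun i => `[- A i, A i]%classic)) => i.
  exact: segment_compact.
move=> x /existsNP[i xi]; apply/eqP/prodf_eq0; exists i => //; apply/eqP/hA.
by rewrite ltNge; apply/negP => H; apply: xi; rewrite /= in_itv/= -ler_norml.
Qed.

End tensors.

(** * Boxes and the fundamental lemma of the calculus of variations *)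

Section boxes.
Context {R : realType} {n : nat}.
Local Notation V := 'rV[R]_n.
Local Notation L := (@lebesgue_rV R n).
Implicit Types a b : 'I_n -> R.

Definition box a b : set V := [set x | forall i, a i < x ord0 i < b i].

Definition boxes : set (set V) := [set A | exists a b, A = box a b].

Lemma measurable_box a b : measurable (box a b).
Proof.
have -> : box a b = \bigcap_(i in [set: 'I_n])
    ((fun x : V => x ord0 i) @^-1` `]a i, b i[%classic).
  apply/seteqP; split => x /=.
    by move=> xab i _ /=; rewrite in_itv; exact: xab.
  by move=> xab i; have := xab i I; rewrite /= in_itv.
apply: fin_bigcap_measurable => // i _.
by rewrite -[X in measurable X]setTI; apply: measurable_coord.
Qed.

Lemma norm_lt_truncn (x : V) : exists k : nat, forall i, `|x ord0 i| < k%:R.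
Proof.
exists (Num.truncn (\sum_i `|x ord0 i|)).+1 => i.
rewrite (le_lt_trans _ (truncnS_gt _))// (bigD1 i)//= lerDl.
by rewrite sumr_ge0.
Qed.

Definition cube (k : nat) := box (fun=> - k%:R) (fun=> k%:R).

Lemma boxes_cover : \bigcup_k cube k = [set: V].
Proof.
apply/seteqP; split => // x _; have [k kx] := norm_lt_truncn x.
by exists k => // i; rewrite -ltr_norml.
Qed.

Lemma setI_closed_boxes : setI_closed boxes.
Proof.
move=> _ _ [a [b ->]] [a' [b' ->]].
exists (fun i => Num.max (a i) (a' i)), (fun i => Num.min (b i) (b' i)).
apply/seteqP; split => x /=.
  move=> [h1 h2] i; have /andP[? ?] := h1 i; have /andP[? ?] := h2 i.
  by rewrite gt_max lt_min; apply/andP; split; apply/andP; split.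
move=> h; split=> i; have := h i; rewrite gt_max lt_min => /andP[/andP[? ?] /andP[? ?]];
  exact/andP.
Qed.

Lemma measurable_rV_boxes : @measurable _ V = <<s boxes >>.
Proof.
rewrite eqEsubset; split; last first.
  apply: smallest_sub; first exact: sigma_algebra_measurable.
  by move=> _ [a [b ->]]; exact: measurable_box.
apply: smallest_sub; first exact: smallest_sigma_algebra.
apply: (big_ind (fun S => S `<=` _)).
- exact: sub0set.
- by move=> S1 S2 h1 h2; rewrite subUset.
- move=> i _ B [Y mY <-]; rewrite setTI.
  pose f := fun x : g_sigma_algebraType boxes => (x : V) ord0 i.
  suff mf : measurable_fun setT f by have := mf measurableT _ mY; rewrite setTI.
  apply: (measurability _ (RGenOInfty.measurableE R)).
  move=> _ [_ [c ->] <-]; rewrite setTI.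
  have -> : f @^-1` `]c, +oo[%classic = \bigcup_k
      box (fun j => if j == i then c else - k%:R) (fun=> k%:R).
    apply/seteqP; split => x /=.
      rewrite in_itv/= andbT => cx; have [k kx] := norm_lt_truncn (x : V).
      exists k => // j; have := kx j; rewrite ltr_norml => /andP[h1 ->].
      by rewrite andbT; case: eqP => [->|].
    by move=> [k _ /(_ i)]; rewrite eqxx in_itv/= andbT => /andP[].
  apply: bigcup_measurable => k _; apply: sub_sigma_algebra.
  by eexists; eexists.
Qed.

Lemma eq_measure_boxes (m1 m2 : {measure set V -> \bar R}) :
  (forall a b, m1 (box a b) = m2 (box a b)) ->
  (forall k : nat, (m1 (cube k) < +oo)%E) ->
  forall A, measurable A -> m1 A = m2 A.
Proof.
move=> m12 fin A mA.
apply: (measure_unique boxes cube) => //.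
- exact: measurable_rV_boxes.
- exact: setI_closed_boxes.
- by move=> k; eexists; eexists.
- exact: boxes_cover.
- by move=> _ [a [b ->]].
Qed.

Definition plateaux k a b : V -> R := tensor (fun i => plateau k (a i) (b i)).

Lemma plateaux_ge0 k a b x : 0 <= plateaux k a b x.
Proof. by apply: prodr_ge0 => i _; exact: plateau_ge0. Qed.

Lemma plateaux_le1 k a b x : plateaux k a b x <= 1.
Proof.
apply: (@le_trans _ _ (\prod_(i < n) (1 : R))); last by rewrite big1.
by apply: ler_prod => i _; rewrite plateau_ge0 plateau_le1.
Qed.

Lemma measurable_plateau k (a b : R) : measurable_fun setT (plateau k a b).
Proof.
apply: continuous_measurable_fun.
exact: is_derive_continuous (is_derive_plateau k a b).
Qed.

Lemma measurable_plateaux k a b : measurable_fun setT (plateaux k a b).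
Proof. by apply: measurable_tensor => i; exact: measurable_plateau. Qed.

Lemma test_function_plateaux k a b : test_function (plateaux k a b).
Proof.
apply: (test_function_tensor (g' := fun i => dplateau k (a i) (b i))) => i.
exact: C1c_plateau.
Qed.

Lemma cvg_plateaux a b (x : V) :
  plateaux k a b x @[k --> \oo] --> (\1_(box a b) x : R).
Proof.
have -> : \1_(box a b) x = \prod_i (a i < x ord0 i < b i)%R%:R :> R.
  rewrite indicE; have [xab|xab] := pselect (box a b x).
    by rewrite mem_set// big1// => i _; rewrite (xab i).
  rewrite memNset//; move/existsNP : xab => [i /negP/negbTE xi].
  by apply/esym/eqP/prodf_eq0; exists i => //; rewrite xi.
apply: cvg_big => [x0|i _]; last exact: cvg_plateau.
by apply: continuousM; [exact: cvg_fst|exact: cvg_snd].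
Qed.

(** Plateaux tend boundedly to the indicator of a box, so [u] integrates to 0 on every box. The
    measures of densities u^+ and u^- then agree on a generating family stable under intersection,
    hence on all Borel sets. *)
Lemma fundamental_lemma (u : V -> R) : L.-integrable setT (EFin \o u) ->
  (forall k a b, (\int[L]_x (u x * plateaux k a b x)%:E = 0)%E) ->
  ae_eq L setT (EFin \o u) (cst 0%E).
Proof.
move=> ui u0.
have mu : measurable_fun setT u by case/integrableP : ui => /measurable_EFinP.
have ubox a b : (\int[L]_(x in box a b) (u x)%:E = 0)%E.
  have mB := measurable_box a b.
  have m1 k : measurable_fun setT (fun x => (u x * plateaux k a b x)%:E).
    by apply/measurable_EFinP; apply: measurable_funM => //; exact: measurable_plateaux.
  have m2 : measurable_fun setT (fun x => (u x * \1_(box a b) x)%:E).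
    by apply/measurable_EFinP; apply: measurable_funM.
  have c1 : {ae L, forall x, [set: V] x ->
      (u x * plateaux k a b x)%:E @[k --> \oo] --> (u x * \1_(box a b) x)%:E}.
    apply: aeW => x _; apply: cvg_EFin; first exact: nearW.
    by apply: cvgM; [exact: cvg_cst|exact: cvg_plateaux].
  have b1 : {ae L, forall x k, [set: V] x ->
      (`|(u x * plateaux k a b x)%:E| <= `|(u x)%:E|)%E}.
    apply: aeW => x k _; rewrite lee_fin normrM ler_piMr//.
    by rewrite ger0_norm ?plateaux_ge0// plateaux_le1.
  have [_ _] := dominated_convergence measurableT m1 m2 c1 (integrable_abse ui) b1.
  have -> : [sequence (\int[L]_x (u x * plateaux k a b x)%:E)%E]_k = cst 0%E.
    by apply/funext => k /=; rewrite u0.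
  move=> /(cvg_unique (@ereal_hausdorff R) (cvg_cst 0%E)) H.
  rewrite integral_mkcond [RHS]H.
  by apply: eq_integral => x _; rewrite epatch_indic/= EFinM.
have mp : measurable_fun setT (u^\+)%R by exact: measurable_funrpos.
have mn : measurable_fun setT (u^\-)%R by exact: measurable_funrneg.
have p0 x : 0 <= (u^\+ x)%R by exact: funrpos_ge0.
have n0 x : 0 <= (u^\- x)%R by exact: funrneg_ge0.
have ip := integrable_funrpos measurableT ui.
have im := integrable_funrneg measurableT ui.
have iA (f : V -> R) A : measurable A -> L.-integrable setT (EFin \o f) ->
    L.-integrable A (EFin \o f).
  by move=> mA; apply: integrableS.
have E A : measurable A -> (\int[L]_(x in A) (u x)%:E =
    \int[L]_(x in A) (u^\+ x)%:E - \int[L]_(x in A) (u^\- x)%:E)%E.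
  move=> mA; rewrite -integralB//; last 2 first.
  - exact: iA.
  - exact: iA.
  apply: eq_integral => x _; rewrite -EFinB; congr EFin.
  by rewrite -[in LHS](funrposBneg u).
have H A : measurable A -> (\int[L]_(x in A) (u^\+ x)%:E = \int[L]_(x in A) (u^\- x)%:E)%E.
  apply: (eq_measure_boxes (m1 := weighted L mp p0) (m2 := weighted L mn n0)).
    move=> a b /=; have := ubox a b; rewrite E; last exact: measurable_box.
    have fp : (\int[L]_(x in box a b) (u^\+ x)%:E)%E \is a fin_num.
      by apply: integrable_fin_num; [exact: measurable_box|apply: iA => //; exact: measurable_box].
    have fn : (\int[L]_(x in box a b) (u^\- x)%:E)%E \is a fin_num.
      by apply: integrable_fin_num; [exact: measurable_box|apply: iA => //; exact: measurable_box].
    by move=> /eqP; rewrite sube_eq ?fin_num_adde_defl// add0e => /eqP.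
  move=> k /=; rewrite /weighted ltey_eq; apply/orP; left.
  by apply: integrable_fin_num; [exact: measurable_box|apply: iA => //; exact: measurable_box].
apply: integral_ae_eq => // A _ mA; rewrite integral0 E// H// subee//.
by apply: integrable_fin_num => //; exact: iA.
Qed.

End boxes.

(** * Increments of a weakly differentiable function along the axes *)

Section increments.
Context {R : realType} {n : nat}.
Local Notation mu := (@lebesgue_measure R).
Local Notation V := 'rV[R]_n.
Local Notation L := (@lebesgue_rV R n).
Local Notation E i := (delta_mx ord0 i : V).

Lemma integral_shift_rV (v : V) (f : V -> \bar R) : measurable_fun setT f ->
  (\int[L]_x f (x + v)%R = \int[L]_x f x)%E.
Proof.
move=> mf; apply: (integral_invariant (mu := L) (tau := fun x => x + v) _ mf).
by move=> g mg g0; exact: ge0_integral_shift.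
Qed.

Lemma integrable_shift_rV (v : V) (f : V -> \bar R) : L.-integrable setT f ->
  L.-integrable setT (fun x => f (x + v)%R).
Proof.
apply: (integrable_invariant (mu := L) (measurable_shift_rV v)) => g mg g0.
exact: ge0_integral_shift.
Qed.

Lemma dplateau_bounded k (a b : R) : exists2 B, 0 <= B & forall u, `|dplateau k a b u| <= B.
Proof.
have out u : ~~ (a < u < b) -> dplateau k a b u = 0.
  move=> uo; rewrite /dplateau /dbump.
  suff -> : 2 * Num.max 0 (u - a) * pos2 (b - u) - pos2 (u - a) * (2 * Num.max 0 (b - u)) = 0.
    by rewrite mulr0 mul0r.
  move: uo; rewrite negb_and -!leNgt /pos2 => /orP[ua|bu].
    by rewrite (max_l (_ : u - a <= 0)) ?subr_le0//; ring.
  by rewrite (max_l (_ : b - u <= 0)) ?subr_le0//; ring.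
have [ab|ba] := leP a b; last first.
  exists 0 => // u; rewrite out ?normr0//; apply/negP => /andP[au ub].
  by move: (lt_trans au ub); rewrite ltNge (ltW ba).
have cd : {within `[a, b], continuous (fun u => `|dplateau k a b u|)}.
  apply: continuous_subspaceT => u.
  exact: (continuous_comp (@continuous_dplateau _ k a b u) (@norm_continuous _ _ _)).
have [c _ cmax] := EVT_max ab cd.
exists `|dplateau k a b c| => // u.
have [/andP[au ub]|/out ->] := boolP (a < u < b); last by rewrite normr0.
by apply: cmax; rewrite in_itv/= !ltW.
Qed.

Definition dplateaux i k (a b : 'I_n -> R) : V -> R :=
  dtensor i (fun j => plateau k (a j) (b j)) (fun j => dplateau k (a j) (b j)).

Lemma measurable_dplateau k (a b : R) : measurable_fun setT (dplateau k a b).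
Proof. by apply: continuous_measurable_fun; exact: continuous_dplateau. Qed.

Lemma measurable_dplateaux i k a b : measurable_fun setT (dplateaux i k a b).
Proof.
apply: measurable_tensor => j; case: ifP => _; first exact: measurable_dplateau.
exact: measurable_plateau.
Qed.

Lemma dplateaux_bounded i k a b : exists2 B, 0 <= B & forall x, `|dplateaux i k a b x| <= B.
Proof.
have [B B0 HB] := dplateau_bounded k (a i) (b i); exists B => // x.
rewrite /dplateaux /dtensor /tensor normr_prod (bigD1 i)//= eqxx -[leRHS]mulr1.
apply: ler_pM => //.
  by apply: prodr_ge0 => j _; exact: normr_ge0.
apply: (@le_trans _ _ (\prod_(j < n | j != i) (1 : R))); last by rewrite big1.
apply: ler_prod => j ji; rewrite (negbTE ji) normr_ge0/= ger0_norm ?plateau_ge0//.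
exact: plateau_le1.
Qed.

Lemma plateauxB k a b (x : V) i (s : R) : plateaux k a b (x - s *: E i) =
  plateaux k (fun j => a j + (j == i)%:R * s) (fun j => b j + (j == i)%:R * s) x.
Proof.
apply: eq_bigr => j _; rewrite !mxE eqxx/= /plateau /bump.
set t := s * _; have -> : (j == i)%:R * s = t by rewrite mulrC.
by congr (1 - (1 + _ * (pos2 _ * pos2 _))^-1); ring.
Qed.

Lemma dplateauxB k a b (x : V) i (s : R) : dplateaux i k a b (x - s *: E i) =
  dplateaux i k (fun j => a j + (j == i)%:R * s) (fun j => b j + (j == i)%:R * s) x.
Proof.
apply: eq_bigr => j _; rewrite !mxE eqxx/=.
set t := s * _; have -> : (j == i)%:R * s = t by rewrite mulrC.
have e1 (A u : R) : u - t - A = u - (A + t) by ring.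
have e2 (A u : R) : A - (u - t) = A + t - u by ring.
by case: ifP => _; rewrite /plateau /dplateau /dbump /bump !(e1, e2).
Qed.

Lemma continuous_dplateaux_line k a b (x : V) i :
  continuous (fun s : R => dplateaux i k a b (x - s *: E i)).
Proof.
move=> s; apply: (@continuous_comp _ _ _ (fun s : R => x - s *: E i) (dplateaux i k a b)).
  apply: (@continuousB _ _ _ (fun=> x) (fun s : R => s *: E i)); first exact: cvg_cst.
  exact: scalel_continuous.
apply: continuous_tensor => j; case: ifP => _; first exact: continuous_dplateau.
exact: is_derive_continuous (is_derive_plateau k (a j) (b j)).
Qed.

Lemma increment_plateaux k a b (x : V) i (t : R) : 0 <= t ->
  (\int[mu]_(s in `[0%R, t]) (dplateaux i k a b (x - s *: E i))%:E =
   (plateaux k a b x - plateaux k a b (x - t *: E i))%:E)%E.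
Proof.
move=> t0.
have d (s : R) : is_derive s (1 : R) (fun s => - plateaux k a b (x - s *: E i))
    (dplateaux i k a b (x - s *: E i)).
  have H1 : is_derive (- s) (1 : R) (fun r : R => plateaux k a b (x + r *: E i))
      (dplateaux i k a b (x + - s *: E i)).
    apply: is_derive_on_line.
    apply: (is_derive_tensor (g' := fun i => dplateau k (a i) (b i))) => u.
    exact: is_derive_plateau.
  have H2 : is_derive s (1 : R) (fun s : R => - s) (-1).
    apply: (@is_derive_of_remainder _ _ _ _ 0) => h.
    by rewrite mul0r normr_le0; apply/eqP; ring.
  have H3 := @is_derive1_comp _ (fun r : R => plateaux k a b (x + r *: E i)) -%R s _ _ H1 H2.
  have -> : (fun s => - plateaux k a b (x - s *: E i)) =
      (fun s => - ((fun r : R => plateaux k a b (x + r *: E i)) \o -%R) s).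
    by apply/funext => r /=; rewrite scaleNr.
  by apply: is_derive_eq; rewrite scaleNr; ring.
have c := @continuous_dplateaux_line k a b x i.
by rewrite (integral_is_derive t0 d c) scale0r subr0 opprK addrC.
Qed.

Lemma integral_indic_segment (t : R) :
  (\int[mu]_s (\1_`[0%R, t] s)%:E = (Num.max 0 t)%:E)%E.
Proof.
rewrite integral_indic//= setIT lebesgue_measure_itv//= lte_fin; case: ltP => t0.
  by rewrite -EFinB subr0.
by [].
Qed.

Lemma measurable_slice (F : V * R -> \bar R) s : measurable_fun setT F ->
  measurable_fun setT (fun x => F (x, s)).
Proof. by move=> mF; apply: (measurableT_comp mF); exact: measurable_pair2. Qed.

(** The weak gradient tested on plateaux alone. This family is stable under translation along the
    axes, and its members are measurable and bounded together with their partial derivatives. *)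
Definition plateau_gradient (rho : V -> R) (G : V -> V) :=
  forall i, L.-integrable setT (fun x => (G x ord0 i)%:E) /\
    forall k a b, (\int[L]_x (rho x * partial i (plateaux k a b) x)%:E =
      - \int[L]_x (G x ord0 i * plateaux k a b x)%:E)%E.

Lemma weak_gradient_plateaux rho G : weak_gradient rho G -> plateau_gradient rho G.
Proof.
move=> wG i; have [ig wg] := wG i; split => // k a b.
by apply: wg; exact: test_function_plateaux.
Qed.

Section increment_formula.
Variables (rho g : V -> R) (i : 'I_n).
Hypotheses (irho : L.-integrable setT (EFin \o rho))
  (ig : L.-integrable setT (EFin \o g))
  (wg : forall k a b,
      (\int[L]_x (rho x * partial i (plateaux k a b) x)%:E =
       - \int[L]_x (g x * plateaux k a b x)%:E)%E).

Let mrho : measurable_fun setT rho.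
Proof. by case/integrableP : irho => /measurable_EFinP. Qed.
Let mg : measurable_fun setT g.
Proof. by case/integrableP : ig => /measurable_EFinP. Qed.

Lemma integrable_mul_bounded (u h : V -> R) (B : R) : L.-integrable setT (EFin \o u) ->
  measurable_fun setT h -> (forall x, `|h x| <= B) ->
  L.-integrable setT (fun x => (u x * h x)%:E).
Proof.
move=> ui mh hB.
have mu' : measurable_fun setT u by case/integrableP : ui => /measurable_EFinP.
apply: (le_integrable _ _ _ (integrableZl measurableT B ui)) => //.
  by apply/measurable_EFinP; exact: measurable_funM.
move=> x _; rewrite -EFinM /= lee_fin normrM [leRHS]normrM mulrC ler_wpM2r//.
by rewrite (le_trans (hB x))// ler_norm.
Qed.

Let measurable_lineV : measurable_fun setT (fun z : V * R => z.1 + z.2 *: E i).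
Proof. exact: measurable_line. Qed.

Let measurable_lineN : measurable_fun setT (fun z : V * R => z.1 - z.2 *: E i).
Proof.
have -> : (fun z : V * R => z.1 - z.2 *: E i) = (fun z => z.1 + z.2 *: - E i).
  by apply/funext => z; rewrite scalerN.
exact: measurable_line.
Qed.

Lemma integrable_line (t C : R) (phi : V * R -> R) : measurable_fun setT phi ->
  (forall s, (\int[L]_x `|(phi (x, s))%:E| <= C%:E)%E) ->
  (L \x mu)%E.-integrable setT (fun z => (phi z * \1_`[0, t] z.2)%:E).
Proof.
move=> mphi phiC.
have C0 : 0 <= C by rewrite -lee_fin; apply: le_trans (phiC 0); exact: integral_ge0.
have mF : measurable_fun setT (fun z => (phi z * \1_`[0, t] z.2)%:E : \bar R).
  apply/measurable_EFinP; apply: measurable_funM => //.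
  by apply: (measurableT_comp _ measurable_snd); exact: measurable_indic.
have mI : measurable_fun setT (fun s : R => (\1_`[0, t] s)%:E : \bar R).
  by apply/measurable_EFinP; exact: measurable_indic.
apply/integrable21ltyP => //.
apply: (@le_lt_trans _ _ (\int[mu]_s (C%:E * (\1_`[0%R, t] s)%:E))%E).
  apply: ge0_le_integral => //.
  - by move=> s _; exact: integral_ge0.
  - apply: (@measurable_fun_fubini_tonelli_G _ _ _ _ _ L
      (fun z => `|(phi z * \1_`[0%R, t] z.2)%:E|%E)) => [|z]; last exact: abse_ge0.
    exact: measurableT_comp.
  - exact: measurable_funeM.
  move=> s _.
  have ms : measurable_fun setT (fun x : V => `|(phi (x, s))%:E|%E).
    apply: measurableT_comp => //; apply/measurable_EFinP.
    by apply: (measurableT_comp mphi); exact: measurable_pair2.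
  rewrite (eq_integral (fun x => ((\1_`[0%R, t] s)%:E * `|(phi (x, s))%:E|)%E)); last first.
    by move=> x _; rewrite EFinM abseM muleC [X in (X * _)%E]gee0_abs// lee_fin.
  have k0 : (0 <= (\1_`[0%R, t] s)%:E :> \bar R)%E by rewrite lee_fin.
  by rewrite ge0_integralZl// muleC; apply: lee_wpmul2r.
rewrite ge0_integralZl//.
by rewrite integral_indic_segment -EFinM ltry.
Qed.

Lemma integrable_line_product (t C B : R) (phi h : V * R -> R) :
  measurable_fun setT phi -> measurable_fun setT h -> (forall z, `|h z| <= B) ->
  (forall s, (\int[L]_x `|(phi (x, s))%:E| <= C%:E)%E) ->
  (L \x mu)%E.-integrable setT (fun z => (phi z * h z * \1_`[0, t] z.2)%:E).
Proof.
move=> mphi mh hB phiC; have H := integrable_line t mphi phiC.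
apply: (le_integrable _ _ _ (integrableZl measurableT B H)) => //.
  apply/measurable_EFinP; apply: measurable_funM; first exact: measurable_funM.
  by apply: (measurableT_comp _ measurable_snd); exact: measurable_indic.
move=> z _; rewrite -EFinM /= lee_fin !normrM [leLHS]mulrAC mulrC ler_wpM2r//.
by rewrite (le_trans (hB z))// ler_norm.
Qed.

Let Cg : R := fine (\int[L]_x `|(g x)%:E|).
Let CgE : (\int[L]_x `|(g x)%:E|)%E = Cg%:E.
Proof.
rewrite /Cg fineK// ge0_fin_numE; last exact: integral_ge0.
by case/integrableP : ig.
Qed.

Let line_g (s : R) : (\int[L]_x `|(g (x + s *: E i))%:E| = Cg%:E)%E.
Proof.
rewrite -CgE (integral_shift_rV (s *: E i) (f := fun x => `|(g x)%:E|%E))//.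
by apply: measurableT_comp => //; exact/measurable_EFinP.
Qed.

(** [fine] sends an infinite or undefined integral to a real; by Fubini this concerns a null set of
    points only. *)
Definition line_average (t : R) (x : V) : R :=
  fine (\int[mu]_s (g (x + s *: E i) * \1_`[0, t] s)%:E).

Let mgl : measurable_fun setT (fun z : V * R => g (z.1 + z.2 *: E i)).
Proof. exact: measurableT_comp. Qed.

Let iline t : (L \x mu)%E.-integrable setT
  (fun z => (g (z.1 + z.2 *: E i) * \1_`[0, t] z.2)%:E).
Proof. by apply: (integrable_line _ (C := Cg)) mgl _ => s; rewrite line_g. Qed.

Lemma integrable_line_average t : L.-integrable setT (EFin \o line_average t).
Proof.
have H := integrable_fubini_F (iline t).
apply: (le_integrable measurableT _ _ H).
  apply/measurable_EFinP; apply: (measurableT_comp (fine_measurable measurableT)) => //.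
  by case/integrableP : H.
move=> x _; rewrite /line_average /fubini_F /=.
by case: integral => [r| |] //=; rewrite normr0 leey.
Qed.

Lemma line_average_mul t (h : V -> R) (B : R) : measurable_fun setT h ->
  (forall x, `|h x| <= B) ->
  (\int[L]_x (line_average t x * h x)%:E =
   \int[mu]_s \int[L]_x (g (x + s *: E i) * h x * \1_`[0, t] s)%:E)%E.
Proof.
move=> mh hB.
have F : (L \x mu)%E.-integrable setT
    (fun z => (g (z.1 + z.2 *: E i) * h z.1 * \1_`[0, t] z.2)%:E).
  apply: (@integrable_line_product t Cg B (fun z : V * R => g (z.1 + z.2 *: E i)) (fun z : V * R => h z.1) mgl) => //.
    exact: measurableT_comp.
  by move=> s; rewrite line_g.
transitivity (\int[L]_x \int[mu]_s (g (x + s *: E i) * h x * \1_`[0, t] s)%:E)%E;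
  last exact: (Fubini F).
apply: ae_eq_integral => //.
- apply/measurable_EFinP; apply: measurable_funM => //.
  by apply/measurable_EFinP; case/integrableP : (integrable_line_average t).
- by case/integrableP : (integrable_fubini_F F).
apply: filterS (ae_integrable1 (iline t)) => x /= ix _.
transitivity ((line_average t x)%:E * (h x)%:E)%E => //.
rewrite /line_average fineK; last exact: integrable_fin_num.
rewrite -integralZr//; apply: eq_integral => s _.
by rewrite -EFinM; congr EFin; ring.
Qed.

(** Against a plateau, the translation of [rho] is moved onto the plateau, whose increment is the
    integral of its derivative along the segment; the weak derivative is used for each s in the
    segment and Fubini reassembles [line_average]. The fundamental lemma concludes. *)
Lemma increment_ae (t : R) : 0 <= t ->
  {ae L, forall x, rho (x + t *: E i) - rho x = line_average t x}.
Proof.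
move=> t0.
pose u (x : V) := rho (x + t *: E i) - rho x - line_average t x.
have is1 := integrable_shift_rV (t *: E i) irho.
have iu : L.-integrable setT (EFin \o u).
  exact: (integrableB measurableT (integrableB measurableT is1 irho) (integrable_line_average t)).
suff H : ae_eq L setT (EFin \o u) (cst 0)%E.
  by apply: filterS H => x /= /(_ I) [] /eqP; rewrite /u subr_eq0 => /eqP.
apply: fundamental_lemma => // k a b.
have pb z : `|plateaux k a b z| <= 1.
  by rewrite ger0_norm ?plateaux_ge0 ?plateaux_le1.
have mp : measurable_fun setT (plateaux k a b) by exact: measurable_plateaux.
have [B B0 dB] := dplateaux_bounded i k a b.
have Crho : exists C : R, (\int[L]_x `|(rho x)%:E| = C%:E)%E.
  exists (fine (\int[L]_x `|(rho x)%:E|)); rewrite fineK// ge0_fin_numE; last exact: integral_ge0.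
  by case/integrableP : irho.
have [C HC] := Crho.
have i1 := integrable_mul_bounded is1 mp pb.
have i2 := integrable_mul_bounded irho mp pb.
have i3 := integrable_mul_bounded (integrable_line_average t) mp pb.
transitivity (\int[L]_x ((rho (x + t *: E i) * plateaux k a b x)%:E -
    (rho x * plateaux k a b x)%:E - (line_average t x * plateaux k a b x)%:E))%E.
  by apply: eq_integral => x _; rewrite -!EFinB /u !mulrBl.
rewrite integralB//; last exact: integrableB.
rewrite (line_average_mul t mp pb).
suff -> : (\int[L]_x ((rho (x + t *: E i) * plateaux k a b x)%:E - (rho x * plateaux k a b x)%:E) =
   \int[mu]_s \int[L]_x (g (x + s *: E i) * plateaux k a b x * \1_`[0, t] s)%:E)%E.
  rewrite subee// -(line_average_mul t mp pb); exact: integrable_fin_num.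
have mB : measurable_fun setT (fun x : V => plateaux k a b (x - t *: E i)).
  by rewrite -scaleNr; apply: (measurableT_comp mp); exact: measurable_shift_rV.
have i4 := integrable_mul_bounded irho mB (fun x => pb (x - t *: E i)).
rewrite integralB//.
rewrite (_ : (\int[L]_x (rho (x + t *: E i) * plateaux k a b x)%:E =
    \int[L]_x (rho x * plateaux k a b (x - t *: E i))%:E)%E); last first.
  rewrite -(integral_shift_rV (t *: E i) (f := fun x => (rho x * plateaux k a b (x - t *: E i))%:E)).
    by apply: eq_integral => x _; rewrite addrK.
  by apply/measurable_EFinP; exact: measurable_funM.
rewrite -integralB//.
have F : (L \x mu)%E.-integrable setT
    (fun z => (rho z.1 * - dplateaux i k a b (z.1 - z.2 *: E i) * \1_`[0, t] z.2)%:E).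
  apply: (@integrable_line_product t C B (fun z : V * R => rho z.1)
    (fun z : V * R => - dplateaux i k a b (z.1 - z.2 *: E i))).
  - exact: measurableT_comp.
  - apply: measurableT_comp => //; apply: measurableT_comp => //.
    exact: measurable_dplateaux.
  - by move=> z; rewrite normrN.
  - by move=> s; rewrite HC.
transitivity (\int[L]_x \int[mu]_s (rho x * - dplateaux i k a b (x - s *: E i) * \1_`[0, t] s)%:E)%E.
  apply: eq_integral => x _.
  transitivity ((- rho x)%:E * (plateaux k a b x - plateaux k a b (x - t *: E i))%:E)%E.
    by rewrite -EFinB -EFinM; congr EFin; ring.
  rewrite -increment_plateaux// integral_mkcond/= -integralZl//; last first.
    apply/integrable_restrict => //.
    rewrite setTI; apply: continuous_compact_integrable; first exact: segment_compact.
    by apply: continuous_subspaceT; exact: continuous_dplateaux_line.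
  apply: eq_integral => s _; rewrite patchE indicE; case: ifPn => _.
    by rewrite -EFinM /=; congr EFin; ring.
  by rewrite mule0 mulr0.
rewrite (Fubini F).
apply: eq_integral => s _.
have [st|st] := boolP (s \in `[0, t]); last first.
  rewrite !integral0_eq// => x _; rewrite indicE mem_setE (negbTE st) mulr0//.
have -> : \1_`[0, t] s = 1 :> R by rewrite indicE mem_setE st.
transitivity ((-1)%:E * \int[L]_x (rho x * dplateaux i k a b (x - s *: E i))%:E)%E.
  rewrite -integralZl//; last first.
    apply: (integrable_mul_bounded irho (B := B)) => //.
    by apply: (measurableT_comp (measurable_dplateaux _ _ _ _)); rewrite -scaleNr;
      exact: measurable_shift_rV.
  by apply: eq_integral => x _; rewrite -EFinM; congr EFin; ring.
rewrite mulN1e.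
(* A translated plateau is the plateau of the translated box, so that [wg] applies to it for each
   [s]. *)
pose a' j := a j + (j == i)%:R * s; pose b' j := b j + (j == i)%:R * s.
rewrite (eq_integral (fun x => (rho x * partial i (plateaux k a' b') x)%:E)); last first.
  move=> x _; rewrite dplateauxB (partial_tensor (g' := fun i => dplateau k (a' i) (b' i)))// => j.
  exact: C1c_plateau.
rewrite wg.
rewrite oppeK -(integral_shift_rV (s *: E i)); last first.
  by apply/measurable_EFinP; apply: measurable_funM => //; exact: measurable_plateaux.
by apply: eq_integral => x _; rewrite -plateauxB addrK mulr1.
Qed.

Lemma increment_test (t : R) (h : V -> R) (B : R) : 0 <= t -> measurable_fun setT h ->
  (forall x, `|h x| <= B) ->
  (\int[L]_x ((rho (x + t *: E i) - rho x) * h x)%:E =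
   \int[mu]_s \int[L]_x (g (x + s *: E i) * h x * \1_`[0, t] s)%:E)%E.
Proof.
move=> t0 mh hB; rewrite -(line_average_mul t mh hB).
have mr : measurable_fun setT (fun x : V => rho (x + t *: E i)).
  by apply: (measurableT_comp mrho); exact: measurable_shift_rV.
apply: ae_eq_integral => //.
- by apply/measurable_EFinP; apply: measurable_funM => //; exact: measurable_funB.
- apply/measurable_EFinP; apply: measurable_funM => //.
  by apply/measurable_EFinP; case/integrableP : (integrable_line_average t).
- by apply: filterS (increment_ae t0) => x /= ->.
Qed.

Lemma increment_L1 (t : R) : 0 <= t ->
  (\int[L]_x `|rho (x + t *: E i) - rho x|%:E <= t%:E * \int[L]_x `|g x|%:E)%E.
Proof.
move=> t0.
have mr : measurable_fun setT (fun x : V => rho (x + t *: E i) - rho x).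
  by apply: measurable_funB => //; apply: (measurableT_comp mrho); exact: measurable_shift_rV.
(* Testing against the sign of the increment produces its L^1 norm. *)
pose sg (x : V) : R := if 0 <= rho (x + t *: E i) - rho x then 1 else -1.
have msg : measurable_fun setT sg.
  by apply: measurable_fun_ifT => //; apply: measurable_fun_ler.
have sg1 x : `|sg x| <= 1 by rewrite /sg; case: ifP => _; rewrite ?normrN normr1.
rewrite (eq_integral (fun x : V => ((rho (x + t *: E i) - rho x) * sg x)%:E)); last first.
  move=> x _; congr EFin; rewrite /sg; case: ifPn => [h|]; first by rewrite ger0_norm// mulr1.
  by rewrite -ltNge => /ltW h; rewrite ler0_norm// mulrN1.
rewrite (increment_test t0 msg sg1).
apply: le_trans (lee_abs _) _.
have F : (L \x mu)%E.-integrable setT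
    (fun z => (g (z.1 + z.2 *: E i) * sg z.1 * \1_`[0, t] z.2)%:E).
  apply: (@integrable_line_product t Cg 1 (fun z : V * R => g (z.1 + z.2 *: E i)) (fun z : V * R => sg z.1) mgl) => //.
    exact: measurableT_comp.
  by move=> s; rewrite line_g.
have mF : measurable_fun setT
    (fun z : V * R => (g (z.1 + z.2 *: E i) * sg z.1 * \1_`[0, t] z.2)%:E : \bar R).
  by case/integrableP : F.
apply: le_trans (le_abse_integral _ _ _) _ => //.
  exact: (measurable_fubini_G F).
apply: (@le_trans _ _ (\int[mu]_s (Cg%:E * (\1_`[0%R, t] s)%:E))%E).
  apply: ge0_le_integral => //.
  - by apply: measurableT_comp => //; exact: (measurable_fubini_G F).
  - by apply: measurable_funeM; apply/measurable_EFinP; exact: measurable_indic.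
  move=> s _; apply: le_trans (le_abse_integral _ _ _) _ => //.
    exact: (measurable_slice s mF).
  have k0 : (0 <= (\1_`[0%R, t] s)%:E :> \bar R)%E by rewrite lee_fin.
  have mgs : measurable_fun setT (fun x : V => `|(g (x + s *: E i))%:E|%E).
    apply: measurableT_comp => //; apply/measurable_EFinP; apply: (measurableT_comp mg).
    exact: measurable_shift_rV.
  rewrite -(line_g s) muleC -ge0_integralZl//.
  apply: ge0_le_integral => //.
  - by apply: measurableT_comp => //; exact: (measurable_slice s mF).
  - exact: measurable_funeM.
  move=> x _; rewrite -EFinM lee_fin !normrM [X in _ * X]ger0_norm// mulrC ler_wpM2l//.
  by rewrite -[leRHS]mulr1 ler_wpM2l.
rewrite ge0_integralZl//.
- by rewrite integral_indic_segment max_r// CgE muleC.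
- by apply/measurable_EFinP; exact: measurable_indic.
- by rewrite -CgE; exact: integral_ge0.
Qed.

End increment_formula.

End increments.

(** * The weak gradient vanishes almost everywhere on the zero set *)

Section vanishing_gradient.
Context {R : realType} {n : nat}.
Local Notation mu := (@lebesgue_measure R).
Local Notation V := 'rV[R]_n.
Local Notation L := (@lebesgue_rV R n).
Local Notation E i := (delta_mx ord0 i : V).

Lemma measurable_section1 (h : V * R -> R) x : measurable_fun setT h ->
  measurable_fun setT (fun s => h (x, s)).
Proof. by move=> mh; apply: (measurableT_comp mh); exact: measurable_pair1. Qed.

Lemma measurable_section2 (h : V * R -> R) s : measurable_fun setT h ->
  measurable_fun setT (fun x => h (x, s)).
Proof. by move=> mh; apply: (measurableT_comp mh); exact: measurable_pair2. Qed.

(** Lebesgue differentiation along segments that shrink nicely to [x] without being centred there;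
    [al = -1] and [al = 0] are the averages to the left and to the right. *)
Lemma cvg_average (al : R) (f : R -> R) (x : R) : -1 <= al <= 0 ->
  locally_integrable setT f -> lebesgue_pt f x ->
  (k.+1%:R%:E * \int[mu]_(y in `[(x + al / k.+1%:R)%R, (x + (al + 1) / k.+1%:R)%R]) (f y)%:E)%E
    @[k --> \oo] --> (f x)%:E.
Proof.
move=> /andP[al1 al0] lf fx.
pose t k : R := k.+1%:R^-1.
have t0 k : 0 < t k by rewrite invr_gt0.
pose I (y : R) k := `[y + al * t k, y + (al + 1) * t k]%classic.
have muI y k : mu (I y k) = (t k)%:E.
  rewrite /I lebesgue_measure_itv/= lte_fin ltrD2l ltr_pM2r ?t0// ltrDl ltr01.
  by rewrite -EFinB; congr EFin; ring.
have t20 k : 0 < 2 * t k by rewrite mulr_gt0.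
have nI y : nicely_shrinking y (I y).
  split=> [k|]; first exact: measurable_itv.
  exists (4, fun k => PosNum (t20 k)); split => //=.
  - by rewrite -[X in _ --> X](mulr0 2); apply: cvgMr; exact: cvg_harmonic.
  - move=> k z; rewrite /I/= in_itv/= /ball/= ltr_distlC => /andP[yz zy].
    have := t0 k; nra.
  - move=> k; rewrite (lebesgue_measure_ball _ (ltW _))// muI -EFinM lee_fin.
    by rewrite -mulr_natl; lra.
have := nice_lebesgue_differentiation nI lf fx.
apply: cvg_trans; apply: near_eq_cvg; near=> k.
by rewrite muI inver gt_eqF ?t0// invrK.
Unshelve. all: by end_near.
Qed.

Definition line_mean (al : R) (i : 'I_n) (A : set V) k (x : V) : R :=
  k.+1%:R * fine (\int[mu]_s (\1_A (x + s *: E i) *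
    \1_`[al / k.+1%:R, (al + 1) / k.+1%:R] s)%:E).

Section line_mean.
Variables (al : R) (i : 'I_n) (A : set V).
Hypotheses (al10 : -1 <= al <= 0) (mA : measurable A).

Let mI k : measurable_fun setT (fun s : R =>
  \1_(`[al / k.+1%:R, (al + 1) / k.+1%:R]%classic : set R) s : R).
Proof. exact: measurable_indic. Qed.

Let mAl (x : V) : measurable_fun setT (fun s : R => \1_A (x + s *: E i) : R).
Proof.
apply: (@measurableT_comp _ _ _ _ _ _ (\1_A : V -> R)); first exact: measurable_indic.
exact: measurable_on_line.
Qed.

Let m2 k : measurable_fun setT (fun z : V * R => (\1_A (z.1 + z.2 *: E i) *
    \1_`[al / k.+1%:R, (al + 1) / k.+1%:R] z.2)%:E : \bar R).
Proof.
apply/measurable_EFinP; apply: measurable_funM.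
  apply: (@measurableT_comp _ _ _ _ _ _ (\1_A : V -> R)); first exact: measurable_indic.
  exact: measurable_line.
by apply: (measurableT_comp _ measurable_snd); exact: mI.
Qed.

Lemma measurable_line_mean k : measurable_fun setT (line_mean al i A k).
Proof.
apply: measurable_funM => //; apply: (measurableT_comp (fine_measurable measurableT)) => //.
apply: (@measurable_fun_fubini_tonelli_F _ _ _ _ _ mu _ (m2 k)) => z.
by rewrite lee_fin mulr_ge0.
Qed.

Let segment_le k (x : V) : (0 <= \int[mu]_s (\1_A (x + s *: E i) *
    \1_`[al / k.+1%:R, (al + 1) / k.+1%:R] s)%:E <= (k.+1%:R^-1)%:E)%E.
Proof.
rewrite integral_ge0/=; last by move=> s _; rewrite lee_fin mulr_ge0.
apply: (@le_trans _ _ (\int[mu]_s (\1_(`[al / k.+1%:R, (al + 1) / k.+1%:R]%classic : set R) s)%:E)%E).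
  apply: ge0_le_integral => //.
  - by apply/measurable_EFinP; apply: measurable_funM; [exact: (mAl x) | exact: (mI k)].
  - exact/measurable_EFinP.
  - move=> s _; rewrite lee_fin -[leRHS]mul1r; apply: ler_wpM2r => //.
rewrite integral_indic//= setIT lebesgue_measure_itv//= lte_fin.
rewrite ltr_pM2r ?invr_gt0// ltrDl ltr01 -EFinB lee_fin le_eqVlt; apply/orP; left.
by apply/eqP; ring.
Qed.

Lemma line_mean_ge0_le1 k x : 0 <= line_mean al i A k x <= 1.
Proof.
rewrite /line_mean; have /andP[] := segment_le k x.
case: integral => [r| |]//=; rewrite !lee_fin => r0 r1.
by rewrite mulr_ge0//= -ler_pdivlMl// mulr1.
Qed.

Lemma line_meanE k (x : V) (u : R) : (line_mean al i A k (x + u *: E i))%:E =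
  (k.+1%:R%:E * \int[mu]_(y in `[(u + al / k.+1%:R)%R, (u + (al + 1) / k.+1%:R)%R])
    (\1_A (x + y *: E i))%:E)%E.
Proof.
rewrite /line_mean EFinM fineK; last first.
  have /andP[h0 h1] := segment_le k (x + u *: E i).
  by rewrite ge0_fin_numE// (le_lt_trans h1)// ltry.
congr (_ * _)%E.
rewrite [RHS]integral_mkcond -[RHS](ge0_integral_shift1 u); last 2 first.
- apply/(measurable_restrictT _ _).1 => //; apply/measurable_EFinP.
  by apply: measurable_funTS; exact: mAl.
- by move=> s; rewrite patchE; case: ifP => _ //; rewrite lee_fin.
apply: eq_integral => s _; rewrite patchE [X in (_ * X)%:E]indicE.
have -> : (s + u \in `[(u + al / k.+1%:R)%R, (u + (al + 1) / k.+1%:R)%R]%classic) =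
   (s \in `[al / k.+1%:R, (al + 1) / k.+1%:R]%classic).
  by rewrite !mem_setE !in_itv/= ![u + _]addrC !lerD2r.
by rewrite -addrA -scalerDl [u + s]addrC; case: ifP => _; rewrite ?mulr1 ?mulr0.
Qed.

(** On every line, Lebesgue differentiation makes the upper limit of the errors vanish almost
    everywhere. Its integral over R^n is therefore 0 by [eq_integral_lines], so that it vanishes
    almost everywhere in R^n. *)
Lemma cvg_line_mean :
  {ae L, forall x, (line_mean al i A k x)%:E @[k --> \oo] --> (\1_A x)%:E}.
Proof.
pose d k x : \bar R := (`|(line_mean al i A k x)%:E - (\1_A x)%:E|)%E.
have md k : measurable_fun setT (d k).
  apply: measurableT_comp => //; apply: emeasurable_funB.
    by apply/measurable_EFinP; exact: measurable_line_mean.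
  by apply/measurable_EFinP; exact: measurable_indic.
pose D x := (`|limn_esup (d ^~ x)|)%E.
have mD : measurable_fun setT D.
  by apply: measurableT_comp => //; exact: measurable_fun_limn_esup.
have D0 x : (0 <= D x)%E by exact: abse_ge0.
have DE x : D x = 0%E -> (line_mean al i A k x)%:E @[k --> \oo] --> (\1_A x)%:E.
  move=> Dx; apply: (sube_cvg0 _ _).1 => //; apply/cvg_abse0P.
  apply: limn_esup_le_cvg; last by move=> k; exact: abse_ge0.
  by move/eqP : Dx; rewrite abse_eq0 => /eqP ->.
suff iD : (\int[L]_x D x = 0)%E.
  have /(ae_eq_integral_abs L measurableT mD).1 : (\int[L]_x `|D x| = 0)%E.
    by rewrite -[RHS]iD; apply: eq_integral => x _; rewrite gee0_abs.
  by apply: filterS => x /= /(_ I); exact: DE.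
rewrite (eq_integral_lines (i := i) (h := cst 0%E))//; first exact: integral0.
move=> x; rewrite integral0; apply/eqP; rewrite -(negbK (_ == _)).
apply/negPn/eqP.
pose f := fun y : R => \1_A (x + y *: E i) : R.
have lf : locally_integrable setT f.
  have -> : f = \1_((fun y : R => x + y *: E i) @^-1` A) by apply/funext => y; rewrite /f !indicE.
  apply: locally_integrable_indic; first exact: openT.
  by rewrite -[X in measurable X]setTI; exact: (measurable_on_line x (E i)).
rewrite -(integral0 mu setT); apply: ae_eq_integral => //.
  by apply: (measurableT_comp mD); exact: measurable_on_line.
have := lebesgue_differentiation lf.
apply: (@filterS _ _ (ae_filter_ringOfSetsType mu)) => u fu _.
apply/eqP; rewrite /D abse_eq0; apply/eqP; apply: (cvg_limn_einf_sup _).2.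
apply/cvg_abse0P; apply/(sube_cvg0 _ _).2 => //.
have := cvg_average al10 lf fu; apply: cvg_trans; apply: near_eq_cvg.
by apply: nearW => k; rewrite line_meanE.
Unshelve. all: by end_near.
Qed.

End line_mean.

Section vanishing.
Variables (rho g : V -> R) (i : 'I_n).
Hypotheses (irho : L.-integrable setT (EFin \o rho))
  (rho0 : forall x, 0 <= rho x)
  (ig : L.-integrable setT (EFin \o g))
  (wg : forall k a b,
      (\int[L]_x (rho x * partial i (plateaux k a b) x)%:E =
       - \int[L]_x (g x * plateaux k a b x)%:E)%E).

Let mrho : measurable_fun setT rho.
Proof. by case/integrableP : irho => /measurable_EFinP. Qed.
Let mg : measurable_fun setT g.
Proof. by case/integrableP : ig => /measurable_EFinP. Qed.

Let cvg_mean al A : -1 <= al <= 0 -> measurable A ->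
  (\int[L]_x (g x * line_mean al i A k x)%:E @[k --> \oo] --> \int[L]_x (g x * \1_A x)%:E)%E.
Proof.
move=> al10 mA.
have m1 k : measurable_fun setT (fun x => (g x * line_mean al i A k x)%:E : \bar R).
  by apply/measurable_EFinP; apply: measurable_funM; [exact: mg | exact: (@measurable_line_mean al i A mA k)].
have m2 : measurable_fun setT (fun x => (g x * \1_A x)%:E : \bar R).
  by apply/measurable_EFinP; apply: measurable_funM; [exact: mg | exact: measurable_indic].
have c : {ae L, forall x, [set: V] x ->
    (g x * line_mean al i A k x)%:E @[k --> \oo] --> (g x * \1_A x)%:E}.
  apply: filterS (cvg_line_mean i al10 mA) => x cx _.
  under eq_fun do rewrite EFinM.
  by rewrite EFinM; apply: cvgeZl.
have b : {ae L, forall x k, [set: V] x -> (`|(g x * line_mean al i A k x)%:E| <= `|(g x)%:E|)%E}.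
  apply: aeW => x k _; rewrite lee_fin normrM -[leRHS]mulr1 ler_wpM2l//.
  by have /andP[h0 h1] := @line_mean_ge0_le1 al i A mA k x; rewrite ger0_norm.
have ia : L.-integrable setT (fun x => `|(g x)%:E|)%E by exact: integrable_abse.
by have [_ _] := dominated_convergence measurableT m1 m2 c ia b.
Qed.

Let mean_swap (h : R -> V -> R) al A k : -1 <= al <= 0 -> measurable A ->
  measurable_fun setT (fun z : V * R => h z.2 z.1) -> (forall s x, 0 <= h s x <= 1) ->
  (forall x, \int[mu]_s (h s x * \1_`[0%R, k.+1%:R^-1] s)%:E =
    \int[mu]_s (\1_A (x + s *: E i) * \1_`[(al / k.+1%:R)%R, ((al + 1) / k.+1%:R)%R] s)%:E)%E ->
  (k.+1%:R%:E * \int[mu]_s \int[L]_x (g x * h s x * \1_`[0%R, k.+1%:R^-1] s)%:E =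
   \int[L]_x (g x * line_mean al i A k x)%:E)%E.
Proof.
move=> al10 mA mh h01 hE.
have mg1 : measurable_fun setT (fun z : V * R => g z.1).
  exact: (measurableT_comp mg measurable_fst).
have F : (L \x mu)%E.-integrable setT
    (fun z => (g z.1 * h z.2 z.1 * \1_`[0, k.+1%:R^-1] z.2)%:E).
  apply: (@integrable_line_product _ _ k.+1%:R^-1 (fine (\int[L]_x `|(g x)%:E|)) 1
    (fun z : V * R => g z.1) (fun z : V * R => h z.2 z.1)) => //.
    by move=> z; have /andP[? ?] := h01 z.2 z.1; rewrite ger0_norm.
  move=> s; rewrite fineK// ge0_fin_numE; last exact: integral_ge0.
  by case/integrableP : ig.
rewrite -(Fubini F) -integralZl//; last exact: (integrable_fubini_F F).
apply: eq_integral => x _.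
rewrite /line_mean -hE.
have hI : mu.-integrable setT (fun s => (h s x * \1_`[0, k.+1%:R^-1] s)%:E).
  apply: (@le_integrable _ _ _ mu _ measurableT _ (fun s => (\1_`[0, k.+1%:R^-1] s)%:E)).
  - apply/measurable_EFinP; apply: measurable_funM; last exact: measurable_indic.
    exact: (measurable_section1 x mh).
  - move=> s _; rewrite lee_fin normrM -[leRHS]mul1r ler_wpM2r//.
    by have /andP[? ?] := h01 s x; rewrite ger0_norm.
  - apply/integrableP; split; first by apply/measurable_EFinP; exact: measurable_indic.
    have -> : (\int[mu]_s `|(\1_`[0%R, k.+1%:R^-1] s)%:E| = \int[mu]_s (\1_`[0%R, k.+1%:R^-1] s)%:E)%E.
      by apply: eq_integral => s _; rewrite gee0_abs// lee_fin.
    by rewrite integral_indic_segment ltry.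
rewrite 2!EFinM fineK; last exact: integrable_fin_num.
rewrite muleCA -[in RHS]integralZl//; congr (_ * _)%E.
by apply: eq_integral => s _; rewrite -EFinM mulrA.
Qed.

(** Increments of [rho] that start in [A] are nonnegative, as [rho] is 0 there. By [increment_test]
    the integral of [g] against the mean of the indicator of [A] over backward segments is then
    nonnegative, and the segments shrink. *)
Let part_ge0 A : measurable A -> (forall x, A x -> rho x = 0) ->
  (0 <= \int[L]_x (g x * \1_A x)%:E)%E.
Proof.
move=> mA A0.
have a10 : -1 <= (-1 : R) <= 0 by rewrite lexx/= oppr_le0 ler01.
have H := cvg_mean a10 mA.
apply: (cvge_ge _ H); apply: nearW => k.
pose h s (x : V) : R := \1_A (x - s *: E i).
have mh : measurable_fun setT (fun z : V * R => h z.2 z.1).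
  apply: (@measurableT_comp _ _ _ _ _ _ (\1_A : V -> R)); first exact: measurable_indic.
  have -> : (fun z : V * R => z.1 - z.2 *: E i) = (fun z => z.1 + z.2 *: - E i).
    by apply/funext => z; rewrite scalerN.
  exact: measurable_line.
rewrite -(@mean_swap h _ A k a10 mA mh); last 2 first.
- by move=> s x; rewrite /h indicE; case: (_ \in _); rewrite lexx ler01.
- move=> x; rewrite -ge0_integral_opp; last 2 first.
  + apply/measurable_EFinP; apply: measurable_funM; last exact: measurable_indic.
    exact: (measurable_section1 x mh).
  + by move=> s; rewrite lee_fin mulr_ge0.
  apply: eq_integral => s _; rewrite /h scaleNr opprK; congr (_ * _)%:E.
  rewrite !indicE !mem_setE !in_itv/= addNr mul0r mulN1r oppr_ge0 andbC.
  by rewrite lerNl.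
apply: mule_ge0; first by rewrite lee_fin.
have mI : measurable_fun setT (\1_A : V -> R) by exact: measurable_indic.
have B1 x : `|\1_A x : R| <= 1 by rewrite indicE; case: (_ \in _); rewrite ?normr1 ?normr0 ?ler01.
have := increment_test irho ig wg (t := k.+1%:R^-1) _ mI B1; rewrite invr_ge0 ler0n => /(_ isT) H1.
have -> : (\int[mu]_s \int[L]_x (g x * h s x * \1_`[0%R, k.+1%:R^-1] s)%:E =
    \int[mu]_s \int[L]_x (g (x + s *: E i)%R * \1_A x * \1_`[0%R, k.+1%:R^-1] s)%:E)%E.
  apply: eq_integral => s _; rewrite -(integral_shift_rV (s *: E i)); last first.
    apply/measurable_EFinP; apply: measurable_funM => //; apply: measurable_funM; first exact: mg.
    exact: (measurable_section2 s mh).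
  by apply: eq_integral => x _; rewrite /h addrK.
rewrite -H1; apply: integral_ge0 => x _; rewrite lee_fin indicE.
case: (boolP (x \in A)) => [|_]; last by rewrite mulr0.
by rewrite inE => /A0 ->; rewrite subr0 mulr1.
Qed.

(** The mirror image of [part_ge0]: increments that end in [A] are nonpositive, and the means are
    taken over forward segments. *)
Let part_le0 A : measurable A -> (forall x, A x -> rho x = 0) ->
  (\int[L]_x (g x * \1_A x)%:E <= 0)%E.
Proof.
move=> mA A0.
have a10 : -1 <= (0 : R) <= 0 by rewrite lexx oppr_le0 ler01.
have H := cvg_mean a10 mA.
apply: (cvge_le _ H); apply: nearW => k.
pose t : R := k.+1%:R^-1.
pose h s (x : V) : R := \1_A (x + (t - s) *: E i).
have mh : measurable_fun setT (fun z : V * R => h z.2 z.1).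
  apply: (@measurableT_comp _ _ _ _ _ _ (\1_A : V -> R)); first exact: measurable_indic.
  have -> : (fun z : V * R => z.1 + (t - z.2) *: E i) = (fun z => (z.1 + z.2 *: - E i) + t *: E i).
    by apply/funext => z; rewrite scalerN scalerBl addrA addrAC.
  by apply: (measurableT_comp (measurable_shift_rV _)); exact: measurable_line.
rewrite -(@mean_swap h _ A k a10 mA mh); last 2 first.
- by move=> s x; rewrite /h indicE; case: (_ \in _); rewrite lexx ler01.
- move=> x.
  have m1 : measurable_fun setT (fun s : R => (h s x * \1_`[0, k.+1%:R^-1] s)%:E : \bar R).
    apply/measurable_EFinP; apply: measurable_funM; last exact: measurable_indic.
    exact: (measurable_section1 x mh).
  have p1 s : (0 <= (h s x * \1_`[0%R, k.+1%:R^-1] s)%:E :> \bar R)%E.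
    by rewrite lee_fin mulr_ge0.
  rewrite -(ge0_integral_shift1 t m1 p1) -ge0_integral_opp//; last first.
    by apply: (measurableT_comp m1); exact: measurable_shift1.
  apply: eq_integral => s _; rewrite /h opprD opprK addrCA subrr addr0; congr (_ * _)%:E.
  rewrite !indicE !mem_setE !in_itv/= mul0r add0r mul1r addrC subr_ge0 andbC.
  by rewrite gerBl.
apply: mule_ge0_le0; first by rewrite lee_fin.
pose hA (x : V) : R := \1_A (x + t *: E i).
have mI : measurable_fun setT hA.
  apply: (@measurableT_comp _ _ _ _ _ _ (\1_A : V -> R)); first exact: measurable_indic.
  exact: measurable_shift_rV.
have B1 x : `|hA x| <= 1 by rewrite /hA indicE; case: (_ \in _); rewrite ?normr1 ?normr0 ?ler01.
have := increment_test irho ig wg (t := t) _ mI B1; rewrite invr_ge0 ler0n => /(_ isT) H1.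
have -> : (\int[mu]_s \int[L]_x (g x * h s x * \1_`[0%R, k.+1%:R^-1] s)%:E =
    \int[mu]_s \int[L]_x (g (x + s *: E i)%R * hA x * \1_`[0%R, t] s)%:E)%E.
  apply: eq_integral => s _; rewrite -(integral_shift_rV (s *: E i)); last first.
    apply/measurable_EFinP; apply: measurable_funM => //; apply: measurable_funM; first exact: mg.
    exact: (measurable_section2 s mh).
  by apply: eq_integral => x _; rewrite /h /hA -addrA -scalerDl addrCA subrr addr0.
have iA := integrable_mul_bounded irho mI B1.
rewrite -H1 (eq_integral (fun x => (-1)%:E * (rho x * hA x)%:E)%E); last first.
  move=> x _; rewrite -EFinM; congr EFin; rewrite /hA indicE.
  case: (boolP (_ \in A)) => [|_]; last by rewrite !mulr0.
  by rewrite inE => /A0 ->; ring.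
rewrite integralZl// mulN1e oppe_le0; apply: integral_ge0 => x _.
by rewrite lee_fin mulr_ge0.
Qed.

(** The two inequalities make the integral of [g] vanish on every measurable part of the zero set of
    [rho], in particular on the parts where [g] is positive and where it is negative. *)
Lemma weak_derivative_vanishes : {ae L, forall x, rho x = 0 -> g x = 0}.
Proof.
have mZ : measurable [set x | rho x = 0].
  rewrite -[X in measurable X]setTI (_ : [set x | rho x = 0] = rho @^-1` [set 0])//.
  exact: mrho.
pose P := [set x | rho x = 0] `&` [set x | 0 < g x].
pose N := [set x | rho x = 0] `&` [set x | g x < 0].
have mP : measurable P.
  apply: measurableI => //; rewrite -[X in measurable X]setTI.
  rewrite (_ : [set x | 0 < g x] = g @^-1` `]0, +oo[%classic); first exact: mg.
  by apply/seteqP; split => x /=; rewrite in_itv/= andbT.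
have mN : measurable N.
  apply: measurableI => //; rewrite -[X in measurable X]setTI.
  rewrite (_ : [set x | g x < 0] = g @^-1` `]-oo, 0[%classic); first exact: mg.
  by apply/seteqP; split => x /=; rewrite in_itv/=.
have zero B : measurable B -> (\int[L]_x (g x * \1_B x)%:E = 0)%E ->
    (forall x, B x -> g x != 0) -> ((forall x, B x -> 0 < g x) \/ (forall x, B x -> g x < 0)) ->
    {ae L, forall x, ~ B x}.
  move=> mB i0 nz sgn.
  have mf : measurable_fun setT (fun x => (g x * \1_B x)%:E : \bar R).
    by apply/measurable_EFinP; apply: measurable_funM; [exact: mg | exact: measurable_indic].
  have : (\int[L]_x `|(g x * \1_B x)%:E| = 0)%E.
    case: sgn => sgn.
      rewrite -[RHS]i0; apply: eq_integral => x _; rewrite gee0_abs// lee_fin indicE.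
      case: (boolP (x \in B)) => [|_]; last by rewrite mulr0.
      by rewrite inE mulr1 => /sgn /ltW.
    have B1 x : `|\1_B x : R| <= 1 by rewrite indicE; case: (_ \in _); rewrite ?normr1 ?normr0 ?ler01.
    have iB := integrable_mul_bounded ig (measurable_indic mB) B1.
    rewrite (eq_integral (fun x => (-1)%:E * (g x * \1_B x)%:E)%E) ?integralZl ?i0 ?mule0//.
    move=> x _; rewrite mulN1e lee0_abs// lee_fin indicE.
    case: (boolP (x \in B)) => [|_]; last by rewrite mulr0.
    by rewrite inE mulr1 => /sgn /ltW.
  move/(ae_eq_integral_abs L measurableT mf).1; apply: filterS => x /= /(_ I) + Bx.
  rewrite indicE mem_set// mulr1 => -[] /eqP; apply/negP; exact: nz.
have aP : {ae L, forall x, ~ P x}.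
  apply: zero => //.
  - by apply/eqP; rewrite eq_le part_ge0// ?part_le0// => x [].
  - by move=> x [_ /= ?]; rewrite gt_eqF.
  - by left => x [].
have aN : {ae L, forall x, ~ N x}.
  apply: zero => //.
  - by apply/eqP; rewrite eq_le part_ge0// ?part_le0// => x [].
  - by move=> x [_ /= ?]; rewrite lt_eqF.
  - by right => x [].
apply: filterS2 aP aN => x nP nN r0.
by case: (ltgtP (g x) 0) => // g0; [case: nN | case: nP].
Qed.

End vanishing.

End vanishing_gradient.

(** * Cauchy-Schwarz with a denominator that may vanish *)

Section cauchy_schwarz.
Context d (T : measurableType d) (R : realType) (mu : {measure set T -> \bar R}).

Lemma ge0_integral_mull (k : R) (f : T -> R) : measurable_fun setT f ->
  (forall x, 0 <= f x) -> 0 <= k ->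
  (\int[mu]_x (k * f x)%:E = k%:E * \int[mu]_x (f x)%:E)%E.
Proof.
move=> mf f0 k0; under eq_integral do rewrite EFinM.
apply: ge0_integralZl => //; first exact/measurable_EFinP.
by move=> x _; rewrite lee_fin.
Qed.

(** Integrate 2 u <= l r + u^2 / (l r) with l = |D| / a, the value that balances the two terms;
    where [r] is 0 both sides are 0 because [u] is. *)
Lemma sqr_div_le_integral (u r : T -> R) (D a : R) :
  measurable_fun setT u -> measurable_fun setT r -> (forall x, 0 <= u x) ->
  (forall x, 0 <= r x) -> (forall x, r x = 0 -> u x = 0) -> 0 < a ->
  (\int[mu]_x (r x)%:E <= a%:E)%E -> (`|D|%:E <= \int[mu]_x (u x)%:E)%E ->
  ((D ^+ 2 / a)%:E <= \int[mu]_x (u x ^+ 2 / r x)%:E)%E.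
Proof.
move=> mu' mr u0 r0 ru a0 ra Du.
have mq : measurable_fun setT (fun x => u x ^+ 2 / r x).
  by apply: measurable_funM; [exact: measurable_funX | exact: measurable_fun_inv].
have q0 x : 0 <= u x ^+ 2 / r x by rewrite divr_ge0 ?sqr_ge0.
set B := (\int[mu]_x (u x ^+ 2 / r x)%:E)%E.
have B0 : (0 <= B)%E by apply: integral_ge0 => x _; rewrite lee_fin.
have [->|D0] := eqVneq D 0; first by rewrite expr0n mul0r.
have [Boo|] := ltP B +oo%E; last by rewrite leye_eq => /eqP ->; exact: leey.
have BE : B = (fine B)%:E by rewrite fineK// ge0_fin_numE.
have nD : 0 < `|D| by rewrite normr_gt0.
pose l := `|D| / a.
have l0 : 0 < l by rewrite divr_gt0.
have e1 x : (0 <= (l * r x)%:E :> \bar R)%E by rewrite lee_fin mulr_ge0// ltW.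
have e2 x : (0 <= (l^-1 * (u x ^+ 2 / r x))%:E :> \bar R)%E.
  by rewrite lee_fin mulr_ge0// invr_ge0 ltW.
have m1 : measurable_fun setT (fun x => (l * r x)%:E : \bar R).
  by apply/measurable_EFinP; exact: measurable_funM.
have m2 : measurable_fun setT (fun x => (l^-1 * (u x ^+ 2 / r x))%:E : \bar R).
  by apply/measurable_EFinP; exact: measurable_funM.
have H : (2%:E * \int[mu]_x (u x)%:E <= l%:E * \int[mu]_x (r x)%:E + l^-1%:E * B)%E.
  have i1 := ge0_integral_mull mr r0 (ltW l0).
  have il0 : 0 <= l^-1 by rewrite invr_ge0 ltW.
  have i2 := ge0_integral_mull mq q0 il0.
  have i3 := ge0_integral_mull mu' u0 (ler0n R 2).
  rewrite -i1 -i2 -i3 -(ge0_integralD mu measurableT (fun z _ => e1 z) m1 (fun z _ => e2 z) m2).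
  apply: ge0_le_integral => //.
  - by move=> x _; rewrite lee_fin mulr_ge0.
  - by apply/measurable_EFinP; exact: measurable_funM.
  - exact: emeasurable_funD.
  - move=> x _; rewrite -EFinD lee_fin.
    have [rx|rx] := eqVneq (r x) 0; first by rewrite rx (ru _ rx) invr0 !mulr0 addr0.
    rewrite -subr_ge0.
    have -> : l * r x + l^-1 * (u x ^+ 2 / r x) - 2 * u x = (l * r x - u x) ^+ 2 / (l * r x).
      by field; rewrite rx gt_eqF.
    by rewrite divr_ge0 ?sqr_ge0// mulr_ge0// ltW.
have H2 : ((2 * `|D|)%:E <= (`|D| + l^-1 * fine B)%:E)%E.
  rewrite EFinM; apply: le_trans (lee_wpmul2l _ Du) _ => //.
  apply: le_trans H _; rewrite EFinD [(l^-1 * _)%:E]EFinM -BE leeD2r//.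
  have -> : `|D| = l * a by rewrite /l divfK// gt_eqF.
  by rewrite [(l * a)%:E]EFinM; apply: lee_wpmul2l => //; rewrite lee_fin ltW.
move: H2; rewrite lee_fin => H2.
have H3 : `|D| <= l^-1 * fine B by lra.
rewrite BE lee_fin -real_normK ?num_real// expr2.
by rewrite ler_pdivlMl// in H3; rewrite mulrAC.
Qed.

End cauchy_schwarz.

(** * The Laplace kernel on R^n *)

Section laplace_kernel.
Context {R : realType}.
Local Notation mu := (@lebesgue_measure R).

Lemma integral_tensor n (f : 'I_n -> R -> R) (c : 'I_n -> R) :
  (forall i, measurable_fun setT (f i)) -> (forall i x, 0 <= f i x) ->
  (forall i, \int[mu]_s (f i s)%:E = (c i)%:E)%E ->
  (\int[lebesgue_rV n]_x (tensor f x)%:E = (\prod_i c i)%:E)%E.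
Proof.
elim: n f c => [f c mf _ _|n IH f c mf f0 fc].
  rewrite big_ord0 /= integral_dirac//; last first.
    by apply/measurable_EFinP; exact: measurable_tensor.
  by rewrite diracT mul1e /tensor big_ord0.
have mt : measurable_fun setT (EFin \o tensor f) by apply/measurable_EFinP; exact: measurable_tensor.
rewrite (integral_lebesgue_cons mt); last first.
  by move=> x; rewrite lee_fin prodr_ge0.
have E s v : tensor f (consrV (s, v)) = f ord0 s * tensor (fun i => f (lift ord0 i)) v.
  rewrite /tensor big_ord_recl; congr (f _ _ * _); first by rewrite mxE unlift_none.
  by apply: eq_bigr => i _; rewrite mxE liftK.
have mt' : measurable_fun setT (tensor (fun i => f (lift ord0 i))) by exact: measurable_tensor.
have IH' := IH (fun i => f (lift ord0 i)) (fun i => c (lift ord0 i)) (fun i => mf _)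
  (fun i => f0 _) (fun i => fc _).
have c0 : 0 <= \prod_i c (lift ord0 i).
  by rewrite -lee_fin -IH'; apply: integral_ge0 => v _; rewrite lee_fin prodr_ge0.
transitivity (\int[mu]_s (\prod_i c (lift ord0 i) * f ord0 s)%:E)%E.
  apply: eq_integral => s _.
  rewrite EFinM -IH' muleC -ge0_integral_mull//; last by move=> v; exact: prodr_ge0.
  by apply: eq_integral => v _; rewrite /= E.
by rewrite (ge0_integral_mull mu (mf ord0) (f0 ord0) c0) fc -EFinM big_ord_recl mulrC.
Qed.

Lemma measurable_expR_abs (M : R) : measurable_fun setT (fun s : R => expR (- (M * `|s|))).
Proof.
apply: measurableT_comp => //; apply: measurable_funN; exact: measurable_funM.
Qed.

Definition lap_mass : R := fine (\int[mu]_s (expR (- `|s|))%:E).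

Let bound : (1 <= \int[mu]_s (expR (- `|s|))%:E <= 2%:E)%E.
Proof.
have I := integral_exponential_pdf (ltr01 : 0 < 1 :> R).
have m1 : measurable_fun setT (fun s : R => (exponential_pdf 1 s)%:E : \bar R).
  by apply/measurable_EFinP; exact: measurable_exponential_pdf.
have p1 s : (0 <= (exponential_pdf 1 s)%:E :> \bar R)%E by rewrite lee_fin exponential_pdf_ge0.
have mN : measurable_fun setT (fun s : R => (exponential_pdf 1 (- s))%:E : \bar R).
  by apply: (measurableT_comp m1); exact: (@measurable_funN _ _ _ setT id).
have mE : measurable_fun setT (fun s : R => (expR (- `|s|))%:E : \bar R).
  apply/measurable_EFinP; have := measurable_expR_abs 1.
  by under eq_fun do rewrite mul1r.
have pE (s : R) : 0 <= s -> exponential_pdf 1 s = expR (- s).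
  by move=> s0; rewrite exponential_pdfE// mul1r mulN1r.
apply/andP; split.
  rewrite -I; apply: ge0_le_integral => // s _.
  rewrite lee_fin; have [s0|s0] := leP 0 s; first by rewrite ger0_norm// pE.
  by rewrite lt0_exponential_pdf// expR_ge0.
apply: (@le_trans _ _ (\int[mu]_s ((exponential_pdf 1 s)%:E + (exponential_pdf 1 (- s))%:E))%E).
  apply: ge0_le_integral => //.
  - exact: emeasurable_funD.
  - move=> s _; rewrite -EFinD lee_fin; have [s0|s0] := leP 0 s.
      by rewrite ger0_norm// pE// lerDl exponential_pdf_ge0.
    have -> : expR (- `|s|) = exponential_pdf 1 (- s).
      by rewrite ltr0_norm// pE// oppr_ge0 ltW.
    by rewrite lerDr exponential_pdf_ge0.
rewrite (ge0_integralD mu measurableT (fun z _ => p1 z) m1 (fun z _ => p1 (- z)) mN).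
by rewrite (ge0_integral_opp m1 p1) I -EFinD lee_fin.
Qed.

Lemma lap_massE : (\int[mu]_s (expR (- `|s|))%:E = lap_mass%:E)%E.
Proof.
have /andP[h1 h2] := bound; rewrite fineK// ge0_fin_numE; last exact: le_trans h1.
by rewrite (le_lt_trans h2)// ltry.
Qed.

Lemma lap_mass_gt0 : 0 < lap_mass.
Proof.
have /andP[h1 _] := bound; rewrite -lte_fin -lap_massE; exact: lt_le_trans h1.
Qed.

Lemma integral_expR_abs (M : R) : 0 < M ->
  (\int[mu]_s (expR (- (M * `|s|)))%:E = (lap_mass / M)%:E)%E.
Proof.
move=> M0.
have mE : measurable_fun setT (fun s : R => (expR (- `|s|))%:E : \bar R).
  apply/measurable_EFinP; have := measurable_expR_abs 1.
  by under eq_fun do rewrite mul1r.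
have := ge0_integral_scale1 M0 mE; rewrite lap_massE => H.
rewrite mulrC EFinM -H; last by move=> s; rewrite lee_fin expR_ge0.
have mM : measurable_fun setT (fun s : R => expR (- `|M * s|) * M).
  apply: measurable_funM => //; rewrite (_ : (fun x : R => _) = (fun s : R => expR (- (M * `|s|)))).
    exact: measurable_expR_abs.
  by apply/funext => s; rewrite normrM (gtr0_norm M0).
rewrite -ge0_integral_mull//.
- apply: eq_integral => s _; rewrite normrM (gtr0_norm M0); congr EFin; field.
  by rewrite gt_eqF.
- by move=> s; rewrite mulr_ge0 ?expR_ge0// ltW.
- by rewrite invr_ge0 ltW.
Qed.

Context {n : nat}.
Local Notation V := 'rV[R]_n.
Local Notation L := (@lebesgue_rV R n).
Local Notation E i := (delta_mx ord0 i : V).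

Definition l1norm (x : V) : R := \sum_i `|x ord0 i|.

Lemma l1norm_ge0 x : 0 <= l1norm x.
Proof. by apply: sumr_ge0 => i _. Qed.

Lemma l1normD x y : l1norm (x + y) <= l1norm x + l1norm y.
Proof. by rewrite -big_split/=; apply: ler_sum => i _; rewrite mxE ler_normD. Qed.

Lemma l1normN x : l1norm (- x) = l1norm x.
Proof. by apply: eq_bigr => i _; rewrite mxE normrN. Qed.

Lemma l1norm_line i (t : R) : l1norm (t *: E i) = `|t|.
Proof.
rewrite /l1norm (bigD1 i)//= big1 => [|j ji]; rewrite !mxE !eqxx/= ?mulr1 ?addr0//.
by rewrite (negbTE ji) mulr0 normr0.
Qed.

Lemma measurable_l1norm : measurable_fun setT l1norm.
Proof.
apply: measurable_sum => i; apply: measurableT_comp => //; exact: measurable_coord.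
Qed.

(** The l1 norm makes the kernel a tensor product, and makes its logarithm Lipschitz of constant M
    along each axis. *)
Definition lap (M : R) (x : V) : R := expR (- (M * l1norm x)).

Lemma lap_tensor M : lap M = tensor (fun _ s => expR (- (M * `|s|))).
Proof.
apply/funext => x; rewrite /lap /tensor /l1norm mulr_sumr -sumrN.
by rewrite (big_morph expR (@expRD R) (@expR0 R)).
Qed.

Lemma measurable_lap M : measurable_fun setT (lap M).
Proof. by rewrite lap_tensor; apply: measurable_tensor => i; exact: measurable_expR_abs. Qed.

Lemma integral_lap M : 0 < M -> (\int[L]_x (lap M x)%:E = ((lap_mass / M) ^+ n)%:E)%E.
Proof.
move=> M0; rewrite lap_tensor (integral_tensor (c := fun=> lap_mass / M)).
- by rewrite prodr_const card_ord.
- by move=> i; exact: measurable_expR_abs.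
- by move=> i s; exact: expR_ge0.
- by move=> i; exact: integral_expR_abs.
Qed.

Definition kern (M : R) (x : V) : R := lap M x / (lap_mass / M) ^+ n.

Section kern.
Variable M : R.
Hypothesis M0 : 0 < M.

Let c0 : 0 < (lap_mass / M) ^+ n.
Proof. by rewrite exprn_gt0// divr_gt0// lap_mass_gt0. Qed.

Lemma kern_gt0 x : 0 < kern M x.
Proof. by apply: divr_gt0 => //; exact: expR_gt0. Qed.

Lemma kern_le x : kern M x <= ((lap_mass / M) ^+ n)^-1.
Proof.
rewrite -[leRHS]mul1r; apply: ler_wpM2r; first by rewrite invr_ge0 ltW.
by rewrite -expR0 ler_expR oppr_le0 mulr_ge0 ?l1norm_ge0// ltW.
Qed.

Lemma kernN x : kern M (- x) = kern M x.
Proof. by rewrite /kern /lap l1normN. Qed.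

Lemma kern_line x i (t : R) : kern M (x + t *: E i) <= expR (M * `|t|) * kern M x.
Proof.
rewrite /kern mulrA; apply: ler_wpM2r; first by rewrite invr_ge0 ltW.
rewrite /lap -expRD ler_expR -subr_ge0.
have := l1normD (x + t *: E i) (- (t *: E i)); rewrite addrK l1normN l1norm_line => H.
have -> : M * `|t| - M * l1norm x - - (M * l1norm (x + t *: E i)) =
  M * (l1norm (x + t *: E i) + `|t| - l1norm x) by ring.
by apply: mulr_ge0; [exact: ltW | rewrite subr_ge0].
Qed.

Lemma measurable_kern : measurable_fun setT (kern M).
Proof. by apply: measurable_funM => //; exact: measurable_lap. Qed.

Lemma integral_kern : (\int[L]_x (kern M x)%:E = 1)%E.
Proof.
under eq_integral do rewrite /kern mulrC.
rewrite (ge0_integral_mull _ (measurable_lap M)).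
- by rewrite integral_lap// -EFinM mulVf ?gt_eqF.
- by move=> x; exact: expR_ge0.
- by rewrite invr_ge0 ltW.
Qed.

Lemma integral_kern_l1 : (\int[L]_x (kern M x * l1norm x)%:E <= (2 ^+ n / M)%:E)%E.
Proof.
have M2 : 0 < M / 2 by rewrite divr_gt0.
(* With L the l1 norm, M L exp(- M L) <= exp(- M L / 2), and halving the rate multiplies the mass of
   the kernel by 2^n: hence the bound 2^n / M. *)
pose c := (M * (lap_mass / M) ^+ n)^-1.
have c00 : 0 <= c by rewrite invr_ge0 mulr_ge0 ?ltW.
apply: (@le_trans _ _ (\int[L]_x (c * lap (M / 2) x)%:E)%E).
  apply: ge0_le_integral => //.
  - by move=> x _; rewrite lee_fin mulr_ge0 ?l1norm_ge0// ltW// kern_gt0.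
  - apply/measurable_EFinP; apply: measurable_funM; first exact: measurable_kern.
    exact: measurable_l1norm.
  - by apply/measurable_EFinP; apply: measurable_funM => //; exact: measurable_lap.
  - move=> x _; rewrite lee_fin /kern /c invfM.
    have q0 : 0 <= ((lap_mass / M) ^+ n)^-1 by rewrite invr_ge0 ltW.
    have -> : lap M x = lap (M / 2) x * lap (M / 2) x by rewrite /lap -expRD; congr expR; field.
    have e3 (u q k : R) : u * u / q * k = q^-1 * u * (k * u) by ring.
    have e4 (u q m : R) : m * q * u = q * u * m by ring.
    rewrite e3 (e4 (lap (M / 2) x) _ M^-1); apply: ler_wpM2l; first by rewrite mulr_ge0// expR_ge0.
    rewrite -[leRHS]div1r ler_pdivlMr// mulrC mulrA.
    rewrite /lap expRN ler_pdivrMr ?expR_gt0// mul1r.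
    have -> : M * l1norm x = 2 * (M / 2 * l1norm x) by field.
    set y := M / 2 * l1norm x.
    have y0 : 0 <= y by rewrite mulr_ge0 ?l1norm_ge0// ltW.
    have h1 : 1 + y / 2 <= expR (y / 2) by exact: expR_ge1Dx.
    have -> : expR y = expR (y / 2) ^+ 2 by rewrite expr2 -expRD; congr expR; field.
    have h2 : (1 + y / 2) ^+ 2 <= expR (y / 2) ^+ 2.
      by apply: lerXn2r; rewrite ?nnegrE ?expR_ge0//; lra.
    apply: le_trans h2; have := sqr_ge0 (1 - y / 2); rewrite !expr2; lra.
rewrite (ge0_integral_mull _ (measurable_lap _))//.
- rewrite integral_lap// -EFinM lee_fin /c le_eqVlt; apply/orP; left; apply/eqP.
  have l0 := lap_mass_gt0.
  rewrite (_ : lap_mass / (M / 2) = 2 * (lap_mass / M)); last by field; rewrite gt_eqF.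
  have e5 (A B : R) : A != 0 -> (M * A)^-1 * (B * A) = B / M.
    by move=> A0; field; rewrite A0 gt_eqF.
  by rewrite [(2 * _) ^+ n]exprMn e5// gt_eqF.
- by move=> x; exact: expR_ge0.
Qed.

End kern.

End laplace_kernel.

(** * Smoothing a law by the Laplace kernel *)

Section smoothing.
Context {R : realType} {n : nat}.
Local Notation V := 'rV[R]_n.
Local Notation L := (@lebesgue_rV R n).
Local Notation E i := (delta_mx ord0 i : V).

Lemma integral_density (p : P2 R n) rho (h : V -> \bar R) : is_density p rho ->
  measurable_fun setT h -> (forall x, (0 <= h x)%E) ->
  (\int[p]_x h x = \int[L]_x (h x * (rho x)%:E))%E.
Proof.
move=> [mr r0 pE] mh h0; rewrite -(integral_weighted L mr r0 mh h0).
by apply: eq_measure_integral => A mA _; exact: pE.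
Qed.

Lemma integral_density1 (p : P2 R n) rho : is_density p rho ->
  (\int[L]_x (rho x)%:E = 1)%E.
Proof. by move=> [_ _ pE]; rewrite -pE// probability_setT. Qed.

Lemma integrable_density (p : P2 R n) rho : is_density p rho ->
  L.-integrable setT (EFin \o rho).
Proof.
move=> pr; have := integral_density1 pr; case: pr => mr r0 _ I.
apply/integrableP; split; first exact/measurable_EFinP.
rewrite (eq_integral (EFin \o rho)) ?I ?ltry// => x _.
by rewrite gee0_abs// lee_fin.
Qed.

Variable p : probability V R.

Lemma integral_probability_gt0 (h : V -> R) : measurable_fun setT h ->
  (forall x, 0 < h x) -> (0 < \int[p]_x (h x)%:E)%E.
Proof.
move=> mh h0; rewrite lt0e integral_ge0 ?andbT; last by move=> x _; rewrite lee_fin ltW.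
apply/eqP => I0.
have mh' : measurable_fun setT (EFin \o h) by exact/measurable_EFinP.
have /(ae_eq_integral_abs p measurableT mh').1 : (\int[p]_x `|(h x)%:E| = 0)%E.
  by rewrite -[RHS]I0; apply: eq_integral => x _; rewrite gee0_abs// lee_fin ltW.
move=> [A [mA A0 hA]].
have : p setT = 0%E.
  apply/eqP; rewrite eq_le measure_ge0 andbT -A0 le_measure ?inE//.
  apply: subset_trans hA => x _ /= /(_ I) [] hx; by move: (h0 x); rewrite hx ltxx.
by move/eqP; rewrite probability_setT onee_eq0.
Qed.

Variable M : R.
Hypothesis M0 : 0 < M.

Definition smooth (x : V) : R := fine (\int[p]_y (kern M (x - y))%:E).

Let C : R := ((lap_mass / M) ^+ n)^-1.

Lemma measurable_kernB : measurable_fun setT (fun z : V * V => kern M (z.1 - z.2)).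
Proof.
apply: (measurableT_comp (measurable_kern M)); apply: measurable_rVD.
  exact: measurable_fst.
rewrite (_ : (fun x : V * V => - x.2) = (fun x => (-1) *: x.2)).
  by apply: measurable_rVZ => //; exact: measurable_snd.
by apply/funext => x; rewrite scaleN1r.
Qed.

Let mkx (x : V) : measurable_fun setT (fun y : V => kern M (x - y)).
Proof.
apply: (@measurableT_comp _ _ _ _ _ _ (kern M) _ (fun y : V => x - y)).
  exact: measurable_kern.
rewrite (_ : (fun y : V => x - y) = (fun y => x + (-1) *: y)).
  by apply: measurable_rVD => //; exact: measurable_rVZ.
by apply/funext => y; rewrite scaleN1r.
Qed.

Let esm_le x : (\int[p]_y (kern M (x - y))%:E <= C%:E)%E.
Proof.
apply: (@le_trans _ _ (\int[p]_y C%:E)%E); last first.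
  by rewrite integral_cst//= probability_setT mule1.
apply: ge0_le_integral => //.
- by move=> y _; rewrite lee_fin ltW// kern_gt0.
- exact/measurable_EFinP.
- by move=> y _; rewrite lee_fin kern_le.
Qed.

Lemma smoothE x : (smooth x)%:E = (\int[p]_y (kern M (x - y))%:E)%E.
Proof.
rewrite /smooth fineK// ge0_fin_numE; last by apply: integral_ge0 => y _; rewrite lee_fin ltW// kern_gt0.
by rewrite (le_lt_trans (esm_le x))// ltry.
Qed.

Lemma smooth_gt0 x : 0 < smooth x.
Proof.
rewrite -lte_fin smoothE; apply: (integral_probability_gt0 (h := fun y => kern M (x - y))) => //.
by move=> y; exact: kern_gt0.
Qed.

Lemma smooth_le x : smooth x <= C.
Proof. by rewrite -lee_fin smoothE; exact: esm_le. Qed.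

Lemma measurable_smooth : measurable_fun setT smooth.
Proof.
apply/measurable_EFinP; rewrite (_ : EFin \o smooth = fun x => \int[p]_y (kern M (x - y))%:E)%E.
  apply: (@measurable_fun_fubini_tonelli_F _ _ _ _ _ p (fun z : V * V => (kern M (z.1 - z.2))%:E)).
    by apply/measurable_EFinP; exact: measurable_kernB.
  by move=> z; rewrite lee_fin ltW// kern_gt0.
by apply/funext => x /=; rewrite smoothE.
Qed.

Lemma smooth_line x i (t : R) : smooth (x + t *: E i) <= expR (M * `|t|) * smooth x.
Proof.
rewrite -lee_fin EFinM !smoothE -ge0_integral_mull ?expR_ge0//; last first.
  by move=> y; rewrite ltW// kern_gt0.
apply: ge0_le_integral => //.
- by move=> y _; rewrite lee_fin ltW// kern_gt0.
- exact/measurable_EFinP.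
- by apply/measurable_EFinP; exact: measurable_funM.
- by move=> y _; rewrite lee_fin addrAC kern_line.
Qed.

(** The regularity is inherited from the kernel, so it holds for every law. *)
Lemma loglip_smooth : loglip M smooth.
Proof.
split; [exact: ltW | exact: measurable_smooth | exact: smooth_gt0 |].
by move=> i x t; exact: smooth_line.
Qed.

(** [smooth p M] is the density of y + u, with y of law [p] and u independent of y with density
    [kern M]. *)
Lemma integral_smooth (F : V -> \bar R) : measurable_fun setT F -> (forall x, (0 <= F x)%E) ->
  (\int[L]_x ((smooth x)%:E * F x) =
   \int[p]_y \int[L]_u ((kern M u)%:E * F (y + u)%R))%E.
Proof.
move=> mF F0.
have k0 x : (0 <= (kern M x)%:E :> \bar R)%E by rewrite lee_fin ltW// kern_gt0.
pose H (z : V * V) := ((kern M (z.1 - z.2))%:E * F z.1)%E.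
have mH : measurable_fun setT H.
  apply: emeasurable_funM; first by apply/measurable_EFinP; exact: measurable_kernB.
  exact: (measurableT_comp mF measurable_fst).
transitivity (\int[L]_x \int[p]_y H (x, y))%E.
  apply: eq_integral => x _; rewrite smoothE muleC -ge0_integralZl//.
    by apply: eq_integral => y _; rewrite /H muleC.
  exact/measurable_EFinP.
rewrite (@fubini_tonelli _ _ _ _ _ L p H mH); last by move=> z; rewrite mule_ge0.
apply: eq_integral => y _.
rewrite -[LHS](ge0_integral_shift y); last 2 first.
- apply: emeasurable_funM => //; apply/measurable_EFinP.
  exact: (measurableT_comp (measurable_kern M) (measurable_shift_rV (- y))).
- by move=> x; rewrite mule_ge0.
by apply: eq_integral => x _; rewrite /H /= addrK addrC.
Qed.

Lemma integral_smooth1 : (\int[L]_x (smooth x)%:E = 1)%E.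
Proof.
have := @integral_smooth (cst 1%E) (measurable_cst _) (fun=> lee01).
under eq_integral do rewrite mule1.
move=> ->; under eq_integral do under eq_integral do rewrite mule1.
under eq_integral do rewrite integral_kern//.
by rewrite integral_cst//= probability_setT mule1.
Qed.

Lemma integral_smooth_l1 : (\int[L]_x (smooth x * l1norm x)%:E <=
  \int[p]_x (l1norm x)%:E + (2 ^+ n / M)%:E)%E.
Proof.
have ml : measurable_fun setT (fun x : V => (l1norm x)%:E : \bar R).
  by apply/measurable_EFinP; exact: measurable_l1norm.
have l0 (x : V) : (0 <= (l1norm x)%:E :> \bar R)%E by rewrite lee_fin l1norm_ge0.
under eq_integral do rewrite EFinM.
rewrite integral_smooth//.
have k0 (x : V) : (0 <= (kern M x)%:E :> \bar R)%E by rewrite lee_fin ltW// kern_gt0.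
have mk : measurable_fun setT (fun x : V => (kern M x)%:E : \bar R).
  by apply/measurable_EFinP; exact: measurable_kern.
apply: (@le_trans _ _ (\int[p]_y ((l1norm y)%:E + (2 ^+ n / M)%:E))%E).
  have mkl : measurable_fun setT (fun z : V * V => (kern M z.2)%:E * (l1norm (z.1 + z.2))%:E)%E.
    apply: emeasurable_funM; first exact: (measurableT_comp mk measurable_snd).
    apply: (measurableT_comp ml); apply: measurable_rVD; [exact: measurable_fst|exact: measurable_snd].
  apply: ge0_le_integral => //.
  - by move=> y _; apply: integral_ge0 => u _; rewrite mule_ge0.
  - apply: (@measurable_fun_fubini_tonelli_F _ _ _ _ _ L
      (fun z : V * V => (kern M z.2)%:E * (l1norm (z.1 + z.2))%:E)%E) => // z.
    by rewrite mule_ge0.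
  - exact: emeasurable_funD.
  - move=> y _.
    apply: (@le_trans _ _ (\int[L]_u ((l1norm y)%:E * (kern M u)%:E + (kern M u * l1norm u)%:E))%E).
      apply: ge0_le_integral => //.
      + by move=> u _; rewrite mule_ge0.
      + apply: emeasurable_funM => //; apply: (measurableT_comp ml).
        exact: measurable_rVD.
      + apply: emeasurable_funD; first exact: measurable_funeM.
        by under eq_fun do rewrite EFinM; exact: emeasurable_funM.
      + move=> u _; rewrite -!EFinM -EFinD lee_fin (mulrC (l1norm y)) -mulrDr.
        by rewrite ler_wpM2l ?l1normD// ltW// kern_gt0.
    rewrite ge0_integralD//; last 4 first.
    + by move=> u _; rewrite mule_ge0.
    + exact: measurable_funeM.
    + by move=> u _; rewrite EFinM mule_ge0.
    + by under eq_fun do rewrite EFinM; exact: emeasurable_funM.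
    rewrite ge0_integralZl// integral_kern// mule1 leeD2l//.
    exact: integral_kern_l1.
rewrite ge0_integralD//.
- by rewrite integral_cst//= probability_setT mule1.
- by move=> y _; rewrite lee_fin divr_ge0 ?exprn_ge0// ltW.
Qed.

End smoothing.

(** * Smoothing a density of finite Fisher information *)

Section smoothing_regularity.
Context {R : realType} {n : nat}.
Local Notation mu := (@lebesgue_measure R).
Local Notation V := 'rV[R]_n.
Local Notation L := (@lebesgue_rV R n).
Local Notation E i := (delta_mx ord0 i : V).

Variables (p : P2 R n) (rho : V -> R) (M : R).
Hypotheses (pr : is_density p rho) (M0 : 0 < M).

Let mrho : measurable_fun setT rho. Proof. by case: pr. Qed.
Let rho0 x : 0 <= rho x. Proof. by case: pr. Qed.
Let irho := integrable_density pr.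
Let mk := measurable_kern (n := n) M.
Let k0 (x : V) : 0 <= kern M x. Proof. exact/ltW/kern_gt0. Qed.
Let C : R := ((lap_mass / M) ^+ n)^-1.

Lemma measurable_kernBl (x : V) : measurable_fun setT (fun y : V => kern M (x - y)).
Proof.
rewrite (_ : (fun y : V => kern M (x - y)) = (fun y => kern M (y - x))).
  exact: (measurableT_comp mk (measurable_shift_rV (- x))).
by apply/funext => y; rewrite -kernN opprB.
Qed.

Let kb (x y : V) : `|kern M (x - y)| <= C.
Proof. by rewrite ger0_norm// kern_le. Qed.

Lemma smooth_density x : (smooth p M x)%:E = (\int[L]_y (rho y * kern M (x - y))%:E)%E.
Proof.
rewrite smoothE// (integral_density pr).
- by apply: eq_integral => y _; rewrite -EFinM mulrC.
- by apply/measurable_EFinP; exact: measurable_kernBl.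
- by move=> y; rewrite lee_fin.
Qed.

Variable f : V -> R.
Hypotheses (lf : loglip M f)
  (fE : forall x, (f x)%:E = (\int[L]_y (rho y * kern M (x - y))%:E)%E).

Let mf : measurable_fun setT f. Proof. by case: lf. Qed.
Let f_gt0 x : 0 < f x. Proof. by case: lf. Qed.
Let f_ge0 x : 0 <= f x. Proof. exact: ltW. Qed.
Let f_line i x t : f (x + t *: E i) <= expR (M * `|t|) * f x. Proof. by case: lf. Qed.


Lemma convol_shift (h : V -> R) (v x : V) : measurable_fun setT h -> (forall x, 0 <= h x) ->
  (\int[L]_y (h (y + v) * kern M (x - y))%:E = \int[L]_y (h y * kern M (x + v - y))%:E)%E.
Proof.
move=> mh h0; rewrite -[RHS](ge0_integral_shift v).
- by apply: eq_integral => y _; rewrite opprD addrACA subrr addr0.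
- by apply/measurable_EFinP; apply: measurable_funM => //; exact: measurable_kernBl.
- by move=> y; rewrite lee_fin mulr_ge0.
Qed.

Definition convol (h : V -> R) (x : V) : \bar R := (\int[L]_y (h y * kern M (x - y))%:E)%E.

Lemma measurable_convol (h : V -> R) : measurable_fun setT h -> (forall x, 0 <= h x) ->
  measurable_fun setT (convol h).
Proof.
move=> mh h0.
apply: (@measurable_fun_fubini_tonelli_F _ _ _ _ _ L
  (fun z : V * V => (h z.2 * kern M (z.1 - z.2))%:E)) => [|z]; last by rewrite lee_fin mulr_ge0.
apply/measurable_EFinP; apply: measurable_funM; first exact: (measurableT_comp mh measurable_snd).
exact: measurable_kernB.
Qed.

Lemma convol_ge0 (h : V -> R) x : (forall x, 0 <= h x) -> (0 <= convol h x)%E.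
Proof. by move=> h0; apply: integral_ge0 => y _; rewrite lee_fin mulr_ge0. Qed.

Lemma integral_convol (h : V -> R) : measurable_fun setT h -> (forall x, 0 <= h x) ->
  (\int[L]_x convol h x = \int[L]_x (h x)%:E)%E.
Proof.
move=> mh h0.
rewrite (@fubini_tonelli _ _ _ _ _ L L (fun z : V * V => (h z.2 * kern M (z.1 - z.2))%:E)); first last.
- by move=> z; rewrite lee_fin mulr_ge0.
- apply/measurable_EFinP; apply: measurable_funM; first exact: (measurableT_comp mh measurable_snd).
  exact: measurable_kernB.
apply: eq_integral => y _ /=.
have mky : measurable_fun setT (fun x : V => kern M (x - y)).
  exact: (measurableT_comp mk (measurable_shift_rV (- y))).
rewrite (ge0_integral_mull _ mky) //.
rewrite (ge0_integral_shift (- y) (f := fun x => (kern M x)%:E)) ?integral_kern ?mule1//.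
- exact/measurable_EFinP.
Qed.

Section direction.
Variables (g : V -> R) (i : 'I_n) (J : R).
Hypotheses (ig : L.-integrable setT (EFin \o g))
  (wg : forall k a b,
      (\int[L]_x (rho x * partial i (plateaux k a b) x)%:E =
       - \int[L]_x (g x * plateaux k a b x)%:E)%E)
  (vg : forall x, rho x = 0 -> g x = 0)
  (gJ : (\int[L]_x (g x ^+ 2 / rho x)%:E <= J%:E)%E).

Let mg : measurable_fun setT g.
Proof. by case/integrableP : ig => /measurable_EFinP. Qed.
Let ag x := `|g x|.
Let mag : measurable_fun setT ag. Proof. exact: measurableT_comp. Qed.
Let ag0 x : 0 <= ag x. Proof. exact: normr_ge0. Qed.
Let q x := g x ^+ 2 / rho x.
Let mq : measurable_fun setT q.
Proof. by apply: measurable_funM; [exact: measurable_funX | exact: measurable_fun_inv]. Qed.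
Let q0 x : 0 <= q x. Proof. by rewrite divr_ge0 ?sqr_ge0. Qed.
Let k x : R := fine (convol ag x).

Let kE x : (k x)%:E = convol ag x.
Proof.
rewrite /k fineK// ge0_fin_numE; last exact: convol_ge0.
have igk : L.-integrable setT (fun y => (g y * kern M (x - y))%:E).
  exact: (integrable_mul_bounded ig (measurable_kernBl x) (kb x)).
case/integrableP : igk => _; rewrite /convol; congr (_ < _)%E.
by apply: eq_integral => y _; congr EFin; rewrite normrM; congr (_ * _); rewrite ger0_norm.
Qed.

Let mkk : measurable_fun setT k.
Proof.
by apply: (measurableT_comp (fine_measurable measurableT)) => //; exact: measurable_convol.
Qed.

Let kk0 x : 0 <= k x. Proof. by rewrite -lee_fin kE convol_ge0. Qed.

(** Convolution does not increase the Fisher information, in pointwise form: Cauchy-Schwarz against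
    the kernel, with [vg] for the points where [rho] vanishes. *)
Let k_sqr x : ((k x ^+ 2 / f x)%:E <= convol q x)%E.
Proof.
have H := @sqr_div_le_integral _ _ _ L (fun y => ag y * kern M (x - y))
  (fun y => rho y * kern M (x - y)) (k x) (f x).
have mkx := measurable_kernBl x.
rewrite /convol (eq_integral (fun y => ((ag y * kern M (x - y)) ^+ 2 / (rho y * kern M (x - y)))%:E)).
  apply: H.
  - exact: measurable_funM.
  - exact: measurable_funM.
  - by move=> y; rewrite mulr_ge0.
  - by move=> y; rewrite mulr_ge0.
  - move=> y /eqP; rewrite mulf_eq0 (gt_eqF (kern_gt0 M0 _)) orbF => /eqP ry.
    by rewrite /ag vg// normr0 mul0r.
  - exact: f_gt0.
  - by rewrite fE.
  - by rewrite ger0_norm// kE.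
move=> y _; congr EFin; rewrite /q /ag.
have kn : kern M (x - y) != 0 by rewrite gt_eqF// kern_gt0.
have [ry|ry] := eqVneq (rho y) 0; first by rewrite ry vg// !(mul0r, invr0, mulr0).
by rewrite exprMn real_normK ?num_real//; field; rewrite kn.
Qed.

Lemma smooth_increment t z : 0 <= t ->
  (`|f (z + t *: E i) - f z|%:E <= \int[mu]_s (k (z + s *: E i) * \1_`[0%R, t] s)%:E)%E.
Proof.
move=> t0.
have mkz := measurable_kernBl z.
have mrs : measurable_fun setT (fun y : V => rho (y + t *: E i)).
  by apply: (measurableT_comp mrho); exact: measurable_shift_rV.
have e1 : (f (z + t *: E i) - f z)%:E =
    (\int[L]_y ((rho (y + t *: E i) - rho y) * kern M (z - y))%:E)%E.
  have i1 := integrable_mul_bounded (integrable_shift_rV (t *: E i) irho) mkz (kb z).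
  have i2 := integrable_mul_bounded irho mkz (kb z).
  rewrite EFinB !fE -(convol_shift _ _ mrho rho0) -(integralB measurableT i1 i2).
  by apply: eq_integral => y _; rewrite -EFinB mulrBl.
have F : (L \x mu)%E.-integrable setT
    (fun w => (g (w.1 + w.2 *: E i) * kern M (z - w.1) * \1_`[0, t] w.2)%:E).
  apply: (@integrable_line_product _ _ t (fine (\int[L]_x `|(g x)%:E|)) C
    (fun w : V * R => g (w.1 + w.2 *: E i)) (fun w : V * R => kern M (z - w.1))) => //.
  - by apply: (measurableT_comp mg); exact: measurable_line.
  - exact: (measurableT_comp mkz measurable_fst).
  - move=> s; rewrite (integral_shift_rV (s *: E i) (f := fun x => `|(g x)%:E|%E)).
      rewrite fineK// ge0_fin_numE; last exact: integral_ge0.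
      by case/integrableP : ig.
    by apply: measurableT_comp => //; exact/measurable_EFinP.
rewrite -[`|_|%:E]/(`|(_)%:E|)%E e1 (increment_test irho ig wg t0 mkz (kb z)).
apply: le_trans (le_abse_integral _ _ _) _ => //; first exact: (measurable_fubini_G F).
apply: ge0_le_integral => //.
- by apply: measurableT_comp => //; exact: (measurable_fubini_G F).
- apply/measurable_EFinP; apply: measurable_funM; last exact: measurable_indic.
  by apply: (measurableT_comp mkk); exact: measurable_on_line.
move=> s _.
have ms : measurable_fun setT (fun y : V => g (y + s *: E i)).
  by apply: (measurableT_comp mg); exact: measurable_shift_rV.
apply: le_trans (le_abse_integral _ _ _) _ => //.
  by apply/measurable_EFinP; apply: measurable_funM => //; exact: measurable_funM.
rewrite EFinM kE /convol -(convol_shift _ _ mag ag0) muleC.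
have mas : measurable_fun setT (fun y : V => ag (y + s *: E i) * kern M (z - y)).
  by apply: measurable_funM => //; apply: (measurableT_comp mag); exact: measurable_shift_rV.
rewrite -(ge0_integral_mull _ mas)//; last by move=> y; rewrite mulr_ge0.
rewrite (eq_integral (fun y : V => (\1_`[0, t] s * (ag (y + s *: E i) * kern M (z - y)))%:E))//.
move=> y _ /=; congr EFin.
rewrite normrM (normrM (g (y + s *: E i))) mulrC; congr (_ * (_ * _)).
  by rewrite ger0_norm.
by rewrite ger0_norm.
Qed.

Let W t x := (\int[mu]_s (convol q (x + s *: E i) * (\1_`[0%R, t] s)%:E))%E.

Let mcq : measurable_fun setT (convol q). Proof. exact: measurable_convol. Qed.
Let cq0 x : (0 <= convol q x)%E. Proof. exact: convol_ge0. Qed.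

Let mI t : measurable_fun setT (fun s : R => (\1_`[0%R, t] s)%:E : \bar R).
Proof. by apply/measurable_EFinP; exact: measurable_indic. Qed.

Let I0 t (s : R) : (0 <= (\1_`[0%R, t] s)%:E :> \bar R)%E. Proof. by rewrite lee_fin. Qed.

Let m2 t : measurable_fun setT
  (fun z : V * R => (convol q (z.1 + z.2 *: E i)%R * (\1_`[0%R, t] z.2)%:E)%E).
Proof.
apply: emeasurable_funM; first by apply: (measurableT_comp mcq); exact: measurable_line.
by apply: (measurableT_comp (mI t)); exact: measurable_snd.
Qed.

Let mW t : measurable_fun setT (W t).
Proof.
apply: (@measurable_fun_fubini_tonelli_F _ _ _ _ _ mu
  (fun z : V * R => (convol q (z.1 + z.2 *: E i)%R * (\1_`[0%R, t] z.2)%:E)%E) (m2 t)) => z.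
by rewrite mule_ge0.
Qed.

Let integral_W t : 0 <= t -> (\int[L]_x W t x <= (t * J)%:E)%E.
Proof.
move=> t0; rewrite (@fubini_tonelli _ _ _ _ _ L mu
  (fun z : V * R => (convol q (z.1 + z.2 *: E i)%R * (\1_`[0%R, t] z.2)%:E)%E) (m2 t)); last first.
  by move=> z; rewrite mule_ge0.
have -> : (\int[mu]_s \int[L]_x (convol q (x + s *: E i)%R * (\1_`[0%R, t] s)%:E) =
    \int[mu]_s ((\int[L]_x (q x)%:E) * (\1_`[0%R, t] s)%:E))%E.
  apply: eq_integral => s _ /=.
  have mcs : measurable_fun setT (fun x : V => convol q (x + s *: E i)).
    by apply: (measurableT_comp mcq); exact: measurable_shift_rV.
  by rewrite ge0_integralZr// (ge0_integral_shift _ mcq cq0) integral_convol.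
rewrite ge0_integralZl//; last 2 first.
- exact: mI.
- by apply: integral_ge0 => x _; rewrite lee_fin.
rewrite integral_indic_segment max_r// muleC EFinM; exact: lee_wpmul2l.
Qed.

(** Cauchy-Schwarz along the segment: the squared increment is at most the integral of k^2 / f times
    that of f, and the latter is at most t exp(M t) f(x) by hypothesis. *)
Let chi2_point t x z : 0 < t ->
  (forall s, 0 <= s <= t -> f (z + s *: E i) <= expR (M * t) * f x) ->
  (((f (z + t *: E i) - f z) ^+ 2 / f x)%:E <= (t * expR (M * t))%:E * W t z)%E.
Proof.
move=> t0 fz.
pose D := f (z + t *: E i) - f z; pose a := t * (expR (M * t) * f x).
have a0 : 0 < a by rewrite /a mulr_gt0// mulr_gt0 ?expR_gt0 ?f_gt0.
pose u s := k (z + s *: E i) * \1_`[0, t] s.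
pose r s := f (z + s *: E i) * \1_`[0, t] s.
have mIr : measurable_fun setT (fun s : R => \1_`[0, t] s : R) by exact: measurable_indic.
have mkz : measurable_fun setT (fun s : R => k (z + s *: E i)).
  by apply: (measurableT_comp mkk); exact: measurable_on_line.
have mfz : measurable_fun setT (fun s : R => f (z + s *: E i)).
  by apply: (measurableT_comp mf); exact: measurable_on_line.
have mu' : measurable_fun setT u by exact: measurable_funM.
have mr : measurable_fun setT r by exact: measurable_funM.
have H : ((D ^+ 2 / a)%:E <= \int[mu]_s (u s ^+ 2 / r s)%:E)%E.
  apply: sqr_div_le_integral => //.
  - by move=> s; rewrite mulr_ge0.
  - by move=> s; apply: mulr_ge0; [exact: f_ge0 | rewrite indicE ler0n].
  - move=> s /eqP; rewrite mulf_eq0 (gt_eqF (f_gt0 _))/= => /eqP h.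
    by rewrite /u h mulr0.
  - apply: (@le_trans _ _ (\int[mu]_s (expR (M * t) * f x * \1_`[0, t] s)%:E)%E).
      apply: ge0_le_integral => //.
      + by move=> s _; rewrite lee_fin mulr_ge0// ltW// smooth_gt0.
      + exact/measurable_EFinP.
      + by apply/measurable_EFinP; exact: measurable_funM.
      + move=> s _; rewrite lee_fin /r indicE mem_setE.
        case: (boolP (s \in `[0, t])) => [|_]; last by rewrite !mulr0.
        by rewrite in_itv/= !mulr1; exact: fz.
    have cc0 : 0 <= expR (M * t) * f x by rewrite mulr_ge0 ?expR_ge0 ?f_ge0.
    have II0 (s : R) : 0 <= \1_`[0, t] s :> R by rewrite indicE ler0n.
    rewrite (ge0_integral_mull mu mIr II0 cc0).
    by rewrite integral_indic_segment (max_r (ltW t0)) -EFinM lee_fin mulrC.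
  - exact: (smooth_increment _ (ltW t0)).
have -> : (f (z + t *: E i) - f z) ^+ 2 / f x = (t * expR (M * t)) * (D ^+ 2 / a).
  by rewrite /a /D; field; rewrite !gt_eqF ?expR_gt0 ?f_gt0.
rewrite EFinM; apply: lee_wpmul2l; first by rewrite lee_fin mulr_ge0 ?expR_ge0// ltW.
apply: (le_trans H); apply: ge0_le_integral => //.
- move=> s _; rewrite lee_fin; apply: divr_ge0; first exact: sqr_ge0.
  by apply: mulr_ge0; [exact: f_ge0 | rewrite indicE ler0n].
- apply/measurable_EFinP; apply: measurable_funM; first exact: measurable_funX.
  exact: measurable_fun_inv.
- apply: emeasurable_funM; last exact: mI.
  by apply: (measurableT_comp mcq); exact: measurable_on_line.
- move=> s _; rewrite /u /r indicE; case: (_ \in _) => /=.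
    by rewrite !mulr1 mule1; exact: k_sqr.
  by rewrite !mulr0 expr0n mul0r mule0.
Qed.

Lemma smooth_chi2 t : (\int[L]_x ((f (x + t *: E i) - f x) ^+ 2 / f x)%:E <=
  (t ^+ 2 * expR (M * `|t|) * J)%:E)%E.
Proof.
have m1 : measurable_fun setT (fun x : V => (f (x + t *: E i) - f x) ^+ 2 / f x).
  apply: measurable_funM; last exact: measurable_fun_inv.
  apply: measurable_funX; apply: measurable_funB => //.
  by apply: (measurableT_comp mf); exact: measurable_shift_rV.
have nn x : 0 <= (f (x + t *: E i) - f x) ^+ 2 / f x.
  by apply: divr_ge0; [exact: sqr_ge0 | exact: f_ge0].
have [->|tn0] := eqVneq t 0.
  rewrite integral0_eq ?expr0n/= ?mul0r// => x _.
  by rewrite scale0r addr0 subrr expr0n mul0r.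
(* For negative [t] the segment is run forward from its other end x + t e_i, as increments are
   controlled for nonnegative lengths. *)
pose v : V := if 0 <= t then 0 else t *: E i.
have nt0 : 0 < `|t| by rewrite normr_gt0.
have c0 : 0 <= `|t| * expR (M * `|t|) by rewrite mulr_ge0 ?expR_ge0.
have W0 x : (0 <= W `|t| x)%E by apply: integral_ge0 => s _; rewrite mule_ge0.
have mWv : measurable_fun setT (fun x : V => W `|t| (x + v)).
  by apply: (measurableT_comp (mW `|t|)); exact: measurable_shift_rV.
apply: (@le_trans _ _ (\int[L]_x ((`|t| * expR (M * `|t|))%:E * W `|t| (x + v)%R))%E).
  apply: ge0_le_integral => //.
  - by move=> x _; rewrite lee_fin.
  - exact/measurable_EFinP.
  - exact: measurable_funeM.
  - move=> x _.
    have [h1 h2] : (f (x + t *: E i) - f x) ^+ 2 = (f (x + v + `|t| *: E i) - f (x + v)) ^+ 2 /\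
      (forall s, 0 <= s <= `|t| -> f (x + v + s *: E i) <= expR (M * `|t|) * f x).
      rewrite /v; case: (leP 0 t) => [t0|t0].
        rewrite addr0 ger0_norm//; split => // s /andP[s0 st].
        apply: (le_trans (f_line _ _ _)); rewrite ger0_norm// ler_wpM2r//.
        by rewrite ler_expR ler_wpM2l// ltW.
      rewrite ltr0_norm// -addrA -scalerDl subrr scale0r addr0; split; first by rewrite -sqrrN opprB.
      move=> s /andP[s0 st]; rewrite -addrA -scalerDl.
      apply: (le_trans (f_line _ _ _)); rewrite ler_wpM2r//.
      rewrite ler_expR; apply: ler_wpM2l; first exact: ltW.
      by rewrite ler_norml; apply/andP; split; lra.
    by rewrite h1; exact: chi2_point.
rewrite ge0_integralZl//.
rewrite (ge0_integral_shift v (mW `|t|) W0).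
apply: (@le_trans _ _ ((`|t| * expR (M * `|t|))%:E * (`|t| * J)%:E)%E).
  by apply: lee_wpmul2l; [rewrite lee_fin | exact: integral_W].
rewrite -EFinM lee_fin -[in leRHS]real_normK ?num_real// le_eqVlt; apply/orP; left; apply/eqP.
ring.
Qed.

End direction.

Section L1.
Variables (G : V -> V) (C1 : R).
Hypotheses (wG : plateau_gradient rho G)
  (C1G : forall i, (\int[L]_x `|(G x ord0 i)%:E| <= C1%:E)%E).

Let step (v : V) : measurable_fun setT (fun x : V => `|rho (x + v) - rho x|).
Proof.
apply: measurableT_comp => //; apply: measurable_funB => //.
by apply: (measurableT_comp mrho); exact: measurable_shift_rV.
Qed.

Let dist (v : V) := (\int[L]_x `|rho (x + v) - rho x|%:E)%E.

Let distD (v w : V) : (dist (v + w) <= dist v + dist w)%E.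
Proof.
have m1 (u : V) : measurable_fun setT (fun x : V => `|rho (x + u) - rho x|%:E : \bar R).
  exact/measurable_EFinP.
have n0 (u x : V) : (0 <= `|rho (x + u) - rho x|%:E :> \bar R)%E by rewrite lee_fin.
rewrite /dist -[in leRHS](ge0_integral_shift w (m1 v) (n0 v)).
have mw : measurable_fun setT (fun x : V => `|rho (x + w + v) - rho (x + w)|%:E : \bar R).
  by apply: (measurableT_comp (m1 v)); exact: measurable_shift_rV.
rewrite -(ge0_integralD L measurableT (fun x _ => n0 v (x + w)) mw (fun x _ => n0 w x) (m1 w)).
apply: ge0_le_integral => //; first exact: emeasurable_funD.
move=> x _; rewrite -EFinD lee_fin.
have -> : rho (x + (v + w)) - rho x = rho (x + w + v) - rho (x + w) + (rho (x + w) - rho x).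
  by rewrite [v + w]addrC addrA; ring.
exact: ler_normD.
Qed.

Let dist_line i t : (dist (t *: E i) <= (`|t| * C1)%:E)%E.
Proof.
have [ig wg] := wG i.
have K s : 0 <= s -> (dist (s *: E i) <= (s * C1)%:E)%E.
  move=> s0; apply: le_trans (increment_L1 irho ig wg s0) _; rewrite EFinM.
  by apply: lee_wpmul2l; [rewrite lee_fin | exact: C1G].
have [t0|t0] := leP 0 t; first by rewrite ger0_norm//; exact: K.
rewrite ltr0_norm//; apply: le_trans (K _ _); last by rewrite oppr_ge0 ltW.
rewrite /dist -[leRHS](ge0_integral_shift (t *: E i)).
- apply: ge0_le_integral => //.
  + exact/measurable_EFinP.
  + have m1 : measurable_fun setT (fun x : V => `|rho (x + (- t) *: E i) - rho x|%:E : \bar R).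
      exact/measurable_EFinP.
    by apply: (measurableT_comp m1); exact: measurable_shift_rV.
  + by move=> x _; rewrite lee_fin -addrA -scalerDl subrr scale0r addr0 distrC.
- exact/measurable_EFinP.
- by move=> x; rewrite lee_fin.
Qed.

(** The L^1 distance to a translate is subadditive in the translation, so the coordinates are
    shifted one at a time. *)
Lemma translation_L1 (v : V) : (dist v <= (l1norm v * C1)%:E)%E.
Proof.
suff H (s : seq 'I_n) : (dist (\sum_(i <- s) v ord0 i *: E i) <=
    ((\sum_(i <- s) `|v ord0 i|) * C1)%:E)%E.
  have := H (index_enum 'I_n); congr (dist _ <= _)%E.
  rewrite [RHS]matrix_sum_delta big_ord1.
  by apply: eq_bigr.
elim: s => [|i s IH].
  rewrite !big_nil mul0r /dist integral0_eq// => x _.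
  by rewrite addr0 subrr normr0.
rewrite !big_cons mulrDl EFinD; apply: le_trans (distD _ _) _; apply: leeD => //.
Qed.

(** The error is at most the mean of the L^1 translation errors over the kernel, whose mean l1 norm
    is at most 2^n / M. *)
Lemma smooth_L1 : 0 <= C1 -> (\int[L]_x `|f x - rho x|%:E <= (2 ^+ n / M * C1)%:E)%E.
Proof.
move=> C10.
have fE' x : (f x)%:E = (\int[L]_u (rho (x + u) * kern M u)%:E)%E.
  rewrite fE -(ge0_integral_shift x); last 2 first.
  - by apply/measurable_EFinP; apply: measurable_funM => //; exact: measurable_kernBl.
  - by move=> y; rewrite lee_fin mulr_ge0.
  by apply: eq_integral => u _; rewrite opprD addrCA subrr addr0 kernN [u + x]addrC.
have mz : measurable_fun setT (fun z : V * V => `|rho (z.1 + z.2) - rho z.1| * kern M z.2).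
  apply: measurable_funM; last exact: (measurableT_comp mk measurable_snd).
  apply: measurableT_comp => //; apply: measurable_funB.
    apply: (measurableT_comp mrho); apply: measurable_rVD; [exact: measurable_fst|exact: measurable_snd].
  exact: (measurableT_comp mrho measurable_fst).
apply: (@le_trans _ _ (\int[L]_x \int[L]_u (`|rho (x + u) - rho x| * kern M u)%:E)%E).
  apply: ge0_le_integral => //.
  - by apply/measurable_EFinP; apply: measurableT_comp => //; exact: measurable_funB.
  - apply: (@measurable_fun_fubini_tonelli_F _ _ _ _ _ L
      (fun z : V * V => (`|rho (z.1 + z.2) - rho z.1| * kern M z.2)%:E)) => [|z].
      exact/measurable_EFinP.
    by rewrite lee_fin mulr_ge0.
  - move=> x _.
    have ib : L.-integrable setT (fun u => (rho (x + u) * kern M u)%:E).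
      apply: (integrable_mul_bounded (u := fun u => rho (x + u)) (B := C)).
      + have := integrable_shift_rV x irho; congr (L.-integrable _ _).
        by apply/funext => u /=; rewrite addrC.
      + exact: mk.
      + by move=> u; rewrite ger0_norm// kern_le.
    have ik : L.-integrable setT (fun u => (rho x * kern M u)%:E).
      under eq_fun do rewrite EFinM; apply: integrableZl => //.
      apply/integrableP; split; first exact/measurable_EFinP.
      rewrite (eq_integral (fun u => (kern M u)%:E)) ?integral_kern ?ltry// => u _.
      by rewrite gee0_abs// lee_fin.
    rewrite -[`|_|%:E]/(`|(_)%:E|)%E.
    have -> : (f x - rho x)%:E = (\int[L]_u ((rho (x + u) - rho x) * kern M u)%:E)%E.
      rewrite (eq_integral (fun u => (rho (x + u) * kern M u)%:E - (rho x * kern M u)%:E)%E).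
        rewrite (integralB measurableT ib ik) -fE' (ge0_integral_mull _ mk)//.
        by rewrite integral_kern// mule1.
      by move=> u _; rewrite -EFinB mulrBl.
    apply: le_trans (le_abse_integral _ _ _) _ => //.
      apply/measurable_EFinP; apply: measurable_funM => //; apply: measurable_funB => //.
      by apply: (measurableT_comp mrho); exact: measurable_rVD.
    rewrite (eq_integral (fun u => (`|rho (x + u) - rho x| * kern M u)%:E))//.
    by move=> u _ /=; rewrite normrM [X in _ * X]ger0_norm.
rewrite (@fubini_tonelli _ _ _ _ _ L L
  (fun z : V * V => (`|rho (z.1 + z.2) - rho z.1| * kern M z.2)%:E)); first last.
- by move=> z; rewrite lee_fin mulr_ge0.
- exact/measurable_EFinP.
apply: (@le_trans _ _ (\int[L]_u (C1 * (kern M u * l1norm u))%:E)%E).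
  apply: ge0_le_integral => //.
  - by move=> u _; apply: integral_ge0 => x _; rewrite lee_fin mulr_ge0.
  - apply: (@measurable_fun_fubini_tonelli_G _ _ _ _ _ L
      (fun z : V * V => (`|rho (z.1 + z.2) - rho z.1| * kern M z.2)%:E)) => [|z].
      exact/measurable_EFinP.
    by rewrite lee_fin mulr_ge0.
  - apply/measurable_EFinP; apply: measurable_funM => //; apply: measurable_funM => //.
    exact: measurable_l1norm.
  - move=> u _ /=; under eq_integral do rewrite mulrC.
    rewrite (ge0_integral_mull _ (step u))//.
    apply: le_trans (lee_wpmul2l _ (translation_L1 u)) _; first by rewrite lee_fin.
    by rewrite -EFinM lee_fin le_eqVlt; apply/orP; left; apply/eqP; ring.
rewrite ge0_integral_mull//; last 2 first.
- by apply: measurable_funM => //; exact: measurable_l1norm.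
- by move=> u; rewrite mulr_ge0// l1norm_ge0.
rewrite mulrC EFinM; apply: lee_wpmul2l; first by rewrite lee_fin.
exact: integral_kern_l1.
Qed.

End L1.

End smoothing_regularity.

(** * The HWI inequality for a smoothed first law *)

Section hwi_regular.
Context {R : realType} {n : nat}.
Local Notation mu := (@lebesgue_measure R).
Local Notation V := 'rV[R]_n.
Local Notation L := (@lebesgue_rV R n).
Local Notation E i := (delta_mx ord0 i : V).

(* The relative entropy density of [r] with respect to the finite measure
   [lap 1], which makes every integrand nonnegative. *)
Definition relent (r : R) (x : V) : R := r * ln r + r * l1norm x - r + lap 1 x.

Definition Dent (h : V -> R) : \bar R := \int[L]_x (relent (h x) x)%:E.

Definition Afun (p : P2 R n) : R := fine (\int[p]_x (l1norm x)%:E).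

Definition lapZ : R := (lap_mass / 1) ^+ n.

Lemma relent_ge0 r x : 0 <= r -> 0 <= relent r x.
Proof.
move=> r0; have := entropy_kernel_ge0 r0 (expR_gt0 (- (1 * l1norm x))).
by rewrite expRK /relent /lap mul1r mulrN opprK.
Qed.

Lemma measurable_relent (h : V -> R) : measurable_fun setT h ->
  measurable_fun setT (fun x => relent (h x) x).
Proof.
move=> mh; apply: measurable_funD; last exact: measurable_lap.
apply: measurable_funB => //; apply: measurable_funD; apply: measurable_funM => //.
  exact: measurableT_comp.
exact: measurable_l1norm.
Qed.

Lemma l1norm_sqnorm (x : V) : l1norm x <= n%:R + sqnorm x.
Proof.
rewrite -[n in n%:R]card_ord -sum1_card natr_sum -big_split/=; apply: ler_sum => i _.
have h := sqr_ge0 (`|x ord0 i| - 1); have e := real_normK (num_real (x ord0 i)).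
rewrite -[x ord0 i * _]expr2 -e; move: h (normr_ge0 (x ord0 i)).
by move: `|x ord0 i| => t; rewrite !expr2; nra.
Qed.

Lemma measurable_sqnorm : measurable_fun setT (fun x : V => sqnorm x).
Proof.
by apply: measurable_sum => i; apply: measurable_funM; exact: measurable_coord.
Qed.

Lemma sqnorm_ge0 (x : V) : 0 <= sqnorm x.
Proof. by apply: sumr_ge0 => i _; rewrite -expr2 sqr_ge0. Qed.

Lemma sqnormN (x : V) : sqnorm (- x) = sqnorm x.
Proof. by apply: eq_bigr => i _; rewrite !mxE mulrNN. Qed.

Lemma AfunE (p : P2 R n) : (\int[p]_x (l1norm x)%:E = (Afun p)%:E)%E.
Proof.
rewrite fineK// ge0_fin_numE; last by apply: integral_ge0 => x _; rewrite lee_fin l1norm_ge0.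
apply: (@le_lt_trans _ _ (\int[p]_x (n%:R%:E + (sqnorm x)%:E))%E).
  apply: ge0_le_integral => //.
  - by move=> x _; rewrite lee_fin l1norm_ge0.
  - by apply/measurable_EFinP; exact: measurable_l1norm.
  - by apply: emeasurable_funD => //; apply/measurable_EFinP; exact: measurable_sqnorm.
  - by move=> x _; rewrite -EFinD lee_fin l1norm_sqnorm.
rewrite ge0_integralD//.
- rewrite integral_cst//= probability_setT mule1.
  by rewrite lte_add_pinfty ?ltry//; exact: second_moment.
- by move=> x _; rewrite lee_fin sqnorm_ge0.
- by apply/measurable_EFinP; exact: measurable_sqnorm.
Qed.

Lemma lapZE : (\int[L]_x (lap 1 x)%:E = lapZ%:E)%E.
Proof. exact: integral_lap. Qed.

Lemma integral_coupling1 (p q : P2 R n) pi (h : V -> \bar R) : coupling p q pi ->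
  measurable_fun setT h -> (forall x, 0 <= h x)%E ->
  (\int[pi]_z h z.1 = \int[p]_x h x)%E.
Proof.
move=> cp mh h0.
rewrite -(ge0_integral_pushforward measurable_fst pi measurableT mh (fun x _ => h0 x)).
apply: eq_measure_integral => A mA _.
transitivity (pi (A `*` setT)); last by case: (cp A mA).
by congr (pi _); apply/seteqP; split => [z ?|z []].
Qed.

Lemma integral_coupling2 (p q : P2 R n) pi (h : V -> \bar R) : coupling p q pi ->
  measurable_fun setT h -> (forall x, 0 <= h x)%E ->
  (\int[pi]_z h z.2 = \int[q]_x h x)%E.
Proof.
move=> cp mh h0.
rewrite -(ge0_integral_pushforward measurable_snd pi measurableT mh (fun x _ => h0 x)).
apply: eq_measure_integral => A mA _.
transitivity (pi (setT `*` A)); last by case: (cp A mA).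
by congr (pi _); apply/seteqP; split => [z ?|z []].
Qed.

(** Gibbs' variational inequality, int eta ln G <= int eta ln eta, with each term put on the side
    where it is nonnegative; infinite values are then harmless. *)
Lemma gibbs (q : P2 R n) eta (G : V -> R) b : is_density q eta -> 0 <= b ->
  measurable_fun setT G -> (forall x, 0 < G x) -> (forall x, ln (G x) <= b) ->
  (\int[L]_x (G x)%:E = 1)%E ->
  ((Afun q + b + lapZ)%:E <= Dent eta + (1 + \int[q]_x (b - ln (G x))%:E))%E.
Proof.
move=> qe b0 mG G0 Gb G1; have [me e0 _] := qe.
have ml := @measurable_l1norm R n.
have mlG : measurable_fun setT (fun x => ln (G x)) by exact: measurableT_comp.
have mbG : measurable_fun setT (fun x => b - ln (G x)) by exact: measurable_funB.
have bG0 x : 0 <= b - ln (G x) by rewrite subr_ge0.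
rewrite (integral_density qe); first last.
- by move=> x; rewrite lee_fin.
- exact/measurable_EFinP.
have A1 : (\int[L]_x (eta x * l1norm x)%:E = (Afun q)%:E)%E.
  rewrite -AfunE (integral_density qe).
  - by apply: eq_integral => x _; rewrite -EFinM mulrC.
  - exact/measurable_EFinP.
  - by move=> x; rewrite lee_fin l1norm_ge0.
have A2 : (\int[L]_x (b * eta x)%:E = b%:E)%E.
  by rewrite ge0_integral_mull// (integral_density1 qe) mule1.
have p1 x : (0 <= (eta x * l1norm x)%:E :> \bar R)%E by rewrite lee_fin mulr_ge0 ?l1norm_ge0.
have p2 x : (0 <= (b * eta x)%:E :> \bar R)%E by rewrite lee_fin mulr_ge0.
have p3 (x : V) : (0 <= (lap 1 x)%:E :> \bar R)%E by rewrite lee_fin expR_ge0.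
have p4 x : (0 <= (relent (eta x) x)%:E :> \bar R)%E by rewrite lee_fin relent_ge0.
have p5 x : (0 <= (G x)%:E :> \bar R)%E by rewrite lee_fin ltW.
have p6 x : (0 <= (b - ln (G x))%:E * (eta x)%:E :> \bar R)%E by rewrite mule_ge0// lee_fin.
have m1 : measurable_fun setT (fun x => (eta x * l1norm x)%:E : \bar R).
  by apply/measurable_EFinP; exact: measurable_funM.
have m2 : measurable_fun setT (fun x => (b * eta x)%:E : \bar R).
  by apply/measurable_EFinP; exact: measurable_funM.
have m3 : measurable_fun setT (fun x : V => (lap 1 x)%:E : \bar R).
  by apply/measurable_EFinP; exact: measurable_lap.
have m4 : measurable_fun setT (fun x => (relent (eta x) x)%:E : \bar R).
  by apply/measurable_EFinP; exact: measurable_relent.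
have m5 : measurable_fun setT (fun x => (G x)%:E : \bar R) by exact/measurable_EFinP.
have m6 : measurable_fun setT (fun x => ((b - ln (G x))%:E * (eta x)%:E)%E).
  by apply: emeasurable_funM; exact/measurable_EFinP.
have p12 x := adde_ge0 (p1 x) (p2 x).
have p56 x := adde_ge0 (p5 x) (p6 x).
have m12 := emeasurable_funD m1 m2.
have m56 := emeasurable_funD m5 m6.
rewrite 2!EFinD -A1 -A2 -lapZE /Dent -G1.
rewrite -(ge0_integralD L measurableT (fun x _ => p1 x) m1 (fun x _ => p2 x) m2).
rewrite -(ge0_integralD L measurableT (fun x _ => p12 x) m12 (fun x _ => p3 x) m3).
rewrite -(ge0_integralD L measurableT (fun x _ => p5 x) m5 (fun x _ => p6 x) m6).
rewrite -(ge0_integralD L measurableT (fun x _ => p4 x) m4 (fun x _ => p56 x) m56).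
apply: ge0_le_integral => //.
- by move=> x _; exact: adde_ge0.
- exact: emeasurable_funD.
- exact: emeasurable_funD.
- move=> x _; rewrite -EFinM -!EFinD lee_fin /relent.
  have := entropy_kernel_ge0 (e0 x) (G0 x); lra.
Qed.

(** Both ends of the coupling are translated by the same noise of density [kern M]: this turns [p]
    into [f] and leaves the transport cost unchanged. On the side of [q] the translation is given to
    [G] instead, so that [eta] itself stays as it is. The term 2^n / M is the growth of the first
    moment of [p]. *)
Lemma hwi_smooth (p q : P2 R n) eta pi (f : V -> R) (J : 'I_n -> R) (M S eps C : R) :
  is_density q eta -> coupling p q pi -> 0 < M -> 0 < S -> 0 < eps ->
  f = smooth p M -> (forall i, 0 <= J i) -> chi2_bound M J f ->
  (\int[pi]_z (sqnorm (z.1 - z.2))%:E = C%:E)%E ->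
  ((Afun q)%:E + Dent f <= Dent eta +
    (Afun p + 2 ^+ n / M + S / 2 * (\sum_i J i) * (1 + eps) + C / (2 * S))%:E)%E.
Proof.
move=> qe cp M0 S0 e0 fE J0 cf CE.
have lf : loglip M f by rewrite fE; exact: loglip_smooth.
have [_ mf f0 _] := lf.
have f1 : (\int[L]_x (f x)%:E = 1)%E by rewrite fE integral_smooth1.
have [b b0 fb] : exists2 b : R, 0 <= b & forall x, ln (f x) <= b.
  exists (Num.max 0 (ln ((lap_mass / M) ^+ n)^-1)); first by rewrite le_max lexx.
  by move=> x; rewrite le_max ler_ln ?posrE ?fE ?smooth_le ?orbT ?smooth_gt0// invr_gt0 exprn_gt0// divr_gt0// lap_mass_gt0.
have [G [h [[mG G0 Gb G1] [mh h0 Gh hf]]]] := smooth_harnack lf cf J0 fb S0 e0.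
rewrite f1 in G1.
have [De|] := ltP (Dent eta) +oo%E; last first.
  by rewrite leye_eq => /eqP ->; rewrite addye// leey.
have k0 (u : V) : (0 <= (kern M u)%:E :> \bar R)%E by rewrite lee_fin ltW// kern_gt0.
have mk : measurable_fun setT (fun u : V => (kern M u)%:E : \bar R).
  by apply/measurable_EFinP; exact: measurable_kern.
pose B x : \bar R := (b - ln (G x))%:E.
have B0 x : (0 <= B x)%E by rewrite lee_fin subr_ge0.
have mB : measurable_fun setT B.
  by apply/measurable_EFinP; apply: measurable_funB => //; exact: measurableT_comp.
have mD : measurable_fun setT (fun z : V * V => z.1 + z.2).
  by apply: measurable_rVD; [exact: measurable_fst|exact: measurable_snd].
have mBu (u : V) : measurable_fun setT (fun y : V => B (y + u)).
  by apply: (measurableT_comp mB); exact: measurable_shift_rV.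
have mByu (y : V) : measurable_fun setT (fun u : V => B (y + u)).
  by apply: (measurableT_comp mB); exact: measurable_rVD.
have mhyu (y : V) : measurable_fun setT (fun u : V => h (y + u)).
  by apply: (measurableT_comp mh); exact: measurable_rVD.
(* Every translate of [G] is still a probability density bounded by exp(b), so Gibbs' inequality
   holds for each [u]. *)
have G' u : ((Afun q + b + lapZ)%:E <= Dent eta + (1 + \int[q]_y B (y + u)%R))%E.
  apply: (gibbs (G := fun x : V => G (x + u)) qe b0) => //.
    by apply: (measurableT_comp mG); exact: measurable_shift_rV.
  rewrite (ge0_integral_shift u (f := fun x => (G x)%:E))//.
    exact/measurable_EFinP.
  by move=> x; rewrite lee_fin ltW.
have Dd : Dent eta = (fine (Dent eta))%:E.
  rewrite fineK// ge0_fin_numE//; apply: integral_ge0 => x _.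
  by rewrite lee_fin relent_ge0//; case: qe.
have D0 : 0 <= fine (Dent eta).
  apply: fine_ge0; apply: integral_ge0 => x _.
  by rewrite lee_fin relent_ge0//; case: qe.
have mkB : measurable_fun setT (fun z : V * V => ((kern M z.2)%:E * B (z.1 + z.2)%R)%E).
  by apply: emeasurable_funM; [exact: (measurableT_comp mk measurable_snd)|exact: measurableT_comp].
have mkh : measurable_fun setT (fun z : V * V => ((kern M z.2)%:E * h (z.1 + z.2)%R)%E).
  by apply: emeasurable_funM; [exact: (measurableT_comp mk measurable_snd)|exact: measurableT_comp].
have kB0 z : (0 <= (kern M z.2)%:E * B (z.1 + z.2)%R)%E by rewrite mule_ge0.
have kh0 z : (0 <= (kern M z.2)%:E * h (z.1 + z.2)%R)%E by rewrite mule_ge0.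
have mBq : measurable_fun setT (fun u : V => \int[q]_y B (y + u)%R)%E.
  apply: (@measurable_fun_fubini_tonelli_G _ _ _ _ _ q (fun z : V * V => B (z.1 + z.2))) => //.
  exact: measurableT_comp.
have Bq0 (u : V) : (0 <= \int[q]_y B (y + u)%R)%E by exact: integral_ge0.
(* The mean over [u] of the inequalities [G'], with weight [kern M]. *)
have S1 : ((Afun q + b + lapZ)%:E <= (fine (Dent eta) + 1)%:E +
    \int[L]_u ((kern M u)%:E * \int[q]_y B (y + u)%R))%E.
  have -> : ((Afun q + b + lapZ)%:E = \int[L]_u ((Afun q + b + lapZ) * kern M u)%:E)%E.
    rewrite ge0_integral_mull ?integral_kern ?mule1//.
    - exact: measurable_kern.
    - rewrite !addr_ge0//; first by apply: fine_ge0; apply: integral_ge0 => x _; rewrite lee_fin l1norm_ge0.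
      by rewrite exprn_ge0// divr_ge0// ltW// lap_mass_gt0.
  have -> : ((fine (Dent eta) + 1)%:E = \int[L]_u ((fine (Dent eta) + 1) * kern M u)%:E)%E.
    rewrite ge0_integral_mull ?integral_kern ?mule1//.
    - exact: measurable_kern.
    - by rewrite addr_ge0.
  have mq1 : measurable_fun setT (fun u : V => ((fine (Dent eta) + 1) * kern M u)%:E : \bar R).
    by apply/measurable_EFinP; apply: measurable_funM => //; exact: measurable_kern.
  have pq1 (u : V) : (0 <= ((fine (Dent eta) + 1) * kern M u)%:E :> \bar R)%E.
    by rewrite EFinM mule_ge0// lee_fin addr_ge0.
  have mq2 : measurable_fun setT (fun u : V => (kern M u)%:E * \int[q]_y B (y + u)%R)%E.
    exact: emeasurable_funM.
  have pq2 (u : V) : (0 <= (kern M u)%:E * \int[q]_y B (y + u)%R)%E by rewrite mule_ge0.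
  rewrite -(ge0_integralD L measurableT (fun x _ => pq1 x) mq1 (fun x _ => pq2 x) mq2).
  apply: ge0_le_integral => //.
  - move=> u _; rewrite EFinM mule_ge0// lee_fin !addr_ge0//.
      by apply: fine_ge0; apply: integral_ge0 => x _; rewrite lee_fin l1norm_ge0.
    by rewrite exprn_ge0// divr_ge0// ltW// lap_mass_gt0.
  - by apply/measurable_EFinP; apply: measurable_funM => //; exact: measurable_kern.
  - exact: emeasurable_funD.
  - move=> u _; rewrite mulrC EFinM [X in (X + _)%E]EFinM muleC [X in (X + _)%E]muleC.
    rewrite [X in (X <= _)%E]muleC -muleDr; last first.
      by apply: ge0_adde_def; rewrite inE// lee_fin addr_ge0.
      by [].
    apply: lee_wpmul2l => //; rewrite [(fine (Dent eta) + 1)%:E]EFinD -Dd -addeA; exact: G'.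
(* The log-Harnack bound [Gh], applied between the translates of the two ends of the coupling by the
   same [u], then integrated. *)
have S2 : (\int[L]_u ((kern M u)%:E * \int[q]_y B (y + u)%R) <=
    \int[L]_x ((f x)%:E * h x) + (C / (2 * S))%:E)%E.
  have -> : (\int[L]_u ((kern M u)%:E * \int[q]_y B (y + u)%R) =
      \int[pi]_z \int[L]_u ((kern M u)%:E * B (z.2 + u)%R))%E.
    rewrite (integral_coupling2 (h := fun y => \int[L]_u ((kern M u)%:E * B (y + u)%R)) cp)%E.
    - rewrite (@fubini_tonelli _ _ _ _ _ q L _ mkB kB0).
      by apply: eq_integral => u _; rewrite /= ge0_integralZl.
    - exact: (@measurable_fun_fubini_tonelli_F _ _ _ _ _ L _ mkB kB0).
    - by move=> y; apply: integral_ge0 => u _; exact: mule_ge0.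
  have -> : (\int[L]_x ((f x)%:E * h x) = \int[pi]_z \int[L]_u ((kern M u)%:E * h (z.1 + u)%R))%E.
    rewrite fE integral_smooth//.
    rewrite (integral_coupling1 (h := fun y => \int[L]_u ((kern M u)%:E * h (y + u)%R)) cp)%E//.
    - exact: (@measurable_fun_fubini_tonelli_F _ _ _ _ _ L _ mkh kh0).
    - by move=> y; apply: integral_ge0 => u _; exact: mule_ge0.
  have msq : measurable_fun setT (fun z : V * V => sqnorm (z.1 - z.2)).
    apply: (measurableT_comp measurable_sqnorm).
    rewrite (_ : (fun z : V * V => z.1 - z.2) = (fun z => z.1 + (-1) *: z.2)).
      by apply: measurable_rVD; [exact: measurable_fst|apply: measurable_rVZ => //; exact: measurable_snd].
    by apply/funext => z; rewrite scaleN1r.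
  have S20 : 0 <= (2 * S)^-1 by rewrite invr_ge0 mulr_ge0// ltW.
  have -> : ((C / (2 * S))%:E = \int[pi]_z ((2 * S)^-1 * sqnorm (z.1 - z.2))%:E)%E.
    rewrite ge0_integral_mull//; first by rewrite CE -EFinM mulrC.
    by move=> z; exact: sqnorm_ge0.
  have mI2 : measurable_fun setT (fun y : V => \int[L]_u ((kern M u)%:E * h (y + u)%R))%E.
    exact: (@measurable_fun_fubini_tonelli_F _ _ _ _ _ L _ mkh kh0).
  have mI1 : measurable_fun setT (fun y : V => \int[L]_u ((kern M u)%:E * B (y + u)%R))%E.
    exact: (@measurable_fun_fubini_tonelli_F _ _ _ _ _ L _ mkB kB0).
  have mz1 : measurable_fun setT (fun z : V * V => \int[L]_u ((kern M u)%:E * h (z.1 + u)%R))%E.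
    exact: (measurableT_comp mI2 measurable_fst).
  have pz1 (z : V * V) : (0 <= \int[L]_u ((kern M u)%:E * h (z.1 + u)%R))%E.
    by apply: integral_ge0 => u _; exact: mule_ge0.
  have mz2 : measurable_fun setT (fun z : V * V => ((2 * S)^-1 * sqnorm (z.1 - z.2))%:E : \bar R).
    by apply/measurable_EFinP; exact: measurable_funM.
  have pz2 (z : V * V) : (0 <= ((2 * S)^-1 * sqnorm (z.1 - z.2))%:E :> \bar R)%E.
    by rewrite lee_fin mulr_ge0// sqnorm_ge0.
  rewrite -(ge0_integralD pi measurableT (fun x _ => pz1 x) mz1 (fun x _ => pz2 x) mz2).
  apply: ge0_le_integral => //.
  - by move=> z _; apply: integral_ge0 => u _; exact: mule_ge0.
  - exact: (measurableT_comp mI1 measurable_snd).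
  - exact: emeasurable_funD.
  - move=> z _.
    set c := (2 * S)^-1 * _; have c0 : 0 <= c by rewrite mulr_ge0// sqnorm_ge0.
    have -> : (c%:E = \int[L]_u (c * kern M u)%:E)%E.
      by rewrite ge0_integral_mull ?integral_kern ?mule1//; exact: measurable_kern.
    have mq1 : measurable_fun setT (fun u : V => (c * kern M u)%:E : \bar R).
      by apply/measurable_EFinP; apply: measurable_funM => //; exact: measurable_kern.
    have pq1 (u : V) : (0 <= (c * kern M u)%:E :> \bar R)%E by rewrite EFinM mule_ge0.
    have mq2 : measurable_fun setT (fun u : V => (kern M u)%:E * h (z.1 + u)%R)%E.
      by apply: emeasurable_funM => //; exact: mhyu.
    have pq2 (u : V) : (0 <= (kern M u)%:E * h (z.1 + u)%R)%E by rewrite mule_ge0.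
    rewrite -(ge0_integralD L measurableT (fun x _ => pq2 x) mq2 (fun x _ => pq1 x) mq1).
    apply: ge0_le_integral => //.
    + by move=> u _; exact: mule_ge0.
    + by apply: emeasurable_funM => //; exact: mByu.
    + exact: emeasurable_funD.
    + move=> u _; rewrite [X in (_ + X)%E]EFinM [X in (_ + X)%E]muleC -muleDr//; last first.
        by apply: ge0_adde_def; rewrite inE// lee_fin.
      apply: lee_wpmul2l => //.
      have := Gh (z.1 + u) (z.2 - z.1).
      rewrite [z.1 + u + _]addrC addrA subrK /B => /le_trans; apply.
      by rewrite leeD2l// lee_fin /c -opprB sqnormN mulrC.
set X := (\int[L]_x (f x * (b - ln (f x)))%:E)%E in hf.
have p1 x : 0 <= f x * (b - ln (f x)) by rewrite mulr_ge0 ?subr_ge0// ltW.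
have p2 x : 0 <= relent (f x) x by rewrite relent_ge0// ltW.
have p3 x : 0 <= b * f x by rewrite mulr_ge0// ltW.
have p4 x : 0 <= f x * l1norm x by rewrite mulr_ge0 ?l1norm_ge0// ltW.
have ml := @measurable_l1norm R n.
have m1 : measurable_fun setT (fun x => f x * (b - ln (f x))).
  by apply: measurable_funM => //; apply: measurable_funB => //; exact: measurableT_comp.
have m2 : measurable_fun setT (fun x => relent (f x) x) by exact: measurable_relent.
have m3 : measurable_fun setT (fun x => b * f x) by exact: measurable_funM.
have m4 : measurable_fun setT (fun x => f x * l1norm x) by exact: measurable_funM.
have addI (u v : V -> R) : measurable_fun setT u -> measurable_fun setT v ->
    (forall x, 0 <= u x) -> (forall x, 0 <= v x) ->
    (\int[L]_x (u x + v x)%:E = \int[L]_x (u x)%:E + \int[L]_x (v x)%:E)%E.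
  move=> mu' mv u0 v0; under eq_integral do rewrite EFinD.
  by rewrite ge0_integralD//; first [exact/measurable_EFinP | move=> x _; rewrite lee_fin].
(* The logarithms of [f] cancel between [X] and [Dent f]. All integrands are nonnegative, so the
   identity holds before either is known to be finite. *)
have XD : (X + Dent f + 1 = b%:E + \int[L]_x (f x * l1norm x)%:E + lapZ%:E)%E.
  have fn x : 0 <= f x by exact: ltW.
  have l0 (x : V) : 0 <= lap 1 x by exact: expR_ge0.
  have mlap := @measurable_lap R n 1.
  have m12 := measurable_funD m1 m2.
  have m34 := measurable_funD m3 m4.
  have p12 x := addr_ge0 (p1 x) (p2 x).
  have p34 x := addr_ge0 (p3 x) (p4 x).
  have -> : (b%:E = \int[L]_x (b * f x)%:E)%E by rewrite ge0_integral_mull// f1 mule1.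
  rewrite -lapZE -[in LHS]f1 /X /Dent -(addI _ _ m1 m2 p1 p2) -(addI _ _ m12 mf p12 fn).
  rewrite -(addI _ _ m3 m4 p3 p4) -(addI _ _ m34 mlap p34 l0).
  by apply: eq_integral => x _; congr EFin; rewrite /relent /=; ring.
have Af := integral_smooth_l1 p M0; rewrite -fE AfunE in Af.
have Af0 : (0 <= \int[L]_x (f x * l1norm x)%:E)%E by apply: integral_ge0 => x _; rewrite lee_fin.
have X0 : (0 <= X)%E by apply: integral_ge0 => x _; rewrite lee_fin.
have Df0 : (0 <= Dent f)%E by apply: integral_ge0 => x _; rewrite lee_fin.
have := le_trans S1 (leeD2l _ (le_trans S2 (leeD2r _ hf))).
rewrite Dd; move: XD Af Af0 X0 Df0; clear hf; clearbody X.
case: X => [x| |]//; case: (Dent f) => [d| |]//;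
  case: (\int[L]_x (f x * l1norm x)%:E)%E => [a| |]//=.
rewrite -!EFinD !lee_fin => -[] xd Af _ _ _ H; lra.
Qed.

End hwi_regular.

(** * Removal of the smoothing, and the entropy as a relative entropy *)

Section entropy_limit.
Context {R : realType} {n : nat}.
Local Notation V := 'rV[R]_n.
Local Notation L := (@lebesgue_rV R n).
Local Notation E i := (delta_mx ord0 i : V).

Lemma le_limn_einf (u v : nat -> \bar R) : (forall k, (u k <= v k)%E) ->
  (limn_einf u <= limn_einf v)%E.
Proof.
move=> uv; rewrite !limn_einf_lim; apply: lee_lim; [exact: is_cvg_einfs..|].
apply: nearW => k; apply: le_ereal_inf_tmp => _ [m /= km <-].
by apply: le_trans (uv m); apply: ereal_inf_lbound; exists m.
Qed.

(** [relent] lies above the affine functions of r that are its tangents at each c > 0, and these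
    pass to the limit. The tangent at [r] itself is optimal when r > 0; for r = 0 one lets c tend to
    0. *)
Lemma relent_lsc (f : nat -> R) (r : R) (x : V) : (forall k, 0 <= f k) -> 0 <= r ->
  f k @[k --> \oo] --> r ->
  ((relent r x)%:E <= limn_einf (fun k => (relent (f k) x)%:E))%E.
Proof.
move=> f0 r0 fr.
have T c : 0 < c -> ((r * (ln c + l1norm x) - c + lap 1 x)%:E <=
    limn_einf (fun k => (relent (f k) x)%:E))%E.
  move=> c0.
  pose v k : \bar R := (f k * (ln c + l1norm x) - c + lap 1 x)%:E.
  have cv : v k @[k --> \oo] --> (r * (ln c + l1norm x) - c + lap 1 x)%:E.
    apply: cvg_EFin; first exact: nearW.
    apply: cvgD; last exact: cvg_cst.
    by apply: cvgB; [apply: cvgMl | exact: cvg_cst].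
  rewrite -(cvg_limn_einf_sup cv).1; apply: le_limn_einf => k.
  rewrite lee_fin /relent; have := entropy_kernel_ge0 (f0 k) c0; lra.
have [r1|r1] := eqVneq r 0; last first.
  have rp : 0 < r by rewrite lt0r r1.
  apply: le_trans (T _ rp); rewrite lee_fin /relent; lra.
rewrite r1; apply/lee_addgt0Pr => c c0; apply: le_trans (leeD2r _ (T _ c0)).
by rewrite -EFinD lee_fin /relent r1; lra.
Qed.

(** The L^1 errors are summable, hence the whole sequence converges almost everywhere; Fatou applies
    because [relent] is nonnegative. *)
Lemma Dent_lsc (f : nat -> V -> R) (rho : V -> R) (B : R) : (forall k, measurable_fun setT (f k)) ->
  (forall k x, 0 <= f k x) -> measurable_fun setT rho -> (forall x, 0 <= rho x) -> 0 <= B ->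
  (forall k, \int[L]_x `|f k x - rho x|%:E <= (B / (2 ^ k.+1)%:R)%:E)%E ->
  (Dent rho <= limn_einf (fun k => Dent (f k)))%E.
Proof.
move=> mf f0 mr r0 B0 fr.
pose e k x : \bar R := `|f k x - rho x|%:E.
have me k : measurable_fun setT (e k).
  by apply/measurable_EFinP; apply: measurableT_comp => //; exact: measurable_funB.
have e0 k x : (0 <= e k x)%E by rewrite lee_fin.
have mS : measurable_fun setT (fun x => \sum_(0 <= k <oo) e k x)%E.
  by apply: ge0_emeasurable_sum => // k x _ _; exact: e0.
have S0 x : (0 <= \sum_(0 <= k <oo) e k x)%E by apply: nneseries_ge0 => k _ _.
have iS : L.-integrable setT (fun x => \sum_(0 <= k <oo) e k x)%E.
  apply/integrableP; split => //.
  rewrite (eq_integral (fun x => \sum_(0 <= k <oo) e k x)%E); last first.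
    by move=> x _; rewrite gee0_abs.
  rewrite integral_nneseries//; apply: (@le_lt_trans _ _ B%:E); last exact: ltry.
  apply: le_trans (epsilon_trick0 xpredT B0).
  by apply: lee_nneseries => k _; [move=> _; exact: integral_ge0 | exact: fr].
have ae := integrable_ae measurableT iS.
apply: le_trans (fatou L measurableT _ _).
- apply: ae_ge0_le_integral => //.
  + by move=> x _; rewrite lee_fin relent_ge0.
  + by apply/measurable_EFinP; exact: measurable_relent.
  + move=> x _; rewrite -[leLHS](_ : limn_einf (fun=> 0%E) = 0%E).
      by apply: le_limn_einf => k; rewrite lee_fin relent_ge0.
    by apply: (cvg_limn_einf_sup _).1; exact: cvg_cst.
  + rewrite (_ : (fun x => _) = (fun x => - limn_esup (fun k => - (relent (f k x) x)%:E))%E).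
      apply: measurableT_comp => //; apply: measurable_fun_limn_esup => k.
      by apply: measurableT_comp => //; apply/measurable_EFinP; exact: measurable_relent.
    by apply/funext => x; rewrite -[LHS]oppeK -limn_esupN.
  + apply: filterS ae => x /(_ I) fx _; apply: relent_lsc => //.
    have Sx : (\sum_(0 <= k <oo) e k x < +oo)%E by rewrite ltey_eq fx.
    have tl := nneseries_tail_cvg Sx (fun k _ => e0 k x).
    have ek : e k x @[k --> \oo] --> 0%E.
      apply: (squeeze_cvge _ (cvg_cst 0%E) tl); apply: nearW => k; rewrite e0/=.
      by rewrite (nneseries_split k 1)// addn1 big_nat1 leeDl// nneseries_ge0.
    apply: cvg_sub0 (cvg_cst (rho x)); apply/cvgr0Pnorm_lt => d d0.
    have /fine_cvgP[_ /cvgr0Pnorm_lt/(_ _ d0)] := ek.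
    by apply: filterS => k /=; rewrite normr_id.
- by move=> k; apply/measurable_EFinP; exact: measurable_relent.
- by move=> k x _; rewrite lee_fin relent_ge0.
Qed.

Lemma hwi_limit (p q : P2 R n) rho G eta pi (J : 'I_n -> R) (S eps C : R) :
  is_density p rho -> plateau_gradient rho G -> (forall i x, rho x = 0 -> G x ord0 i = 0) ->
  (forall i, 0 <= J i) ->
  (forall i, \int[L]_x ((G x ord0 i) ^+ 2 / rho x)%:E <= (J i)%:E)%E ->
  is_density q eta -> coupling p q pi -> 0 < S -> 0 < eps ->
  (\int[pi]_z (sqnorm (z.1 - z.2))%:E = C%:E)%E ->
  ((Afun q)%:E + Dent rho <= Dent eta +
    (Afun p + S / 2 * (\sum_i J i) * (1 + eps) + C / (2 * S))%:E)%E.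
Proof.
move=> pr wG vG J0 GJ qe cp S0 e0 CE.
have [mr r0 _] := pr; have [me eta0 _] := qe.
(* Powers of 2 make the errors of [smooth_L1] a geometric series, as [Dent_lsc] requires. *)
pose M k : R := (2 ^ k.+1)%:R; have M0 k : 0 < M k by rewrite ltr0n expn_gt0.
pose f k := smooth p (M k).
pose C1 := \sum_i fine (\int[L]_x `|(G x ord0 i)%:E|)%E.
have fG i : (\int[L]_x `|(G x ord0 i)%:E| = (fine (\int[L]_x `|(G x ord0 i)%:E|))%:E)%E.
  rewrite fineK// ge0_fin_numE; last exact: integral_ge0.
  by case: (wG i) => /integrableP[_].
have fG0 i : 0 <= fine (\int[L]_x `|(G x ord0 i)%:E|)%E by apply: fine_ge0; exact: integral_ge0.
have C10 : 0 <= C1 by apply: sumr_ge0 => i _.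
have C1G i : (\int[L]_x `|(G x ord0 i)%:E| <= C1%:E)%E.
  rewrite fG lee_fin /C1 (bigD1 i)//= lerDl.
  by apply: sumr_ge0 => j _; exact: fG0.
have lf k : loglip (M k) (f k) by exact: loglip_smooth.
have fE k x : ((f k x)%:E = \int[L]_y (rho y * kern (M k) (x - y))%:E)%E by exact: smooth_density.
have lsc : (Dent rho <= limn_einf (fun k => Dent (f k)))%E.
  apply: (Dent_lsc (B := 2 ^+ n * C1)) => //.
  - by move=> k; exact: measurable_smooth.
  - by move=> k x; exact/ltW/smooth_gt0.
  - by rewrite mulr_ge0// exprn_ge0.
  - move=> k; apply: le_trans (smooth_L1 pr (M0 k) (lf k) (fE k) wG C1G C10) _.
    by rewrite lee_fin mulrAC.
have reg k : ((Afun q)%:E + Dent (f k) <= Dent eta +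
    (Afun p + 2 ^+ n / M k + S / 2 * (\sum_i J i) * (1 + eps) + C / (2 * S))%:E)%E.
  apply: (hwi_smooth qe cp (M0 k) S0 e0 erefl J0) => //.
  move=> i t; have [ig wg] := wG i.
  exact: (smooth_chi2 pr (M0 k) (lf k) (fE k) ig wg (vG i) (GJ i)).
have [De|] := ltP (Dent eta) +oo%E; last first.
  by rewrite leye_eq => /eqP ->; rewrite addye// leey.
have Dd : Dent eta = (fine (Dent eta))%:E.
  rewrite fineK// ge0_fin_numE//; apply: integral_ge0 => x _.
  by rewrite lee_fin relent_ge0.
set d := fine (Dent eta) in Dd.
pose K := d + (Afun p + S / 2 * (\sum_i J i) * (1 + eps) + C / (2 * S)) - Afun q.
have : (limn_einf (fun k => Dent (f k)) <= K%:E)%E.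
  pose v k : \bar R := (geometric (2 ^+ n / 2) 2^-1 k + K)%:E.
  have cv : v k @[k --> \oo] --> K%:E.
    apply: cvg_EFin; first exact: nearW.
    rewrite -[X in _ --> X]add0r; apply: cvgD; last exact: cvg_cst.
    apply: cvg_geometric; rewrite ger0_norm// invf_lt1//; lra.
  rewrite -(cvg_limn_einf_sup cv).1; apply: le_limn_einf => k.
  have := reg k; rewrite Dd -leeBrDl// -EFinD -?EFinB; move/le_trans; apply.
  rewrite lee_fin /K /geometric /= /M natrX exprS invfM exprVn.
  rewrite le_eqVlt; apply/orP; left; apply/eqP; ring.
move/(le_trans lsc); rewrite /K EFinB => H.
by rewrite Dd -leeBrDl// -EFinD.
Qed.

Lemma density_ae_eq (p : P2 R n) rho eta : is_density p rho -> is_density p eta ->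
  {ae L, forall x, rho x = eta x}.
Proof.
move=> pr pe; have [mr _ rE] := pr; have [me _ eE] := pe.
have := @integral_ae_eq _ _ _ L setT measurableT (EFin \o eta) (EFin \o rho)
  (integrable_density pr).
have me' : measurable_fun setT (EFin \o eta) by exact/measurable_EFinP.
move=> /(_ me') H; have {H} := H _.
suff h : forall A, A `<=` setT -> measurable A ->
    (\int[L]_(x in A) (EFin \o rho) x = \int[L]_(x in A) (EFin \o eta) x)%E.
  by move=> /(_ h); apply: filterS => x /= /(_ I) [].
by move=> A _ mA; rewrite /= -rE// eE.
Qed.

(** The integrand differs from [relent] by the integrable [j]. When [Dent rho] is infinite, the
    negative part of rho ln rho is still dominated by |j|, so only the positive part diverges and
    both sides are -oo. *)
Lemma integral_xlnx (p : P2 R n) rho : is_density p rho ->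
  (- (\int[L]_x (rho x * ln (rho x))%:E) = (Afun p + @lapZ R n - 1)%:E - Dent rho)%E.
Proof.
move=> pr; have [mr r0 _] := pr.
have ml := @measurable_l1norm R n.
pose j x := rho x * l1norm x - rho x + lap 1 x.
have mj : measurable_fun setT j.
  apply: measurable_funD; last exact: measurable_lap.
  by apply: measurable_funB => //; exact: measurable_funM.
have irl : L.-integrable setT (fun x => (rho x * l1norm x)%:E).
  apply/integrableP; split; first by apply/measurable_EFinP; exact: measurable_funM.
  rewrite (eq_integral (fun x => (l1norm x)%:E * (rho x)%:E)%E).
    rewrite -(integral_density pr) ?AfunE ?ltry//.
      exact/measurable_EFinP.
    by move=> x; rewrite lee_fin l1norm_ge0.
  by move=> x _; rewrite gee0_abs ?lee_fin ?mulr_ge0 ?l1norm_ge0// -EFinM mulrC.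
have ilap : L.-integrable setT (fun x : V => (lap 1 x)%:E).
  apply/integrableP; split; first by apply/measurable_EFinP; exact: measurable_lap.
  rewrite (eq_integral (fun x : V => (lap 1 x)%:E)) ?lapZE ?ltry// => x _.
  by rewrite gee0_abs// lee_fin expR_ge0.
have irho := integrable_density pr.
have ij : L.-integrable setT (EFin \o j).
  have -> : EFin \o j = fun x => ((rho x * l1norm x)%:E - (rho x)%:E + (lap 1 x)%:E)%E.
    by apply/funext => x; rewrite -EFinB -EFinD.
  by apply: integrableD => //; exact: integrableB.
have jE : (\int[L]_x (j x)%:E = (Afun p + @lapZ R n - 1)%:E)%E.
  rewrite (eq_integral (fun x => ((rho x * l1norm x)%:E - (rho x)%:E + (lap 1 x)%:E)%E))//.
  rewrite integralD//; last exact: integrableB.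
  rewrite integralB// (integral_density1 pr) lapZE.
  rewrite (eq_integral (fun x => (l1norm x)%:E * (rho x)%:E)%E).
    rewrite -(integral_density pr) ?AfunE.
    - by rewrite -EFinB -EFinD; congr EFin; ring.
    - exact/measurable_EFinP.
    - by move=> x; rewrite lee_fin l1norm_ge0.
  by move=> x _; rewrite -EFinM mulrC.
pose a x := rho x * ln (rho x).
have ma : measurable_fun setT a by apply: measurable_funM => //; exact: measurableT_comp.
have aE x : relent (rho x) x = a x + j x by rewrite /relent /a /j; ring.
have D0 : (0 <= Dent rho)%E by apply: integral_ge0 => x _; rewrite lee_fin relent_ge0.
have mre : measurable_fun setT (fun x => (relent (rho x) x)%:E : \bar R).
  by apply/measurable_EFinP; exact: measurable_relent.
have [De|] := ltP (Dent rho) +oo%E.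
  have iD : L.-integrable setT (fun x => (relent (rho x) x)%:E).
    apply/integrableP; split => //; rewrite (eq_integral (fun x => (relent (rho x) x)%:E))//.
    by move=> x _; rewrite gee0_abs// lee_fin relent_ge0.
  rewrite (eq_integral (fun x => (relent (rho x) x)%:E - (j x)%:E)%E); last first.
    by move=> x _; rewrite -EFinB aE addrK.
  rewrite integralB// jE oppeB; last by rewrite fin_num_adde_defl.
  by rewrite addeC.
rewrite leye_eq => /eqP De; rewrite De.
have naj : (\int[L]_x ((fun x => (a x)%:E)^\- x) < +oo)%E.
  have iab := integrable_abse ij.
  apply: (@le_lt_trans _ _ (\int[L]_x `|(j x)%:E|)%E); last by case/integrableP : ij.
  apply: ge0_le_integral => //.
  - by apply: measurable_funeneg; exact/measurable_EFinP.
  - by apply: measurableT_comp => //; exact/measurable_EFinP.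
  - move=> x _; rewrite !unlock ge_max abse_ge0 andbT -EFinN lee_fin.
    have := relent_ge0 x (r0 x); rewrite aE.
    have := ler_norm (j x); rewrite /=; lra.
have paj : (\int[L]_x ((fun x => (a x)%:E)^\+ x) = +oo)%E.
  apply/eqP; rewrite -leye_eq leNgt; apply/negP => pa.
  have ia : L.-integrable setT (fun x => (a x)%:E).
    apply/integrableP; split; first exact/measurable_EFinP.
    rewrite (eq_integral (fun x => (fun x => (a x)%:E)^\+ x + (fun x => (a x)%:E)^\- x)%E).
      rewrite ge0_integralD//; first exact: lte_add_pinfty.
      - by apply: measurable_funepos; exact/measurable_EFinP.
      - by apply: measurable_funeneg; exact/measurable_EFinP.
    by move=> x _; rewrite -[RHS]/(((fun x => (a x)%:E)^\+ \+ (fun x => (a x)%:E)^\-) x)%E -fune_abse.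
  have : L.-integrable setT (fun x => (relent (rho x) x)%:E).
    have -> : (fun x => (relent (rho x) x)%:E) = ((fun x => (a x)%:E) \+ (EFin \o j))%E.
      by apply/funext => x; rewrite aE EFinD.
    exact: integrableD.
  case/integrableP => _; rewrite (eq_integral (fun x => (relent (rho x) x)%:E)).
    by rewrite -/(Dent rho) De ltxx.
  by move=> x _; rewrite gee0_abs// lee_fin relent_ge0.
rewrite [X in (- X)%E]integralE paj addye//.
by rewrite eqe_oppLR/=; apply/negbT; exact: (lt_eqF naj).
Qed.

Lemma entropyE (p : P2 R n) rho : is_density p rho ->
  entropy p = ((Afun p + @lapZ R n - 1)%:E - Dent rho)%E.
Proof.
move=> pr; rewrite /entropy.
suff -> : [set (- \int[L]_x (eta x * ln (eta x))%:E)%E | eta in is_density p] =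
    [set ((Afun p + @lapZ R n - 1)%:E - Dent rho)%E] by rewrite ereal_sup1.
apply/seteqP; split => [_ [eta pe <-]|_ ->]; last first.
  by exists rho => //; exact: integral_xlnx.
rewrite /= (integral_xlnx pe); congr (_ - _)%E; apply: ae_eq_integral => //.
- by apply/measurable_EFinP; apply: measurable_relent; case: pe.
- by apply/measurable_EFinP; apply: measurable_relent; case: pr.
- by apply: filterS (density_ae_eq pe pr) => x -> _.
Qed.

Lemma entropy_no_density (p : P2 R n) : (forall rho, ~ is_density p rho) -> entropy p = -oo%E.
Proof.
move=> np; rewrite /entropy (_ : [set _ | _ in _] = set0) ?ereal_sup0//.
by apply/seteqP; split => // x [rho /np].
Qed.

End entropy_limit.

(** * Laws with a given density, couplings, and the real value of W2 *)

Section density_probability.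
Context {R : realType} {n : nat}.
Local Notation V := 'rV[R]_n.
Local Notation L := (@lebesgue_rV R n).

Section weighted_probability.
Variables (rho : V -> R) (mr : measurable_fun setT rho) (r0 : forall x, 0 <= rho x).
Hypothesis r1 : (\int[L]_x (rho x)%:E = 1)%E.

Definition densityP of (\int[L]_x (rho x)%:E = 1)%E := weighted L mr r0.

Let w := weighted L mr r0.

HB.instance Definition _ := isMeasure.Build _ _ _ (densityP r1)
  (measure0 w) (measure_ge0 w) (@measure_semi_sigma_additive _ _ _ w).

Let densityP_setT : densityP r1 setT = 1%E.
Proof. exact: r1. Qed.

HB.instance Definition _ := Measure_isProbability.Build _ _ _ (densityP r1) densityP_setT.

End weighted_probability.

Lemma exists_density (rho : V -> R) : measurable_fun setT rho -> (forall x, 0 <= rho x) ->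
  (\int[L]_x (rho x)%:E = 1)%E -> (\int[L]_x (sqnorm x * rho x)%:E < +oo)%E ->
  exists p : P2 R n, is_density p rho.
Proof.
move=> mr r0 r1 r2.
have sm : (\int[densityP mr r0 r1]_x (sqnorm x)%:E < +oo)%E.
  rewrite (_ : integral _ _ _ = \int[L]_x (sqnorm x * rho x)%:E)%E//.
  apply: (integral_weighted L mr r0) => [|x]; last by rewrite lee_fin sqnorm_ge0.
  by apply/measurable_EFinP; exact: measurable_sqnorm.
by exists (MkP2 sm); split.
Qed.

Lemma sqnorm_le_l1norm (x : V) : sqnorm x <= l1norm x ^+ 2.
Proof.
rewrite expr2 {1}/l1norm mulr_suml; apply: ler_sum => i _.
rewrite -[leLHS]ger0_norm ?normrM; last by rewrite -expr2 sqr_ge0.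
rewrite ler_wpM2l// /l1norm (bigD1 i)//= lerDl.
by apply: sumr_ge0.
Qed.

Lemma sqnormB_le (x y : V) : sqnorm (x - y) <= 2 * sqnorm x + 2 * sqnorm y.
Proof.
rewrite /sqnorm /dot !mulr_sumr -big_split/=; apply: ler_sum => i _; rewrite !mxE.
have := sqr_ge0 (x ord0 i + y ord0 i); rewrite expr2; lra.
Qed.

(** Reference laws for the HWI inequality: [M = 1] shows that finite Fisher information forces
    finite entropy, and a small [M] supplies the large entropy used in [fisher_gt0]. *)
Lemma exists_laplace M : 0 < M -> exists2 q : P2 R n, is_density q (kern M) &
  entropy q = (M * Afun q + ln ((lap_mass / M) ^+ n))%:E.
Proof.
move=> M0; have c0 : 0 < (lap_mass / M) ^+ n :> R by rewrite exprn_gt0// divr_gt0// lap_mass_gt0.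
have k0 (x : V) : 0 <= kern M x by exact/ltW/kern_gt0.
have mk := @measurable_kern R n M.
have [q qk] : exists q : P2 R n, is_density q (kern M).
  apply: exists_density => //; first exact: integral_kern.
  have M2 : 0 < M / 2 by rewrite divr_gt0.
  (* With L the l1 norm and y = M L / 4, the bound y <= exp y squared reads L^2 <= (16 / M^2) exp(M
     L / 2). *)
  pose c := 16 / M ^+ 2 / (lap_mass / M) ^+ n.
  have cc0 : 0 <= c by rewrite !divr_ge0// ltW// exprn_gt0.
  apply: (@le_lt_trans _ _ (\int[L]_x (c * lap (M / 2) x)%:E)%E); last first.
    rewrite (ge0_integral_mull _ (measurable_lap _))//; last by move=> x; exact: expR_ge0.
    by rewrite integral_lap// -EFinM ltry.
  apply: ge0_le_integral => //.
  - by move=> x _; rewrite lee_fin mulr_ge0// sqnorm_ge0.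
  - by apply/measurable_EFinP; apply: measurable_funM => //; exact: measurable_sqnorm.
  - by apply/measurable_EFinP; apply: measurable_funM => //; exact: measurable_lap.
  - move=> x _; rewrite lee_fin /kern /c.
    have e1 (a b d : R) : a * (b / d) = a * b / d by ring.
    have e2 (a b d : R) : a / d * b = a * b / d by ring.
    rewrite e1 e2; apply: ler_wpM2r; first by rewrite invr_ge0 ltW.
    have -> : lap M x = lap (M / 2) x * lap (M / 2) x by rewrite /lap -expRD; congr expR; field.
    rewrite mulrA; apply: ler_wpM2r; first exact: expR_ge0.
    apply: (@le_trans _ _ (l1norm x ^+ 2 * lap (M / 2) x)).
      by apply: ler_wpM2r; [exact: expR_ge0 | exact: sqnorm_le_l1norm].
    rewrite /lap expRN ler_pdivrMr ?expR_gt0//.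
    set y := M * l1norm x / 4.
    have y0 : 0 <= y by rewrite !mulr_ge0 ?l1norm_ge0// ltW.
    have h1 : y <= expR y by apply: le_trans (expR_ge1Dx _); lra.
    have h2 : y ^+ 2 <= expR y ^+ 2 by apply: lerXn2r; rewrite ?nnegrE ?expR_ge0.
    have -> : expR (M / 2 * l1norm x) = expR y ^+ 2.
      by rewrite expr2 -expRD; congr expR; rewrite /y; field.
    have -> : l1norm x ^+ 2 = 16 / M ^+ 2 * y ^+ 2 by rewrite /y; field; rewrite gt_eqF.
    by apply: ler_wpM2l => //; rewrite divr_ge0// ltW// exprn_gt0.
exists q => //.
rewrite (entropyE qk) -(integral_xlnx qk).
have ml := @measurable_l1norm R n.
have Aq : (\int[L]_x (kern M x * l1norm x)%:E = (Afun q)%:E)%E.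
  rewrite -AfunE (integral_density qk).
  - by apply: eq_integral => x _; rewrite -EFinM mulrC.
  - exact/measurable_EFinP.
  - by move=> x; rewrite lee_fin l1norm_ge0.
rewrite (eq_integral (fun x => - ((M * (kern M x * l1norm x))%:E + (ln ((lap_mass / M) ^+ n) * kern M x)%:E))%E).
  have i1 : L.-integrable setT (fun x => (M * (kern M x * l1norm x))%:E).
    under eq_fun do rewrite EFinM; apply: integrableZl => //.
    apply/integrableP; split; first by apply/measurable_EFinP; exact: measurable_funM.
    rewrite (eq_integral (fun x => (kern M x * l1norm x)%:E)) ?Aq ?ltry// => x _.
    by rewrite gee0_abs// lee_fin mulr_ge0// l1norm_ge0.
  have i2 : L.-integrable setT (fun x => (ln ((lap_mass / M) ^+ n) * kern M x)%:E).
    under eq_fun do rewrite EFinM; apply: integrableZl => //; exact: (integrable_density qk).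
  under eq_integral do rewrite -EFinD -EFinN.
  rewrite (eq_integral (fun x => (-1)%:E * ((M * (kern M x * l1norm x))%:E + (ln ((lap_mass / M) ^+ n) * kern M x)%:E))%E).
    rewrite integralZl//; last exact: integrableD.
    rewrite mulN1e oppeK integralD// (ge0_integral_mull _ _ _ (ltW M0)) ?Aq; first last.
    - by move=> x; rewrite mulr_ge0// l1norm_ge0.
    - exact: measurable_funM.
    under [X in (_ + X)%E]eq_integral do rewrite EFinM.
    rewrite integralZl//; last exact: (integrable_density qk).
    by rewrite integral_kern// mule1 -EFinM -EFinD.
  by move=> x _; rewrite -EFinD -EFinM mulN1r.
move=> x _; rewrite -EFinD -EFinN; congr EFin.
have -> : ln (kern M x) = - (M * l1norm x) - ln ((lap_mass / M) ^+ n).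
  by rewrite /kern lnM ?posrE ?expR_gt0 ?invr_gt0// lnV ?posrE// /lap expRK.
ring.
Qed.

Lemma coupling_prod (p q : P2 R n) : coupling p q (p \x q)%E.
Proof.
move=> A mA; split; rewrite -[X in X = _]/((product_measure1 p q) _) product_measure1E//.
  by rewrite -[RHS]mule1; congr (_ * _)%E; exact: probability_setT.
by rewrite -[RHS]mul1e; congr (_ * _)%E; exact: probability_setT.
Qed.

Lemma coupling_cost_lty (p q : P2 R n) pi : coupling p q pi ->
  (\int[pi]_z (sqnorm (z.1 - z.2))%:E < +oo)%E.
Proof.
move=> cp.
have ms := @measurable_sqnorm R n.
have s0 := @sqnorm_ge0 R n.
have m2 : measurable_fun setT (fun x : V => 2 * sqnorm x) by exact: measurable_funM.
have I (r : P2 R n) : (\int[r]_x (2 * sqnorm x)%:E < +oo)%E.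
  rewrite (ge0_integral_mull _ ms s0)// lte_mul_pinfty//.
  exact: second_moment.
have m1 : measurable_fun setT (fun z : V * V => (2 * sqnorm z.1)%:E : \bar R).
  by apply/measurable_EFinP; exact: (measurableT_comp m2 measurable_fst).
have m1' : measurable_fun setT (fun z : V * V => (2 * sqnorm z.2)%:E : \bar R).
  by apply/measurable_EFinP; exact: (measurableT_comp m2 measurable_snd).
have p1 (x : V) : (0 <= (2 * sqnorm x)%:E :> \bar R)%E by rewrite lee_fin mulr_ge0.
apply: (@le_lt_trans _ _ (\int[pi]_z ((2 * sqnorm z.1)%:E + (2 * sqnorm z.2)%:E))%E).
  apply: ge0_le_integral => //.
  - by move=> z _; rewrite lee_fin.
  - apply/measurable_EFinP; apply: (measurableT_comp ms).
    rewrite (_ : (fun z : V * V => z.1 - z.2) = (fun z => z.1 + (-1) *: z.2)).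
      by apply: measurable_rVD; [exact: measurable_fst|apply: measurable_rVZ => //; exact: measurable_snd].
    by apply/funext => z; rewrite scaleN1r.
  - exact: emeasurable_funD.
  - by move=> z _; rewrite -EFinD lee_fin sqnormB_le.
rewrite (ge0_integralD pi measurableT (fun z _ => p1 z.1) m1 (fun z _ => p1 z.2) m1').
rewrite (integral_coupling1 (h := fun x => (2 * sqnorm x)%:E) cp)//; last exact/measurable_EFinP.
rewrite (integral_coupling2 (h := fun x => (2 * sqnorm x)%:E) cp)//; last exact/measurable_EFinP.
exact: lte_add_pinfty.
Qed.

(** The infimum is used through couplings of cost below any C > w^2. It is finite because the
    product coupling has finite cost, by the second moments. *)
Lemma W2P (p q : P2 R n) : exists w : R, [/\ 0 <= w, W2 p q = w%:E,
  forall pi, coupling p q pi -> ((w ^+ 2)%:E <= \int[pi]_z (sqnorm (z.1 - z.2))%:E)%E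
  & forall C, w ^+ 2 < C -> exists pi C', [/\ coupling p q pi, 0 <= C', C' < C &
      (\int[pi]_z (sqnorm (z.1 - z.2))%:E = C'%:E)%E]].
Proof.
rewrite /W2; set A := [set c | _]; set m := ereal_inf A.
have A0 c : A c -> (0 <= c)%E.
  by move=> [pi _ ->]; apply: integral_ge0 => z _; rewrite lee_fin sqnorm_ge0.
have m0 : (0 <= m)%E by apply: le_ereal_inf_tmp => c /A0.
have moo : (m < +oo)%E.
  apply: le_lt_trans (coupling_cost_lty (coupling_prod p q)).
  by apply: ereal_inf_lbound; exists (p \x q)%E => //; exact: coupling_prod.
have mE : m = (fine m)%:E by rewrite fineK// ge0_fin_numE.
have fm0 : 0 <= fine m by exact: fine_ge0.
exists (Num.sqrt (fine m)); rewrite sqr_sqrtr//; split => //.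
- by rewrite {1}mE.
- by move=> pi cp; rewrite -mE; apply: ereal_inf_lbound; exists pi.
- move=> C mC; have : (m < C%:E)%E by rewrite mE lte_fin.
  move=> /ereal_inf_lt[c [pi cp ->] cC].
  have c0 : (0 <= \int[pi]_z (sqnorm (z.1 - z.2))%:E)%E by apply: A0; exists pi.
  have cE : (\int[pi]_z (sqnorm (z.1 - z.2))%:E = (fine (\int[pi]_z (sqnorm (z.1 - z.2))%:E))%:E)%E.
    by rewrite fineK// ge0_fin_numE// (lt_trans cC)// ltry.
  exists pi, (fine (\int[pi]_z (sqnorm (z.1 - z.2))%:E)); split => //.
    exact: fine_ge0.
  by rewrite -lte_fin -cE.
Qed.

Lemma le_mul_of_young (x j w : R) : 0 <= j -> 0 <= w ->
  (forall S eps C, 0 < S -> 0 < eps -> w ^+ 2 < C ->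
    x <= S / 2 * j ^+ 2 * (1 + eps) + C / (2 * S)) -> x <= j * w.
Proof.
move=> j0 w0 H.
have H1 S : 0 < S -> x <= S / 2 * j ^+ 2 + w ^+ 2 / (2 * S).
  move=> S0; apply/ler_addgt0Pr => d d0.
  have Sj : 0 < S * j ^+ 2 + 1 by rewrite ltr_wpDl// mulr_ge0 ?sqr_ge0// ltW.
  have e0 : 0 < d / (S * j ^+ 2 + 1) by rewrite divr_gt0.
  have Sd : w ^+ 2 < w ^+ 2 + S * d by rewrite ltrDl mulr_gt0.
  apply: le_trans (H _ _ _ S0 e0 Sd) _.
  have -> : (w ^+ 2 + S * d) / (2 * S) = w ^+ 2 / (2 * S) + d / 2 by field; rewrite gt_eqF.
  have : S * j ^+ 2 * (d / (S * j ^+ 2 + 1)) <= d.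
    rewrite mulrCA ger_pMr// ler_pdivrMr// mul1r; lra.
  lra.
apply/ler_addgt0Pr => d0 d00.
(* The optimal time is S = w / j. Either number may be 0, so both are shifted by [d], chosen so
   small that the loss d (j + w) / 2 stays below [d0]. *)
pose d := d0 / (j + w + 1).
have jw : 0 < j + w + 1 by lra.
have d_gt0 : 0 < d by rewrite divr_gt0.
have wd : 0 < w + d by lra.
have jd : 0 < j + d by lra.
apply: le_trans (H1 ((w + d) / (j + d)) (divr_gt0 wd jd)) _.
have h1 : (w + d) / (j + d) / 2 * j ^+ 2 <= (w + d) * j / 2.
  have -> : (w + d) / (j + d) / 2 * j ^+ 2 = (w + d) * j / 2 * (j / (j + d)).
    by field; rewrite gt_eqF.
  apply: ler_piMr; first by rewrite divr_ge0// mulr_ge0// ltW.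
  by rewrite ler_pdivrMr// mul1r; lra.
have h2 : w ^+ 2 / (2 * ((w + d) / (j + d))) <= w * (j + d) / 2.
  have -> : w ^+ 2 / (2 * ((w + d) / (j + d))) = w * (j + d) / 2 * (w / (w + d)).
    by field; rewrite !gt_eqF.
  apply: ler_piMr; first by rewrite divr_ge0// mulr_ge0// ltW.
  by rewrite ler_pdivrMr// mul1r; lra.
have h3 : d * (j + w + 1) = d0 by rewrite /d divfK// gt_eqF.
nra.
Qed.

(** * The HWI inequality and its first consequences *)

Section hwi.
Variables (p : P2 R n) (rho : V -> R) (G : V -> V) (J : R).
Hypotheses (pr : is_density p rho) (wG : plateau_gradient rho G)
  (GJ : (\int[L]_x (sqnorm (G x) / rho x)%:E = J%:E)%E).

Let mr : measurable_fun setT rho. Proof. by case: pr. Qed.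
Let r0 x : 0 <= rho x. Proof. by case: pr. Qed.
Let mG i : measurable_fun setT (fun x => G x ord0 i).
Proof. by case: (wG i) => /integrableP[/measurable_EFinP]. Qed.

(** [weak_derivative_vanishes] says that [G] is 0 almost everywhere on the zero set of [rho]; this
    version is 0 there at every point, which the Cauchy-Schwarz step of the smoothing asks for. *)
Let G' (x : V) : V := if rho x == 0 then 0 else G x.

Let mG' i : measurable_fun setT (fun x => G' x ord0 i).
Proof.
have -> : (fun x => G' x ord0 i) = (fun x => if rho x == 0 then 0 else G x ord0 i).
  by apply/funext => x; rewrite /G'; case: ifP => // _; rewrite mxE.
apply: measurable_fun_ifT => //; exact: measurable_fun_eqr.
Qed.

Lemma weak_gradient_ae i : {ae L, forall x, G' x ord0 i = G x ord0 i}.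
Proof.
have [ig wg] := wG i.
apply: filterS (weak_derivative_vanishes (integrable_density pr) r0 ig wg) => x h.
by rewrite /G'; case: eqP => // /h ->; rewrite mxE.
Qed.

Lemma weak_gradient_vanish : [/\ plateau_gradient rho G',
  forall i x, rho x = 0 -> G' x ord0 i = 0
  & (\int[L]_x (sqnorm (G' x) / rho x)%:E = J%:E)%E].
Proof.
split.
- move=> i; have [ig wg] := wG i; split.
    apply: (le_integrable measurableT _ _ ig); first exact/measurable_EFinP.
    move=> x _; rewrite /G'; case: ifP => // _; by rewrite mxE abse0 abse_ge0.
  move=> k a b; rewrite wg; congr (- _)%E; apply: ae_eq_integral => //.
  + by apply/measurable_EFinP; apply: measurable_funM => //; exact: measurable_plateaux.
  + by apply/measurable_EFinP; apply: measurable_funM => //; exact: measurable_plateaux.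
  + by apply: filterS (weak_gradient_ae i) => x -> _.
- by move=> i x rx; rewrite /G' rx eqxx mxE.
- rewrite -GJ; apply: eq_integral => x _; congr EFin.
  by rewrite /G'; case: eqP => // ->; rewrite invr0 !mulr0.
Qed.

Let Ji i := fine (\int[L]_x ((G' x ord0 i) ^+ 2 / rho x)%:E)%E.

Let JiE : (forall i, \int[L]_x ((G' x ord0 i) ^+ 2 / rho x)%:E = (Ji i)%:E)%E /\ \sum_i Ji i = J.
Proof.
have [_ _ GJ'] := weak_gradient_vanish.
have mq i : measurable_fun setT (fun x => (G' x ord0 i) ^+ 2 / rho x).
  by apply: measurable_funM; [exact: measurable_funX | exact: measurable_fun_inv].
have q0 i x : 0 <= (G' x ord0 i) ^+ 2 / rho x by rewrite divr_ge0 ?sqr_ge0.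
have S : (\sum_i \int[L]_x ((G' x ord0 i) ^+ 2 / rho x)%:E = J%:E)%E.
  rewrite -GJ' -ge0_integral_sum//.
  - apply: eq_integral => x _; rewrite sumEFin; congr EFin.
    by rewrite -mulr_suml; congr (_ / _); apply: eq_bigr => i _; rewrite expr2.
  - by move=> i; exact/measurable_EFinP.
  - by move=> i x _; rewrite lee_fin.
have I0 i : (0 <= \int[L]_x ((G' x ord0 i) ^+ 2 / rho x)%:E)%E.
  by apply: integral_ge0 => x _; rewrite lee_fin.
have E1 i : (\int[L]_x ((G' x ord0 i) ^+ 2 / rho x)%:E = (Ji i)%:E)%E.
  rewrite fineK// ge0_fin_numE//; apply: (@le_lt_trans _ _ J%:E); last exact: ltry.
  by rewrite -S (bigD1 i)//= leeDl// sume_ge0.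
split => //; apply: EFin_inj; rewrite -S -sumEFin.
by apply: eq_bigr => i _; rewrite E1.
Qed.

Lemma fisher_ge0 : 0 <= J.
Proof.
rewrite -lee_fin -GJ; apply: integral_ge0 => x _.
by rewrite lee_fin divr_ge0// sqnorm_ge0.
Qed.

Let hwi_real (q : P2 R n) eta w : is_density q eta -> W2 p q = w%:E ->
  (Dent eta < +oo)%E ->
  (Dent rho < +oo)%E /\
  (Afun q - fine (Dent eta)) - (Afun p - fine (Dent rho)) <= Num.sqrt J * w.
Proof.
move=> qe pq De.
have [GE sumJ] := JiE; have [wG' vG _] := weak_gradient_vanish.
have [w' [w0 w'E _ inf]] := W2P p q; rewrite pq in w'E; case: w'E => ww'; subst w'.
have J0 i : 0 <= Ji i.
  by apply: fine_ge0; apply: integral_ge0 => x _; rewrite lee_fin divr_ge0 ?sqr_ge0.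
have D0 h : (forall x, 0 <= h x) -> (0 <= Dent h)%E.
  by move=> h0; apply: integral_ge0 => x _; rewrite lee_fin relent_ge0.
have e0 x : 0 <= eta x by case: qe.
have Dd : Dent eta = (fine (Dent eta))%:E by rewrite fineK// ge0_fin_numE// D0.
have H S eps C : 0 < S -> 0 < eps -> w ^+ 2 < C ->
    ((Afun q)%:E + Dent rho <= (fine (Dent eta) +
      (Afun p + S / 2 * J * (1 + eps) + C / (2 * S)))%:E)%E.
  move=> S0 ep0 /inf[pi [C' [cp C0 CC CE]]].
  have := hwi_limit pr wG' vG J0 _ qe cp S0 ep0 CE.
  rewrite sumJ => H0; apply: (le_trans (H0 _)); first by move=> i; rewrite GE.
  by rewrite {1}Dd -EFinD lee_fin !lerD2l ler_wpM2r ?ltW// invr_gt0 mulr_gt0.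
have Dr : (Dent rho < +oo)%E.
  have wl : w ^+ 2 < w ^+ 2 + 1 by rewrite ltrDl.
  have := H 1 1 _ ltr01 ltr01 wl.
  by rewrite -leeBrDl// => /le_lt_trans; apply; rewrite -EFinB ltry.
have Drr : Dent rho = (fine (Dent rho))%:E by rewrite fineK// ge0_fin_numE// D0.
split => //; apply: le_mul_of_young; rewrite ?sqrtr_ge0// => S eps C S0 ep0 /(H _ _ _ S0 ep0).
rewrite Drr -EFinD lee_fin sqr_sqrtr ?fisher_ge0//; lra.
Qed.

(** The HWI inequality from [p] to a Laplace law, whose entropy is finite, bounds the entropy of [p]
    from below. *)
Lemma entropy_fin_num : entropy p \is a fin_num.
Proof.
have [q qk qE] := exists_laplace ltr01.
have [w [_ wE _ _]] := W2P p q.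
have [] := @hwi_real q _ w qk wE.
  move: qE; rewrite (entropyE qk); case: (Dent _) => //=.
  by move=> *; exact: ltry.
move=> Dr _; have : Dent rho \is a fin_num.
  rewrite ge0_fin_numE//; apply: integral_ge0 => x _.
  by rewrite lee_fin relent_ge0.
by move=> h; rewrite (entropyE pr) -(fineK h) -EFinB.
Qed.

Theorem entropy_hwi (q : P2 R n) w : W2 p q = w%:E ->
  (entropy q <= entropy p + (Num.sqrt J * w)%:E)%E.
Proof.
move=> wE.
have [[eta qe]|nq] := pselect (exists eta, is_density q eta); last first.
  by rewrite entropy_no_density ?leNye// => eta qe; apply: nq; exists eta.
rewrite (entropyE qe).
have [De|] := ltP (Dent eta) +oo%E; last by rewrite leye_eq => /eqP ->; rewrite leNye.
have [Dr H] := hwi_real qe wE De.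
rewrite (entropyE pr).
have D0 (h : V -> R) : (forall x, 0 <= h x) -> (0 <= Dent h)%E.
  by move=> h0; apply: integral_ge0 => x _; rewrite lee_fin relent_ge0.
have -> : Dent eta = (fine (Dent eta))%:E.
  by rewrite fineK// ge0_fin_numE// D0//; case: qe.
have -> : Dent rho = (fine (Dent rho))%:E by rewrite fineK// ge0_fin_numE// D0.
by rewrite -!EFinB -EFinD lee_fin; lra.
Qed.

(** If J were 0, the HWI inequality would make the entropy of [p] maximal among all laws. The rate
    lap_mass exp(- h) normalizes by exp(n h), which yields a Laplace law of entropy at least n h,
    above that of [p]. *)
Lemma fisher_gt0 : (0 < n)%N -> 0 < J.
Proof.
move=> n0; rewrite lt0r fisher_ge0 andbT; apply/eqP => J0.
have hp := entropy_fin_num.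
pose h := `|fine (entropy p)| + 1.
have h0 : 0 < h by rewrite ltr_wpDl.
have M0 : 0 < lap_mass * expR (- h) :> R by rewrite mulr_gt0 ?lap_mass_gt0 ?expR_gt0.
have [q qk qE] := exists_laplace M0.
have [w [_ wE _ _]] := W2P p q.
have := entropy_hwi wE; rewrite J0 sqrtr0 mul0r adde0 qE -(fineK hp) lee_fin.
have -> : lap_mass / (lap_mass * expR (- h)) = expR h :> R.
  by rewrite invfM mulrA divff ?gt_eqF ?lap_mass_gt0// mul1r expRN invrK.
rewrite -expRM_natl expRK => H.
have A0 : 0 <= Afun q by apply: fine_ge0; apply: integral_ge0 => x _; rewrite lee_fin l1norm_ge0.
have := ler_norm (fine (entropy p)).
have h1 : h <= n%:R * h by apply: ler_peMl; [exact: ltW | rewrite ler1n].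
have := mulr_ge0 (ltW M0) A0; rewrite /h in h1 H *; lra.
Qed.

End hwi.

End density_probability.

(** * Density of the span of plateaux in L^2 of a law *)

Section density_of_plateaux.
Context {R : realType} {n : nat}.
Local Notation V := 'rV[R]_n.
Local Notation E i := (delta_mx ord0 i : V).

(** The relation carries the partial derivatives along with the function, so that every combination
    comes with explicit ones. *)
Inductive plateau_span : (V -> R) -> ('I_n -> V -> R) -> Prop :=
| plateau_span_gen k a b : plateau_span (plateaux k a b) (fun i => dplateaux i k a b)
| plateau_span_comb f d g e c : plateau_span f d -> plateau_span g e ->
    plateau_span (fun x => f x + c * g x) (fun i x => d i x + c * e i x).

Lemma continuous_plateaux k a b : continuous (plateaux k a b : V -> R).
Proof.
apply: continuous_tensor => i; exact: is_derive_continuous (is_derive_plateau k (a i) (b i)).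
Qed.

Lemma continuous_dplateaux i k a b : continuous (dplateaux i k a b : V -> R).
Proof.
apply: continuous_tensor => j; case: ifP => _; first exact: continuous_dplateau.
exact: is_derive_continuous (is_derive_plateau k (a j) (b j)).
Qed.

Lemma is_derive_plateaux i k a b (x : V) :
  is_derive x (E i) (plateaux k a b : V -> R) (dplateaux i k a b x).
Proof.
apply: (is_derive_tensor (g' := fun i => dplateau k (a i) (b i))) => u.
exact: is_derive_plateau.
Qed.

Lemma plateau_span_regular f d : plateau_span f d ->
  [/\ continuous f, forall i, continuous (d i), forall i x, is_derive x (E i) f (d i x)
    & exists2 B, 0 <= B & forall x, `|f x| <= B /\ forall i, `|d i x| <= B].
Proof.
elim=> {f d} [k a b|f d g e c _ [cf cd ff [B B0 fB]] _ [cg ce gg [C C0 gC]]].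
  split.
  - exact: continuous_plateaux.
  - by move=> i; exact: continuous_dplateaux.
  - by move=> i x; exact: is_derive_plateaux.
  - have /boolp.choice[B HB] : forall i, exists B, 0 <= B /\ forall x : V, `|dplateaux i k a b x| <= B.
      by move=> i; have [B B0 HB] := dplateaux_bounded (R := R) i k a b; exists B.
    have s0 : 0 <= \sum_i B i by apply: sumr_ge0 => i _; case: (HB i).
    exists (1 + \sum_i B i); first by rewrite addr_ge0.
    move=> x; split; first by rewrite ger0_norm ?plateaux_ge0// (le_trans (plateaux_le1 _ _ _ _))// lerDl.
    move=> i; have [_ /(_ x)/le_trans] := HB i; apply.
    rewrite (bigD1 i)//= addrCA lerDl addr_ge0//; apply: sumr_ge0 => j _.
    by case: (HB j).
split.
- by move=> x; exact: (cvgD (cf x) (cvgM (cvg_cst c) (cg x))).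
- by move=> i x; exact: (cvgD (cd i x) (cvgM (cvg_cst c) (ce i x))).
- move=> i x.
  have H1 := ff i x; have H2 := gg i x.
  have -> : (fun x => f x + c * g x) = f + c *: g by apply/funext => y; rewrite !fctE.
  exact: (is_deriveD H1 (is_deriveZ c H2)).
- exists (B + `|c| * C); first by rewrite addr_ge0// mulr_ge0.
  move=> x; have [h1 h2] := fB x; have [h3 h4] := gC x; split.
    by rewrite (le_trans (ler_normD _ _))// lerD// normrM ler_wpM2l.
  by move=> i; rewrite (le_trans (ler_normD _ _))// lerD// normrM ler_wpM2l.
Qed.

Lemma plateau_span_measurable f d : plateau_span f d -> measurable_fun setT f.
Proof.
elim=> {f d} [k a b|f d g e c _ mf _ mg]; first exact: measurable_plateaux.
by apply: measurable_funD => //; exact: measurable_funM.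
Qed.

Lemma plateau_span_dmeasurable f d i : plateau_span f d -> measurable_fun setT (d i).
Proof.
elim=> {f d} [k a b|f d g e c _ mf _ mg]; first exact: measurable_dplateaux.
by apply: measurable_funD => //; exact: measurable_funM.
Qed.

Lemma plateau_span_gradient (rho : V -> R) (G : V -> V) f d i :
  (lebesgue_rV n).-integrable setT (EFin \o rho) -> plateau_gradient rho G ->
  plateau_span f d ->
  (\int[lebesgue_rV n]_x (rho x * d i x)%:E =
   - \int[lebesgue_rV n]_x (G x ord0 i * f x)%:E)%E.
Proof.
move=> ir wG; have [ig wg] := wG i.
elim=> {f d} [k a b|f d g e c sf IHf sg IHg].
  rewrite -wg; apply: eq_integral => x _; congr (_ * _)%:E.
  by rewrite (partial_tensor (g' := fun i => dplateau k (a i) (b i)))// => j; exact: C1c_plateau.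
have [_ _ _ [B _ fB]] := plateau_span_regular sf.
have [_ _ _ [C _ gC]] := plateau_span_regular sg.
have i1 := integrable_mul_bounded ir (plateau_span_dmeasurable i sf) (fun x => (fB x).2 i).
have i2 := integrable_mul_bounded ir (plateau_span_dmeasurable i sg) (fun x => (gC x).2 i).
have j1 := integrable_mul_bounded ig (plateau_span_measurable sf) (fun x => (fB x).1).
have j2 := integrable_mul_bounded ig (plateau_span_measurable sg) (fun x => (gC x).1).
have i2c := integrableZl measurableT c i2.
have j2c := integrableZl measurableT c j2.
rewrite (eq_integral (fun x => (rho x * d i x)%:E + c%:E * (rho x * e i x)%:E)%E); last first.
  by move=> x _; rewrite -EFinM -EFinD; congr EFin; ring.
rewrite [in RHS](eq_integral (fun x => (G x ord0 i * f x)%:E + c%:E * (G x ord0 i * g x)%:E)%E); last first.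
  by move=> x _; rewrite -EFinM -EFinD; congr EFin; ring.
rewrite !integralD// !integralZl// IHf IHg fin_num_oppeD ?muleN//.
by rewrite fin_numM// integrable_fin_num.
Qed.

Variable p : probability V R.

Definition approximable (f : V -> R) := forall eps, 0 < eps -> exists g d,
  plateau_span g d /\ (\int[p]_x ((f x - g x) ^+ 2)%:E < eps%:E)%E.

Let m2 (f g : V -> R) : measurable_fun setT f -> measurable_fun setT g ->
  measurable_fun setT (fun x => ((f x - g x) ^+ 2)%:E : \bar R).
Proof.
by move=> mf mg; apply/measurable_EFinP; apply: measurable_funX; exact: measurable_funB.
Qed.

Let sqr_split (f1 f2 g1 g2 : V -> R) (c : R) : measurable_fun setT f1 -> measurable_fun setT f2 ->
  measurable_fun setT g1 -> measurable_fun setT g2 ->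
  (\int[p]_x ((f1 x + c * f2 x - (g1 x + c * g2 x)) ^+ 2)%:E <=
   2%:E * \int[p]_x ((f1 x - g1 x) ^+ 2)%:E +
   (2 * c ^+ 2)%:E * \int[p]_x ((f2 x - g2 x) ^+ 2)%:E)%E.
Proof.
move=> mf1 mf2 mg1 mg2.
have q1 : measurable_fun setT (fun x => (f1 x - g1 x) ^+ 2) by apply: measurable_funX; exact: measurable_funB.
have q2 : measurable_fun setT (fun x => (f2 x - g2 x) ^+ 2) by apply: measurable_funX; exact: measurable_funB.
have c2 : 0 <= 2 * c ^+ 2 by rewrite mulr_ge0 ?sqr_ge0.
rewrite -(ge0_integral_mull _ q1) -?(ge0_integral_mull _ q2)//; first last.
- by move=> x; exact: sqr_ge0.
- by move=> x; exact: sqr_ge0.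
have a1 x : (0 <= (2 * (f1 x - g1 x) ^+ 2)%:E :> \bar R)%E by rewrite lee_fin mulr_ge0 ?sqr_ge0.
have a2 x : (0 <= (2 * c ^+ 2 * (f2 x - g2 x) ^+ 2)%:E :> \bar R)%E by rewrite lee_fin mulr_ge0 ?sqr_ge0.
have b1 : measurable_fun setT (fun x => (2 * (f1 x - g1 x) ^+ 2)%:E : \bar R).
  by apply/measurable_EFinP; exact: measurable_funM.
have b2 : measurable_fun setT (fun x => (2 * c ^+ 2 * (f2 x - g2 x) ^+ 2)%:E : \bar R).
  by apply/measurable_EFinP; exact: measurable_funM.
rewrite -(ge0_integralD p measurableT (fun x _ => a1 x) b1 (fun x _ => a2 x) b2).
apply: ge0_le_integral => //.
- by move=> x _; rewrite lee_fin sqr_ge0.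
- by apply: m2; apply: measurable_funD => //; exact: measurable_funM.
- exact: emeasurable_funD.
- move=> x _; rewrite -EFinD lee_fin.
  have := sqr_ge0 (f1 x - g1 x - c * (f2 x - g2 x)); rewrite !expr2; lra.
Qed.

Lemma approximable_comb f g c : measurable_fun setT f -> measurable_fun setT g ->
  approximable f -> approximable g -> approximable (fun x => f x + c * g x).
Proof.
move=> mf mg af ag eps e0.
have e4 : 0 < eps / 4 by rewrite divr_gt0.
have c2 : 0 < 2 * c ^+ 2 + 1 by rewrite ltr_wpDl// mulr_ge0 ?sqr_ge0.
have e5 : 0 < eps / 2 / (2 * c ^+ 2 + 1) by rewrite !divr_gt0.
have [f' [d [sf fI]]] := af _ e4; have [g' [e [sg gI]]] := ag _ e5.
exists (fun x => f' x + c * g' x), (fun i x => d i x + c * e i x).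
split; first exact: plateau_span_comb.
apply: le_lt_trans (sqr_split c mf mg (plateau_span_measurable sf) (plateau_span_measurable sg)) _.
have h2 : ((2 * c ^+ 2)%:E * \int[p]_x ((g x - g' x) ^+ 2)%:E < (eps / 2)%:E)%E.
  apply: (@le_lt_trans _ _ ((2 * c ^+ 2)%:E * (eps / 2 / (2 * c ^+ 2 + 1))%:E)%E).
    by apply: lee_wpmul2l; [rewrite lee_fin mulr_ge0 ?sqr_ge0 | exact: ltW].
  rewrite -EFinM lte_fin mulrA ltr_pdivrMr//; nra.
have h1 : (2%:E * \int[p]_x ((f x - f' x) ^+ 2)%:E < (eps / 2)%:E)%E.
  have -> : ((eps / 2)%:E = 2%:E * (eps / 4)%:E :> \bar R)%E by rewrite -EFinM; congr EFin; field.
  by rewrite lte_pmul2l.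
have -> : (eps%:E = (eps / 2)%:E + (eps / 2)%:E :> \bar R)%E by rewrite -EFinD; congr EFin; field.
by apply: lteD.
Qed.

Lemma approximable_limit (f : V -> R) (g : nat -> V -> R) (h : V -> \bar R) :
  measurable_fun setT f -> (forall k, measurable_fun setT (g k)) ->
  (forall k, approximable (g k)) -> p.-integrable setT h ->
  (forall k x, (((f x - g k x) ^+ 2)%:E <= h x)%E) ->
  (forall x, g k x @[k --> \oo] --> f x) -> approximable f.
Proof.
move=> mf mg ag ih gh gf eps e0.
have e4 : 0 < eps / 4 by rewrite divr_gt0.
have mk k := m2 mf (mg k).
have c : {ae p, forall x, [set: V] x -> ((f x - g k x) ^+ 2)%:E @[k --> \oo] --> (cst 0%E x : \bar R)}.
  apply: aeW => x _; apply: cvg_EFin; first exact: nearW.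
  have h0 : f x - g k x @[k --> \oo] --> (0 : R).
    by rewrite -(subrr (f x)); apply: cvgB; [exact: cvg_cst | exact: gf].
  rewrite (_ : _ \o _ = fun k => (f x - g k x) * (f x - g k x)); last by apply/funext => k; rewrite /= expr2.
  by have := cvgM h0 h0; rewrite mulr0; apply.
have b : {ae p, forall x k, [set: V] x -> (`|((f x - g k x) ^+ 2)%:E| <= h x)%E}.
  by apply: aeW => x k _; rewrite gee0_abs// lee_fin sqr_ge0.
have [_ _ H] := dominated_convergence measurableT mk (measurable_cst _) c ih b.
rewrite integral0 in H.
have : \forall k \near \oo, (\int[p]_x ((f x - g k x) ^+ 2)%:E < (eps / 4)%:E)%E.
  have e4' : (0%E < (eps / 4)%:E)%E by rewrite lte_fin.
  exact: H _ (open_ereal_lt' e4').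
move=> [k _ /(_ k (leqnn k)) fk].
have [g' [d [sg gI]]] := ag k _ e4.
exists g', d; split => //.
pose z : V -> R := cst 0.
have mz : measurable_fun setT z by exact: measurable_cst.
have := sqr_split (f1 := f) (f2 := g k) (g1 := g k) (g2 := g') 1 mf (mg k) (mg k) (plateau_span_measurable sg).
rewrite (eq_integral (fun x => ((f x - g' x) ^+ 2)%:E)); last first.
  by move=> x _; congr (_ ^+ 2)%:E; ring.
rewrite expr1n mulr1 => /le_lt_trans; apply.
have -> : (eps%:E = 2%:E * (eps / 4)%:E + 2%:E * (eps / 4)%:E :> \bar R)%E.
  by rewrite -EFinM -EFinD; congr EFin; field.
by apply: lteD; rewrite lte_pmul2l.
Qed.

Lemma approximable_plateaux k a b : approximable (plateaux k a b).
Proof.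
move=> eps e0; exists (plateaux k a b), (fun i => dplateaux i k a b); split.
  exact: plateau_span_gen.
rewrite integral0_eq ?lte_fin// => x _.
by rewrite subrr expr0n.
Qed.

Let icst (c : R) : p.-integrable setT (fun=> c%:E).
Proof. exact: finite_measure_integrable_cst. Qed.

(** Dynkin's argument: the measurable sets with approximable indicator form a lambda-system that
    contains the boxes, which are stable under intersection and generate the Borel sets. *)
Lemma approximable_indic A : measurable A -> approximable \1_A.
Proof.
move=> mA; pose D := [set A | measurable A /\ approximable (\1_A : V -> R)].
suff: <<s @boxes R n >> `<=` D by rewrite -measurable_rV_boxes => /(_ A mA)[].
have bnd (B C : set V) (x : V) : (((\1_B x - \1_C x : R) ^+ 2)%:E <= 1%:E)%E.
  rewrite lee_fin !indicE expr2; do 2 case: (_ \in _) => /=; lra.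
have box_appr a b : approximable (\1_(box a b) : V -> R).
  apply: (@approximable_limit _ (fun k => plateaux k a b) (fun=> 1%:E)) => //.
  - exact: measurable_indic (measurable_box _ _).
  - by move=> k; exact: measurable_plateaux.
  - by move=> k; exact: approximable_plateaux.
  - move=> k x; have := plateaux_ge0 k a b x; have := plateaux_le1 k a b x.
    by rewrite lee_fin indicE expr2; case: (_ \in _) => /=; nra.
  - by move=> x; exact: cvg_plateaux.
have lim (F : nat -> set V) B : measurable B -> (forall k, D (F k)) ->
    (forall x, \1_(F k) x @[k --> \oo] --> (\1_B x : R)) -> D B.
  move=> mB DF FB; split => //.
  apply: (@approximable_limit _ (fun k => \1_(F k)) (fun=> 1%:E)) => //.
  - by move=> k; apply: measurable_indic; case: (DF k).
  - by move=> k; case: (DF k).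
have lims (F : nat -> set V) : nondecreasing_seq F -> (forall k, measurable (F k)) ->
    forall x, \1_(F k) x @[k --> \oo] --> (\1_(\bigcup_k F k) x : R).
  move=> nF mF x; have [[k _ Fkx]|nx] := pselect ((\bigcup_k F k) x).
    apply: cvg_near_cst; exists k => // m /= km.
    rewrite !indicE !mem_set//; first by exists k.
    by have /subsetPset := nF _ _ km; apply.
  apply: cvg_near_cst; apply: nearW => k.
  by rewrite !indicE !memNset// => Fk; apply: nx; exists k.
have mbox (a b : 'I_n -> R) := measurable_box a b.
apply: lambda_system_subset => //.
- exact: setI_closed_boxes.
- split => //.
  + rewrite -(boxes_cover (R := R) (n := n)).
    apply: (lim (fun k => cube k)).
    * by apply: bigcup_measurable => k _; exact: mbox.
    * by move=> k; split; [exact: mbox | exact: box_appr].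
    * apply: lims => [k l kl|k]; last exact: mbox.
      apply/subsetPset => x bx i; have /andP[h1 h2] := bx i.
      have kl' : (k%:R <= l%:R :> R) by rewrite ler_nat.
      by rewrite (le_lt_trans _ h1) ?lerN2//= (lt_le_trans h2).
  + move=> B C CB [mB aB] [mC aC]; split; first exact: measurableD.
    have -> : \1_(B `\` C) = (fun x => \1_B x + -1 * \1_C x) :> (V -> R).
      apply/funext => x; rewrite !indicE in_setD.
      have [Cx|Cx] := boolP (x \in C); last by rewrite andbT mulr0 addr0.
      by rewrite andbF mulN1r; move: Cx; rewrite inE => /CB /mem_set ->; rewrite subrr.
    by apply: approximable_comb => //; exact: measurable_indic.
  + move=> F nF DF; apply: (lim F) => //.
      by apply: bigcup_measurable => k _; case: (DF k).
    by apply: lims => // k; case: (DF k).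
- by move=> _ [a [b ->]]; split.
Qed.

Import HBNNSimple.

Lemma approximable_nnsfun (g : {nnsfun V >-> R}) : approximable g.
Proof.
have gE : (g : V -> R) = fun x : V => \sum_(r <- finmap.enum_fset (fset_set (range g))) r * \1_(g @^-1` [set r]) x.
  apply/funext => x; rewrite fimfunE fsbig_finite//.
rewrite gE.
have mi r : measurable (g @^-1` [set r]) by exact: measurable_sfunP.
elim: (finmap.enum_fset _) => [|r s IH].
  (* [plateau_span] has no constructor for 0, which is obtained as a plateau minus itself. *)
  move=> eps e0; exists (fun x => plateaux 0 (fun=> 0) (fun=> 0) x + -1 * plateaux 0 (fun=> 0) (fun=> 0) x).
  eexists; split; first by apply: plateau_span_comb; exact: plateau_span_gen.
  rewrite integral0_eq ?lte_fin// => x _.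
  by rewrite big_nil; congr EFin; ring.
rewrite (_ : (fun x => _) = fun x => \sum_(t <- s) t * \1_(g @^-1` [set t]) x + r * \1_(g @^-1` [set r]) x).
  apply: approximable_comb => //.
  - by apply: measurable_sum => t; apply: measurable_funM => //; exact: measurable_indic.
  - exact: approximable_indic.
by apply/funext => x; rewrite big_cons addrC.
Qed.

Lemma approximable_ge0 (f : V -> R) : measurable_fun setT f -> (forall x, 0 <= f x) ->
  (\int[p]_x (f x ^+ 2)%:E < +oo)%E -> approximable f.
Proof.
move=> mf f0 f2.
have mf' : measurable_fun setT (EFin \o f) by exact/measurable_EFinP.
pose g := nnsfun_approx measurableT mf'.
have gf k x : g k x <= f x.
  rewrite nnsfun_approxE; have := @le_approx _ _ _ setT (EFin \o f) k x (fun x _ => f0 x) I.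
  by rewrite lee_fin.
apply: (@approximable_limit _ (fun k => g k) (fun x => (f x ^+ 2)%:E)) => //.
- by move=> k; exact: approximable_nnsfun.
- apply/integrableP; split; first by apply/measurable_EFinP; exact: measurable_funX.
  rewrite (eq_integral (fun x => (f x ^+ 2)%:E))// => x _.
  by rewrite gee0_abs// lee_fin sqr_ge0.
- move=> k x; rewrite lee_fin; have g0 : 0 <= g k x by [].
  by have := gf k x; rewrite !expr2; nra.
- move=> x; have := @cvg_nnsfun_approx _ _ _ _ measurableT _ mf' (fun x _ => f0 x) x I.
  by move/fine_cvgP => [_].
Qed.

Lemma approximable_L2 (f : V -> R) : measurable_fun setT f ->
  (\int[p]_x (f x ^+ 2)%:E < +oo)%E -> approximable f.
Proof.
move=> mf f2.
pose fp x := Num.max (f x) 0; pose fm x := Num.max (- f x) 0.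
have mfp : measurable_fun setT fp by exact: measurable_maxr.
have mfm : measurable_fun setT fm by apply: measurable_maxr => //; exact: measurableT_comp.
have -> : f = fun x => fp x + -1 * fm x.
  apply/funext => x; rewrite /fp /fm mulN1r; case: (leP 0 (f x)) => h.
    by rewrite max_r ?oppr_le0// subr0.
  by rewrite max_l ?oppr_ge0 ?ltW// opprK add0r.
have le (h : V -> R) : measurable_fun setT h -> (forall x, h x ^+ 2 <= f x ^+ 2) ->
    (\int[p]_x (h x ^+ 2)%:E < +oo)%E.
  move=> mh hf; apply: le_lt_trans f2; apply: ge0_le_integral => //.
  - by move=> x _; rewrite lee_fin sqr_ge0.
  - by apply/measurable_EFinP; exact: measurable_funX.
  - by apply/measurable_EFinP; exact: measurable_funX.
  - by move=> x _; rewrite lee_fin.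
apply: approximable_comb => //; apply: approximable_ge0 => //.
- by move=> x; rewrite /fp le_max lexx orbT.
- apply: le => // x; rewrite /fp; case: (leP (f x) 0) => // _.
  by rewrite expr0n sqr_ge0.
- by move=> x; rewrite /fm le_max lexx orbT.
- apply: le => // x; rewrite /fm; case: (leP (- f x) 0) => _.
    by rewrite expr0n sqr_ge0.
  by rewrite sqrrN.
Qed.

End density_of_plateaux.

Lemma integrable_of_fin_num d (T : measurableType d) (R : realType)
    (mu : measure T R) (f : T -> \bar R) :
  measurable_fun setT f -> (\int[mu]_x f x)%E \is a fin_num -> mu.-integrable setT f.
Proof.
move=> mf; rewrite integralE fin_numB => /andP[h1 h2]; apply/integrableP; split => //.
have -> : (\int[mu]_x `|f x| = \int[mu]_x (f^\+ x + f^\- x))%E.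
  by apply: eq_integral => x _; rewrite -[RHS]/((f^\+ \+ f^\-)%E x) -fune_abse.
rewrite ge0_integralD//; first by rewrite lte_add_pinfty// ltey_eq ?h1 ?h2.
- exact: measurable_funepos.
- exact: measurable_funeneg.
Qed.

(** * Maps with a Jacobian and the entropy of image laws *)

Section jacobian_maps.
Context {R : realType} {n : nat}.
Local Notation V := 'rV[R]_n.
Local Notation L := (lebesgue_rV n).
Local Notation mu := lebesgue_measure.
Local Notation E i := (delta_mx ord0 i : V).

(** The change of variables formula itself serves as the definition of the Jacobian, and is stable
    under composition. The measurable left inverse is what the density of the image law is written
    with. *)
Definition jacobian_map (T : V -> V) (j : V -> R) :=
  [/\ measurable_fun setT T, measurable_fun setT j, forall x, 0 < j x,
    forall F : V -> \bar R, measurable_fun setT F -> (forall x, (0 <= F x)%E) ->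
      (\int[L]_x (F (T x) * (j x)%:E) = \int[L]_x F x)%E
  & exists2 S : V -> V, measurable_fun setT S & cancel T S].

Lemma jacobian_map_id : jacobian_map id (cst 1).
Proof.
split => //.
- by move=> F mF F0; apply: eq_integral => x _; rewrite mule1.
- by exists id.
Qed.

Lemma jacobian_map_comp T1 j1 T2 j2 : jacobian_map T1 j1 -> jacobian_map T2 j2 ->
  jacobian_map (T2 \o T1) (fun x => j2 (T1 x) * j1 x).
Proof.
move=> [mT1 mj1 j10 I1 [S1 mS1 TS1]] [mT2 mj2 j20 I2 [S2 mS2 TS2]]; split.
- exact: measurableT_comp.
- by apply: measurable_funM => //; exact: measurableT_comp.
- by move=> x; rewrite mulr_gt0.
- move=> F mF F0; rewrite -(I2 F mF F0) -(I1 (fun y => F (T2 y) * (j2 y)%:E)%E).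
  + by apply: eq_integral => x _; rewrite /= EFinM muleA.
  + by apply: emeasurable_funM; [exact: measurableT_comp | exact/measurable_EFinP].
  + by move=> x; apply: mule_ge0 => //; rewrite lee_fin ltW.
- exists (S1 \o S2); first exact: measurableT_comp.
  by move=> x /=; rewrite TS2 TS1.
Qed.

Lemma jacobian_map_signed T j (f : V -> R) : jacobian_map T j -> measurable_fun setT f ->
  (\int[L]_x (f (T x) * j x)%:E = \int[L]_x (f x)%:E)%E.
Proof.
move=> [mT mj j0 IT _] mf.
have pM (a c : R) : 0 < c -> Num.max (a * c) 0 = Num.max a 0 * c.
  by move=> c0; rewrite maxr_pMl ?mul0r// ltW.
rewrite integralE [RHS]integralE; congr (_ - _)%E.
- rewrite -(IT (fun x => ((EFin \o f)^\+ x))%E)//.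
  + apply: eq_integral => x _.
    by rewrite !unlock /= -!EFin_max -EFinM pM.
  + by apply: measurable_funepos; exact/measurable_EFinP.
- rewrite -(IT (fun x => ((EFin \o f)^\- x))%E)//.
  + apply: eq_integral => x _.
    by rewrite !unlock /= -?EFinN -!EFin_max -EFinM -mulNr pM.
  + by apply: measurable_funeneg; exact/measurable_EFinP.
Qed.

Section shear.
Variables (i : 'I_n) (xi d : V -> R) (t B : R).
Hypothesis (mxi : measurable_fun setT xi) (md : measurable_fun setT d).
Hypothesis cd : continuous d.
Hypothesis dxi : forall x, is_derive x (E i) xi (d x).
Hypothesis (dB : forall x, `|d x| <= B) (tB : t * B <= 2^-1) (t0 : 0 <= t).

Let tau (y : V) (s : R) := s + t * xi (y + s *: E i).

Let j12 (x : V) : 2^-1 <= 1 + t * d x.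
Proof.
have : `|t * d x| <= 2^-1 by rewrite normrM ger0_norm// (le_trans _ tB)// ler_wpM2l.
rewrite ler_norml => /andP[+ _]; lra.
Qed.

Let dtau (y : V) (s : R) : is_derive s (1 : R) (tau y) (1 + t * d (y + s *: E i)).
Proof.
have h := is_derive_on_line (dxi (y + s *: E i)).
exact: (is_deriveD (is_derive_id s (1 : R)) (is_deriveZ t h)).
Qed.

Let ctau y : continuous (fun s : R => 1 + t * d (y + s *: E i)).
Proof.
move=> s; apply: cvgD; first exact: cvg_cst.
apply: cvgM; first exact: cvg_cst.
apply: (@continuous_comp _ _ _ (fun s : R => y + s *: E i) d); last exact: cd.
apply: cvgD; first exact: cvg_cst.
by apply: cvgZr_tmp; exact: cvg_id.
Qed.

Let half_gt0 : 0 < 2^-1 :> R. Proof. by rewrite invr_gt0. Qed.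

Let tau_le y a b : (tau y a <= tau y b) = (a <= b).
Proof. exact: (expanding_leE half_gt0 (fun s => j12 _) (dtau y) (@ctau y)). Qed.

(** A shear moves points along the lines of one direction only, so the one-dimensional change of
    variables on each line suffices. The bound t B <= 1/2 keeps the derivative on a line at least
    1/2. *)
Lemma jacobian_map_shear :
  jacobian_map (fun x => x + (t * xi x) *: E i) (fun x => 1 + t * d x).
Proof.
have mT : measurable_fun setT (fun x : V => x + (t * xi x) *: E i).
  apply: measurable_rVD; first exact: measurable_id.
  by apply: measurable_rVZ; [exact: measurable_funM | exact: measurable_cst].
have mj : measurable_fun setT (fun x : V => 1 + t * d x).
  by apply: measurable_funD => //; exact: measurable_funM.
have j0 x : 0 < 1 + t * d x by exact: lt_le_trans (j12 x).
(* The preimage of [y] is y + s y e_i, where [s y] is the root of [tau y]. *)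
have /boolp.choice[s ys] : forall y, exists s, tau y s = 0.
  by move=> y; exact: (expanding_surj half_gt0 (fun s => j12 _) (dtau y) (@ctau y)).
split => //.
- move=> F mF F0; apply: (@eq_integral_lines _ _ i) => //.
  + by apply: emeasurable_funM; [exact: measurableT_comp | exact/measurable_EFinP].
  + by move=> x; apply: mule_ge0 => //; rewrite lee_fin ltW.
  + move=> x.
    have mFx : measurable_fun setT (fun s : R => F (x + s *: E i)) by apply: (measurableT_comp mF); exact: measurable_on_line.
    rewrite -(ge0_change_of_variable half_gt0 (fun s => j12 _) (dtau x) (@ctau x) mFx (fun s => F0 _)).
    by apply: eq_integral => r _; rewrite /tau scalerDl addrA.
- exists (fun y => y + s y *: E i).
    apply: measurable_rVD; first exact: measurable_id.
    apply: measurable_rVZ; last exact: measurable_cst.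
    apply: (measurability _ (RGenCInfty.measurableE R)) => _ [_ [a ->] <-].
    (* As [tau y] is increasing, its root is at least [a] exactly when tau y a <= 0, a measurable
       condition on [y]. *)
    have -> : setT `&` s @^-1` `[a, +oo[ = [set y : V | a + t * xi (y + a *: E i) <= 0].
      apply/seteqP; split => y /=.
        by move=> [_]; rewrite in_itv/= andbT -(tau_le y) ys.
      by move=> h; split => //; rewrite in_itv/= andbT -(tau_le y) ys.
    have mh : measurable_fun setT (fun y : V => a + t * xi (y + a *: E i)).
      apply: measurable_funD => //; apply: measurable_funM => //.
      by apply: (measurableT_comp mxi); exact: measurable_shift_rV.
    have := mh measurableT `]-oo, 0]%classic (measurable_itv _); rewrite setTI.
    by rewrite [X in measurable X -> _](_ : _ = [set y : V | a + t * xi (y + a *: E i) <= 0])//; apply/seteqP; split => y; rewrite /= in_itv.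
move=> x; set y := x + _.
suff -> : s y = - (t * xi x) by rewrite /y scaleNr addrK.
have e : tau y (- (t * xi x)) = 0 by rewrite /tau /y scaleNr addrK addNr.
apply/eqP; rewrite eq_le; apply/andP; split.
- by rewrite -(tau_le y (s y)) ys e.
- by rewrite -(tau_le y _ (s y)) ys e.
Qed.

End shear.

Section push.
Variables (p : P2 R n) (T : V -> V) (C : R).
Hypothesis mT : measurable_fun setT T.
Hypothesis TC : forall x, sqnorm (T x - x) <= C.

(** The coupling is the law of (x, T x). Bounded displacements keep the second moment finite. *)
Lemma exists_push : exists q : P2 R n,
  (forall A, measurable A -> q A = p (T @^-1` A)) /\
  forall w, W2 p q = w%:E -> ((w ^+ 2)%:E <= \int[p]_x (sqnorm (T x - x))%:E)%E.
Proof.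
pose q0 := distribution p (mfun_Sub (mem_set mT)).
have q2 : (\int[q0]_x (sqnorm x)%:E < +oo)%E.
  have -> : (\int[q0]_x (sqnorm x)%:E = \int[p]_x (sqnorm (T x))%:E)%E.
    rewrite /q0 /distribution ge0_integral_pushforward ?preimage_setT//.
    - by apply/measurable_EFinP; exact: measurable_sqnorm.
    - by move=> x _; rewrite lee_fin sqnorm_ge0.
  have i1 : (\int[p]_x (2 * sqnorm x + 2 * C)%:E < +oo)%E.
    have C0 : 0 <= C by exact: le_trans (sqnorm_ge0 _) (TC 0).
    rewrite (eq_integral (fun x => ((2 * sqnorm x)%:E + (2 * C)%:E)%E)); last first.
      by move=> x _; rewrite EFinD.
    rewrite ge0_integralD//=.
    - rewrite ge0_integral_mull//.
      + rewrite lte_add_pinfty//; first by rewrite lte_mul_pinfty//; exact: second_moment.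
        by rewrite integral_cst//= probability_setT mule1 ltry.
      + exact: measurable_sqnorm.
      + by move=> x; exact: sqnorm_ge0.
    - by move=> x _; rewrite lee_fin mulr_ge0// sqnorm_ge0.
    - by apply/measurable_EFinP; apply: measurable_funM => //; exact: measurable_sqnorm.
    - by move=> x _; rewrite lee_fin mulr_ge0.
  apply: le_lt_trans i1; apply: ge0_le_integral => //=.
  - by move=> x _; rewrite lee_fin sqnorm_ge0.
  - by apply/measurable_EFinP; apply: (measurableT_comp measurable_sqnorm).
  - apply/measurable_EFinP; apply: measurable_funD => //.
    by apply: measurable_funM => //; exact: measurable_sqnorm.
  - move=> x _; rewrite lee_fin.
    have := sqnormB_le (T x - x) (- x); rewrite opprK subrK sqnormN.
    by have := TC x; lra.
pose q := MkP2 q2; exists q; split => // w Ww.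
have mI : measurable_fun setT (fun x : V => (x, T x)).
  by apply/measurable_fun_pairP; split => //=; exact: measurable_id.
pose pi : probability (V * V)%type R := distribution p (mfun_Sub (mem_set mI)).
have cpi : coupling p q pi.
  move=> A mA; split; rewrite /pi /distribution /pushforward/=; congr (p _); apply/seteqP.
    by split => x //= [].
  by split => x //= [].
have [w' [_ Ww' /(_ _ cpi)/le_trans + _]] := W2P p q.
move: Ww'; rewrite Ww => -[<-]; apply.
rewrite /pi /distribution ge0_integral_pushforward ?preimage_setT//.
- rewrite le_eqVlt; apply/orP; left; apply/eqP; apply: eq_integral => x _.
  by rewrite /= -sqnormN opprB.
- apply/measurable_EFinP; apply: (measurableT_comp measurable_sqnorm).
  apply: measurable_fun_rVP => i; rewrite (_ : (fun x => _) = fun z : V * V => z.1 ord0 i - z.2 ord0 i).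
    by apply: measurable_funB; apply: (measurableT_comp (measurable_coord i)).
  by apply/funext => z; rewrite !mxE.
- by move=> z _; rewrite lee_fin sqnorm_ge0.
Qed.

End push.

(** The image density satisfies eta(T x) j(x) = rho(x), so that its logarithm at T x is ln rho - ln
    j; the bound on ln j makes the correction integrable. *)
Lemma entropy_push (p q : P2 R n) rho T j C : is_density p rho -> jacobian_map T j ->
  (forall A, measurable A -> q A = p (T @^-1` A)) ->
  (forall x, `|ln (j x)| <= C) -> entropy p \is a fin_num ->
  entropy q = (entropy p + \int[L]_x (rho x * ln (j x))%:E)%E.
Proof.
move=> pr TJ qT jC pf; have [mT mj j0 IT [S mS TS]] := TJ; have [mr r0 rI] := pr.
pose eta y := rho (S y) / j (S y).
have etaE x : eta (T x) * j x = rho x by rewrite /eta TS divfK// gt_eqF.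
have mje : measurable_fun setT (fun x => (j x)^-1).
  by apply: measurable_fun_inv => // x; exact: lt0r_neq0.
have meta : measurable_fun setT eta.
  by apply: measurable_funM; [exact: measurableT_comp | exact: (measurableT_comp mje)].
have eta0 y : 0 <= eta y by rewrite /eta divr_ge0// ltW.
have qe : is_density q eta.
  split => // A mA.
  have mTA : measurable (T @^-1` A) by rewrite -[X in measurable X]setTI; exact: mT.
  rewrite (qT A mA) (rI _ mTA).
  rewrite integral_mkcond [RHS]integral_mkcond -(IT ((fun y => (eta y)%:E) \_ A)).
  - apply: eq_integral => x _; rewrite !patchE -etaE.
    have -> : (x \in T @^-1` A) = (T x \in A) by apply/idP/idP; rewrite !inE.
    by case: ifP; rewrite ?mul0e// EFinM.
  - by apply/(measurable_restrictT _ mA); apply: measurable_funTS; exact/measurable_EFinP.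
  - by move=> x; rewrite patchE; case: ifP => //; rewrite lee_fin.
rewrite (entropyE qe) -(integral_xlnx qe) (entropyE pr) -(integral_xlnx pr).
have mf : measurable_fun setT (fun y => eta y * ln (eta y)).
  by apply: measurable_funM => //; apply: measurableT_comp => //; exact: measurable_ln.
rewrite -(jacobian_map_signed TJ mf).
have mrl : measurable_fun setT (fun x => (rho x * ln (rho x))).
  by apply: measurable_funM => //; apply: measurableT_comp => //; exact: measurable_ln.
have i1 : L.-integrable setT (fun x => (rho x * ln (rho x))%:E).
  apply: integrable_of_fin_num; first exact/measurable_EFinP.
  by rewrite -fin_numN; rewrite (entropyE pr) -(integral_xlnx pr) in pf.
have mlj : measurable_fun setT (fun x => ln (j x)) by apply: measurableT_comp => //; exact: measurable_ln.
have i2 := integrable_mul_bounded (integrable_density pr) mlj jC.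
rewrite (eq_integral (fun x => (rho x * ln (rho x))%:E - (rho x * ln (j x))%:E)%E); last first.
  move=> x _; rewrite -EFinB; congr EFin.
  have [rx|rx] := eqVneq (rho x) 0.
    by rewrite rx !mul0r subr0 -mulrA (mulrC _ (j x)) mulrA etaE rx mul0r.
  have rx0 : 0 < rho x by rewrite lt0r rx r0.
  rewrite -mulrA (mulrC _ (j x)) mulrA etaE -mulrBr /eta TS lnM ?posrE ?invr_gt0//.
  by rewrite lnV ?posrE.
rewrite integralB//= fin_num_oppeB//.
exact: integrable_fin_num.
Qed.

End jacobian_maps.

(** From below, ln(1 + u) >= u / (1 + u) = u - u^2 / (1 + u), by ln t <= t - 1 at t = 1 / (1 + u);
    the last term is at most 2 u^2 when |u| <= 1/2. *)
Lemma ln1D_ge (R : realType) (u : R) : `|u| <= 2^-1 -> u - 2 * u ^+ 2 <= ln (1 + u) <= u.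
Proof.
rewrite ler_norml => /andP[u1 u2]; have u0 : 0 < 1 + u by lra.
have h : (1 + u) * (1 + u)^-1 = 1 by rewrite divff// gt_eqF.
have := ln_le_subr1 u0; rewrite addrAC subrr add0r => ->; rewrite andbT.
have i0 : 0 < (1 + u)^-1 by rewrite invr_gt0.
have := ln_le_subr1 i0; rewrite lnV ?posrE// => h1; rewrite expr2; nra.
Qed.

(** * Composition of shears, one per coordinate *)

Section push_all_coordinates.
Context {R : realType} {n : nat}.
Local Notation V := 'rV[R]_n.
Local Notation L := (lebesgue_rV n).
Local Notation E i := (delta_mx ord0 i : V).
Variables (xi d : 'I_n -> V -> R) (B : R).
Hypothesis (mxi : forall i, measurable_fun setT (xi i)) (md : forall i, measurable_fun setT (d i)).
Hypothesis (cxi : forall i, continuous (xi i)) (cd : forall i, continuous (d i)).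
Hypothesis dxi : forall i x, is_derive x (E i) (xi i) (d i x).
Hypothesis (xiB : forall i x, `|xi i x| <= B) (dB : forall i x, `|d i x| <= B) (B0 : 0 <= B).
Implicit Types (t : R) (s : seq 'I_n) (x : V).

(** Moving the coordinates in turn replaces the map x + t xi(x) by a product of shears, each with a
    one-dimensional Jacobian. The two agree to first order in t; [pushsum] records the first-order
    terms at the intermediate points. *)
Fixpoint pushmap t s x : V :=
  if s is i :: s' then pushmap t s' x + (t * xi i (pushmap t s' x)) *: E i else x.

Fixpoint pushjac t s x : R :=
  if s is i :: s' then (1 + t * d i (pushmap t s' x)) * pushjac t s' x else 1.

Fixpoint pushsum (f : 'I_n -> V -> R) t s x : R :=
  if s is i :: s' then f i (pushmap t s' x) + pushsum f t s' x else 0.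

Lemma jacobian_map_push t s : 0 <= t -> t * B <= 2^-1 -> jacobian_map (pushmap t s) (pushjac t s).
Proof.
move=> t0 tB; elim: s => [|i s IH]; first exact: jacobian_map_id.
exact: jacobian_map_comp IH (jacobian_map_shear (mxi i) (md i) (@cd i) (dxi i) (dB i) tB t0).
Qed.

Let small t i x : 0 <= t -> t * B <= 2^-1 -> `|t * d i x| <= 2^-1.
Proof. by move=> t0 tB; rewrite normrM ger0_norm// (le_trans _ tB)// ler_wpM2l. Qed.

Lemma pushjac_gt0 t s x : 0 <= t -> t * B <= 2^-1 -> 0 < pushjac t s x.
Proof. by move=> t0 tB; have [] := jacobian_map_push s t0 tB. Qed.

Lemma ln_pushjac t s x : 0 <= t -> t * B <= 2^-1 ->
  t * pushsum d t s x - (size s)%:R * (2 * t ^+ 2 * B ^+ 2) <= ln (pushjac t s x) /\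
  `|ln (pushjac t s x)| <= (size s)%:R.
Proof.
move=> t0 tB; elim: s => [|i s [IH1 IH2]] /=; first by rewrite mulr0 mul0r subr0 ln1 normr0 lexx.
set y := pushmap t s x; have h := small i y t0 tB.
have /andP[h1 h2] := ln1D_ge h.
have p1 : 0 < 1 + t * d i y by move: h; rewrite ler_norml => /andP[+ _]; lra.
rewrite lnM ?posrE ?pushjac_gt0//.
have sq : (t * d i y) ^+ 2 <= t ^+ 2 * B ^+ 2.
  rewrite exprMn; apply: ler_wpM2l; first exact: sqr_ge0.
  by rewrite -[X in X <= _]real_normK ?num_real// lerXn2r// nnegrE.
rewrite -natr1 mulrDr (mulrDl _ 1); split; first by lra.
rewrite (le_trans (ler_normD _ _))// addrC lerD//.
have sq1 : (t * d i y) ^+ 2 <= 2^-1 * 2^-1.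
  by rewrite -[X in X <= _]real_normK ?num_real// -expr2 lerXn2r// nnegrE.
by move: h; rewrite !ler_norml => /andP[? ?]; lra.
Qed.

Lemma measurable_pushmap t s : measurable_fun setT (pushmap t s).
Proof.
elim: s => [|i s IH] /=; first exact: measurable_id.
apply: measurable_rVD => //; apply: measurable_rVZ; last exact: measurable_cst.
by apply: measurable_funM => //; exact: measurableT_comp.
Qed.

Lemma measurable_pushsum (f : 'I_n -> V -> R) t s : (forall i, measurable_fun setT (f i)) ->
  measurable_fun setT (pushsum f t s).
Proof.
move=> mf; elim: s => [|i s IH] /=; first exact: measurable_cst.
apply: measurable_funD => //; apply: measurableT_comp => //; exact: measurable_pushmap.
Qed.

Lemma pushmap_notin t s x i : i \notin s -> pushmap t s x ord0 i = x ord0 i.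
Proof.
elim: s => //= j s IH; rewrite inE negb_or => /andP[ij /IH].
by rewrite !mxE eqxx/= (negPf ij) mulr0 addr0.
Qed.

(** As the letters are distinct, each coordinate is moved at most once, so the squared displacements
    add exactly. *)
Lemma sqnorm_pushmap t s x : uniq s ->
  sqnorm (pushmap t s x - x) = t ^+ 2 * pushsum (fun i y => xi i y ^+ 2) t s x.
Proof.
elim: s => [|i s IH] /=; first by rewrite subrr mulr0 /sqnorm /dot big1// => i _; rewrite mxE mul0r.
move=> /andP[/(pushmap_notin t x) is_ /IH]; set y := pushmap t s x => e.
rewrite mulrDr -e /sqnorm /dot (bigD1 i)//= [in RHS](bigD1 i)//= addrA; congr (_ + _).
  by rewrite !mxE !eqxx/= mulr1 -/y is_; ring.
apply: eq_bigr => j ji; rewrite !mxE eqxx/= (negPf ji) mulr0 addr0//.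
Qed.

Lemma pushsum_bound (f : 'I_n -> V -> R) M t s x : (forall i y, `|f i y| <= M) ->
  `|pushsum f t s x| <= (size s)%:R * M.
Proof.
move=> fM; elim: s => [|i s IH] /=; first by rewrite normr0 mul0r.
by rewrite (le_trans (ler_normD _ _))// -natr1 mulrDl mul1r [leRHS]addrC lerD.
Qed.

Lemma cvg_pushmap (t_ : nat -> R) s x : t_ k @[k --> \oo] --> 0 ->
  pushmap (t_ k) s x @[k --> \oo] --> x.
Proof.
move=> t0; elim: s => [|i s IH] /=; first exact: cvg_cst.
rewrite -[X in _ --> X]addr0 -(scale0r (E i)) -(mul0r (xi i x)).
apply: cvgD => //; apply: cvgZr_tmp; apply: cvgM => //.
exact: (cvg_comp _ _ IH (@cxi i x)).
Qed.

Lemma cvg_pushsum (f : 'I_n -> V -> R) (t_ : nat -> R) s x : (forall i, continuous (f i)) ->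
  t_ k @[k --> \oo] --> 0 ->
  pushsum f (t_ k) s x @[k --> \oo] --> \sum_(i <- s) f i x.
Proof.
move=> cf t0; elim: s => [|i s IH] /=; first by rewrite big_nil; exact: cvg_cst.
rewrite big_cons; apply: cvgD => //.
exact: (cvg_comp _ _ (@cvg_pushmap t_ s x t0) (@cf i x)).
Qed.

Variables (p : P2 R n) (rho : V -> R).
Hypothesis pr : is_density p rho.

Lemma integrable_pushsum (f : 'I_n -> V -> R) M t s : (forall i, measurable_fun setT (f i)) ->
  (forall i y, `|f i y| <= M) ->
  L.-integrable setT (fun x => (rho x * pushsum f t s x)%:E).
Proof.
move=> mf fM; apply: (integrable_mul_bounded (integrable_density pr) (measurable_pushsum _ _ mf)).
by move=> x; exact: pushsum_bound.
Qed.

Lemma cvg_integral_pushsum (f : 'I_n -> V -> R) M (t_ : nat -> R) s : (forall i, continuous (f i)) ->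
  (forall i, measurable_fun setT (f i)) -> (forall i y, `|f i y| <= M) ->
  t_ k @[k --> \oo] --> 0 ->
  fine (\int[L]_x (rho x * pushsum f (t_ k) s x)%:E) @[k --> \oo] -->
  fine (\int[L]_x (rho x * \sum_(i <- s) f i x)%:E).
Proof.
move=> cf mf fM t0.
have [mr r0 _] := pr.
have m1 k : measurable_fun setT (fun x => (rho x * pushsum f (t_ k) s x)%:E : \bar R).
  by apply/measurable_EFinP; apply: measurable_funM => //; exact: measurable_pushsum.
have m2 : measurable_fun setT (fun x => (rho x * \sum_(i <- s) f i x)%:E : \bar R).
  by apply/measurable_EFinP; apply: measurable_funM => //; exact: measurable_sum.
have ib : L.-integrable setT (fun x => (rho x * ((size s)%:R * M))%:E).
  by apply: (integrable_mul_bounded (B := `|(size s)%:R * M|) (integrable_density pr)) => // x.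
have c : {ae L, forall x, [set: V] x ->
    (rho x * pushsum f (t_ k) s x)%:E @[k --> \oo] --> (rho x * \sum_(i <- s) f i x)%:E}.
  apply: aeW => x _; apply: cvg_EFin; first exact: nearW.
  by apply: cvgM; [exact: cvg_cst | exact: cvg_pushsum].
have b : {ae L, forall x k, [set: V] x ->
    (`|(rho x * pushsum f (t_ k) s x)%:E| <= (rho x * ((size s)%:R * M))%:E)%E}.
  apply: aeW => x k _; rewrite lee_fin normrM ger0_norm// ler_wpM2l//.
  exact: pushsum_bound.
have [ifin _ H] := dominated_convergence measurableT m1 m2 c ib b.
by apply: fine_cvg; rewrite fineK//; exact: integrable_fin_num.
Qed.

(** The entropy gain is linear in t up to an error of order t^2 governed by [B], which comes from
    replacing ln(1 + u) by u in each shear; the displacement is bounded through the coupling of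
    [exists_push]. *)
Lemma push_entropy t s h : 0 <= t -> t * B <= 2^-1 -> uniq s -> entropy p = h%:E ->
  exists q w, [/\ W2 p q = w%:E, 0 <= w,
    w ^+ 2 <= t ^+ 2 * fine (\int[L]_x (rho x * pushsum (fun i y => xi i y ^+ 2) t s x)%:E)
    & ((h + t * fine (\int[L]_x (rho x * pushsum d t s x)%:E)
        - (size s)%:R * (2 * t ^+ 2 * B ^+ 2))%:E <= entropy q)%E].
Proof.
move=> t0 tB us Hp.
have msq i : measurable_fun setT (fun y => xi i y ^+ 2) by exact: measurable_funX.
have sqB i y : `|xi i y ^+ 2| <= B ^+ 2 by rewrite normrX lerXn2r// nnegrE.
have TJ := jacobian_map_push s t0 tB; have mT := measurable_pushmap t s.
have TC x : sqnorm (pushmap t s x - x) <= t ^+ 2 * ((size s)%:R * B ^+ 2).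
  rewrite sqnorm_pushmap// ler_wpM2l ?sqr_ge0//.
  exact: le_trans (ler_norm _) (pushsum_bound _ _ _ sqB).
have [q [qT qw]] := exists_push p mT TC.
have [w [w0 Ww _ _]] := W2P p q.
have fi := integrable_fin_num measurableT (integrable_pushsum t s msq sqB).
have fd := integrable_fin_num measurableT (integrable_pushsum t s md dB).
exists q, w; split => //.
- rewrite -lee_fin (le_trans (qw _ Ww))//.
  rewrite (integral_density pr)//; first last.
  + by move=> x; rewrite lee_fin sqnorm_ge0.
  + apply/measurable_EFinP; rewrite (_ : (fun x => _) = fun x => t ^+ 2 * pushsum (fun i y => xi i y ^+ 2) t s x).
      by apply: measurable_funM => //; exact: measurable_pushsum.
    by apply/funext => x; rewrite sqnorm_pushmap.
  rewrite EFinM fineK// -integralZl//; last exact: integrable_pushsum msq sqB.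
  rewrite le_eqVlt; apply/orP; left; apply/eqP; apply: eq_integral => x _.
  by rewrite sqnorm_pushmap// -!EFinM; congr EFin; ring.
- have lC x := (ln_pushjac s x t0 tB).2.
  rewrite (entropy_push pr TJ qT lC) ?Hp// -addrA EFinD leeD2l//.
  have [mr r0 _] := pr; have ir := integrable_density pr.
  set K := _ * (2 * _ * _).
  have mlj : measurable_fun setT (fun x => ln (pushjac t s x)).
    by apply: measurableT_comp; [exact: measurable_ln | by case: TJ].
  have i1 := integrableZl measurableT t (integrable_pushsum t s md dB).
  have i2 := integrableZl measurableT K ir.
  have -> : ((t * fine (\int[L]_x (rho x * pushsum d t s x)%:E) - K)%:E =
     \int[L]_x (t%:E * (rho x * pushsum d t s x)%:E - K%:E * (rho x)%:E))%E.
    rewrite integralB// !integralZl//; last exact: integrable_pushsum md dB.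
    by rewrite (integral_density1 pr) mule1 EFinB EFinM fineK.
  apply: le_integral => //.
  + exact: integrableB.
  + exact: (integrable_mul_bounded ir mlj lC).
  + move=> x _; rewrite -!EFinM -EFinB lee_fin.
    have := (ln_pushjac s x t0 tB).1; rewrite -/K => hx.
    by have := ler_wpM2l (r0 x) hx; lra.
Qed.

End push_all_coordinates.

(** * Ascent of the entropy along an approximate score *)

Section entropy_slope_lower_bound.
Context {R : realType} {n : nat}.
Local Notation V := 'rV[R]_n.
Local Notation L := (lebesgue_rV n).
Variables (p : P2 R n) (rho : V -> R) (G : V -> V) (J : R).
Hypothesis pr : is_density p rho.
Hypothesis wG : plateau_gradient rho G.
Hypothesis GJ : (\int[L]_x (sqnorm (G x) / rho x)%:E)%E = J%:E.
Hypothesis G0 : forall i x, rho x = 0 -> G x ord0 i = 0.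

Let mG i : measurable_fun setT (fun x => G x ord0 i).
Proof. by have [/measurable_int/measurable_EFinP + _] := wG i. Qed.

Let mr : measurable_fun setT rho. Proof. by have [] := pr. Qed.

Let r0 x : 0 <= rho x. Proof. by have [_ + _] := pr; apply. Qed.

Let mri : measurable_fun setT (fun x => (rho x)^-1).
Proof. exact: measurable_fun_inv. Qed.

Let part i := fine (\int[L]_x (G x ord0 i ^+ 2 / rho x)%:E).

Let integrable_part i : L.-integrable setT (fun x => (G x ord0 i ^+ 2 / rho x)%:E).
Proof.
have m1 : measurable_fun setT (fun x => (G x ord0 i ^+ 2 / rho x)).
  by apply: measurable_funM => //; exact: measurable_funX.
have p1 x : 0 <= G x ord0 i ^+ 2 / rho x by rewrite divr_ge0// sqr_ge0.
apply/integrableP; split; first exact/measurable_EFinP.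
have : (\int[L]_x (sqnorm (G x) / rho x)%:E < +oo)%E by rewrite GJ ltry.
apply: le_lt_trans; apply: ge0_le_integral => //.
- by apply: measurableT_comp => //; exact/measurable_EFinP.
- apply/measurable_EFinP; apply: measurable_funM => //.
  by apply: (measurableT_comp measurable_sqnorm); exact: measurable_fun_rVP.
- move=> x _; rewrite gee0_abs ?lee_fin//; apply: ler_wpM2r; first by rewrite invr_ge0.
  rewrite /sqnorm /dot (bigD1 i)//= expr2 lerDl; apply: sumr_ge0 => j _.
  by rewrite -expr2 sqr_ge0.
Qed.

Let sum_part : \sum_i part i = J.
Proof.
apply: EFin_inj; rewrite -GJ -sumEFin.
have -> : (\int[L]_x (sqnorm (G x) / rho x)%:E = \sum_i \int[L]_x (G x ord0 i ^+ 2 / rho x)%:E)%E.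
  rewrite -integral_sum//; apply: eq_integral => x _.
  by rewrite sumEFin /sqnorm /dot mulr_suml; congr EFin; apply: eq_bigr => i _; rewrite expr2.
by apply: eq_bigr => i _; rewrite fineK//; exact: integrable_fin_num.
Qed.

(** The cross term of the expanded square is the weak gradient tested against [f]. The value [c = 1]
    measures the distance from [f] to - G / rho in L^2(p), and [c = 2] serves to bound the size of
    [f] from below. *)
Lemma plateau_quadratic i f d c : plateau_span f d ->
  (\int[L]_x (rho x * (c * f x + G x ord0 i / rho x) ^+ 2)%:E =
   (part i + c ^+ 2 * fine (\int[L]_x (rho x * f x ^+ 2)%:E)
    - 2 * c * fine (\int[L]_x (rho x * d i x)%:E))%:E)%E.
Proof.
move=> sf; have [_ _ _ [B B0 fB]] := plateau_span_regular sf.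
have mf := plateau_span_measurable sf; have ir := integrable_density pr.
have f2B x : `|f x ^+ 2| <= B ^+ 2 by rewrite normrX lerXn2r// ?nnegrE//; case: (fB x).
have i2 := integrable_mul_bounded ir (measurable_funX 2 mf) f2B.
have i3 := integrable_mul_bounded (wG i).1 mf (fun x => (fB x).1).
have i2c := integrableZl measurableT (c ^+ 2) i2.
have i3c := integrableZl measurableT (2 * c) i3.
have -> : (\int[L]_x (rho x * (c * f x + G x ord0 i / rho x) ^+ 2)%:E =
   \int[L]_x ((G x ord0 i ^+ 2 / rho x)%:E + (c ^+ 2)%:E * (rho x * f x ^+ 2)%:E
     + (2 * c)%:E * (G x ord0 i * f x)%:E))%E.
  apply: eq_integral => x _; rewrite -!EFinM -!EFinD; congr EFin.
  have [e|e] := eqVneq (rho x) 0; last by field.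
  by rewrite (G0 i e) e; ring.
have i12 := integrableD measurableT (integrable_part i) i2c.
rewrite (integralD measurableT i12 i3c) (integralD measurableT (integrable_part i) i2c) !integralZl//.
have e := plateau_span_gradient i ir wG sf.
have f3 : (\int[L]_x (G x ord0 i * f x)%:E)%E \is a fin_num by exact: integrable_fin_num.
have f2 : (\int[L]_x (rho x * f x ^+ 2)%:E)%E \is a fin_num by exact: integrable_fin_num.
have f1 : (\int[L]_x (G x ord0 i ^+ 2 / rho x)%:E)%E \is a fin_num by exact: integrable_fin_num.
rewrite e fineN -(fineK f1) -(fineK f2) -(fineK f3) -!EFinM -!EFinD /part /=; congr EFin; ring.
Qed.

Lemma approximate_gradient i eps : 0 < eps -> exists f d, [/\ plateau_span f d,
  part i + fine (\int[L]_x (rho x * f x ^+ 2)%:E)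
    - 2 * fine (\int[L]_x (rho x * d i x)%:E) <= eps
  & part i <= 2 * fine (\int[L]_x (rho x * f x ^+ 2)%:E) + 2 * eps].
Proof.
move=> e0; pose v x := - (G x ord0 i / rho x).
have mv : measurable_fun setT v by apply: measurable_funN; exact: measurable_funM.
have v2 : (\int[p]_x (v x ^+ 2)%:E < +oo)%E.
  rewrite (integral_density pr); first last.
  - by move=> x; rewrite lee_fin sqr_ge0.
  - by apply/measurable_EFinP; exact: measurable_funX.
  rewrite (_ : (\int[L]_x _ = \int[L]_x (G x ord0 i ^+ 2 / rho x)%:E)%E).
    have := integrable_fin_num measurableT (integrable_part i).
    by rewrite fin_numElt => /andP[].
  apply: eq_integral => x _; rewrite -EFinM; congr EFin; rewrite /v.
  have [e|e] := eqVneq (rho x) 0; last by field.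
  by rewrite (G0 i e) e; ring.
have [f [d [sf fe]]] := approximable_L2 mv v2 e0.
exists f, d.
have h1 : part i + fine (\int[L]_x (rho x * f x ^+ 2)%:E)
    - 2 * fine (\int[L]_x (rho x * d i x)%:E) <= eps.
  rewrite -lee_fin; have := plateau_quadratic i 1 sf; rewrite expr1n mul1r mulr1 => <-.
  move: fe; rewrite (integral_density pr); first last.
  - by move=> x; rewrite lee_fin sqr_ge0.
  - apply/measurable_EFinP; apply: measurable_funX; apply: measurable_funB => //.
    exact: plateau_span_measurable sf.
  move=> /ltW; apply: le_trans; rewrite le_eqVlt; apply/orP; left; apply/eqP.
  by apply: eq_integral => x _; rewrite -EFinM; congr EFin; rewrite /v; ring.
split => //.
(* With Q the integral of rho f^2 and A that of rho d_i, this reads part + 4 Q - 4 A >= 0;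
   eliminating A with [h1] leaves part <= 2 Q + 2 eps. *)
have : (0 <= \int[L]_x (rho x * (2 * f x + G x ord0 i / rho x) ^+ 2)%:E)%E.
  by apply: integral_ge0 => x _; rewrite lee_fin mulr_ge0 ?sqr_ge0.
by rewrite (plateau_quadratic i 2 sf) lee_fin; lra.
Qed.

(* Pushing [p] by x |-> x + t xi(x), with xi close to - G / rho in L^2(p),
   raises the entropy by nearly t sqrt J |xi| while moving by t |xi|. *)
Lemma entropy_ascent h l r : (0 < n)%N -> entropy p = h%:E -> 0 <= l -> l < Num.sqrt J -> 0 < r ->
  exists q w, [/\ W2 p q = w%:E, 0 < w, w < r & ((h + l * w)%:E <= entropy q)%E].
Proof.
move=> n0 Hp l0 lJ r_gt0; have J0 := fisher_gt0 pr wG GJ n0.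
pose a := Num.sqrt J; have aJ : a ^+ 2 = J by rewrite sqr_sqrtr// ltW.
have a0 : 0 < a by rewrite sqrtr_gt0.
(* The first bound ensures b >= a / 2, where b^2 = Q is the squared size of the field; the second
   makes the error e / 2 smaller than (a - l) b, which is at least (a - l) a / 2. *)
pose e := Num.min (J / 8) ((a - l) * a / 4).
have e0 : 0 < e by rewrite lt_min divr_gt0//= divr_gt0// mulr_gt0// subr_gt0.
have e1 : e <= J / 8 by rewrite ge_min lexx.
have e2 : e <= (a - l) * a / 4 by rewrite ge_min lexx orbT.
have en : 0 < e / n%:R by rewrite divr_gt0// ltr0n.
have /boolp.choice[xi /boolp.choice[dd Hxi]] := fun i => approximate_gradient i en.
have sxi i : plateau_span (xi i) (dd i) by case: (Hxi i).
pose d i := dd i i.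
have /boolp.choice[B' HB] : forall i, exists B, 0 <= B /\ forall x, `|xi i x| <= B /\ `|d i x| <= B.
  move=> i; have [_ _ _ [B B0 fB]] := plateau_span_regular (sxi i); exists B; split => // x.
  by have [h1 h2] := fB x; split; [exact: h1 | exact: h2].
pose B := \sum_i B' i.
have BB i : B' i <= B.
  by rewrite /B (bigD1 i)//= lerDl; apply: sumr_ge0 => j _; case: (HB j).
have B0 : 0 <= B by apply: sumr_ge0 => j _; case: (HB j).
have xiB i x : `|xi i x| <= B by rewrite (le_trans _ (BB i))//; case: (HB i) => _ /(_ x)[].
have dB i x : `|d i x| <= B by rewrite (le_trans _ (BB i))//; case: (HB i) => _ /(_ x)[].
have mxi i : measurable_fun setT (xi i) by exact: plateau_span_measurable (sxi i).
have md i : measurable_fun setT (d i) by exact: plateau_span_dmeasurable (sxi i).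
have cxi i : continuous (xi i) by case: (plateau_span_regular (sxi i)).
have cd i : continuous (d i) by have [_ h1 _ _] := plateau_span_regular (sxi i); exact: h1.
have dxi i x : is_derive x (delta_mx ord0 i : V) (xi i) (d i x).
  by have [_ _ h1 _] := plateau_span_regular (sxi i); exact: h1.
have csq i : continuous (fun y => xi i y ^+ 2).
  by move=> x; exact: (continuous_comp (@cxi i x) (@exprn_continuous _ 2 _)).
have msq i : measurable_fun setT (fun y => xi i y ^+ 2) by exact: measurable_funX.
have sqB i y : `|xi i y ^+ 2| <= B ^+ 2 by rewrite normrX lerXn2r// nnegrE.
pose s := enum 'I_n.
pose A := fine (\int[L]_x (rho x * \sum_(i <- s) d i x)%:E).
pose Q := fine (\int[L]_x (rho x * \sum_(i <- s) xi i x ^+ 2)%:E).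
have ir := integrable_density pr.
have sumI (f : 'I_n -> V -> R) M : (forall i, measurable_fun setT (f i)) ->
    (forall i x, `|f i x| <= M) ->
    fine (\int[L]_x (rho x * \sum_(i <- s) f i x)%:E) = \sum_i fine (\int[L]_x (rho x * f i x)%:E).
  move=> mf fM; apply: EFin_inj.
  have ii i := integrable_mul_bounded ir (mf i) (fM i).
  have E : (\int[L]_x (rho x * \sum_(i <- s) f i x)%:E = \sum_i \int[L]_x (rho x * f i x)%:E)%E.
    rewrite -integral_sum//; apply: eq_integral => x _.
    by rewrite big_enum/= mulr_sumr sumEFin.
  rewrite E -sumEFin; transitivity (\sum_i \int[L]_x (rho x * f i x)%:E)%E.
    rewrite fineK//; apply/sum_fin_numP => i _ _; exact: integrable_fin_num.
  by apply: eq_bigr => i _; rewrite fineK//; exact: integrable_fin_num.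
have nn : \sum_(i < n) (e / n%:R) = e.
  by rewrite sumr_const card_ord -[LHS]mulr_natr divfK// pnatr_eq0 -lt0n.
have QA : J + Q - 2 * A <= e.
  rewrite -sum_part /Q /A (sumI _ _ msq sqB) (sumI _ _ md dB) -nn mulr_sumr -big_split/= -sumrB.
  by apply: ler_sum => i _; case: (Hxi i).
have JQ : J <= 2 * Q + 2 * e.
  rewrite -sum_part /Q (sumI _ _ msq sqB) -nn !mulr_sumr -big_split/=.
  by apply: ler_sum => i _; case: (Hxi i).
have Q0 : 0 <= Q by lra.
pose b := Num.sqrt Q; have bQ : b ^+ 2 = Q by rewrite sqr_sqrtr.
have b0 : 0 <= b by exact: sqrtr_ge0.
(* From [QA], 2 A >= a^2 + b^2 - e >= 2 a b - e: a push of size b in L^2(p) raises the entropy at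
   rate nearly a b, which exceeds l b. *)
have lb : l * b < A.
  have ab : a / 2 <= b.
    by rewrite -(ler_pXn2r (n := 2)) ?nnegrE ?divr_ge0 ?(ltW a0)// exprMn aJ bQ expr2; lra.
  have h1 := sqr_ge0 (a - b); rewrite expr2 in h1; rewrite !expr2 in aJ bQ.
  have h2 : (a - l) * (a / 2) <= (a - l) * b by rewrite ler_wpM2l// subr_ge0 ltW.
  have h3 : 0 < (a - l) * a by rewrite mulr_gt0// subr_gt0.
  lra.
(* The time of the push runs through the harmonic sequence. In the limit the gain per unit of time
   exceeds l b strictly, while t B and the displacement tend to 0, so one term of the sequence meets
   all requirements. *)
have t0 := @cvg_harmonic R.
pose Ak k := fine (\int[L]_x (rho x * pushsum xi d (harmonic k) s x)%:E).
pose Qk k := fine (\int[L]_x (rho x * pushsum xi (fun i y => xi i y ^+ 2) (harmonic k) s x)%:E).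
have cA : Ak k @[k --> \oo] --> A := cvg_integral_pushsum mxi cxi pr (s := s) cd md dB t0.
have cQ : Qk k @[k --> \oo] --> Q := cvg_integral_pushsum mxi cxi pr (s := s) csq msq sqB t0.
have cb : Num.sqrt (Qk k) @[k --> \oo] --> b := cvg_comp _ _ cQ (@sqrt_continuous R Q).
have c1 : Ak k - l * Num.sqrt (Qk k) - n%:R * (2 * B ^+ 2) * harmonic k @[k --> \oo] --> A - l * b - n%:R * (2 * B ^+ 2) * 0.
  apply: cvgB; last by apply: cvgMl_tmp.
  by apply: cvgB => //; exact: cvgMl_tmp.
have c2 : harmonic k * B @[k --> \oo] --> 0 * B by exact: cvgMr_tmp.
have c3 : harmonic k * Num.sqrt (Qk k) @[k --> \oo] --> 0 * b by exact: cvgM.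
have : \forall k \near \oo, [/\ 0 < Ak k - l * Num.sqrt (Qk k) - n%:R * (2 * B ^+ 2) * harmonic k,
    harmonic k * B < 2^-1 & harmonic k * Num.sqrt (Qk k) < r].
  have n1 := cvgr_gt _ c1 0; have n2 := cvgr_lt _ c2 2^-1; have n3 := cvgr_lt _ c3 r.
  near=> k; split; near: k.
  - by apply: n1; rewrite mulr0 subr0 subr_gt0.
  - by apply: n2; rewrite mul0r invr_gt0.
  - by apply: n3; rewrite mul0r.
move=> [k _ /(_ k (leqnn k)) [h1 h2 h3]].
have tk0 : 0 < harmonic k :> R by exact: harmonic_gt0.
have [q [w [Ww w0 wQ wH]]] := push_entropy mxi md cd dxi xiB dB B0 pr (ltW tk0) (ltW h2) (enum_uniq 'I_n : uniq s) Hp.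
rewrite -/(Qk k) in wQ; rewrite -/(Ak k) size_enum_ord in wH.
have wle : w <= harmonic k * Num.sqrt (Qk k).
  have Qk0 : 0 <= Qk k.
    have := le_trans (sqr_ge0 w) wQ; rewrite pmulr_rge0// exprn_gt0//.
  rewrite -(ler_pXn2r (n := 2)) ?nnegrE ?mulr_ge0 ?sqrtr_ge0 ?(ltW tk0)//.
  by rewrite exprMn sqr_sqrtr.
exists q, w.
have H1 : l * w < harmonic k * Ak k - n%:R * (2 * harmonic k ^+ 2 * B ^+ 2).
  have : l * w <= l * (harmonic k * Num.sqrt (Qk k)) by rewrite ler_wpM2l.
  have := mulr_gt0 tk0 h1; rewrite !expr2; lra.
have H2 : ((h + l * w)%:E <= entropy q)%E.
  by apply: le_trans wH; rewrite lee_fin; lra.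
split => //; last exact: le_lt_trans h3.
(* A zero displacement would contradict the HWI inequality, since the entropy has strictly
   increased. *)
rewrite lt0r w0 andbT; apply/eqP => wz.
have := entropy_hwi pr wG GJ Ww; rewrite wz mulr0 adde0 Hp => /(le_trans wH).
by rewrite lee_fin; move: H1; rewrite wz mulr0; lra.
Unshelve. all: by end_near.
Qed.

End entropy_slope_lower_bound.

(** * The slope of the entropy and eikonal proportionality *)

Section slope.
Context {R : realType} {n : nat}.
Local Notation V := 'rV[R]_n.
Local Notation L := (lebesgue_rV n).
Implicit Types (p q : P2 R n) (U F : P2 R n -> \bar R) (d : P2 R n -> P2 R n -> \bar R).

Lemma eq_metric_slope d d' F p : (forall q, d p q = d' p q) ->
  metric_slope d F p = metric_slope d' F p.
Proof.
move=> dd'; rewrite /metric_slope; congr (maxe _ (ereal_inf _)).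
apply: eq_imagel => r _; congr ereal_sup; apply/seteqP; split => x [q dq <-].
- by exists q; rewrite /= -?dd'.
- by exists q; rewrite /= ?dd'.
Qed.

Section value.
Variables (p : P2 R n) (rho : V -> R) (G : V -> V) (J : R).
Hypothesis n0 : (0 < n)%N.
Hypothesis pr : is_density p rho.
Hypothesis wG : plateau_gradient rho G.
Hypothesis GJ : (\int[L]_x (sqnorm (G x) / rho x)%:E)%E = J%:E.

(** The HWI inequality bounds all the quotients by sqrt J / s, already in the ball of radius 1;
    [entropy_ascent] finds in every ball a quotient as close to this value as desired. *)
Lemma metric_slope_W2 s : 0 < s ->
  metric_slope (fun p q => s%:E * W2 p q)%E (fun q => - entropy q)%E p = (Num.sqrt J / s)%:E.
Proof.
move=> s0; have J0 := fisher_gt0 pr wG GJ n0.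
have Js : 0 <= Num.sqrt J / s by rewrite divr_ge0 ?sqrtr_ge0// ltW.
have hf := entropy_fin_num pr wG GJ; set h := fine (entropy p).
have Hp : entropy p = h%:E by rewrite fineK.
rewrite /metric_slope; apply/eqP; rewrite eq_le; apply/andP; split.
  rewrite ge_max lee_fin Js/=; apply: ge_ereal_inf.
  exists (ereal_sup [set (maxe 0 (- entropy p - - entropy q) / (s%:E * W2 p q))%E |
     q in [set q | (0 < s%:E * W2 p q < 1%:E)%E]]); first by exists 1; [exact: ltr01 | by []].
  apply: ge_ereal_sup => _ [q /= /andP[d0 _] <-].
  have [w [w0 Ww _ _]] := W2P p q; rewrite Ww -EFinM lte_fin in d0.
  have w_gt0 : 0 < w by rewrite pmulr_rgt0 in d0.
  rewrite Ww -EFinM inver gt_eqF// lee_pdivrMr//.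
  have -> : ((Num.sqrt J / s)%:E * (s * w)%:E = (Num.sqrt J * w)%:E :> \bar R)%E.
    by rewrite -EFinM; congr EFin; field; rewrite gt_eqF.
  rewrite ge_max lee_fin mulr_ge0 ?sqrtr_ge0//= oppeK addeC Hp leeBlDl//.
  by rewrite -Hp; exact: (entropy_hwi pr wG GJ Ww).
rewrite le_max; apply/orP; right; apply: le_ereal_inf_tmp => _ [r /= r0 <-].
apply/lee_addgt0Pr => eps e0.
pose l := Num.max 0 (Num.sqrt J - eps * s).
have J1 : 0 < Num.sqrt J by rewrite sqrtr_gt0.
have [G' [wG' G0 GJ']] : exists G' : V -> V, [/\ plateau_gradient rho G',
    forall i x, rho x = 0 -> G' x ord0 i = 0
    & (\int[L]_x (sqnorm (G' x) / rho x)%:E)%E = J%:E].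
  by have [h1 h2 h3] := weak_gradient_vanish pr wG GJ; eexists; split; [exact: h1 | exact: h2 | exact: h3].
have l0 : 0 <= l by rewrite le_max lexx.
have lJ : l < Num.sqrt J by rewrite gt_max J1/= gtrBl mulr_gt0.
have rs : 0 < r / s by rewrite divr_gt0.
have [q [w [Ww w0 wr wH]]] := entropy_ascent pr wG' GJ' G0 n0 Hp l0 lJ rs.
apply: (@le_trans _ _ ((l / s)%:E + eps%:E)%E).
  rewrite -EFinD lee_fin -lerBlDr ler_pdivlMr// mulrBl divfK ?gt_eqF//.
  by rewrite le_max lexx orbT.
rewrite leeD2r//; apply: ereal_sup_ge.
exists (maxe 0 (- entropy p - - entropy q) / (s%:E * W2 p q))%E.
  exists q => //=; rewrite Ww -EFinM !lte_fin mulr_gt0//=.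
  by move: wr; rewrite ltr_pdivlMr// mulrC.
rewrite Ww -EFinM inver gt_eqF ?mulr_gt0// lee_pdivlMr ?mulr_gt0//.
have -> : ((l / s)%:E * (s * w)%:E = (l * w)%:E :> \bar R)%E.
  by rewrite -EFinM; congr EFin; field; rewrite gt_eqF.
by rewrite le_max; apply/orP; right; rewrite oppeK addeC Hp leeBrDr// -EFinD addrC.
Qed.

End value.

Lemma weak_gradient_finite p : (fisher p < +oo)%E ->
  exists rho G J, [/\ is_density p rho, plateau_gradient rho G &
    (\int[L]_x (sqnorm (G x) / rho x)%:E)%E = J%:E].
Proof.
move=> /ereal_inf_lt[_ [rho [G [pr wG ->]]] Goo].
exists rho, G, (fine (\int[L]_x (sqnorm (G x) / rho x)%:E)); split => //.
  exact: weak_gradient_plateaux.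
rewrite fineK// ge0_fin_numE//; apply: integral_ge0 => x _.
by rewrite lee_fin divr_ge0 ?sqnorm_ge0//; case: pr.
Qed.

(* The slope does not see the choice of the density and of its gradient, so all
   the finite values in the infimum defining [fisher] agree. *)
Lemma fisherP p : (0 < n)%N -> (fisher p < +oo)%E ->
  exists rho G J, [/\ is_density p rho, plateau_gradient rho G,
    (\int[L]_x (sqnorm (G x) / rho x)%:E)%E = J%:E, 0 < J & fisher p = J%:E].
Proof.
move=> n0 pf; have [rho [G [J [pr wG GJ]]]] := weak_gradient_finite pf.
have J0 := fisher_gt0 pr wG GJ n0; exists rho, G, J; split => //.
apply/eqP; rewrite eq_le; apply/andP; split; last first.
  apply: le_ereal_inf_tmp => _ [rho' [G' [pr' /weak_gradient_plateaux wG' ->]]].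
  have [|] := leP +oo%E (\int[L]_x (sqnorm (G' x) / rho' x)%:E)%E.
    by rewrite leye_eq => /eqP ->; rewrite leey.
  move=> foo; have [J' GJ'] : exists J', (\int[L]_x (sqnorm (G' x) / rho' x)%:E)%E = J'%:E.
    exists (fine (\int[L]_x (sqnorm (G' x) / rho' x)%:E)).
    rewrite fineK// ge0_fin_numE//; apply: integral_ge0 => x _.
    by rewrite lee_fin divr_ge0 ?sqnorm_ge0//; case: pr'.
  rewrite GJ' lee_fin; have J'0 := fisher_gt0 pr' wG' GJ' n0.
  have := metric_slope_W2 n0 pr wG GJ ltr01; rewrite (metric_slope_W2 n0 pr' wG' GJ' ltr01).
  by rewrite !divr1 => -[e]; rewrite -(sqr_sqrtr (ltW J0)) -(sqr_sqrtr (ltW J'0)) e.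
move: pf; rewrite {1}/fisher => /ereal_inf_lt[_ [rho' [G' [pr' wG' ->]]] foo].
have [J' GJ'] : exists J', (\int[L]_x (sqnorm (G' x) / rho' x)%:E)%E = J'%:E.
  exists (fine (\int[L]_x (sqnorm (G' x) / rho' x)%:E)).
  rewrite fineK// ge0_fin_numE//; apply: integral_ge0 => x _.
  by rewrite lee_fin divr_ge0 ?sqnorm_ge0//; case: pr'.
have wG2 := weak_gradient_plateaux wG'; have J'0 := fisher_gt0 pr' wG2 GJ' n0.
have := metric_slope_W2 n0 pr wG GJ ltr01; rewrite (metric_slope_W2 n0 pr' wG2 GJ' ltr01).
rewrite !divr1 => -[e].
rewrite -(sqr_sqrtr (ltW J0)) -e (sqr_sqrtr (ltW J'0)) -GJ'; by apply: ereal_inf_lbound; exists rho', G'; split.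
Qed.

Lemma entropy_slopeE U p u : (0 < n)%N -> (fisher p < +oo)%E -> U p = u%:E -> 0 < u ->
  entropy_slope U p = (Num.sqrt (fine (fisher p)) / Num.sqrt (2 * u))%:E.
Proof.
move=> n0 pf Up u0; have [rho [G [J [pr wG GJ J0 ->]]]] := fisherP n0 pf.
rewrite /entropy_slope -(metric_slope_W2 n0 pr wG GJ) ?sqrtr_gt0 ?mulr_gt0//.
by apply: eq_metric_slope => q; rewrite /tensor_length Up add0e -EFinM.
Qed.

(** With an infinite factor the length is 0 or +oo, so no point lies at a distance in ]0, 1[ and the
    slope takes its value at isolated points. *)
Lemma entropy_slope_pinfty U p : U p = +oo%E -> entropy_slope U p = 0%E.
Proof.
move=> Up; apply/eqP; rewrite eq_le; apply/andP; split; last by rewrite le_max lexx.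
rewrite ge_max lexx/=; apply: ge_ereal_inf.
eexists; first by exists 1; [exact: ltr01 | reflexivity].
apply: ge_ereal_sup => _ [q /= /andP[d0 d1] <-]; exfalso.
move: d0 d1; rewrite /tensor_length Up add0e mulry gtr0_sg// mul1e /=.
have [w [w0 -> _ _]] := W2P p q; rewrite mulyr.
by move: w0; rewrite le0r => /orP[/eqP ->|/gtr0_sg ->]; rewrite ?sgr0 ?mul0e ?ltxx ?mul1e.
Qed.

Lemma entropy_slope_fisher_multiple c p : (0 < n)%N -> 0 < c -> (fisher p < +oo)%E ->
  entropy_slope (fisher_multiple c) p = (1 / Num.sqrt (2 * c))%:E.
Proof.
move=> n0 c0 pf; have [rho [G [J [pr wG GJ J0 FJ]]]] := fisherP n0 pf.
rewrite (entropy_slopeE (u := c * J))// ?mulr_gt0//; last by rewrite /fisher_multiple FJ.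
rewrite FJ/= mulrA sqrtrM ?mulr_ge0 ?ltW//; congr EFin; field.
by rewrite !gt_eqF// sqrtr_gt0// mulr_gt0.
Qed.

Lemma sqrte_fisher_ratio c p : (0 < n)%N -> 0 < c -> (fisher p < +oo)%E ->
  (sqrte (fisher p) / sqrte (2%:E * fisher_multiple c p))%E = (1 / Num.sqrt (2 * c))%:E.
Proof.
move=> n0 c0 pf; have [rho [G [J [pr wG GJ J0 FJ]]]] := fisherP n0 pf.
have J1 : 0 < Num.sqrt J by rewrite sqrtr_gt0.
have c1 : 0 < Num.sqrt (2 * c) by rewrite sqrtr_gt0 mulr_gt0.
rewrite /fisher_multiple FJ -!EFinM /= mulrA sqrtrM ?mulr_ge0 ?ltW// inver gt_eqF ?mulr_gt0//.
by rewrite -EFinM; congr EFin; field; rewrite !gt_eqF.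
Qed.

(** For the converse, let k be the slope. Where J is infinite so is U, because U >= eps J. Where J
    is finite, U cannot be +oo, as the slope would be 0; U is positive by the same bound and
    positivity of J, and sqrt J / sqrt (2 U) = k solves to U = J / (2 k^2). *)
Lemma eikonalE U : (0 < n)%N -> classC U -> eikonal U <-> constant_entropy_slope U.
Proof.
move=> n0 [U0 _ [eps e0 eU]]; split.
  move=> [c c0 ->]; exists (1 / Num.sqrt (2 * c)).
    by rewrite divr_gt0// sqrtr_gt0 mulr_gt0.
  by move=> p; exact: entropy_slope_fisher_multiple.
move=> [k k0 kU]; have k2 : 0 < 2 * k ^+ 2 by rewrite mulr_gt0// exprn_gt0.
exists (2 * k ^+ 2)^-1; first by rewrite invr_gt0.
apply/funext => p; rewrite /fisher_multiple; have [|pf] := leP +oo%E (fisher p).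
  rewrite leye_eq => /eqP pf; rewrite pf mulry gtr0_sg ?invr_gt0// mul1e.
  by apply/eqP; rewrite -leye_eq -[X in (X <= _)%E](_ : eps%:E * fisher p = +oo)%E// pf mulry gtr0_sg// mul1e.
have := kU _ pf; have [rho [G [J [pr wG GJ J0 FJ]]]] := fisherP n0 pf.
case Up : (U p) => [u| |]; last by have := U0 p; rewrite Up.
- have u0 : 0 < u.
    by have := eU p; rewrite Up FJ -EFinM lee_fin; apply: lt_le_trans; rewrite mulr_gt0.
  rewrite (entropy_slopeE (u := u))// FJ => -[] /=; rewrite -EFinM => <-; congr EFin.
  by rewrite expr_div_n !sqr_sqrtr ?ltW// ?mulr_gt0//; field; rewrite !gt_eqF.
- by rewrite entropy_slope_pinfty// => -[k1]; move: k0; rewrite -k1 ltxx.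
Qed.

End slope.

(** * Integrals of functions equal almost everywhere *)

Section ae_eq.
Import HBNNSimple.

Lemma ge0_integral_ae_eq d (T : measurableType d) (R : realType)
    (mu : measure T R) (F G : T -> \bar R) :
  (forall x, 0 <= F x)%E -> (forall x, 0 <= G x)%E -> measurable_fun setT G ->
  {ae mu, forall x, F x = G x} -> (\int[mu]_x F x = \int[mu]_x G x)%E.
Proof.
(* [F] is not assumed measurable *)
move=> F0 G0 mG [N [mN N0 FGN]].
have mNC : measurable (~` N) by exact: measurableC.
have FG x : ~ N x -> F x = G x by move=> Nx; apply: contrapT => FGx; apply: Nx; exact: FGN.
have aeN : {ae mu, forall x, ~ N x}.
  by exists N; split => // x /= /contrapT.
(* A measurable function keeps its integral when cut off on the null set [N]; a simple function
   below [F] is thereby brought below [G], and conversely. *)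
have le (h : T -> \bar R) : measurable_fun setT h -> (forall x, 0 <= h x)%E ->
    (\int[mu]_x h x = \int[mu]_x (h \_ (~` N)) x)%E.
  move=> mh h0; apply: ge0_ae_eq_integral => //.
  - exact: (measurable_restrictT _ mNC).1 (measurable_funTS mh).
  - by move=> x _; rewrite patchE; case: ifP.
  - apply: filterS aeN => x Nx _; rewrite patchE mem_set//.
apply/eqP; rewrite eq_le; apply/andP; split.
  rewrite ge0_integralTE//; apply: ge_ereal_sup => _ [h /= hF <-].
  have mh : measurable_fun setT (fun x => (h x)%:E : \bar R) by apply/measurable_EFinP; exact: measurable_funP.
  rewrite -integralT_nnsfun (le _ mh)//; last by move=> x; rewrite lee_fin.
  apply: ge0_le_integral => //.
  - by move=> x _; rewrite patchE; case: ifP => // _; rewrite lee_fin.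
  - exact: (measurable_restrictT _ mNC).1 (measurable_funTS mh).
  - move=> x _; rewrite patchE; case: ifP => // xN; rewrite -FG; first exact: hF.
    by rewrite inE in xN.
rewrite (le _ mG)// ge0_integralTE; last by move=> x; rewrite patchE; case: ifP.
rewrite ge0_integralTE//; apply: le_ereal_sup => _ [h /= hG <-].
exists h => //= x; apply: le_trans (hG x) _; rewrite patchE; case: ifP => // xN.
by rewrite FG//; rewrite inE in xN.
Qed.

End ae_eq.

(** * Indefinite integrals of locally integrable functions *)

Section indefinite_integral.
Context {R : realType}.
Local Notation mu := (@lebesgue_measure R).
Variables phi g : R -> R.
Hypothesis lg : locally_integrable setT g.
Hypothesis phig : forall a b : R, a <= b ->
  ((phi b - phi a)%:E = \int[mu]_(x in `[a, b]) (g x)%:E)%E.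

Let ig (a b : R) : mu.-integrable `[a, b] (EFin \o g).
Proof.
have [mg _ gK] := lg; apply/integrableP; split.
  by apply: measurable_funTS; exact/measurable_EFinP.
by apply: gK => //; exact: segment_compact.
Qed.

Let phiE (a y : R) : a <= y -> phi y = phi a + (\int[mu]_(t in `[a, y]) g t)%R.
Proof. by move=> ay; rewrite /Rintegral -phig//= addrC subrK. Qed.

Lemma indefinite_integral_continuous : continuous phi.
Proof.
move=> x; have ab : x - 1 < x + 1 by rewrite ltrD2l gt0_cp.
have /(continuous_within_itvP _ ab)[+ _ _] := parameterized_integral_continuous (ltW ab) (ig (x - 1) (x + 1)).
have xab : x \in `](x - 1), (x + 1)[ by rewrite in_itv/= ltrBlDr ltrDl ltr01.
move=> /(_ x xab) cF.
have c2 : (fun y => phi (x - 1) + (\int[mu]_(t in `[(x - 1)%R, y]) g t)%R) y @[y --> x] --> phi x.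
  by rewrite [X in _ --> X](phiE (a := x - 1)) ?gerBl//; apply: cvgD => //; exact: cvg_cst.
apply: cvg_trans c2; apply: near_eq_cvg; near=> y; rewrite -phiE//.
by apply: ltW; near: y; apply: (cvgr_gt x (@cvg_id _ _)); rewrite gtrBl.
Unshelve. all: by end_near.
Qed.

Lemma indefinite_integral_derive : {ae mu, forall x, is_derive x (1 : R) phi (g x)}.
Proof.
move: lg => /lebesgue_differentiation.
apply: filterS; first exact: (ae_filter_ringOfSetsType mu).
move=> x gx; have xu : x < x + 1 by rewrite ltrDl.
have [|dF FE] := FTC1_lebesgue_pt (a := BLeft (x - 1)) xu (ig _ _) _ gx.
  by rewrite /= lte_fin gtrBl.
have dF' : is_derive x (1 : R) (fun y => (\int[mu]_(t in `[(x - 1)%R, y]) g t)%R) (g x).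
  by apply: DeriveDef; [exact: dF | rewrite -derive1E; exact: FE].
have d2 := is_deriveD (is_derive_cst (phi (x - 1)) x (1 : R)) dF'.
rewrite add0r in d2.
apply: near_eq_is_derive d2.
near=> y; symmetry; apply: phiE.
by apply: ltW; near: y; apply: (cvgr_gt x (@cvg_id _ _)); rewrite gtrBl.
Unshelve. all: by end_near.
Qed.

End indefinite_integral.

(** * Base densities: Cramer-Rao bound and the Gaussian *)

Section score.
Context {R : realType}.
Local Notation mu := (@lebesgue_measure R).
Implicit Types (phi g : R -> R) (J : R).

(** The pointwise derivative in [base_fisher] is replaced by a measurable [g] of which [phi] is an
    indefinite integral; the two agree almost everywhere, and [g] is what Fubini and integration by
    parts can handle. *)
Definition score phi g J :=
  [/\ measurable_fun setT phi /\ measurable_fun setT g, forall x, 0 < phi x,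
    forall a b : R, a <= b -> ((phi b - phi a)%:E = \int[mu]_(x in `[a, b]) (g x)%:E)%E,
    (\int[mu]_x (phi x)%:E = 1)%E /\ (\int[mu]_x (x ^+ 2 * phi x)%:E = 1)%E
  & (\int[mu]_x (g x ^+ 2 / phi x)%:E = J%:E)%E].

Lemma base_density_score phi : base_density phi -> exists g, score phi g (J0 phi).
Proof.
move=> [[[g lg phig] phi0] i1 _ i2 foo]; exists g.
have mphi : measurable_fun setT phi.
  by apply: continuous_measurable_fun; exact: indefinite_integral_continuous lg phig.
have mg : measurable_fun setT g by case: lg.
split => //; rewrite /J0 fineK; last first.
  rewrite ge0_fin_numE//; apply: integral_ge0 => x _.
  by rewrite lee_fin divr_ge0 ?sqr_ge0// ltW.
symmetry; apply: ge0_integral_ae_eq.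
- by move=> x; rewrite lee_fin divr_ge0 ?sqr_ge0// ltW.
- by move=> x; rewrite lee_fin divr_ge0 ?sqr_ge0// ltW.
- apply/measurable_EFinP; apply: measurable_funM; first exact: measurable_funX.
  exact: measurable_fun_inv.
- have := indefinite_integral_derive lg phig.
  apply: filterS; first exact: (ae_filter_ringOfSetsType mu).
  by move=> x dx; rewrite derive1E derive_val.
Qed.

Section facts.
Variables (phi g : R -> R) (J : R).
Hypothesis sc : score phi g J.

Let mphi : measurable_fun setT phi. Proof. by case: sc => -[]. Qed.
Let mg : measurable_fun setT g. Proof. by case: sc => -[]. Qed.
Let phi0 x : 0 < phi x. Proof. by case: sc. Qed.
Let mgp : measurable_fun setT (fun x => g x ^+ 2 / phi x).
Proof. by apply: measurable_funM; [exact: measurable_funX | exact: measurable_fun_inv]. Qed.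

Let ige (f : R -> R) c : measurable_fun setT f -> (forall x, 0 <= f x) ->
  (\int[mu]_x (f x)%:E = c%:E)%E -> mu.-integrable setT (EFin \o f).
Proof.
move=> mf f0 fc; apply/integrableP; split; first exact/measurable_EFinP.
rewrite (_ : (\int[mu]_x _ = c%:E)%E) ?ltry// -fc; apply: eq_integral => x _.
by rewrite /= ger0_norm.
Qed.

Lemma integrable_score_base : mu.-integrable setT (EFin \o phi).
Proof. by apply: (@ige _ 1) => // [x|]; [exact: ltW | case: sc => _ _ _ []]. Qed.

Let i2 : mu.-integrable setT (EFin \o (fun x => x ^+ 2 * phi x)).
Proof.
apply: (@ige _ 1) => [|x|]; last by case: sc => _ _ _ [].
- by apply: measurable_funM => //; exact: measurable_funX.
- by rewrite mulr_ge0 ?sqr_ge0// ltW.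
Qed.

Let iJ : mu.-integrable setT (EFin \o (fun x => g x ^+ 2 / phi x)).
Proof. by apply: (@ige _ J) => // [x|]; [rewrite divr_ge0 ?sqr_ge0// ltW | case: sc]. Qed.

Let dominated (f h1 h2 : R -> R) : measurable_fun setT f ->
  mu.-integrable setT (EFin \o h1) -> mu.-integrable setT (EFin \o h2) ->
  (forall x, 2 * `|f x| <= h1 x + h2 x) -> mu.-integrable setT (EFin \o f).
Proof.
move=> mf j1 j2 fh; apply: (le_integrable measurableT _ _ (integrableD measurableT j1 j2)).
  exact/measurable_EFinP.
move=> x _ /=; rewrite lee_fin; have := fh x; have := normr_ge0 (f x); have := ler_norm (h1 x + h2 x); lra.
Qed.

Let young (a c : R) x : 2 * `|a * g x| <= a ^+ 2 * phi x + g x ^+ 2 / phi x.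
Proof.
have p0 := phi0 x; have -> : g x ^+ 2 / phi x = phi x * (g x / phi x) ^+ 2 by field; rewrite gt_eqF.
have -> : a * g x = phi x * (a * (g x / phi x)) by field; rewrite gt_eqF.
rewrite normrM (gtr0_norm p0).
set b := g x / phi x.
have h : 2 * `|a * b| <= a ^+ 2 + b ^+ 2.
  by rewrite normrM -(real_normK (num_real a)) -(real_normK (num_real b)); have := sqr_ge0 (`|a| - `|b|); rewrite !expr2; lra.
by have := ler_wpM2l (ltW p0) h; lra.
Qed.

Lemma integrable_score : mu.-integrable setT (EFin \o g).
Proof.
apply: (dominated _ integrable_score_base iJ) => // x.
by have := young 1 0 x; rewrite !mul1r expr1n mul1r.
Qed.

Let ixg : mu.-integrable setT (EFin \o (fun x => x * g x)).
Proof.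
apply: (dominated _ i2 iJ) => [|x]; first exact: measurable_funM.
exact: young.
Qed.

Let ixphi : mu.-integrable setT (EFin \o (fun x => x * phi x)).
Proof.
apply: (dominated _ integrable_score_base i2) => [|x]; first exact: measurable_funM.
have p0 := phi0 x; rewrite normrM (gtr0_norm p0).
have h : 2 * `|x| <= 1 + x ^+ 2.
  by rewrite -[X in _ <= 1 + X]real_normK ?num_real//; have := sqr_ge0 (1 - `|x|); rewrite !expr2; lra.
by have := ler_wpM2l (ltW p0) h; lra.
Qed.

(* Cramer-Rao: 0 <= int (g / phi + x)^2 phi = J - 2 + 1, since int x g = -1. *)
Lemma score_ge1 : 1 <= J.
Proof.
have [_ _ phig [I1 I2] IJ] := sc.
have Ig := integral_id_derivative phig integrable_score_base ixphi integrable_score ixg.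
have i2xg := integrableZl measurableT 2 ixg.
have : (0 <= \int[mu]_x ((g x ^+ 2 / phi x)%:E + 2%:E * (x * g x)%:E + (x ^+ 2 * phi x)%:E))%E.
  apply: integral_ge0 => x _; rewrite -EFinM -!EFinD lee_fin.
  have p0 := phi0 x.
  have -> : g x ^+ 2 / phi x + 2 * (x * g x) + x ^+ 2 * phi x = phi x * (g x / phi x + x) ^+ 2.
    by field; rewrite gt_eqF.
  by rewrite mulr_ge0 ?sqr_ge0// ltW.
have i12 := integrableD measurableT iJ i2xg.
rewrite (integralD measurableT i12 i2) (integralD measurableT iJ i2xg) integralZl//.
by rewrite IJ I2 Ig I1 -EFinN -EFinM -!EFinD lee_fin; lra.
Qed.

End facts.

(** The derivative is - x times the density, so the Fisher integrand is x^2 times the density and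
    the integral is the variance. *)
Lemma gaussian_fisher : base_fisher (@gaussian R) = 1%E.
Proof.
rewrite /base_fisher -std_normal_variance integral_std_normal; last 2 first.
- by apply/measurable_EFinP; exact: measurable_funX.
- by move=> x; rewrite lee_fin sqr_ge0.
apply: eq_integral => x _; have dg := is_derive_std_normal_pdf x.
have -> : derive1 (@gaussian R) x = - x * gaussian x by rewrite derive1E; exact: derive_val.
have : gaussian x != 0 by rewrite gt_eqF// /gaussian std_normal_pdfE mulr_gt0 ?expR_gt0// normal_peak_gt0 ?oner_eq0.
by move=> h; rewrite -EFinM; congr EFin; rewrite -/(gaussian x); field.
Qed.

Lemma base_density_gaussian : base_density (@gaussian R).
Proof.
have mE (h : R -> R) : measurable_fun setT h -> measurable_fun setT (fun x => (h x)%:E : \bar R).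
  by move=> mh; exact/measurable_EFinP.
have iid : (normal_prob 0 1 : probability _ R).-integrable setT (EFin \o (fun x : R => - x)).
  apply: (@std_normal_exp_dominated _ 1 1); first exact: measurable_funN.
  by move=> x; rewrite normrN !mul1r norm_le_exp.
have cd : continuous (fun x : R => - x * gaussian x).
  move=> x; apply: cvgM; first by apply: cvgN; exact: cvg_id.
  exact: (is_derive_continuous (j := fun x => - x * gaussian x) (@is_derive_std_normal_pdf R)).
split.
- split; last by move=> x; rewrite /gaussian std_normal_pdfE mulr_gt0 ?expR_gt0// normal_peak_gt0 ?oner_eq0.
  exists (fun x => - x * gaussian x).
    by apply: open_integrable_locally; [exact: openT | exact: integrable_std_normal_pdf].
  by move=> a b ab; rewrite (integral_is_derive ab (@is_derive_std_normal_pdf R)).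
- have := integral_std_normal (@measurable_cst _ _ _ _ setT (1%E : \bar R)) (fun=> lee01).
  rewrite integral_cst//= probability_setT mule1 => ->.
  by apply: eq_integral => x _; rewrite mul1e.
- set f := fun x : R => (x * gaussian x)%:E : \bar R.
  have jf : mu.-integrable setT f.
    apply: (@integrable_std_normal_pdf _ id); apply: (@std_normal_exp_dominated _ 1 1) => // x.
    by rewrite !mul1r norm_le_exp.
  have mf := measurable_int _ jf.
  have fN x : f (- x) = (- f x)%E by rewrite /f /gaussian std_normal_pdfN mulNr EFinN.
  rewrite integralE -(ge0_integral_opp (f := f^\-)%E)//; last exact: measurable_funeneg.
  rewrite (_ : (\int[mu]_x _ = \int[mu]_x (f^\+ x))%E); last first.
    by apply: eq_integral => x _; rewrite !unlock fN oppeK.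
  by rewrite subee//; have := integrable_pos_fin_num measurableT jf.
- rewrite -std_normal_variance integral_std_normal; last 2 first.
  + by apply: mE; exact: measurable_funX.
  + by move=> x; rewrite lee_fin sqr_ge0.
  by apply: eq_integral => x _; rewrite EFinM.
- by rewrite gaussian_fisher ltry.
Qed.

End score.

(** * Integration by parts against a C^1 function of compact support *)

Section integration_by_parts.
Context {R : realType}.
Local Notation mu := (@lebesgue_measure R).
Local Notation mR := (measurableTypeR R).
Variables (r r' u u' : R -> R) (K C : R).
Hypothesis (ir : mu.-integrable setT (EFin \o r)) (ir' : mu.-integrable setT (EFin \o r')).
Hypothesis rr' : forall a b, a <= b -> ((r b - r a)%:E = \int[mu]_(x in `[a, b]) (r' x)%:E)%E.
Hypothesis du : forall s : R, is_derive s (1 : R) u (u' s).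
Hypothesis cu' : continuous u'.
Hypothesis u0 : forall s, K <= `|s| -> u s = 0.
Hypothesis (u'0 : forall s, K <= `|s| -> u' s = 0) (u'C : forall s, `|u' s| <= C) (uC : forall s, `|u s| <= C).
Hypothesis K0 : 0 <= K.

Let D := [set z : mR * mR | - K <= z.1 /\ z.1 <= z.2 /\ z.2 <= K].

Let mr' : measurable_fun setT r'. Proof. by have /measurable_int/measurable_EFinP := ir'. Qed.
Let mr : measurable_fun setT r. Proof. by have /measurable_int/measurable_EFinP := ir. Qed.
Let mu' : measurable_fun setT u'. Proof. exact: continuous_measurable_fun. Qed.
Let mu_ : measurable_fun setT u. Proof. apply: continuous_measurable_fun; exact: is_derive_continuous du. Qed.

Let mD : measurable D.
Proof.
have m1 : measurable_fun setT (fun z : mR * mR => z.1) := measurable_fst.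
have m2 : measurable_fun setT (fun z : mR * mR => z.2) := measurable_snd.
have -> : D = (fst @^-1` [set x : mR | - K <= x]) `&` ((fun z : mR * mR => z.2 - z.1) @^-1` [set x : mR | 0 <= x] `&` (snd @^-1` [set x : mR | x <= K])).
  by apply/seteqP; split => z /=; rewrite subr_ge0.
have mge (a : R) : measurable ([set x | a <= x] : set mR).
  by rewrite (_ : [set x | _] = `[a, +oo[%classic)//; apply/seteqP; split => x /=; rewrite in_itv/= andbT.
have mle (a : R) : measurable ([set x | x <= a] : set mR).
  by rewrite (_ : [set x | _] = `]-oo, a]%classic)//; apply/seteqP; split => x /=; rewrite in_itv.
have mB : measurable_fun setT (fun z : mR * mR => z.2 - z.1) by exact: measurable_funB.
apply: measurableI; first by rewrite -[X in measurable X]setTI; exact: m1.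
apply: measurableI; first by rewrite -[X in measurable X]setTI; exact: (mB measurableT _ (mge 0)).
by rewrite -[X in measurable X]setTI; exact: m2.
Qed.

Let F (z : mR * mR) : \bar R := (r' z.1 * (u' z.2 * \1_D z))%:E.

Let mF : measurable_fun setT F.
Proof.
apply/measurable_EFinP; apply: measurable_funM.
  exact: (measurableT_comp mr' measurable_fst).
apply: measurable_funM; first exact: (measurableT_comp mu' measurable_snd).
exact: measurable_indic.
Qed.

Let iF : (mu \x mu)%E.-integrable setT F.
Proof.
apply/(integrable12ltyP _ _ mF).
have C0 : 0 <= C by exact: le_trans (u'C 0).
have le s : (\int[mu]_t `|F (s, t)| <= (C * (K + K))%:E * `|(r' s)%:E|)%E.
  have -> : ((C * (K + K))%:E * `|(r' s)%:E| = \int[mu]_(t in `[(- K)%R, K]) (`|r' s| * C)%:E)%E.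
    rewrite integral_cst//= lebesgue_measure_itv/= lte_fin; case: ltP => h.
      by rewrite -EFinB -!EFinM; congr EFin; ring.
    rewrite mule0 (_ : K = 0) ?addr0 ?mulr0 ?mul0e//.
    by apply/eqP; rewrite eq_le K0 andbT; lra.
  rewrite [leRHS]integral_mkcond; apply: ge0_le_integral => //.
  - by apply: (measurableT_comp (f := abse)) => //; exact: (measurableT_comp mF (pair1_measurable s)).
  - by apply/(measurable_restrictT _ _).1 => //; exact: measurable_cst.
  - move=> t _; rewrite /F /= patchE indicE; case: ifPn => h.
      rewrite lee_fin normrM ler_wpM2l// normrM (le_trans _ (u'C t))// ler_piMr//.
      by case: (_ \in _); rewrite ?normr1 ?normr0.
    rewrite memNset ?mulr0 ?normr0// => -[/= h1 [h2 h3]].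
    by move: h; rewrite notin_setE; apply; rewrite /= in_itv/= h3 (le_trans h1 h2).
apply: (@le_lt_trans _ _ (\int[mu]_s ((C * (K + K))%:E * `|(r' s)%:E|))%E).
  apply: ge0_le_integral => //.
  - by move=> s _; apply: integral_ge0.
  - apply: (@measurable_fun_fubini_tonelli_F _ _ _ _ _ mu (fun z => `|F z|%E)) => [|z]; last exact: abse_ge0.
    exact: measurableT_comp.
  - by apply: emeasurable_funM => //; apply: measurableT_comp => //; exact/measurable_EFinP.
have CK : 0 <= C * (K + K) by rewrite mulr_ge0// addr_ge0.
rewrite ge0_integralZl// ?lee_fin//; last by apply: measurableT_comp => //; exact/measurable_EFinP.
by rewrite lte_mul_pinfty//; case/integrableP: ir'.
Qed.

(** Fubini for r'(s) u'(t) on the triangle - K <= s <= t <= K. Integrating in t first gives - r' u,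
    as u vanishes at K; integrating in s first gives (r - r(- K)) u', whose constant part
    contributes 0. *)
Lemma integration_by_parts_compact :
  (\int[mu]_x (r x * u' x)%:E = - \int[mu]_x (r' x * u x)%:E)%E.
Proof.
have uK : u K = 0 by rewrite u0// ger0_norm.
have uNK : u (- K) = 0 by rewrite u0// normrN ger0_norm.
have KK : - K <= K by rewrite (le_trans _ K0)// oppr_le0.
have left_ s : (\int[mu]_t F (s, t) = - (r' s * u s)%:E)%E.
  have [/andP[s1 s2]|sK] := boolP (- K <= s <= K); last first.
    rewrite u0; last by rewrite leNgt ltr_norml; apply: contra sK => /andP[? ?]; rewrite !ltW.
    rewrite mulr0 oppe0; apply: integral0_eq => t _.
    rewrite /F /= indicE memNset ?mulr0// => -[/= h1 [h2 h3]].
    by move: sK; rewrite h1 (le_trans h2 h3).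
  have -> : (\int[mu]_t F (s, t) = \int[mu]_t ((r' s)%:E * ((EFin \o u') \_ `[s, K]) t))%E.
    apply: eq_integral => t _; rewrite /F /= patchE indicE mem_setE.
    have -> : ((s, t) \in D) = (t \in `[s, K]).
      by rewrite in_itv/=; apply/idP/idP; [rewrite inE/= => -[_ [-> ->]] | move=> /andP[? ?]; rewrite inE].
    by case: ifP => _; rewrite ?mulr1 ?EFinM ?mulr0 ?mule0//= mulr0.
  rewrite integralZl//; last first.
    apply: (integrable_restrict _ _ measurableT _).1 => //; rewrite setTI.
    by apply: continuous_compact_integrable; [exact: segment_compact | exact: continuous_subspaceT].
  rewrite -integral_mkcond (integral_is_derive s2 du cu') uK sub0r -EFinM.
  by rewrite -EFinN mulrN.
have right_ t : (\int[mu]_s F (s, t) = (r t * u' t - r (- K) * u' t)%:E)%E.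
  have [tK|tK] := leP K `|t|.
    by rewrite u'0// !mulr0 subr0; apply: integral0_eq => s _; rewrite /F /= u'0// mul0r mulr0.
  have [t1 t2] : - K < t /\ t < K by move: tK; rewrite ltr_norml => /andP.
  have -> : (\int[mu]_s F (s, t) = \int[mu]_s ((u' t)%:E * ((EFin \o r') \_ `[(- K)%R, t]) s))%E.
    apply: eq_integral => s _; rewrite /F /= patchE indicE mem_setE.
    have -> : ((s, t) \in D) = (s \in `[- K, t]).
      by rewrite in_itv/=; apply/idP/idP; [rewrite inE/= => -[-> [-> _]] | move=> /andP[h1 h2]; rewrite inE; split => //=; split => //; exact: ltW].
    by case: ifP => _; rewrite ?mulr1 ?mulr0 ?mule0//= -EFinM mulrC.
  rewrite integralZl//; last first.
    apply: (integrable_restrict _ _ measurableT _).1 => //; rewrite setTI.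
    by apply: integrableS ir'.
  by rewrite -integral_mkcond -rr' ?(ltW t1)// -EFinM mulrBr !(mulrC (u' t)).
have iu : mu.-integrable setT (fun t => (r t * u' t)%:E).
  apply: (le_integrable measurableT _ _ (integrableZl measurableT C ir)).
    by apply/measurable_EFinP; exact: measurable_funM.
  move=> t _; rewrite /= -?EFinM lee_fin !normrM mulrC ler_wpM2r//.
  by rewrite (le_trans (u'C t))// ler_norm.
have u'E : (\int[mu]_t (u' t)%:E = 0)%E.
  rewrite (_ : (\int[mu]_t (u' t)%:E)%E = (\int[mu]_(t in `[(- K)%R, K]) (u' t)%:E)%E).
    by rewrite (integral_is_derive KK du cu') uK uNK subrr.
  rewrite [RHS]integral_mkcond; apply: eq_integral => t _; rewrite patchE mem_setE in_itv/= -ler_norml.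
  by case: leP => // h; rewrite u'0// ltW.
have iu' : mu.-integrable setT (EFin \o u').
  rewrite (_ : EFin \o u' = (EFin \o u') \_ `[- K, K]).
    apply: (integrable_restrict _ _ measurableT _).1 => //; rewrite setTI.
    by apply: continuous_compact_integrable; [exact: segment_compact | exact: continuous_subspaceT].
  apply/funext => t; rewrite patchE mem_setE in_itv/= -ler_norml.
  by case: leP => // h; rewrite /= u'0// ltW.
have ju : mu.-integrable setT (fun s => (r' s * u s)%:E).
  apply: (le_integrable measurableT _ _ (integrableZl measurableT C ir')).
    by apply/measurable_EFinP; exact: measurable_funM.
  move=> t _; rewrite /= -?EFinM lee_fin !normrM mulrC ler_wpM2r//.
  by rewrite (le_trans (uC t))// ler_norm.
have := Fubini iF.
rewrite (_ : (\int[mu]_x \int[mu]_y F (x, y) = - \int[mu]_x (r' x * u x)%:E)%E); last first.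
  rewrite -integralN; last exact: integrable_add_def.
  by apply: eq_integral => s _; rewrite left_.
move=> ->; rewrite (_ : (\int[mu]_y \int[mu]_x F (x, y) =
    \int[mu]_x ((r x * u' x)%:E - (r (- K))%:E * (u' x)%:E))%E); last first.
  by apply: eq_integral => t _; rewrite right_ EFinB EFinM.
have iu2 := integrableZl measurableT (r (- K)) iu'.
by rewrite integralB// integralZl// u'E mule0 sube0.
Qed.

End integration_by_parts.

(** * Identification of R^1 with the line *)

Section line_measure.
Context {R : realType}.
Local Notation V := 'rV[R]_1.
Local Notation L := (@lebesgue_rV R 1).
Local Notation mu := (@lebesgue_measure R).

Lemma ge0_integral_rV1 (h : R -> \bar R) : measurable_fun setT h -> (forall x, 0 <= h x)%E ->
  (\int[L]_x h (x ord0 ord0) = \int[mu]_s h s)%E.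
Proof.
move=> mh h0; rewrite integral_lebesgue_consr//; last exact: (measurableT_comp mh (measurable_coord ord0)).
rewrite (eq_integral (cst (\int[mu]_s h s)%E)).
  by rewrite integral_cst//= diracT mule1.
by move=> v _; apply: eq_integral => s _; rewrite mxE unlift_none.
Qed.

Lemma integral_rV1 (h : R -> \bar R) : measurable_fun setT h ->
  (\int[L]_x h (x ord0 ord0) = \int[mu]_s h s)%E.
Proof.
move=> mh; rewrite integralE [RHS]integralE; congr (_ - _)%E.
- by rewrite -ge0_integral_rV1//; [apply: eq_integral => x _; rewrite !unlock | exact: measurable_funepos].
- by rewrite -ge0_integral_rV1//; [apply: eq_integral => x _; rewrite !unlock | exact: measurable_funeneg].
Qed.

Lemma integrable_rV1 (h : R -> \bar R) : mu.-integrable setT h ->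
  L.-integrable setT (fun x => h (x ord0 ord0)).
Proof.
move=> /integrableP[mh hoo]; apply/integrableP; split.
  exact: (measurableT_comp mh (measurable_coord ord0)).
by rewrite (ge0_integral_rV1 (h := fun s => `|h s|%E))//; exact: measurableT_comp.
Qed.

Lemma row1E (x : V) : x = 0 + x ord0 ord0 *: delta_mx ord0 ord0.
Proof. by apply/rowP => i; rewrite (ord1 i) !mxE !eqxx/= mulr1 add0r. Qed.

Lemma test_function_line (psi : V -> R) : test_function psi ->
  exists K C : R, [/\ 0 <= K, continuous (fun s : R => partial ord0 psi (0 + s *: delta_mx ord0 ord0)),
    forall s : R, is_derive s (1 : R) (fun s : R => psi (0 + s *: delta_mx ord0 ord0))
      (partial ord0 psi (0 + s *: delta_mx ord0 ord0)),
    forall s : R, K <= `|s| -> psi (0 + s *: delta_mx ord0 ord0) = 0 /\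
      partial ord0 psi (0 + s *: delta_mx ord0 ord0) = 0
    & forall s : R, `|psi (0 + s *: delta_mx ord0 ord0)| <= C /\
      `|partial ord0 psi (0 + s *: delta_mx ord0 ord0)| <= C].
Proof.
move=> [dpsi cpsi [A cA Apsi]].
set ln := fun s : R => 0 + s *: delta_mx ord0 ord0 : V.
have cl : continuous ln.
  by move=> s; apply: cvgD; [exact: cvg_cst | apply: cvgZr_tmp; exact: cvg_id].
have dl (s : R) : is_derive s (1 : R) (fun s : R => psi (ln s)) (partial ord0 psi (ln s)).
  by apply: is_derive_on_line; apply: DeriveDef.
have cd : continuous (fun s : R => partial ord0 psi (ln s)).
  by move=> s; exact: (continuous_comp (@cl s) (@cpsi ord0 (ln s))).
have cp : continuous (fun s : R => psi (ln s)) := is_derive_continuous dl.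
have [M [Mr AM]] : bounded_set [set (x : V) ord0 ord0 | x in A].
  apply: compact_bounded; apply: continuous_compact => //.
  by apply: continuous_subspaceT => x; exact: coord_continuous.
(* The function vanishes as soon as |s| > |M| + 1; one more unit makes it vanish on a neighbourhood
   of every s with |s| >= K, hence so does its derivative at s. *)
pose K := `|M| + 2.
have p0 s : `|M| + 1 < `|s| -> psi (ln s) = 0.
  move=> Ms; apply: Apsi => As; move: Ms; apply/negP; rewrite -leNgt.
  apply: (AM (`|M| + 1)); first by rewrite (le_lt_trans (ler_norm M))// ltrDl.
  by exists (ln s) => //; rewrite !mxE !eqxx/= mulr1 add0r.
have K0 : 0 <= K by rewrite addr_ge0.
have out s : K <= `|s| -> psi (ln s) = 0 /\ partial ord0 psi (ln s) = 0.
  move=> Ks; have Ms : `|M| + 1 < `|s| by apply: lt_le_trans Ks; rewrite ltrD2l ltr1n.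
  split; first exact: p0.
  have H : is_derive s (1 : R) (fun s : R => psi (ln s)) 0.
    apply: (near_eq_is_derive _ (is_derive_cst (0 : R) s (1 : R))).
    near=> t; rewrite /cst p0//; near: t.
    exact: (cvgr_gt _ (@norm_continuous _ R s)).
  have := @derive_val _ _ _ _ _ _ _ (dl s); rewrite -derive1E => <-.
  by rewrite derive1E; exact: derive_val.
have bnd (f : R -> R) : continuous f -> (forall s, K <= `|s| -> f s = 0) ->
    exists2 C, 0 <= C & forall s, `|f s| <= C.
  move=> cf f0; have [N [_ fN]] : bounded_set [set f s | s in `[- K, K]].
    apply: compact_bounded; apply: continuous_compact; last exact: segment_compact.
    exact: continuous_subspaceT.
  exists (`|N| + 1) => [|s]; first by rewrite addr_ge0.
  have [/f0 ->|sK] := leP K `|s|; first by rewrite normr0 addr_ge0.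
  apply: (fN (`|N| + 1)); first by rewrite (le_lt_trans (ler_norm N))// ltrDl.
  by exists s => //=; rewrite in_itv/= -ler_norml ltW.
have [C1 C10 HC1] := bnd _ cp (fun s h => (out s h).1).
have [C2 C20 HC2] := bnd _ cd (fun s h => (out s h).2).
exists K, (C1 + C2); split => // s; split.
  by rewrite (le_trans (HC1 s))// lerDl.
by rewrite (le_trans (HC2 s))// lerDr.
Unshelve. all: by end_near.
Qed.

Lemma weak_gradient_line (r r' : R -> R) :
  mu.-integrable setT (EFin \o r) -> mu.-integrable setT (EFin \o r') ->
  (forall a b, a <= b -> ((r b - r a)%:E = \int[mu]_(x in `[a, b]) (r' x)%:E)%E) ->
  weak_gradient (fun x : V => r (x ord0 ord0)) (fun x => \row_i r' (x ord0 ord0)).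
Proof.
move=> ir ir' rr' i; rewrite (ord1 i); split.
  rewrite (_ : (fun x => _) = fun x : V => (EFin \o r') (x ord0 ord0)); first exact: integrable_rV1.
  by apply/funext => x; rewrite /= mxE.
move=> psi tp; have [K [C [K0 cu du out bd]]] := test_function_line tp.
have mr : measurable_fun setT r by have /measurable_int/measurable_EFinP := ir.
have mr' : measurable_fun setT r' by have /measurable_int/measurable_EFinP := ir'.
have := integration_by_parts_compact ir ir' rr' du cu (fun s h => (out s h).1)
  (fun s h => (out s h).2) (fun s => (bd s).2) (fun s => (bd s).1) K0.
have mup : measurable_fun setT (fun s : R => partial ord0 psi (0 + s *: delta_mx ord0 ord0)).
  exact: continuous_measurable_fun.
have mu_ : measurable_fun setT (fun s : R => psi (0 + s *: delta_mx ord0 ord0)).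
  by apply: continuous_measurable_fun; exact: is_derive_continuous du.
rewrite -[in X in X = _ -> _]integral_rV1; last by apply/measurable_EFinP; exact: measurable_funM.
rewrite -[in X in _ = X -> _]integral_rV1; last by apply/measurable_EFinP; exact: measurable_funM.
move=> H; rewrite (_ : (\int[L]_x _)%E = (\int[L]_x (r (x ord0 ord0) *
   partial ord0 psi (0 + x ord0 ord0 *: delta_mx ord0 ord0))%:E)%E).
  rewrite H; congr (- _)%E; apply: eq_integral => x _.
  by rewrite -row1E mxE.
by apply: eq_integral => x _; rewrite -row1E.
Qed.

End line_measure.

(** * Fisher information of the laws of a leaf *)

Section leaf_fisher.
Context {R : realType}.
Local Notation V := 'rV[R]_1.
Local Notation L := (@lebesgue_rV R 1).
Local Notation mu := (@lebesgue_measure R).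
Variables (phi g : R -> R) (J m sigma : R).
Hypothesis (sc : score phi g J) (s0 : 0 < sigma).

Let T (x : R) := (x - m) / sigma.

Let dT x : is_derive x (1 : R) T (sigma^-1).
Proof.
have h := is_deriveD (is_derive_id x (1 : R)) (is_derive_cst (- m) x (1 : R)).
have := is_deriveZ sigma^-1 h; rewrite addr0.
have -> : sigma^-1 *: (1 : R) = sigma^-1 by rewrite /GRing.scale/= mulr1.
by rewrite (_ : _ \*: _ = T)//; apply/funext => y; rewrite /T !fctE /GRing.scale/= mulrC.
Qed.

Let si0 : 0 < sigma^-1. Proof. by rewrite invr_gt0. Qed.

Let mT : measurable_fun setT T.
Proof. by apply: continuous_measurable_fun; exact: is_derive_continuous dT. Qed.

Lemma integral_location_scale (F : R -> \bar R) : measurable_fun setT F -> (forall x, 0 <= F x)%E ->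
  (\int[mu]_x (F (T x) * sigma^-1%:E) = \int[mu]_x F x)%E.
Proof.
by move=> mF F0; apply: (ge0_change_of_variable si0 (fun=> lexx _) dT) => // x; exact: cvg_cst.
Qed.

Let mphi : measurable_fun setT phi. Proof. by case: sc => -[]. Qed.
Let mg : measurable_fun setT g. Proof. by case: sc => -[]. Qed.
Let phi0 x : 0 < phi x. Proof. by case: sc. Qed.

Let r x := sigma^-1 * phi (T x).
Let r' x := sigma^-1 * (sigma^-1 * g (T x)).

Let mr : measurable_fun setT r.
Proof. by apply: measurable_funM => //; exact: (measurableT_comp mphi mT). Qed.

Let mr' : measurable_fun setT r'.
Proof. by do 2 apply: measurable_funM => //; exact: (measurableT_comp mg mT). Qed.

Let r0 x : 0 < r x. Proof. by rewrite mulr_gt0. Qed.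

Let integral_r : (\int[mu]_x (r x)%:E = 1)%E.
Proof.
have [_ _ _ [I1 _] _] := sc; rewrite -I1 -[RHS]integral_location_scale//.
- by apply: eq_integral => x _; rewrite -EFinM mulrC.
- exact/measurable_EFinP.
- by move=> x; rewrite lee_fin ltW.
Qed.

Let integrable_r : mu.-integrable setT (EFin \o r).
Proof.
apply/integrableP; split; first exact/measurable_EFinP.
rewrite (_ : (\int[mu]_x _ = 1%:E)%E) ?ltry// -integral_r; apply: eq_integral => x _.
by rewrite /= gtr0_norm.
Qed.

Let integrable_r' : mu.-integrable setT (EFin \o r').
Proof.
have ig : mu.-integrable setT (EFin \o g) := integrable_score sc.
apply/integrableP; split; first exact/measurable_EFinP.
have -> : (\int[mu]_x `|(EFin \o r') x| = \int[mu]_x (sigma^-1 * `|g x|)%:E)%E.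
  rewrite -(integral_location_scale (F := fun x => (sigma^-1 * `|g x|)%:E)).
  - apply: eq_integral => x _; rewrite /= /r' !normrM (gtr0_norm si0) -EFinM; congr EFin; ring.
  - by apply/measurable_EFinP; apply: measurable_funM => //; exact: measurableT_comp.
  - by move=> x; rewrite lee_fin mulr_ge0 ?(ltW si0).
rewrite ge0_integral_mull ?(ltW si0)//; last exact: measurableT_comp.
by rewrite lte_mul_pinfty// ?lee_fin ?(ltW si0)//; case/integrableP : ig.
Qed.

Let increments_r a b : a <= b -> ((r b - r a)%:E = \int[mu]_(x in `[a, b]) (r' x)%:E)%E.
Proof.
move=> ab; have [_ _ phig _ _] := sc.
have Tab : T a <= T b by rewrite /T ler_pM2r// lerD2r.
have ig : mu.-integrable setT (EFin \o g) := integrable_score sc.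
have mI := measurable_itv `[T a, T b].
rewrite -mulrBr EFinM phig// integral_mkcond [in RHS]integral_mkcond.
have E x : ((EFin \o r') \_ `[a, b]) x = (sigma^-1%:E * (((EFin \o g) \_ `[T a, T b]) (T x) * sigma^-1%:E))%E.
  rewrite !patchE !mem_setE !in_itv/= /T !ler_pM2r// !lerD2r.
  by case: ifP => _; rewrite ?mul0e ?mule0//= /r' -!EFinM; congr EFin; ring.
have mh : measurable_fun setT ((EFin \o g) \_ `[T a, T b]).
  by apply/(measurable_restrictT _ _).1 => //; apply: measurable_funTS; exact/measurable_EFinP.
pose q x := if x \in `[T a, T b] then g x else 0.
have mE : (EFin \o g) \_ `[T a, T b] = EFin \o q.
  by apply/funext => x; rewrite /q /= patchE mem_setE; case: ifP.
have pM (c : R) : Num.max (c * sigma^-1) 0 = Num.max c 0 * sigma^-1.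
  by rewrite maxr_pMl ?mul0r// ltW.
have pME c : (maxe (c%:E * sigma^-1%:E) 0 = maxe c%:E 0 * sigma^-1%:E)%E.
  by rewrite -EFinM -!EFin_max -EFinM pM.
have [_ dH] : True /\ mu.-integrable setT ((EFin \o g) \_ `[T a, T b]).
  by split=> //; apply: (integrable_restrict _ _ measurableT _).1 => //; rewrite setTI; exact: integrableS ig.
have sgn : (\int[mu]_x (((EFin \o g) \_ `[T a, T b]) (T x) * sigma^-1%:E) =
    \int[mu]_x ((EFin \o g) \_ `[T a, T b]) x)%E.
  rewrite mE integralE [RHS]integralE; rewrite mE in mh; congr (_ - _)%E.
  - rewrite -[RHS]integral_location_scale//; last exact: measurable_funepos.
    by apply: eq_integral => x _; rewrite !unlock; exact: pME (q (T x)).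
  - rewrite -[RHS]integral_location_scale//; last exact: measurable_funeneg.
    by apply: eq_integral => x _; rewrite !unlock; have := pME (- q (T x)); rewrite EFinN mulNe; apply.
transitivity (sigma^-1%:E * \int[mu]_x (((EFin \o g) \_ `[T a, T b]) (T x) * sigma^-1%:E))%E; first by rewrite sgn.
rewrite -integralZl//; first by apply: eq_integral => x _; rewrite -E.
apply/integrableP; split.
  by apply: emeasurable_funM => //; exact: (measurableT_comp mh mT).
have /integrableP[_] := dH; rewrite -(integral_location_scale (F := fun x => `|((EFin \o g) \_ `[T a, T b]) x|%E))//; last exact: measurableT_comp.
apply: le_lt_trans; rewrite le_eqVlt; apply/orP; left; apply/eqP.
by apply: eq_integral => x _; rewrite abseM [X in (_ * X)%E]gee0_abs// lee_fin ltW.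
Qed.

(** [leaf_law] is a choice, so existence is the point: x^2 <= 2 sigma^2 (T x)^2 + 2 m^2 bounds the
    second moment by moments of the base density. *)
Lemma leaf_law_density : is_density (leaf_law phi m sigma) (leaf_density phi m sigma).
Proof.
suff [p pd] : exists p, is_density p (leaf_density phi m sigma).
  exact: (@getPex _ [set p | is_density p (leaf_density phi m sigma)] (ex_intro _ p pd)).
have md : measurable_fun setT (leaf_density phi m sigma : V -> R).
  exact: (measurableT_comp mr (measurable_coord ord0)).
apply: exists_density => //.
- by move=> x; exact: ltW (r0 _).
- rewrite (integral_rV1 (h := fun x => (r x)%:E)); first exact: integral_r.
  exact/measurable_EFinP.
have [_ _ _ [I1 I2] _] := sc.
rewrite (_ : (fun x : V => _) = fun x : V => (fun s : R => (s ^+ 2 * r s)%:E) (x ord0 ord0)); last first.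
  by apply/funext => x; rewrite /sqnorm /dot big_ord1 expr2.
rewrite (integral_rV1 (h := fun x => (x ^+ 2 * r x)%:E)); last first.
  by apply/measurable_EFinP; apply: measurable_funM => //; exact: measurable_funX.
have p1 x : 0 <= x ^+ 2 * phi x by rewrite mulr_ge0 ?sqr_ge0// ltW.
have c1 : 0 <= 2 * sigma ^+ 2 by rewrite mulr_ge0// sqr_ge0.
have c2 : 0 <= 2 * m ^+ 2 by rewrite mulr_ge0// sqr_ge0.
pose F y := ((2 * sigma ^+ 2) * (y ^+ 2 * phi y) + (2 * m ^+ 2) * phi y)%:E : \bar R.
have F0 x : (0 <= F x)%E by rewrite lee_fin; apply: addr_ge0; apply: mulr_ge0 => //; exact: ltW.
have mF : measurable_fun setT F.
  apply/measurable_EFinP; apply: measurable_funD; last exact: measurable_funM.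
  by apply: measurable_funM => //; apply: measurable_funM => //; exact: measurable_funX.
apply: (@le_lt_trans _ _ (\int[mu]_y F y)%E).
  rewrite -[leRHS]integral_location_scale//; apply: ge0_le_integral => //.
  - by move=> x _; rewrite lee_fin mulr_ge0 ?sqr_ge0// ltW.
  - by apply/measurable_EFinP; apply: measurable_funM => //; exact: measurable_funX.
  - by apply: emeasurable_funM => //; exact: (measurableT_comp mF mT).
  move=> x _; rewrite /F -EFinM lee_fin /r.
  have e : x = sigma * T x + m by rewrite /T; field; rewrite gt_eqF.
  have h : x ^+ 2 <= 2 * sigma ^+ 2 * T x ^+ 2 + 2 * m ^+ 2.
    by rewrite {1}e; have := sqr_ge0 (sigma * T x - m); rewrite !expr2; lra.
  have p0 : 0 <= sigma^-1 * phi (T x) by rewrite mulr_ge0// ltW.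
  by have := ler_wpM2r p0 h; lra.
rewrite /F.
have -> : (\int[mu]_y (2 * sigma ^+ 2 * (y ^+ 2 * phi y) + 2 * m ^+ 2 * phi y)%:E =
    \int[mu]_y ((2 * sigma ^+ 2 * (y ^+ 2 * phi y))%:E + (2 * m ^+ 2 * phi y)%:E))%E.
  by apply: eq_integral => y _; rewrite EFinD.
have m1 : measurable_fun setT (fun x : R => x ^+ 2 * phi x) by apply: measurable_funM => //; exact: measurable_funX.
rewrite ge0_integralD//.
- by rewrite !ge0_integral_mull// ?I1 ?I2 ?mule1 -?EFinD ?ltry// => x; exact: ltW.
- by move=> x _; rewrite lee_fin mulr_ge0.
- by apply/measurable_EFinP; exact: measurable_funM.
- by move=> x _; rewrite lee_fin mulr_ge0// ltW.
- by apply/measurable_EFinP; exact: measurable_funM.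
Qed.

(** The explicit gradient only bounds the infimum in [fisher] from above. Equality holds because the
    slope of the entropy at this law, computed from this gradient or from the one given by
    [fisherP], is the same number. *)
Lemma fisher_leaf : fisher (leaf_law phi m sigma) = (J / sigma ^+ 2)%:E.
Proof.
have wG := weak_gradient_line integrable_r integrable_r' increments_r.
have GJ : (\int[L]_x (sqnorm (\row_i r' (x ord0 ord0) : V) / leaf_density phi m sigma x)%:E)%E = (J / sigma ^+ 2)%:E.
  have [_ _ _ _ IJ] := sc.
  have mq : measurable_fun setT (fun x : R => r' x ^+ 2 / r x).
    by apply: measurable_funM; [exact: measurable_funX | exact: measurable_fun_inv].
  have mq2 : measurable_fun setT (fun x : R => g x ^+ 2 / phi x).
    by apply: measurable_funM; [exact: measurable_funX | exact: measurable_fun_inv].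
  rewrite (_ : (fun x : V => _) = fun x : V => (fun s : R => (r' s ^+ 2 / r s)%:E) (x ord0 ord0)); last first.
    by apply/funext => x; rewrite /sqnorm /dot big_ord1 mxE expr2.
  rewrite (integral_rV1 (h := fun s => (r' s ^+ 2 / r s)%:E)); last exact/measurable_EFinP.
  have p2 x : 0 <= g x ^+ 2 / phi x by rewrite divr_ge0 ?sqr_ge0// ltW.
  have s2 : 0 <= sigma ^- 2 by rewrite invr_ge0 sqr_ge0.
  rewrite mulrC EFinM -IJ -ge0_integral_mull// -[RHS]integral_location_scale.
  - apply: eq_integral => x _; rewrite -EFinM /r' /r; congr EFin; field.
    by rewrite !gt_eqF.
  - by apply/measurable_EFinP; exact: measurable_funM.
  - by move=> x; rewrite lee_fin mulr_ge0.
have pf : (fisher (leaf_law phi m sigma) < +oo)%E.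
  apply: (@le_lt_trans _ _ (J / sigma ^+ 2)%:E); last exact: ltry.
  by rewrite -GJ; apply: ereal_inf_lbound; eexists; eexists; split; [exact: leaf_law_density | exact: wG | by []].
have [rho [G [J' [pr wG' GJ' J'0 ->]]]] := fisherP (ltn0Sn 0) pf.
have wG2 := weak_gradient_plateaux wG.
have J0 := fisher_gt0 leaf_law_density wG2 GJ (ltn0Sn 0).
have := metric_slope_W2 (ltn0Sn 0) pr wG' GJ' ltr01.
rewrite (metric_slope_W2 (ltn0Sn 0) leaf_law_density wG2 GJ ltr01) !divr1 => -[e].
by rewrite -(sqr_sqrtr (ltW J'0)) -e sqr_sqrtr// ltW.
Qed.

End leaf_fisher.

(** * Multiplication by a positive real in the extended reals *)

Section scaling_lemmas.
Context {R : realType}.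
Implicit Types (k : R) (x y z : \bar R).

Lemma scaleVKe k x : 0 < k -> (k^-1%:E * (k%:E * x) = x)%E.
Proof. by move=> k0; rewrite muleA -EFinM mulVf ?gt_eqF// mul1e. Qed.

Lemma scale_pinftyE k x : 0 < k -> (k%:E * x = +oo)%E <-> x = +oo%E.
Proof.
move=> k0; split => [h|->]; last by rewrite mulry gtr0_sg// mul1e.
by rewrite -(scaleVKe x k0) h mulry gtr0_sg ?invr_gt0// mul1e.
Qed.

Lemma scale_lt_pinfty k x : 0 < k -> (k%:E * x < +oo)%E <-> (x < +oo)%E.
Proof.
move=> k0; rewrite !ltey; split => /eqP h; apply/eqP => e; apply: h.
  exact/(scale_pinftyE _ k0).
exact/(scale_pinftyE x k0).
Qed.

Lemma scaleeB k x y : 0 < k -> (k%:E * (x - y) = k%:E * x - k%:E * y)%E.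
Proof.
move=> k0; have ky : (k%:E * +oo = +oo)%E by rewrite mulry gtr0_sg// mul1e.
have kNy : (k%:E * -oo = -oo)%E by rewrite mulrNy gtr0_sg// mul1e.
by case: x => [x| |]; case: y => [y| |] //=; rewrite ?ky ?kNy// -!EFinM -EFinB mulrBr.
Qed.

Import HBNNSimple.

(* [f] need not be measurable *)
Lemma integral_scale d (T : measurableType d) (mu : measure T R) (D : set T) (f : T -> \bar R) k :
  0 < k -> (\int[mu]_(x in D) (k%:E * f x) = k%:E * \int[mu]_(x in D) f x)%E.
Proof.
move=> k0; rewrite integral_mkcond [in RHS]integral_mkcond.
rewrite (_ : (fun x : T => k%:E * f x)%E \_ D = fun x : T => (k%:E * (f \_ D) x)%E); last first.
  by apply/funext => x; rewrite !patchE; case: ifP => //; rewrite mule0.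
move: (f \_ D) => {}f {D}.
(* Scaling the simple functions below [g] gives one inequality for every constant; the other one is
   this inequality for [k^-1]. *)
have le (c : R) (g : T -> \bar R) : 0 < c -> (forall x : T, 0 <= g x)%E ->
    (c%:E * \int[mu]_x g x <= \int[mu]_x (c%:E * g x))%E.
  move=> c0 g0; have cg0 (x : T) : (0 <= c%:E * g x)%E by rewrite mule_ge0// lee_fin ltW.
  rewrite -lee_pdivlMl// ge0_integralTE//; apply: ge_ereal_sup => _ [h /= hg <-].
  rewrite lee_pdivlMl// ge0_integralTE//; apply: ereal_sup_ubound.
  exists (scale_nnsfun h (ltW c0)); last by rewrite -sintegralrM.
  by move=> x /=; rewrite EFinM lee_pmul2l ?lte_fin//; exact: hg.
have eq (g : T -> \bar R) : (forall x : T, 0 <= g x)%E ->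
    (\int[mu]_x (k%:E * g x) = k%:E * \int[mu]_x g x)%E.
  move=> g0; apply/eqP; rewrite eq_le; apply/andP; split; last exact: le.
  have ki : 0 < k^-1 by rewrite invr_gt0.
  have kg0 (x : T) : (0 <= k%:E * g x)%E by rewrite mule_ge0// lee_fin ltW.
  have := le _ _ ki kg0.
  rewrite lee_pdivrMl// => /le_trans; apply; rewrite le_eqVlt; apply/orP; left; apply/eqP.
  by congr (_ * _)%E; apply: eq_integral => x _; rewrite scaleVKe.
rewrite integralE [in RHS]integralE scaleeB// ge0_funeposM ?(ltW k0)// ge0_funenegM ?(ltW k0)//.
by rewrite !eq.
Qed.

Lemma limn_einf_scale k (u : nat -> \bar R) : 0 < k ->
  (k%:E * limn_einf u <= limn_einf (fun i => k%:E * u i))%E.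
Proof.
move=> k0; rewrite !limn_einf_lim.
have c : (k%:E * einfs u i)%E @[i --> \oo] --> (k%:E * limn (einfs u))%E.
  by apply: cvgeZl => //; exact: is_cvg_einfs.
rewrite -(cvg_lim (@ereal_hausdorff R) c); apply: lee_lim.
- by apply/cvg_ex; eexists; exact: c.
- exact: is_cvg_einfs.
apply: nearW => i; apply: le_ereal_inf_tmp => _ [m /= im <-].
by rewrite lee_pmul2l ?lte_fin//; apply: ereal_inf_lbound; exists m.
Qed.

End scaling_lemmas.

(** * Scaling of the metric slope *)

Section metric_slope_scaling.
Context {R : realType} {n : nat}.
Implicit Types (p q : P2 R n) (F : P2 R n -> \bar R) (d : P2 R n -> P2 R n -> \bar R).

(** The ball of radius r for [d'] is the ball of radius r / s for [d], and quotients are divided by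
    s. The equality follows by exchanging the two functions. *)
Let slope_scale_le d d' F p s : 0 < s -> (forall q, d' p q = s%:E * d p q)%E ->
  (s^-1%:E * metric_slope d F p <= metric_slope d' F p)%E.
Proof.
move=> s0 dd'; have si : 0 < s^-1 by rewrite invr_gt0.
rewrite /metric_slope maxe_pMr//; last by rewrite lee_fin ltW.
rewrite mule0 le_max2 //; apply: le_ereal_inf_tmp => _ [r /= r0 <-].
rewrite lee_pdivrMl//; apply: ge_ereal_inf.
eexists; first by exists (r / s); [exact: divr_gt0 | reflexivity].
apply: ge_ereal_sup => _ [q /= /andP[d0 dr] <-].
rewrite -lee_pdivrMl//; apply: ereal_sup_ge.
exists (maxe 0 (F p - F q) / d' p q)%E.
  exists q => //=; rewrite dd'; move: d0 dr; case: (d p q) => [w| |]//; rewrite -EFinM !lte_fin => w0 wr.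
  by rewrite mulr_gt0//= mulrC -ltr_pdivlMr.
rewrite dd'; move: d0 dr; case: (d p q) => [w| |]//; rewrite lte_fin => w0 _.
rewrite -EFinM !inver !gt_eqF ?mulr_gt0// muleCA -EFinM.
by rewrite invfM.
Qed.

Lemma metric_slope_scale d d' F p s : 0 < s -> (forall q, d' p q = s%:E * d p q)%E ->
  (metric_slope d' F p = s^-1%:E * metric_slope d F p)%E.
Proof.
move=> s0 dd'; apply/eqP; rewrite eq_le; apply/andP; split; last exact: slope_scale_le.
have si : 0 < s^-1 by rewrite invr_gt0.
rewrite -lee_pdivrMl//; apply: slope_scale_le => // q.
by rewrite dd' scaleVKe.
Qed.

End metric_slope_scaling.

(** * Effect of the change of unit on lengths, distances and minimizers *)

Section change_of_unit.
Context {R : realType} {n : nat}.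
Implicit Types (p q : P2 R n) (U : P2 R n -> \bar R) (gamma : R -> P2 R n) (e l : R).

(** These signs are what lets a product distribute over e + U in the extended reals. *)
Definition cost_data e U := 0 <= e /\ forall p, (0 <= U p)%E.

Lemma cost_data_scale l e U : 0 < l -> cost_data e U -> cost_data (l * e) (change_unit l U).
Proof.
move=> l0 [e0 U0]; split; first by rewrite mulr_ge0// ltW.
by move=> p; rewrite mule_ge0// lee_fin ltW.
Qed.

Lemma change_unitK l U : 0 < l -> change_unit l^-1 (change_unit l U) = U.
Proof. by move=> l0; apply/funext => p; exact: scaleVKe. Qed.

(* To obtain an equivalence it is enough to prove one implication for all units. *)
Lemma change_unit_iff (P : R -> (P2 R n -> \bar R) -> Prop) :
  (forall l e U, 0 < l -> cost_data e U -> P e U -> P (l * e) (change_unit l U)) ->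
  forall l e U, 0 < l -> cost_data e U -> P (l * e) (change_unit l U) <-> P e U.
Proof.
move=> H l e U l0 D; split; last exact: H.
have li : 0 < l^-1 by rewrite invr_gt0.
move=> /(H _ _ _ li (cost_data_scale l0 D)).
by rewrite mulrA mulVf ?gt_eqF// mul1r change_unitK.
Qed.

Lemma cost_density_scale l e U p : 0 < l -> cost_data e U ->
  (2%:E * ((l * e)%:E + change_unit l U p) = l%:E * (2%:E * (e%:E + U p)))%E.
Proof.
move=> l0 [e0 U0]; rewrite /change_unit EFinM -ge0_muleDr ?lee_fin//.
by rewrite muleCA.
Qed.

Lemma sqrte_cost_density l e U p : 0 < l -> cost_data e U ->
  (sqrte (2%:E * ((l * e)%:E + change_unit l U p)) =
   (Num.sqrt l)%:E * sqrte (2%:E * (e%:E + U p)))%E.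
Proof. by move=> l0 D; rewrite cost_density_scale// sqrteM// lee_fin ltW. Qed.

Lemma cost_speed_scale l e U gamma t : 0 < l -> cost_data e U ->
  (cost_speed (l * e) (change_unit l U) gamma t = (Num.sqrt l)%:E * cost_speed e U gamma t)%E.
Proof. by move=> l0 D; rewrite /cost_speed sqrte_cost_density// muleA. Qed.

Lemma cost_length_scale l e U T gamma : 0 < l -> cost_data e U ->
  (cost_length (l * e) (change_unit l U) T gamma = (Num.sqrt l)%:E * cost_length e U T gamma)%E.
Proof.
move=> l0 D; rewrite /cost_length -integral_scale ?sqrtr_gt0//.
by apply: eq_integral => t _; exact: cost_speed_scale.
Qed.

Let cost_dist_le l e U p q : 0 < l -> cost_data e U ->
  ((Num.sqrt l)%:E * cost_dist e U p q <= cost_dist (l * e) (change_unit l U) p q)%E.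
Proof.
move=> l0 D; apply: le_ereal_inf_tmp => _ [T [gamma [T0 ac gp gq ->]]].
rewrite cost_length_scale// lee_pmul2l ?lte_fin ?sqrtr_gt0//.
by apply: ereal_inf_lbound; exists T, gamma; split.
Qed.

(** One inequality is read off the infimum over curves; applied to the inverse unit it gives the
    other. *)
Lemma cost_dist_scale l e U p q : 0 < l -> cost_data e U ->
  (cost_dist (l * e) (change_unit l U) p q = (Num.sqrt l)%:E * cost_dist e U p q)%E.
Proof.
move=> l0 D; apply/eqP; rewrite eq_le; apply/andP; split; last exact: cost_dist_le.
have li : 0 < l^-1 by rewrite invr_gt0.
have := cost_dist_le p q li (cost_data_scale l0 D).
rewrite mulrA mulVf ?gt_eqF// mul1r change_unitK// sqrtrV ?(ltW l0)//.
by rewrite lee_pdivrMl ?sqrtr_gt0.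
Qed.

Lemma classC_scale l U : 0 < l -> classC U -> classC (change_unit l U).
Proof.
move=> l0 [U0 lU [eps eps0 eU]]; split.
- by move=> p; rewrite mule_ge0// lee_fin ltW.
- move=> p_ p pp; apply: le_trans (limn_einf_scale _ l0).
  by rewrite lee_pmul2l ?lte_fin//; exact: lU.
- exists (l * eps); first exact: mulr_gt0.
  by move=> p; rewrite EFinM -muleA lee_pmul2l ?lte_fin.
Qed.

Lemma geodesic_scale T gamma l e U : 0 < l -> cost_data e U ->
  geodesic (l * e) (change_unit l U) T gamma <-> geodesic e U T gamma.
Proof.
apply: (change_unit_iff (P := fun e U => geodesic e U T gamma)) => {}l {}e {}U l0 D [T0 ac eql fin].
have s0 : 0 < Num.sqrt l by rewrite sqrtr_gt0.
split; [exact: T0 | exact: ac | |].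
  by rewrite cost_length_scale// cost_dist_scale// eql.
by rewrite cost_length_scale//; exact: (scale_lt_pinfty _ s0).2 fin.
Qed.

Lemma minimizers_exist_scale l e U : 0 < l -> cost_data e U ->
  minimizers_exist (l * e) (change_unit l U) <-> minimizers_exist e U.
Proof.
apply: change_unit_iff => {}l {}e {}U l0 D H p q; rewrite cost_dist_scale//.
have s0 : 0 < Num.sqrt l by rewrite sqrtr_gt0.
move=> /(scale_lt_pinfty _ s0)/H[T [gamma [g gp gq]]]; exists T, gamma; split => //.
exact/geodesic_scale.
Qed.

Lemma minimizers_stable_scale l e U : 0 < l -> cost_data e U ->
  minimizers_stable (l * e) (change_unit l U) <-> minimizers_stable e U.
Proof.
apply: change_unit_iff => {}l {}e {}U l0 D H p_ q_ gamma_ p q.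
have s0 : 0 < Num.sqrt l by rewrite sqrtr_gt0.
have cvg0 (f : nat -> \bar R) : (fun k => (Num.sqrt l)%:E * f k)%E @ \oo --> 0%E -> f @ \oo --> 0%E.
  move=> h; have := cvgeZl (y := (Num.sqrt l)^-1%:E) isT h; rewrite mule0.
  by under eq_fun do rewrite scaleVKe//.
rewrite cost_dist_scale//; under eq_fun do rewrite cost_dist_scale//.
move=> /(scale_lt_pinfty _ s0) pq /cvg0 pp; under eq_fun do rewrite cost_dist_scale//.
move=> /cvg0 qq g; have [|phi [gamma [hphi ge g0 g1 gn]]] := H p_ q_ gamma_ p q pq pp qq.
  by move=> k; have [/(geodesic_scale _ _ l0 D) ? ? ? ?] := g k; split.
by exists phi, gamma; split => //; exact/geodesic_scale.
Qed.

Lemma no_finite_cost_approach_scale l e U : 0 < l -> cost_data e U ->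
  no_finite_cost_approach (l * e) (change_unit l U) <-> no_finite_cost_approach e U.
Proof.
apply: change_unit_iff => {}l {}e {}U l0 D H T gamma T0 ac h0 hT.
have s0 : 0 < Num.sqrt l by rewrite sqrtr_gt0.
have := H T gamma T0 ac h0 hT.
have -> : (\int[lebesgue_measure]_(t in `[0%R, T[) cost_speed (l * e) (change_unit l U) gamma t =
    \int[lebesgue_measure]_(t in `[0%R, T[) ((Num.sqrt l)%:E * cost_speed e U gamma t))%E.
  by apply: eq_integral => t _; rewrite cost_speed_scale.
by move=> h; rewrite integral_scale// h; exact: ((scale_pinftyE _ s0).2 erefl).
Qed.

Lemma well_posed_scale l e U : 0 < l -> cost_data e U ->
  well_posed (l * e) (change_unit l U) <-> well_posed e U.
Proof.
move=> l0 D; have h1 := minimizers_exist_scale l0 D.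
have h2 := minimizers_stable_scale l0 D; have h3 := no_finite_cost_approach_scale l0 D.
split => -[a b c]; split; [exact: h1.1 a | exact: h2.1 b | exact: h3.1 c | | |].
- exact: h1.2 a.
- exact: h2.2 b.
- exact: h3.2 c.
Qed.

Lemma boundary_at_infinity_scale l e U : 0 < l -> cost_data e U ->
  boundary_at_infinity (l * e) (change_unit l U) <-> boundary_at_infinity e U.
Proof.
apply: change_unit_iff => {}l {}e {}U l0 D H p q hp hq.
by rewrite cost_dist_scale//; apply/(scale_pinftyE _ _).2; [rewrite sqrtr_gt0 | exact: H].
Qed.

Lemma geodesic_traces_scale l e U p q : 0 < l -> cost_data e U ->
  geodesic_traces (l * e) (change_unit l U) p q = geodesic_traces e U p q.
Proof.
move=> l0 D; apply/seteqP; split => A [T [gamma [g gp gq AE]]]; exists T, gamma; split => //.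
  exact/(geodesic_scale _ _ l0 D).
exact/geodesic_scale.
Qed.

Lemma cost_dist_ratio l e U p q r s : 0 < l -> cost_data e U ->
  (0 < cost_dist e U r s < +oo)%E ->
  (cost_dist (l * e) (change_unit l U) p q / cost_dist (l * e) (change_unit l U) r s =
   cost_dist e U p q / cost_dist e U r s)%E.
Proof.
move=> l0 D; rewrite !cost_dist_scale//; have s0 : 0 < Num.sqrt l by rewrite sqrtr_gt0.
case: (cost_dist e U r s) => [b| |] /andP[]//; rewrite lte_fin => b0 _.
rewrite -EFinM !inver !gt_eqF ?mulr_gt0// muleC muleA -EFinM muleC; congr (_ * _%:E)%E.
by rewrite invfM mulrAC mulVf ?mul1r ?gt_eqF.
Qed.

Lemma cost_dist_neq l e U p q : 0 < l -> cost_data e U -> l != 1 ->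
  (0 < cost_dist e U p q < +oo)%E -> cost_dist (l * e) (change_unit l U) p q <> cost_dist e U p q.
Proof.
move=> l0 D l1; rewrite cost_dist_scale//.
case: (cost_dist e U p q) => [b| |] /andP[]//; rewrite lte_fin -EFinM => b0 _ [] /eqP.
rewrite -subr_eq0 -{2}(mul1r b) -mulrBl mulf_eq0 (gt_eqF b0) orbF subr_eq0 => /eqP e1.
by move/eqP: l1; apply; rewrite -(sqr_sqrtr (ltW l0)) e1 expr1n.
Qed.

Lemma entropy_slope_scale l U p : 0 < l -> (forall p, 0 <= U p)%E ->
  (entropy_slope (change_unit l U) p = (Num.sqrt l)^-1%:E * entropy_slope U p)%E.
Proof.
move=> l0 U0; apply: metric_slope_scale => [|q]; first by rewrite sqrtr_gt0.
have D : cost_data 0 U by split.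
by rewrite /tensor_length -{1}(mulr0 l) sqrte_cost_density// muleA.
Qed.

Lemma fisher_multiple_scale l c : change_unit l (fisher_multiple c) = fisher_multiple (l * c) :> (P2 R n -> _).
Proof. by apply/funext => p; rewrite /change_unit /fisher_multiple EFinM muleA. Qed.

Lemma eikonal_scale l U : 0 < l -> eikonal (change_unit l U) <-> eikonal U.
Proof.
move=> l0; split => -[c c0].
  move=> E; exists (l^-1 * c); first by rewrite mulr_gt0 ?invr_gt0.
  by rewrite -(change_unitK U l0) E fisher_multiple_scale.
by move=> ->; exists (l * c); [exact: mulr_gt0 | exact: fisher_multiple_scale].
Qed.

End change_of_unit.

(** * Curvature of conformal metrics on the half-plane *)

Section conformal_surface.
Context {R : realType}.
Local Notation V := 'rV[R]_2.
Implicit Types (f h : V -> R) (y z : V) (i j k l : 'I_2) (c s : R).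

(* Both sides are 0 where [h] has no derivative. *)
Lemma partial_scale c i h y : c != 0 -> partial i (fun w => c * h w) y = c * partial i h y.
Proof.
move=> c0; rewrite /partial.
have [dh|ndh] := pselect (derivable h y (delta_mx ord0 i)).
  by rewrite (_ : (fun w => c * h w) = c *: h)// deriveZ.
have ndg : ~ derivable (fun w => c * h w) y (delta_mx ord0 i).
  move=> dg; apply: ndh; rewrite (_ : h = c^-1 *: (fun w => c * h w)); first exact: derivableZ.
  by apply/funext => w; rewrite !fctE /GRing.scale/= mulKf.
have lim0 (g : V -> R) : ~ derivable g y (delta_mx ord0 i) -> 'D_(delta_mx ord0 i) g y = 0.
  move=> ng; rewrite /derive; apply: xgetPN => l gl; apply: ng.
  by apply/cvg_ex; exists l.
by rewrite !lim0// mulr0.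
Qed.

Lemma christoffel_conformal f k i j y : christoffel (fun w => (f w)%:M) k i j y =
  2^-1 * (f y)^-1 * (partial i f y *+ (j == k) + partial j f y *+ (i == k)
                     - partial k f y *+ (i == j)).
Proof.
have p a b l : partial l (fun w => (f w)%:M a b) y = partial l f y *+ (a == b).
  rewrite /partial; have [->|ab] := eqVneq a b.
    by congr ('D_ _ _ _); apply/funext => w; rewrite mxE eqxx.
  rewrite (_ : (fun w => _) = cst 0) ?derive_cst//.
  by apply/funext => w; rewrite mxE (negPf ab).
rewrite /christoffel -mulrA (bigD1 k)//= big1 ?addr0; last first.
  by move=> l lk; rewrite invmx_scalar mxE eq_sym (negPf lk) mul0r.
by rewrite invmx_scalar mxE eqxx/= !p.
Qed.

Lemma gauss_curvature_conformal f z : gauss_curvature (fun w => (f w)%:M) z =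
  f z * riemann (fun w => (f w)%:M) ord0 ord_max ord0 ord_max z / f z ^+ 2.
Proof.
rewrite /gauss_curvature det_scalar (bigD1 ord0)//= big1 ?addr0 ?mxE//.
by move=> l l0; rewrite mxE eq_sym (negPf l0) mul0r.
Qed.

(** A constant factor leaves the Christoffel symbols unchanged, hence also the curvature tensor with
    one index up; lowering that index contributes c and the determinant c^2. *)
Lemma gauss_curvature_scale f c z : c != 0 ->
  gauss_curvature (fun w => (c * f w)%:M) z = gauss_curvature (fun w => (f w)%:M) z / c.
Proof.
move=> c0; rewrite !gauss_curvature_conformal.
have chr k i j : christoffel (fun w => (c * f w)%:M) k i j = christoffel (fun w => (f w)%:M) k i j.
  apply/funext => y; rewrite !christoffel_conformal !partial_scale// -!mulrnAr -!mulrDr -mulrBr.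
  have [->|fy] := eqVneq (f y) 0; first by rewrite mulr0 !invr0 !(mulr0, mul0r).
  by field; rewrite c0 fy.
have -> : riemann (fun w => (c * f w)%:M) ord0 ord_max ord0 ord_max z =
          riemann (fun w => (f w)%:M) ord0 ord_max ord0 ord_max z.
  rewrite /riemann !chr; congr (_ + _); apply: eq_bigr => m _; by rewrite !chr.
have [->|fz] := eqVneq (f z) 0; first by rewrite !(mulr0, mul0r).
by field; rewrite c0.
Qed.

Local Notation h2 y := ((y : V) ord0 ord_max).

Lemma near_upper z : 0 < h2 z -> \forall y \near (z : V), 0 < h2 y.
Proof. by move=> z0; exact: (cvgr_gt _ (@coord_continuous _ _ _ ord0 ord_max z)). Qed.

Section height_function.
Variables (F : V -> R) (h : R -> R).
Hypothesis Fh : forall w : V, 0 < h2 w -> F w = h (h2 w).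

(** [F] is prescribed on the open half-plane only, so the derivative is computed from an equality
    that holds near the point. *)
Lemma is_derive_height y (d : R) i : 0 < h2 y -> is_derive (h2 y) (1 : R) h d ->
  is_derive y (delta_mx ord0 i : V) F (d *+ (i == ord_max)).
Proof.
move=> y0 dh; apply: is_derive_line.
have E (t : R) : h2 (y + t *: delta_mx ord0 i) = h2 y + t * (i == ord_max)%:R.
  by rewrite !mxE eqxx/= eq_sym.
have near0 : \forall t \near (0 : R), 0 < h2 y + t * (i == ord_max)%:R.
  have c : (fun t : R => h2 y + t * (i == ord_max)%:R) t @[t --> (0 : R)] --> h2 y + 0 * (i == ord_max)%:R.
    by apply: cvgD; [exact: cvg_cst | apply: cvgMr_tmp; exact: cvg_id].
  by apply: (cvgr_gt _ c); rewrite mul0r addr0.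
have [ei|iN] := eqVneq i ord_max; last first.
  rewrite (negPf iN) mulr0n in E near0 *; apply: (near_eq_is_derive _ (is_derive_cst (h (h2 y)) (0 : R) (1 : R))).
  by near=> t; rewrite Fh E mulr0 addr0.
rewrite mulr1n; rewrite ei eqxx in E near0 *.
apply: (near_eq_is_derive (f := fun t : R => h (h2 y + t))).
  by near=> t; rewrite Fh E mulr1//; near: t; move: near0; apply: filterS => t; rewrite mulr1.
have dh' : is_derive (h2 y + 0) (1 : R) h d by rewrite addr0.
have ds := is_deriveD (is_derive_cst (h2 y) (0 : R) (1 : R)) (is_derive_id (0 : R) (1 : R)).
have := is_derive1_comp dh' ds; rewrite add0r mulr1.
by [].
Unshelve. all: by end_near.
Qed.

Lemma continuous_height y (d : R) : 0 < h2 y -> is_derive (h2 y) (1 : R) h d ->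
  {for y, continuous F}.
Proof.
move=> y0 dh; have ch : {for h2 y, continuous h}.
  by apply/differentiable_continuous/derivable1_diffP; case: dh.
have c := continuous_comp (@coord_continuous _ _ _ ord0 ord_max y) ch.
move=> S; rewrite Fh// => hS.
have cS : \forall w \near (y : V), S (h (h2 w)) := c S hS.
change (\forall w \near (y : V), S (F w)).
by apply: filterS2 (near_upper y0) cS => w w0; rewrite Fh.
Qed.

End height_function.

Lemma is_derive_inv_pow (a s : R) m : 0 < s ->
  is_derive s (1 : R) (fun t : R => a * t^-1 ^+ m.+1) (- (a * m.+1%:R) * s^-1 ^+ m.+2).
Proof.
move=> s0; have sN : s != 0 by rewrite gt_eqF.
have dV := is_deriveV sN (is_derive_id s (1 : R)).
have h := is_deriveZ a (is_deriveX m.+1 dV).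
rewrite (_ : (fun t : R => a * t^-1 ^+ m.+1) = a \*: (GRing.inv ^+ m.+1 : R -> R)); last first.
  by apply/funext => t; rewrite /= exprfctE.
apply: (is_derive_eq h); rewrite /GRing.scale/= mulr1 -exprVn.
have -> : s^-1 ^+ m.+2 = s^-1 ^+ m * s^-1 ^+ 2 by rewrite -exprD addn2.
by move: (s^-1 ^+ m) (s^-1 ^+ 2) (m.+1%:R : R) => P Q N; ring.
Qed.

Variables (f : V -> R) (A : R).
Hypothesis fA : forall w : V, 0 < h2 w -> f w = A * (h2 w)^-1 ^+ 2.
Hypothesis A0 : 0 < A.

Let partial_f i y : 0 < h2 y -> partial i f y = - (A * 2) *+ (i == ord_max) * (h2 y)^-1 ^+ 3.
Proof.
move=> y0; rewrite mulrnAl; have h := is_derive_height fA i y0 (is_derive_inv_pow A 1 y0).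
exact: (@derive_val _ _ _ _ _ _ _ h).
Qed.

Let partial2_f i j y : 0 < h2 y ->
  partial j (partial i f) y = - (- (A * 2) *+ (i == ord_max) * 3) *+ (j == ord_max) * (h2 y)^-1 ^+ 4.
Proof.
move=> y0; rewrite [RHS]mulrnAl.
have h := is_derive_height (F := partial i f)
  (h := fun s => - (A * 2) *+ (i == ord_max) * s^-1 ^+ 3) (fun w => @partial_f i w) j y0 (is_derive_inv_pow _ 2 y0).
exact: (@derive_val _ _ _ _ _ _ _ h).
Qed.

Lemma C2_inv_square z : 0 < h2 z -> C2_near f z.
Proof.
move=> z0; apply: filterS (near_upper z0) => y y0 i j; split.
- by case: (is_derive_height fA i y0 (is_derive_inv_pow A 1 y0)).
- by case: (is_derive_height (fun w => @partial_f i w) j y0 (is_derive_inv_pow _ 2 y0)).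
- exact: (continuous_height (fun w => @partial_f i w) y0 (is_derive_inv_pow _ 2 y0)).
- exact: (continuous_height (fun w => @partial2_f i j w) y0 (is_derive_inv_pow _ 3 y0)).
Qed.

(** The Christoffel symbols of the hyperbolic half-plane are - G k i j divided by the height,
    whatever the factor [A]. *)
Let G k i j : R :=
  (i == ord_max)%:R * (j == k)%:R + (j == ord_max)%:R * (i == k)%:R - (k == ord_max)%:R * (i == j)%:R.

Let christoffel_f k i j y : 0 < h2 y -> christoffel (fun w => (f w)%:M) k i j y = - G k i j * (h2 y)^-1 ^+ 1.
Proof.
move=> y0; have mb (x : R) (b : bool) : x *+ b = x * b%:R by rewrite mulr_natr.
rewrite christoffel_conformal !partial_f// fA// !(mb (_ * _)) !(mb (- _)) /G.
by field; rewrite !gt_eqF.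
Qed.

Lemma gauss_curvature_inv_square z : 0 < h2 z ->
  gauss_curvature (fun w => (f w)%:M) z = - A^-1.
Proof.
move=> z0; rewrite gauss_curvature_conformal fA//.
have p k i j l : partial l (christoffel (fun w => (f w)%:M) k i j) z =
    - (- G k i j * 1) *+ (l == ord_max) * (h2 z)^-1 ^+ 2.
  have h := is_derive_height (fun w => @christoffel_f k i j w) l z0 (is_derive_inv_pow _ 0 z0).
  by rewrite /partial (@derive_val _ _ _ _ _ _ _ h) mulrnAl.
rewrite /riemann !p big_ord_recl big_ord1 !christoffel_f// /G /=.
by rewrite ?mulr0n ?mulr1n ?expr1; field; rewrite !gt_eqF.
Qed.

End conformal_surface.

(** * Gauss curvature of location-scale leaves *)

Section leaf_curvature.
Context {R : realType}.
Implicit Types (phi : R -> R) (U : P2 R 1 -> \bar R) (e l c : R) (z : 'rV[R]_2).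

Lemma J0_ge1 phi : base_density phi -> 1 <= J0 phi.
Proof. by move=> /base_density_score[g sc]; exact: score_ge1 sc. Qed.

Lemma fisher_leaf_point phi z : base_density phi -> 0 < z ord0 ord_max ->
  fisher (leaf_point phi z) = (J0 phi * (z ord0 ord_max)^-1 ^+ 2)%:E.
Proof.
move=> /base_density_score[g sc] z0.
by rewrite /leaf_point (fisher_leaf _ sc z0) exprVn.
Qed.

Lemma leaf_factor_fisher_multiple phi c z : base_density phi -> 0 < z ord0 ord_max ->
  leaf_factor 0 (fisher_multiple c) phi z = 2 * c * J0 phi * (z ord0 ord_max)^-1 ^+ 2.
Proof.
move=> bd z0; rewrite /leaf_factor /fisher_multiple fisher_leaf_point// add0e -!EFinM /=.
by rewrite !mulrA.
Qed.

Lemma leaf_curvature_fisher_multiple phi c z : base_density phi -> 0 < c -> 0 < z ord0 ord_max ->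
  leaf_curvature 0 (fisher_multiple c) phi z = - 1 / (2 * c * J0 phi).
Proof.
move=> bd c0 z0; rewrite mulN1r; apply: gauss_curvature_inv_square => // [w w0|].
  exact: leaf_factor_fisher_multiple.
by rewrite !mulr_gt0// (lt_le_trans ltr01 (J0_ge1 bd)).
Qed.

Lemma curvature_defined_fisher_multiple phi c z : base_density phi -> 0 < c ->
  0 < z ord0 ord_max -> curvature_defined 0 (fisher_multiple c) phi z.
Proof.
move=> bd c0 z0; split => //.
  apply: filterS (near_upper z0) => w w0.
  by rewrite /fisher_multiple fisher_leaf_point.
apply: (@C2_inv_square _ _ (2 * c * J0 phi)) => // w w0.
exact: leaf_factor_fisher_multiple.
Qed.

Lemma leaf_factor_scale l e U phi z : 0 < l -> cost_data e U ->
  leaf_factor (l * e) (change_unit l U) phi z = l * leaf_factor e U phi z.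
Proof.
move=> l0 D; rewrite /leaf_factor cost_density_scale//.
case: (2%:E * _)%E => [x| |] //=; first by rewrite mulry gtr0_sg// mul1e mulr0.
by rewrite mulrNy gtr0_sg// mul1e mulr0.
Qed.

Lemma leaf_curvature_scale l e U phi z : 0 < l -> cost_data e U ->
  leaf_curvature (l * e) (change_unit l U) phi z = leaf_curvature e U phi z / l.
Proof.
move=> l0 D; rewrite /leaf_curvature -gauss_curvature_scale ?gt_eqF//.
by congr gauss_curvature; apply/funext => w; rewrite /leaf_metric leaf_factor_scale.
Qed.

Lemma C2_near_scale c (f : 'rV[R]_2 -> R) z : c != 0 -> C2_near f z ->
  C2_near (fun w => c * f w) z.
Proof.
move=> c0; apply: filterS => y H i j; have [d1 d2 c1 c2] := H i j.
have E (h : 'rV[R]_2 -> R) k : partial k (fun w => c * h w) = fun w => c * partial k h w.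
  by apply/funext => w; exact: partial_scale.
have Z (h : 'rV[R]_2 -> R) v : derivable h y v -> derivable (fun w => c * h w) y v.
  move=> /derivableP dh; have [d _] := is_deriveZ c dh; exact: d.
split.
- exact: Z.
- by rewrite E; exact: Z.
- by rewrite E; apply: (cvgM (cvg_cst c) c1).
- by rewrite !E; apply: (cvgM (cvg_cst c) c2).
Qed.

Lemma curvature_defined_scale l e U phi z : 0 < l -> cost_data e U ->
  curvature_defined (l * e) (change_unit l U) phi z <-> curvature_defined e U phi z.
Proof.
apply: (change_unit_iff (P := fun e U => curvature_defined e U phi z)) => {}l {}e {}U l0 D [z0 fU C2]; split; [exact: z0 | |].
  by apply: filterS fU => w fw; rewrite fin_numM.
rewrite (_ : leaf_factor _ _ phi = fun w => l * leaf_factor e U phi w).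
  by apply: C2_near_scale => //; rewrite gt_eqF.
by apply/funext => w; exact: leaf_factor_scale.
Qed.

End leaf_curvature.

(** * What a change of unit preserves and what it alters *)

Theorem theorem4p23 (R : realType) (lambda : R) (lambda_gt0 : 0 < lambda) :
  (* the cost geometry on P_2(R^n) *)
  (forall (n : nat) (e : R) (U : P2 R n -> \bar R),
    (0 < n)%N -> 0 <= e -> classC U ->
    let e' := lambda * e in
    let U' := change_unit lambda U in
    (* the change of unit preserves the class of admissible data *)
    (0 <= e' /\ classC U') /\
    (* homothety of the metric and of the distance *)
    (forall p v w, tangent p v -> tangent p w ->
      cost_metric e' U' p v w = (lambda%:E * cost_metric e U p v w)%E) /\
    (forall p q, cost_dist e' U' p q =
      ((Num.sqrt lambda)%:E * cost_dist e U p q)%E) /\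
    (* invariance: finiteness of distances, boundary at infinity, and
       well-posedness *)
    (forall p q, (cost_dist e' U' p q < +oo)%E <->
      (cost_dist e U p q < +oo)%E) /\
    (boundary_at_infinity e' U' <-> boundary_at_infinity e U) /\
    (well_posed e' U' <-> well_posed e U) /\
    (* invariance: geodesics, their traces, and ratios of distances *)
    (forall T gamma, geodesic e' U' T gamma <-> geodesic e U T gamma) /\
    (forall p q, geodesic_traces e' U' p q = geodesic_traces e U p q) /\
    (forall p q r s, (0 < cost_dist e U r s < +oo)%E ->
      (cost_dist e' U' p q / cost_dist e' U' r s =
       cost_dist e U p q / cost_dist e U r s)%E) /\
    (* invariance: eikonal proportionality, in its two equivalent forms *)
    (eikonal U <-> constant_entropy_slope U) /\
    (eikonal U' <-> eikonal U) /\
    (constant_entropy_slope U' <-> constant_entropy_slope U) /\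
    (* dependence on the unit: distances and slope *)
    (lambda != 1 -> forall p q, (0 < cost_dist e U p q < +oo)%E ->
      cost_dist e' U' p q <> cost_dist e U p q) /\
    (forall p, entropy_slope U' p =
      ((Num.sqrt lambda)^-1%:E * entropy_slope U p)%E) /\
    (forall p, metric_slope (cost_dist 0 U') (fun q => - entropy q)%E p =
      ((Num.sqrt lambda)^-1%:E *
       metric_slope (cost_dist 0 U) (fun q => - entropy q)%E p)%E)) /\
  (* the slope for multiples of the Fisher information *)
  (forall (n : nat) (c : R) (p : P2 R n),
    (0 < n)%N -> 0 < c -> (fisher p < +oo)%E ->
    let U := fisher_multiple c in
    let U' := change_unit lambda U in
    entropy_slope U p = (sqrte (fisher p) / sqrte (2%:E * U p))%E /\
    entropy_slope U p = (1 / Num.sqrt (2 * c))%:E /\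
    entropy_slope U' p = (1 / Num.sqrt (2 * (lambda * c)))%:E /\
    (lambda != 1 -> entropy_slope U' p <> entropy_slope U p)) /\
  (* the Gauss curvature of location-scale leaves *)
  (forall (e : R) (U : P2 R 1 -> \bar R) (phi : R -> R) (z : 'rV[R]_2),
    0 <= e -> classC U -> base_density phi ->
    let e' := lambda * e in
    let U' := change_unit lambda U in
    (curvature_defined e' U' phi z <-> curvature_defined e U phi z) /\
    (curvature_defined e U phi z ->
      [/\ leaf_curvature e' U' phi z = leaf_curvature e U phi z / lambda,
          Num.sg (leaf_curvature e' U' phi z) =
            Num.sg (leaf_curvature e U phi z)
        & leaf_curvature e' U' phi z < 0 <-> leaf_curvature e U phi z < 0])) /\
  (* the Gaussian leaf *)
  (base_density (@gaussian R) /\ J0 (@gaussian R) = 1) /\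
  (* the curvature of location-scale leaves at e = 0, for multiples of the
     Fisher information *)
  (forall (c : R) (phi : R -> R) (z : 'rV[R]_2),
    0 < c -> base_density phi -> 0 < z ord0 ord_max ->
    let U := fisher_multiple c in
    let U' := change_unit lambda U in
    let K psi y := leaf_curvature 0 U psi y in
    let K' psi y := leaf_curvature (lambda * 0) U' psi y in
    curvature_defined 0 U phi z /\
    (* dependence on the unit: the value of the curvature *)
    K phi z = - 1 / (2 * c * J0 phi) /\
    K' phi z = - 1 / (2 * (lambda * c) * J0 phi) /\
    (lambda != 1 -> K' phi z <> K phi z) /\
    (c = 2 -> K phi z = - 1 / (4 * J0 phi) /\ K gaussian z = - 1 / 4) /\
    (* invariance: ranking of the leaves, extremum at the Gaussian leaf, and
       ratio of curvatures *)
    (forall (psi : R -> R) (y : 'rV[R]_2),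
      base_density psi -> 0 < y ord0 ord_max ->
      (K' phi z <= K' psi y <-> K phi z <= K psi y)) /\
    (forall y : 'rV[R]_2, 0 < y ord0 ord_max ->
      [/\ K gaussian y <= K phi z, K' gaussian y <= K' phi z,
          K gaussian y / K phi z = J0 phi
        & K' gaussian y / K' phi z = J0 phi])).
Proof.
have l0 := lambda_gt0; have s0 : 0 < Num.sqrt lambda by rewrite sqrtr_gt0.
split; [|split; [|split; [|split]]].
- move=> n e U n0 e0 CU e' U'.
  have U0 : forall p, (0 <= U p)%E by case: CU.
  have D : cost_data e U by split.
  have CU' := classC_scale l0 CU.
  have eU := eikonalE n0 CU; have eU' := eikonalE n0 CU'; have eUU' := eikonal_scale U l0.
  split; first by split; [apply: mulr_ge0 => //; exact: ltW | exact: CU'].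
  split; first by move=> p v w _ _; rewrite /cost_metric cost_density_scale// -muleA.
  split; first by move=> p q; exact: cost_dist_scale.
  split; first by move=> p q; rewrite cost_dist_scale//; exact: scale_lt_pinfty.
  split; first exact: boundary_at_infinity_scale.
  split; first exact: well_posed_scale.
  split; first by move=> T gamma; exact: geodesic_scale.
  split; first by move=> p q; exact: geodesic_traces_scale.
  split; first by move=> p q r s; exact: cost_dist_ratio.
  split; first exact: eU.
  split; first exact: eUU'.
  (* Constancy of the slope is transferred through proportionality, using [eikonalE] in both
     units. *)
  split; first exact: (iff_trans (iff_sym eU') (iff_trans eUU' eU)).
  split; first by move=> l1 p q; exact: cost_dist_neq.
  split; first by move=> p; exact: entropy_slope_scale.
  move=> p; apply: metric_slope_scale => // q.
  by have := cost_dist_scale p q l0 (conj (lexx 0) U0); rewrite mulr0.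
- move=> n c p n0 c0 pf U U'.
  have E := entropy_slope_fisher_multiple n0 c0 pf.
  have lc0 : 0 < lambda * c by rewrite mulr_gt0.
  have E' : entropy_slope U' p = (1 / Num.sqrt (2 * (lambda * c)))%:E.
    by rewrite /U' /U fisher_multiple_scale entropy_slope_fisher_multiple.
  split; first by rewrite E sqrte_fisher_ratio.
  split; first exact: E.
  split; first exact: E'.
  (* Equal slopes would give 2 lambda c = 2 c, hence lambda = 1. *)
  move=> l1; rewrite E' E !div1r => -[] /invr_inj e.
  have h1 : 0 <= 2 * (lambda * c) by rewrite mulr_ge0// ltW.
  have h2 : 0 <= 2 * c by rewrite mulr_ge0// ltW.
  have : 2 * (lambda * c) = 2 * c by rewrite -(sqr_sqrtr h1) e sqr_sqrtr.
  rewrite mulrCA -[RHS]mul1r => /mulIf lE; move/eqP: l1; apply.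
  by apply: lE; rewrite gt_eqF// mulr_gt0.
- move=> e U phi z e0 [U0 _ _] bd e' U'.
  have D : cost_data e U by split.
  split; first exact: curvature_defined_scale.
  have li : 0 < lambda^-1 by rewrite invr_gt0.
  move=> _; rewrite leaf_curvature_scale//; split => //.
    by rewrite sgrM (gtr0_sg li) mulr1.
  by rewrite pmulr_llt0.
- split; first exact: base_density_gaussian.
  by rewrite /J0 gaussian_fisher.
- move=> c phi z c0 bd z0 U U' K K'.
  have lc0 : 0 < lambda * c by rewrite mulr_gt0.
  have KE psi (y : 'rV[R]_2) : base_density psi -> 0 < y ord0 ord_max -> K psi y = - 1 / (2 * c * J0 psi).
    by move=> bp y0; exact: leaf_curvature_fisher_multiple.
  have KE' psi (y : 'rV[R]_2) : base_density psi -> 0 < y ord0 ord_max ->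
      K' psi y = - 1 / (2 * (lambda * c) * J0 psi).
    by move=> bp y0; rewrite /K' mulr0 /U' /U fisher_multiple_scale leaf_curvature_fisher_multiple.
  have bg := @base_density_gaussian R.
  have Jg : J0 (@gaussian R) = 1 by rewrite /J0 gaussian_fisher.
  have J1 (psi : R -> R) (bp : base_density psi) := J0_ge1 bp.
  have Jp (psi : R -> R) (bp : base_density psi) : 0 < J0 psi := lt_le_trans ltr01 (J1 psi bp).
  have KK' psi (y : 'rV[R]_2) (bp : base_density psi) (y0 : 0 < y ord0 ord_max) : K' psi y = K psi y / lambda.
    by rewrite KE'// KE//; field; rewrite !gt_eqF// Jp.
  have li : 0 < lambda^-1 by rewrite invr_gt0.
  have J0N := lt0r_neq0 (Jp _ bd).
  (* The Cramer-Rao bound J0 >= 1 makes the Gaussian leaf the most negatively curved one. *)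
  have Kg (y : 'rV[R]_2) : 0 < y ord0 ord_max -> K gaussian y <= K phi z.
    move=> y0; rewrite !KE// Jg !mulN1r lerN2 mulr1 lef_pV2 ?posrE ?mulr_gt0 ?Jp//.
    by rewrite ler_peMr ?J1// mulr_ge0// ltW.
  split; first exact: curvature_defined_fisher_multiple.
  split; first exact: KE.
  split; first exact: KE'.
  split.
    move=> l1; rewrite KK'// => e; move/eqP: l1; apply.
    have K0 : K phi z != 0 by rewrite KE// mulf_neq0 ?oppr_eq0 ?oner_eq0// invr_eq0 gt_eqF// !mulr_gt0// Jp.
    have e1 : K phi z * lambda^-1 = K phi z * 1 by rewrite mulr1.
    by apply: invr_inj; rewrite invr1; exact: (mulfI K0 e1).
  split.
    by move=> c2; rewrite !KE// Jg c2; split; congr (_ / _); ring.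
  split.
    by move=> psi y bp y0; rewrite (KK' phi z bd z0) (KK' psi y bp y0) (ler_pM2r li).
  move=> y y0; split.
  - exact: Kg.
  - by rewrite (KK' gaussian y bg y0) (KK' phi z bd z0) (ler_pM2r li); exact: Kg.
  - by rewrite (KE gaussian y bg y0) (KE phi z bd z0) Jg; field; rewrite J0N !gt_eqF.
  - by rewrite (KE' gaussian y bg y0) (KE' phi z bd z0) Jg; field; rewrite J0N !gt_eqF.
Qed.
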